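(* Assume that the weight $v\in kQ_0$ is regular. Then the following hold. (1) For every $i\in Q_0$ there is an isomorphism of $A$-modules $${}^v\Lambda(Q)e_i\cong\bigoplus_{N\in\operatorname{ind}\mathcal P(Q)}N^{\oplus\dim e_iN}.$$ (2) There is an isomorphism of $A$-modules $${}^v\Lambda(Q)\cong\bigoplus_{N\in\operatorname{ind}\mathcal P(Q)}N^{\oplus\dim N}.$$
   Context: $k$ is a field; $Q=(Q_0,Q_1,h,t)$ is a finite connected acyclic quiver, an arrow $\alpha$ going from its tail $t(\alpha)$ to its head $h(\alpha)$. Paths are composed from left to right, $e_i$ is the trivial path at $i$. $A=kQ$; modules are left modules. $\mathcal P(Q)=\operatorname{add}\{\tau_1^{-n}A\mid n\ge0\}$ is the category of preprojective $A$-modules ($\tau_1^{-1}$ the inverse Auslander-Reiten translation), and $\operatorname{ind}\mathcal P(Q)$ is a set of representatives of isomorphism classes of its indecomposable objects. A weight $v=(v_i)\in kQ_0=k^{Q_0}$ is regular if $\sum_{i\in Q_0}v_i\dim(e_iN)\ne0$ in $k$ for every indecomposable finite-dimensional $A$-module $N$ (in particular all $v_i\neq0$). $\overline Q$ is the double of $Q$: add for each $\alpha\in Q_1$ an arrow $\alpha^*:h(\alpha)\to t(\alpha)$. Put $\rho_i=\sum_{t(\alpha)=i}\alpha\alpha^*-\sum_{h(\alpha)=i}\alpha^*\alpha$ ($\alpha\in Q_1$), ${}^v\varrho=\sum_iv_i^{-1}\rho_i$, ${}^v\eta_a=a\,{}^v\varrho-{}^v\varrho\,a$ for every arrow $a$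 of $\overline Q$, and ${}^v\Lambda(Q)=k\overline Q/({}^v\eta_a\mid a\in\overline Q_1)$ (the quiver Heisenberg algebra), which is a left $A$-module through $A=kQ\to{}^v\Lambda(Q)$. *)

(* Defs.v *)
From HB Require Import structures.
From mathcomp Require Import all_boot all_algebra.
From mathcomp Require Import boolp classical_sets cardinality.

Set Implicit Arguments.
Unset Strict Implicit.
Unset Printing Implicit Defensive.

Import GRing.Theory.
Local Open Scope classical_set_scope.
Local Open Scope ring_scope.

Definition mod_iso (R : pzRingType) (U V : lmodType R) : Prop :=
  exists f : {linear U -> V}, bijective f.

Definition res_scalars (R S : pzRingType) (f : {rmorphism R -> S})
  (M : lmodType S) : Type := M.

Section Restrict.
Variables (R S : pzRingType) (f : {rmorphism R -> S}) (M : lmodType S).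

Local Notation rM := (res_scalars f M).

HB.instance Definition _ := GRing.Zmodule.on rM.

Let scl (a : R) (x : rM) : rM := f a *: (x : M).

Fact res_scalars_scaleA a b x : scl a (scl b x) = scl (a * b) x.
Proof. by rewrite /scl scalerA rmorphM. Qed.
Fact res_scalars_scale1 : left_id 1 scl.
Proof. by move=> x; rewrite /scl rmorph1 scale1r. Qed.
Fact res_scalars_scaleDr : right_distributive scl +%R.
Proof. by move=> a x y; rewrite /scl scalerDr. Qed.
Fact res_scalars_scaleDl x : {morph scl^~ x : a b / a + b}.
Proof. by move=> a b; rewrite /scl rmorphD scalerDl. Qed.

HB.instance Definition _ := GRing.Zmodule_isLmodule.Build R rM
  res_scalars_scaleA res_scalars_scale1 res_scalars_scaleDr res_scalars_scaleDl.

End Restrict.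

Section DirectSum.
Variables (R : pzRingType) (I : Type) (M : I -> lmodType R).

Record dsum := Dsum {
  dsum_fun :> forall i, M i;
  dsum_finite : finite_set [set i | dsum_fun i != 0] }.

Lemma dsum_ext (x y : dsum) : (forall i, x i = y i) -> x = y.
Proof.
case: x y => [x xf] [y yf] /= xy.
have {}xy : x = y by apply: functional_extensionality_dep.
by case: y / xy yf => yf; rewrite (Prop_irrelevance xf yf).
Qed.

HB.instance Definition _ := gen_eqMixin dsum.
HB.instance Definition _ := gen_choiceMixin dsum.

Fact dsum0_finite : finite_set [set i | (0 : M i) != 0].
Proof. by apply: sub_finite_set (@finite_set0 I) => i /=; rewrite eqxx. Qed.

Fact dsumN_finite (x : dsum) : finite_set [set i | - x i != 0].
Proof. by apply: sub_finite_set (dsum_finite x) => i /=; rewrite oppr_eq0. Qed.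

Fact dsumD_finite (x y : dsum) : finite_set [set i | x i + y i != 0].
Proof.
apply: (@sub_finite_set _ _ ([set i | x i != 0] `|` [set i | y i != 0])).
  move=> i /= xy; case: (eqVneq (x i) 0) => [xi0|]; last by left.
  by right; move: xy; rewrite /= xi0 add0r.
by rewrite finite_setU; split; exact: dsum_finite.
Qed.

Fact dsumZ_finite a (x : dsum) : finite_set [set i | a *: x i != 0].
Proof.
apply: sub_finite_set (dsum_finite x) => i /=; apply: contra_neq => ->.
exact: scaler0.
Qed.

Let zero := Dsum dsum0_finite.
Let opp x := Dsum (dsumN_finite x).
Let add x y := Dsum (dsumD_finite x y).
Let scl a x := Dsum (dsumZ_finite a x).

Fact dsum_addA : associative add.
Proof. by move=> x y z; apply: dsum_ext => i /=; rewrite addrA. Qed.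
Fact dsum_addC : commutative add.
Proof. by move=> x y; apply: dsum_ext => i /=; rewrite addrC. Qed.
Fact dsum_add0 : left_id zero add.
Proof. by move=> x; apply: dsum_ext => i /=; rewrite add0r. Qed.
Fact dsum_addN : left_inverse zero opp add.
Proof. by move=> x; apply: dsum_ext => i /=; rewrite addNr. Qed.

HB.instance Definition _ :=
  GRing.isZmodule.Build dsum dsum_addA dsum_addC dsum_add0 dsum_addN.

Fact dsum_scaleA a b x : scl a (scl b x) = scl (a * b) x.
Proof. by apply: dsum_ext => i /=; rewrite scalerA. Qed.
Fact dsum_scale1 : left_id 1 scl.
Proof. by move=> x; apply: dsum_ext => i /=; rewrite scale1r. Qed.
Fact dsum_scaleDr : right_distributive scl +%R.
Proof. by move=> a x y; apply: dsum_ext => i /=; rewrite scalerDr. Qed.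
Fact dsum_scaleDl x : {morph scl^~ x : a b / a + b}.
Proof. by move=> a b; apply: dsum_ext => i /=; rewrite scalerDl. Qed.

HB.instance Definition _ := GRing.Zmodule_isLmodule.Build R dsum
  dsum_scaleA dsum_scale1 dsum_scaleDr dsum_scaleDl.

Lemma dsum0E i : (0 : dsum) i = 0. Proof. by []. Qed.
Lemma dsumDE (x y : dsum) i : (x + y) i = x i + y i. Proof. by []. Qed.
Lemma dsumNE (x : dsum) i : (- x) i = - x i. Proof. by []. Qed.
Lemma dsumZE a (x : dsum) i : (a *: x) i = a *: x i. Proof. by []. Qed.

End DirectSum.

Definition indecomposable (R : pzRingType) (M : lmodType R) : Prop :=
  (exists x : M, x != 0) /\
  forall U V : lmodType R, mod_iso M (U * V)%type ->
    (forall u : U, u = 0) \/ (forall w : V, w = 0).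

Section LeftIdeal.
Variables (R : pzRingType) (e : R).

Definition left_ideal_pred : {pred R^o} := fun x => `[< exists y : R, x = y * e >].

Fact left_ideal_submod : submod_closed left_ideal_pred.
Proof.
split; first by apply/asboolP; exists 0; rewrite mul0r.
move=> a x y /asboolP[x' ->] /asboolP[y' ->]; apply/asboolP.
by exists (a * x' + y'); rewrite mulrDl -mulrA.
Qed.

HB.instance Definition _ :=
  GRing.isSubmodClosed.Build R R^o left_ideal_pred
    (GRing.submod_closed_semi left_ideal_submod).

Record left_ideal := LeftIdeal {
  left_ideal_val :> R^o; _ : left_ideal_val \in left_ideal_pred }.

HB.instance Definition _ := [isSub for left_ideal_val].
HB.instance Definition _ := [Choice of left_ideal by <:].
HB.instance Definition _ := [SubChoice_isSubLmodule of left_ideal by <:].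

End LeftIdeal.

Section RingQuotient.
Variables (R : pzRingType) (S : set R).

Definition two_sided_ideal (J : set R) : Prop :=
  [/\ J 0, forall x y, J x -> J y -> J (x - y)
    & forall a x b, J x -> J (a * x * b)].

Definition ideal_gen : set R :=
  [set x | forall J, two_sided_ideal J -> S `<=` J -> J x].

Lemma ideal_genP : two_sided_ideal ideal_gen.
Proof.
split=> [J [] //|x y Jx Jy J JI SJ|a x b Jx J JI SJ].
  by case: (JI) => _ JB _; apply: JB; [exact: Jx|exact: Jy].
by case: (JI) => _ _ JM; apply: JM; exact: Jx.
Qed.

Lemma ideal_gen0 : ideal_gen 0.
Proof. by case: ideal_genP. Qed.
Lemma ideal_genB x y : ideal_gen x -> ideal_gen y -> ideal_gen (x - y).
Proof. by case: ideal_genP => _ + _; apply. Qed.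
Lemma ideal_genN x : ideal_gen x -> ideal_gen (- x).
Proof. by move=> Ix; rewrite -[- x]add0r; apply: ideal_genB => //; exact: ideal_gen0. Qed.
Lemma ideal_genD x y : ideal_gen x -> ideal_gen y -> ideal_gen (x + y).
Proof. by move=> Ix Iy; rewrite -[y]opprK; apply: ideal_genB => //; exact: ideal_genN. Qed.
Lemma ideal_genMl a x : ideal_gen x -> ideal_gen (a * x).
Proof. by move=> Ix; rewrite -[a * x]mulr1; case: ideal_genP => _ _; apply. Qed.
Lemma ideal_genMr x b : ideal_gen x -> ideal_gen (x * b).
Proof. by move=> Ix; rewrite -[x]mul1r; case: ideal_genP => _ _; apply. Qed.

Definition ideal_cong (x y : R) : bool := `[< ideal_gen (x - y) >].

Fact ideal_cong_refl : reflexive ideal_cong.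
Proof. by move=> x; apply/asboolP; rewrite subrr; exact: ideal_gen0. Qed.
Fact ideal_cong_sym : symmetric ideal_cong.
Proof.
by move=> x y; apply/asboolP/asboolP => /ideal_genN; rewrite opprB.
Qed.
Fact ideal_cong_trans : transitive ideal_cong.
Proof.
move=> y x z /asboolP xy /asboolP yz; apply/asboolP.
by rewrite -(subrKA y); exact: ideal_genD.
Qed.

Canonical ideal_cong_equiv := EquivRel ideal_cong ideal_cong_refl ideal_cong_sym ideal_cong_trans.

Local Open Scope quotient_scope.

Definition ringquot : Type := {eq_quot ideal_cong}.

HB.instance Definition _ := Choice.on ringquot.
HB.instance Definition _ := EqQuotient.on ringquot.

Let pi (x : R) : ringquot := \pi_ringquot x.
Let zero := pi 0.
Let one := pi 1.
Let opp (x : ringquot) := pi (- repr x).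
Let add (x y : ringquot) := pi (repr x + repr y).
Let mul (x y : ringquot) := pi (repr x * repr y).

Let piP (x y : R) : (pi x = pi y) <-> ideal_gen (x - y).
Proof.
by split=> [/eqmodP/asboolP|xy]; last by apply/eqmodP/asboolP.
Qed.

Let piK (x : ringquot) : pi (repr x) = x.
Proof. exact: reprK. Qed.

Let reprP (x : R) : ideal_gen (repr (pi x) - x).
Proof. by apply/piP; rewrite piK. Qed.

Let piN x : opp (pi x) = pi (- x).
Proof. by apply/piP; rewrite -opprD; apply: ideal_genN; exact: reprP. Qed.

Let piD x y : add (pi x) (pi y) = pi (x + y).
Proof.
apply/piP; rewrite opprD addrACA.
by apply: ideal_genD; exact: reprP.
Qed.

Let piM x y : mul (pi x) (pi y) = pi (x * y).
Proof.
apply/piP; set x' := repr _; set y' := repr _.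
rewrite -(subrKA (x' * y)) -mulrBr -mulrBl.
by apply: ideal_genD; [apply: ideal_genMl|apply: ideal_genMr]; exact: reprP.
Qed.

Fact ringquot_addA : associative add.
Proof. by move=> x y z; rewrite -[x]piK -[y]piK -[z]piK !piD addrA. Qed.
Fact ringquot_addC : commutative add.
Proof. by move=> x y; rewrite -[x]piK -[y]piK !piD addrC. Qed.
Fact ringquot_add0 : left_id zero add.
Proof. by move=> x; rewrite -[x]piK !piD add0r. Qed.
Fact ringquot_addN : left_inverse zero opp add.
Proof. by move=> x; rewrite -[x]piK piN !piD addNr. Qed.

HB.instance Definition _ := GRing.isZmodule.Build ringquot
  ringquot_addA ringquot_addC ringquot_add0 ringquot_addN.

Fact ringquot_mulA : associative mul.
Proof. by move=> x y z; rewrite -[x]piK -[y]piK -[z]piK !piM mulrA. Qed.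
Fact ringquot_mul1 : left_id one mul.
Proof. by move=> x; rewrite -[x]piK !piM mul1r. Qed.
Fact ringquot_mulr1 : right_id one mul.
Proof. by move=> x; rewrite -[x]piK !piM mulr1. Qed.
Fact ringquot_mulDl : left_distributive mul add.
Proof.
move=> x y z; rewrite -[x]piK -[y]piK -[z]piK.
by rewrite [in LHS]piD !piM piD mulrDl.
Qed.
Fact ringquot_mulDr : right_distributive mul add.
Proof.
move=> x y z; rewrite -[x]piK -[y]piK -[z]piK.
by rewrite [in LHS]piD !piM piD mulrDr.
Qed.

HB.instance Definition _ := GRing.Zmodule_isPzRing.Build ringquot
  ringquot_mulA ringquot_mul1 ringquot_mulr1 ringquot_mulDl ringquot_mulDr.

Definition quot_map (x : R) : ringquot := \pi_ringquot x.

Lemma quot_map_eq0 x : quot_map x = 0 <-> ideal_gen x.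
Proof. by rewrite -{2}[x]subr0; exact: piP. Qed.

Lemma quot_map_surj (y : ringquot) : exists x, quot_map x = y.
Proof. by exists (repr y); exact: reprK. Qed.

Fact quot_map_zmod : zmod_morphism quot_map.
Proof. by move=> x y; apply/esym; rewrite -[RHS]piD -piN. Qed.
Fact quot_map_monoid : monoid_morphism quot_map.
Proof. by split=> [//|x y]; apply/esym; exact: piM. Qed.

HB.instance Definition _ :=
  GRing.isZmodMorphism.Build R ringquot quot_map quot_map_zmod.
HB.instance Definition _ :=
  GRing.isMonoidMorphism.Build R ringquot quot_map quot_map_monoid.

End RingQuotient.

Record quiver := Quiver {
  vert : finType;
  arrow : finType;
  qtail : arrow -> vert;
  qhead : arrow -> vert;
  vert_gt0 : (0 < #|vert|)%N }.

Arguments qtail {q}.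
Arguments qhead {q}.

Section Paths.
Variable Q : quiver.

(* (i, s) is a path: it starts at i and runs through the arrows of s *)
Fixpoint is_path (i : vert Q) (s : seq (arrow Q)) : bool :=
  if s is a :: s' then (qtail a == i) && is_path (qhead a) s' else true.

Definition end_of (i : vert Q) (s : seq (arrow Q)) : vert Q :=
  last i (map qhead s).

Definition qpath : Type := {p : vert Q * seq (arrow Q) | is_path p.1 p.2}.
HB.instance Definition _ := Countable.on qpath.
HB.instance Definition _ := SubType.on qpath.

Definition psrc (p : qpath) : vert Q := (val p).1.
Definition parrows (p : qpath) : seq (arrow Q) := (val p).2.
Definition ptgt (p : qpath) : vert Q := end_of (psrc p) (parrows p).
Definition plen (p : qpath) : nat := size (parrows p).

Lemma is_path_cat i s1 s2 :
  is_path i (s1 ++ s2) = is_path i s1 && is_path (end_of i s1) s2.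
Proof. by elim: s1 i => //= a s IHs i; rewrite IHs andbA. Qed.

Lemma end_of_cat i s1 s2 : end_of i (s1 ++ s2) = end_of (end_of i s1) s2.
Proof. by rewrite /end_of map_cat last_cat. Qed.

Definition ptriv (i : vert Q) : qpath := exist _ (i, [::]) isT.

Fact parrow_proof (a : arrow Q) : is_path (qtail a) [:: a].
Proof. by rewrite /= eqxx. Qed.
Definition parrow (a : arrow Q) : qpath := exist _ (qtail a, [:: a]) (parrow_proof a).

Fact ptake_proof n (p : qpath) : is_path (psrc p) (take n (parrows p)).
Proof.
by move: (valP p); rewrite -{1}(cat_take_drop n (val p).2) is_path_cat => /andP[].
Qed.
Definition ptake n (p : qpath) : qpath := exist _ (psrc p, take n (parrows p)) (ptake_proof n p).

Fact pdrop_proof n (p : qpath) : is_path (ptgt (ptake n p)) (drop n (parrows p)).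
Proof.
by move: (valP p); rewrite -{1}(cat_take_drop n (val p).2) is_path_cat => /andP[].
Qed.
Definition pdrop n (p : qpath) : qpath :=
  exist _ (ptgt (ptake n p), drop n (parrows p)) (pdrop_proof n p).

(* only meaningful if p ends where q starts *)
Definition pcat (p q : qpath) : qpath := insubd p (psrc p, parrows p ++ parrows q).

Lemma pcat_take_drop n p : pcat (ptake n p) (pdrop n p) = p.
Proof.
apply: val_inj; rewrite val_insubd /psrc /parrows /= cat_take_drop.
by rewrite (valP p) -surjective_pairing.
Qed.

Lemma plen_take n p : (n <= plen p)%N -> plen (ptake n p) = n.
Proof. by rewrite /plen /parrows /= size_take_min => /minn_idPl. Qed.
Lemma plen_drop n p : plen (pdrop n p) = (plen p - n)%N.
Proof. by rewrite /plen /parrows /= size_drop. Qed.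
Lemma ptake_take m n p : (m <= n)%N -> ptake m (ptake n p) = ptake m p.
Proof. by move=> mn; apply: val_inj; rewrite /ptake /psrc /parrows /= take_takel. Qed.
Lemma pdrop_drop l m p : pdrop l (pdrop m p) = pdrop (l + m) p.
Proof.
apply: val_inj; rewrite /pdrop /ptgt /ptake /psrc /parrows /= -end_of_cat.
by rewrite drop_drop addnC takeD.
Qed.
Lemma pdrop_take m n p : (m <= n)%N ->
  pdrop m (ptake n p) = ptake (n - m) (pdrop m p).
Proof.
move=> mn; apply: val_inj; rewrite /pdrop /ptgt /ptake /psrc /parrows /=.
by rewrite take_takel // take_drop subnK.
Qed.
Lemma ptake0 p : ptake 0 p = ptriv (psrc p).
Proof. by apply: val_inj; congr (_, _); exact: take0. Qed.
Lemma pdrop0 p : pdrop 0 p = p.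
Proof.
apply: val_inj; rewrite [RHS]surjective_pairing; congr (_, _).
  by rewrite ptake0.
exact: drop0.
Qed.
Lemma ptake_len p : ptake (plen p) p = p.
Proof.
by apply: val_inj; rewrite /= take_size /psrc /parrows -surjective_pairing.
Qed.
Lemma pdrop_len p : plen (pdrop (plen p) p) = 0%N.
Proof. by rewrite plen_drop subnn. Qed.

End Paths.

Section PathAlgebra.
Variables (k : fieldType) (Q : quiver).

Definition pathalg : Type := dsum (fun _ : qpath Q => k^o).
HB.instance Definition _ := GRing.Lmodule.on pathalg.

Definition coef (f : pathalg) (p : qpath Q) : k := dsum_fun f p.
Arguments coef : simpl never.

Lemma pathalg_ext (f g : pathalg) : coef f =1 coef g -> f = g.
Proof. by move=> fg; apply: (@dsum_ext _ _ _ f g) => p; exact: fg. Qed.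

Fact pathmul_finite (f g : pathalg) :
  finite_set [set p | (\sum_(n < (plen p).+1)
                 coef f (ptake n p) * coef g (pdrop n p) : k^o) != 0].
Proof.
apply: sub_finite_set (finite_image2 (@pcat Q) (dsum_finite f) (dsum_finite g)).
move=> p /= nz; have [n nzn] : exists n : 'I_(plen p).+1,
    coef f (ptake n p) * coef g (pdrop n p) != 0.
  apply/existsP; move: nz; apply: contra_neqT; rewrite negb_exists => /forallP z.
  by rewrite big1 // => n _; apply/eqP; move: (z n); rewrite negbK.
exists (ptake n p); first by apply: contra_neq nzn => fz; rewrite /coef fz mul0r.
exists (pdrop n p); first by apply: contra_neq nzn => gz; rewrite /coef gz mulr0.
exact: pcat_take_drop.
Qed.

(* p |-> \sum_(p = p1 p2) f p1 * g p2, the bilinear extension of composition *)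
Definition pathmul (f g : pathalg) : pathalg := Dsum (pathmul_finite f g).

Fact pathone_finite : finite_set [set p : qpath Q | (((plen p == 0)%N)%:R : k^o) != 0].
Proof.
apply: (@sub_finite_set _ _ (range (@ptriv Q))).
  move=> p /=; case: (plen p =P 0%N) => [p_0 _|_]; last by rewrite eqxx.
  have p0 : parrows p = [::] by exact: size0nil.
  by exists (psrc p) => //; apply: val_inj; rewrite /= -p0 /psrc /parrows -surjective_pairing.
by apply: finite_image; exact: finite_finset.
Qed.
Definition pathone : pathalg := Dsum pathone_finite.

Lemma coefM f g p : coef (pathmul f g) p =
  \sum_(n < (plen p).+1) coef f (ptake n p) * coef g (pdrop n p).
Proof. by []. Qed.
Lemma coef1 p : coef pathone p = (plen p == 0)%N%:R.
Proof. by []. Qed.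
Lemma coefD f g p : coef (f + g) p = coef f p + coef g p.
Proof. by []. Qed.
Lemma coefZ c f p : coef (c *: f) p = c * coef f p.
Proof. by []. Qed.

Fact pathmulA : associative pathmul.
Proof.
move=> f g h; apply: pathalg_ext => p; apply/esym; rewrite !coefM; set L := plen p.
pose F m n := coef f (ptake m p) * coef g (ptake (n - m) (pdrop m p)) * coef h (pdrop n p).
transitivity (\sum_(n < L.+1) \sum_(m < L.+1 | (m <= n)%N) F m n).
  apply: eq_bigr => n _; have nL : (n <= L)%N by rewrite -ltnS.
  rewrite coefM plen_take // big_distrl /=.
  rewrite (big_ord_widen_cond L.+1 predT (fun m => coef f (ptake m (ptake n p)) *
     coef g (pdrop m (ptake n p)) * coef h (pdrop n p))) ?ltnS //=.
  by apply: eq_bigr => m mn; rewrite /F ptake_take // pdrop_take.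
rewrite (exchange_big_dep predT) //=; apply: eq_bigr => m _.
have mL : (m <= L)%N by rewrite -ltnS.
rewrite coefM plen_drop big_distrr /=.
rewrite -(big_mkord (fun n => (m <= n)%N) (F m)).
rewrite -(big_mkord predT (fun l => coef f (ptake m p) * (coef g (ptake l (pdrop m p)) *
   coef h (pdrop l (pdrop m p))))).
rewrite -(big_nat_widenl _ _ _ predT) //= -{1}[m : nat]add0n big_addn subSn //.
apply: eq_bigr => l _; rewrite /F addnK mulrA pdrop_drop //.
Qed.

Fact pathmul1 : left_id pathone pathmul.
Proof.
move=> f; apply: pathalg_ext => p; rewrite coefM big_ord_recl /= ptake0 pdrop0.
rewrite coef1 /= mul1r big1 ?addr0 // => n _.
by rewrite coef1 plen_take //= mul0r.
Qed.

Fact pathmulr1 : right_id pathone pathmul.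
Proof.
move=> f; apply: pathalg_ext => p; rewrite coefM big_ord_recr /= ptake_len.
rewrite coef1 pdrop_len mulr1 big1 ?add0r // => n _.
by rewrite coef1 plen_drop subn_eq0 leqNgt ltn_ord mulr0.
Qed.

Fact pathmulDl : left_distributive pathmul +%R.
Proof.
move=> f g h; apply: pathalg_ext => p; rewrite coefD !coefM -big_split.
by apply: eq_bigr => n _; rewrite coefD mulrDl.
Qed.

Fact pathmulDr : right_distributive pathmul +%R.
Proof.
move=> f g h; apply: pathalg_ext => p; rewrite coefD !coefM -big_split.
by apply: eq_bigr => n _; rewrite coefD mulrDr.
Qed.

Fact pathone_neq0 : pathone != 0.
Proof.
have /card_gt0P[i _] := vert_gt0 Q.
apply/eqP => /(congr1 (coef^~ (ptriv i))); rewrite coef1 /= => /eqP.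
by rewrite oner_eq0.
Qed.

HB.instance Definition _ := GRing.Zmodule_isNzRing.Build pathalg
  pathmulA pathmul1 pathmulr1 pathmulDl pathmulDr pathone_neq0.

Fact pathscaleAl (c : k) (f g : pathalg) : c *: (f * g) = (c *: f) * g.
Proof.
apply: pathalg_ext => p; rewrite coefZ !coefM big_distrr /=.
by apply: eq_bigr => n _; rewrite coefZ mulrA.
Qed.
HB.instance Definition _ := GRing.Lmodule_isLalgebra.Build k pathalg pathscaleAl.

Fact pathscaleAr (c : k) (f g : pathalg) : c *: (f * g) = f * (c *: g).
Proof.
apply: pathalg_ext => p; rewrite coefZ !coefM big_distrr /=.
by apply: eq_bigr => n _; rewrite coefZ mulrCA.
Qed.
HB.instance Definition _ := GRing.Lalgebra_isAlgebra.Build k pathalg pathscaleAr.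

Fact pathbase_finite (p : qpath Q) : finite_set [set q | ((q == p)%:R : k^o) != 0].
Proof.
apply: (@sub_finite_set _ _ [set p]); last exact: finite_set1.
by by move=> q /=; case: (q =P p) => // _; rewrite eqxx.
Qed.
Definition pathbase (p : qpath Q) : pathalg := Dsum (pathbase_finite p).

Definition path_idem (i : vert Q) : pathalg := pathbase (ptriv i).
Definition path_arrow (a : arrow Q) : pathalg := pathbase (parrow a).

Lemma pathbaseM p q : pathbase p * pathbase q =
  if ptgt p == psrc q then pathbase (pcat p q) else 0.
Proof.
have cb r r' : coef (pathbase r) r' = (r' == r)%:R by [].
apply: pathalg_ext => r; rewrite coefM; case: eqP => pq; last first.
  rewrite big1 // => n _; rewrite !cb.
  case: (ptake n r =P p) => [tp|_]; last by rewrite mul0r.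
  case: (pdrop n r =P q) => [dq|_]; last by rewrite mulr0.
  by case: pq; rewrite -tp -dq.
have vc : val (pcat p q) = (psrc p, parrows p ++ parrows q).
  rewrite val_insubd ifT //= is_path_cat; apply/andP; split; first exact: (valP p).
  by rewrite -/(ptgt p) pq; exact: (valP q).
have tc : ptake (plen p) (pcat p q) = p.
  apply: val_inj; rewrite /= /psrc /parrows vc /= [RHS]surjective_pairing.
  by rewrite take_size_cat.
have dc : pdrop (plen p) (pcat p q) = q.
  apply: val_inj; rewrite /= tc pq /parrows vc /= [RHS]surjective_pairing.
  by rewrite drop_size_cat.
rewrite cb; case: (r =P pcat p q) => [->|rc].
  have pL : (plen p < (plen (pcat p q)).+1)%N.
    by rewrite ltnS /plen {2}/parrows vc size_cat leq_addr.
  rewrite (bigD1 (Ordinal pL)) //= tc dc !cb !eqxx mulr1 big1 ?addr0 // => n nL.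
  rewrite cb; case: eqP => [np|_]; last by rewrite mul0r.
  case/eqP: nL; apply: val_inj => /=.
  by rewrite -(plen_take (n := n) (p := pcat p q)) ?np // -ltnS.
rewrite big1 // => n _; rewrite !cb.
case: (ptake n r =P p) => [tp|_]; last by rewrite mul0r.
case: (pdrop n r =P q) => [dq|_]; last by rewrite mulr0.
by case: rc; rewrite -tp -dq pcat_take_drop.
Qed.

End PathAlgebra.

Definition quiver_connected (Q : quiver) : Prop :=
  forall i j : vert Q,
    connect (fun x y => [exists a : arrow Q,
       ((qtail a == x) && (qhead a == y)) || ((qtail a == y) && (qhead a == x))]) i j.

Definition quiver_acyclic (Q : quiver) : Prop :=
  forall p : qpath Q, psrc p = ptgt p -> plen p = 0%N.

(* inl a is the arrow a itself and inr a is the reversed arrow a^* *)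
Definition double_quiver (Q : quiver) : quiver :=
  @Quiver (vert Q) (arrow Q + arrow Q)%type
    (fun b => match b with inl a => qtail a | inr a => qhead a end)
    (fun b => match b with inl a => qhead a | inr a => qtail a end)
    (vert_gt0 Q).

Section Embedding.
Variables (k : fieldType) (Q : quiver).

Let unstar (b : arrow (double_quiver Q)) : option (arrow Q) :=
  match b with inl a => Some a | inr _ => None end.

Definition star_free (q : qpath (double_quiver Q)) : bool := all (isSome \o unstar) (parrows q).

Fact to_double_proof (p : qpath Q) : @is_path (double_quiver Q) (psrc p) (map inl (parrows p)).
Proof. by case: p => -[i s]; rewrite /psrc /parrows /=; elim: s i => //= a s IHs i /andP[-> /IHs]. Qed.
Definition to_double (p : qpath Q) : qpath (double_quiver Q) :=
  exist _ (psrc p : vert (double_quiver Q), map inl (parrows p)) (to_double_proof p).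

Definition from_double (q : qpath (double_quiver Q)) : qpath Q :=
  insubd (ptriv (psrc q : vert Q)) (psrc q : vert Q, pmap unstar (parrows q)).

Lemma val_from_double q : star_free q ->
  val (from_double q) = (psrc q : vert Q, pmap unstar (parrows q)).
Proof.
move=> q0; rewrite val_insubd ifT //= ; move: q q0 => [[i s]] /=.
rewrite /star_free /parrows /psrc /=; elim: s i => //= -[a|a] s IHs i //=.
by move=> /andP[-> ps] /(IHs _ ps).
Qed.

Lemma from_doubleK q : star_free q -> to_double (from_double q) = q.
Proof.
move=> q0; apply: val_inj; rewrite [RHS]surjective_pairing /= /psrc /parrows.
rewrite val_from_double //=; congr (_, _); move: q0; rewrite /star_free /parrows.
by elim: (val q).2 => //= -[a|a] s IHs //= /IHs ->.
Qed.

Lemma to_doubleK p : from_double (to_double p) = p.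
Proof.
have p0 : star_free (to_double p).
  by rewrite /star_free /parrows /= all_map; exact/allP.
apply: val_inj; rewrite val_from_double // [RHS]surjective_pairing; congr (_, _).
by apply: map_pK.
Qed.

Fact path_embed_finite (f : pathalg k Q) : finite_set
  [set q | ((if star_free q then coef f (from_double q) else 0) : k^o) != 0].
Proof.
apply: sub_finite_set (finite_image to_double (dsum_finite f)) => q /=.
case: ifPn => [q0 nz|_]; last by rewrite eqxx.
by exists (from_double q) => //; exact: from_doubleK.
Qed.

(* the inclusion of kQ into the path algebra of the double quiver: the linear
   extension of to_double *)
Definition path_embed (f : pathalg k Q) : pathalg k (double_quiver Q) :=
  Dsum (path_embed_finite f).

Lemma coef_embed f q :
  coef (path_embed f) q = if star_free q then coef f (from_double q) else 0.
Proof. by []. Qed.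

Lemma path_embed_base p : path_embed (pathbase k p) = pathbase k (to_double p).
Proof.
apply: pathalg_ext => q; rewrite coef_embed.
rewrite -[coef _ q]/(((q == to_double p)%:R) : k).
rewrite -[coef _ (from_double q)]/(((from_double q == p)%:R) : k).
case: ifPn => q0.
  by congr (nat_of_bool _)%:R; apply/eqP/eqP => [<-|->]; rewrite ?from_doubleK ?to_doubleK.
case: eqP => // qp; move: q0; rewrite qp /star_free /parrows /=.
by rewrite all_map /= all_predT.
Qed.

Fact path_embed_zmod : zmod_morphism path_embed.
Proof.
move=> f g; apply: pathalg_ext => q; rewrite coefD coef_embed.
rewrite -[coef (- _) q]/(- coef (path_embed g) q) !coef_embed.
case: ifP => _; first by rewrite coefD.
by rewrite subrr.
Qed.

Lemma star_free_take_drop n q :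
  star_free q = star_free (ptake n q) && star_free (pdrop n q).
Proof.
by rewrite /star_free /parrows /= -all_cat cat_take_drop.
Qed.

Lemma plen_from_double q : star_free q -> plen (from_double q) = plen q.
Proof.
by move=> q0; rewrite -[in RHS](from_doubleK q0) /plen /parrows /= size_map.
Qed.

Lemma to_double_take n p : to_double (ptake n p) = ptake n (to_double p).
Proof. by apply: val_inj; congr (_, _); rewrite /parrows /= map_take. Qed.

Lemma ptgt_to_double p : ptgt (to_double p) = ptgt p.
Proof. by rewrite /ptgt /end_of /psrc /parrows /= -map_comp. Qed.

Lemma to_double_drop n p : to_double (pdrop n p) = pdrop n (to_double p).
Proof.
apply: val_inj; congr (_, _); last by rewrite /parrows /= map_drop.
by rewrite -to_double_take ptgt_to_double.
Qed.

Lemma from_double_take n q : star_free q ->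
  from_double (ptake n q) = ptake n (from_double q).
Proof. by move=> q0; rewrite -{1}(from_doubleK q0) -to_double_take to_doubleK. Qed.

Lemma from_double_drop n q : star_free q ->
  from_double (pdrop n q) = pdrop n (from_double q).
Proof. by move=> q0; rewrite -{1}(from_doubleK q0) -to_double_drop to_doubleK. Qed.

Fact path_embed_monoid : monoid_morphism path_embed.
Proof.
split=> [|f g]; apply: pathalg_ext => q.
  rewrite coef_embed !coef1; case: ifPn => [/plen_from_double -> //|].
  by case: eqP => // /size0nil q0; rewrite /star_free q0.
rewrite coef_embed !coefM; case: ifPn => q0.
  rewrite plen_from_double //; apply: eq_bigr => n _.
  have /andP[q1 q2] : star_free (ptake n q) && star_free (pdrop n q).
    by rewrite -star_free_take_drop.
  by rewrite !coef_embed q1 q2 from_double_take // from_double_drop.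
rewrite big1 // => n _; rewrite !coef_embed; move: q0.
by rewrite (star_free_take_drop n); do 2!case: star_free; rewrite //= ?mul0r ?mulr0.
Qed.

HB.instance Definition _ :=
  GRing.isZmodMorphism.Build _ _ path_embed path_embed_zmod.
HB.instance Definition _ :=
  GRing.isMonoidMorphism.Build _ _ path_embed path_embed_monoid.

End Embedding.

Section QuiverHeisenberg.
Variables (k : fieldType) (Q : quiver) (v : vert Q -> k).

Notation x a := (path_arrow k (inl a : arrow (double_quiver Q))).
Notation xs a := (path_arrow k (inr a : arrow (double_quiver Q))).

Definition rho (i : vert Q) : pathalg k (double_quiver Q) :=
  \sum_(a : arrow Q | qtail a == i) x a * xs a -
  \sum_(a : arrow Q | qhead a == i) xs a * x a.

Definition wrho : pathalg k (double_quiver Q) := \sum_(i : vert Q) (v i)^-1 *: rho i.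

Definition eta (b : arrow (double_quiver Q)) : pathalg k (double_quiver Q) :=
  path_arrow k b * wrho - wrho * path_arrow k b.

Definition qHeis : Type := ringquot (range eta).
HB.instance Definition _ := GRing.PzRing.on qHeis.

Definition qHeis_proj : {rmorphism pathalg k (double_quiver Q) -> qHeis} :=
  quot_map (range eta).

Definition qHeis_incl : {rmorphism pathalg k Q -> qHeis} :=
  qHeis_proj \o @path_embed k Q.

Definition qHeis_mod : lmodType (pathalg k Q) := res_scalars qHeis_incl qHeis^o.

Definition qHeis_idem_mod (i : vert Q) : lmodType (pathalg k Q) :=
  res_scalars qHeis_incl (left_ideal (qHeis_proj (path_idem k (i : vert (double_quiver Q))))).

End QuiverHeisenberg.

Section Dimension.
Variables (k : fieldType) (V : lmodType k).

Definition has_basis_of_size (S : set V) (n : nat) : Prop :=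
  exists b : 'I_n -> V, (forall i, S (b i)) /\
    forall x, S x -> exists! c : {ffun 'I_n -> k}, x = \sum_i c i *: b i.

(* the dimension of the subspace S; 0 if it is infinite *)
Definition dimk (S : set V) : nat := xget 0%N [set n | has_basis_of_size S n].

End Dimension.

Section Modules.
Variables (k : fieldType) (A : algType k).

Definition kspace (M : lmodType A) : lmodType k := res_scalars (GRing.in_alg A) M.

Definition fin_dim (M : lmodType A) : Prop :=
  exists n, @has_basis_of_size k (kspace M) setT n.

Definition mdim (M : lmodType A) : nat := @dimk k (kspace M) setT.

(* the dimension of e M, for an idempotent e *)
Definition mdim_at (e : A) (M : lmodType A) : nat :=
  @dimk k (kspace M) (range (fun x : M => e *: x)).

End Modules.

Lemma linear_ext (R : pzRingType) (U V : lmodType R) (f g : {linear U -> V}) :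
  f =1 g -> f = g.
Proof.
case: f g => [f [[fD] [fZ]]] [g [[gD] [gZ]]] /= /funext fg.
case: g / fg gD gZ => gD gZ.
by rewrite (Prop_irrelevance gD fD) (Prop_irrelevance gZ fZ).
Qed.

Section LinearDual.
Variables (k : fieldType) (A : algType k) (M : lmodType A).

(* D M = Hom_k(M, k), a right A-module by (f a)(m) = f (a m); right A-modules
   are left modules over the converse ring A^c *)
Definition kdual : Type := {linear kspace M -> k^o}.

HB.instance Definition _ := gen_eqMixin kdual.
HB.instance Definition _ := gen_choiceMixin kdual.

Let ev (f : kdual) (m : M) : k := f m.

Let mk (g : M -> k)
  (H : forall c (m n : M), g (c%:A *: m + n) = c * g m + g n) : kdual :=
  HB.pack (g : kspace M -> k^o) (GRing.isLinear.Build k (kspace M) k^o *:%R g H).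

Let evP (f : kdual) c (m n : M) : ev f (c%:A *: m + n) = c * ev f m + ev f n.
Proof. exact: (linearP f). Qed.

Let kdual_ext (f g : kdual) : ev f =1 ev g -> f = g.
Proof. by move=> fg; apply: linear_ext => m; exact: fg. Qed.

Fact kdual0_linear c (m n : M) : (0 : k) = c * 0 + 0.
Proof. by rewrite mulr0 addr0. Qed.
Fact kdualN_linear (f : kdual) c (m n : M) :
  - ev f (c%:A *: m + n) = c * - ev f m + - ev f n.
Proof. by rewrite evP opprD mulrN. Qed.
Fact kdualD_linear (f g : kdual) c (m n : M) :
  ev f (c%:A *: m + n) + ev g (c%:A *: m + n) =
  c * (ev f m + ev g m) + (ev f n + ev g n).
Proof. by rewrite !evP mulrDr addrACA. Qed.
Fact kdualZ_linear (a : A) (f : kdual) c (m n : M) :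
  ev f (a *: (c%:A *: m + n)) = c * ev f (a *: m) + ev f (a *: n).
Proof. by rewrite scalerDr scalerA -scalerAr mulr1 -{1}[a]mul1r scalerAl -scalerA evP. Qed.

Let zero := mk kdual0_linear.
Let opp f := mk (kdualN_linear f).
Let add f g := mk (kdualD_linear f g).
Let scl (a : A^c) f := mk (kdualZ_linear a f).

Fact kdual_addA : associative add.
Proof. by move=> f g h; apply: kdual_ext => m; apply: addrA. Qed.
Fact kdual_addC : commutative add.
Proof. by move=> f g; apply: kdual_ext => m; apply: addrC. Qed.
Fact kdual_add0 : left_id zero add.
Proof. by move=> f; apply: kdual_ext => m; apply: add0r. Qed.
Fact kdual_addN : left_inverse zero opp add.
Proof. by move=> f; apply: kdual_ext => m; apply: addNr. Qed.

HB.instance Definition _ :=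
  GRing.isZmodule.Build kdual kdual_addA kdual_addC kdual_add0 kdual_addN.

Fact kdual_scaleA a b f : scl a (scl b f) = scl (a * b) f.
Proof. by apply: kdual_ext => m; rewrite /ev /= scalerA. Qed.
Fact kdual_scale1 : left_id 1 scl.
Proof. by move=> f; apply: kdual_ext => m; rewrite /ev /= scale1r. Qed.
Fact kdual_scaleDr : right_distributive scl +%R.
Proof. by move=> a f g; apply: kdual_ext. Qed.
Fact kdual_scaleDl f : {morph scl^~ f : a b / a + b}.
Proof.
move=> a b; apply: kdual_ext => m; rewrite /ev /= scalerDl.
exact: (raddfD f).
Qed.

HB.instance Definition _ := GRing.Zmodule_isLmodule.Build A^c kdual
  kdual_scaleA kdual_scale1 kdual_scaleDr kdual_scaleDl.

Lemma kdual_scaleE (a : A^c) (f : kdual) (m : M) :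
  (a *: f : kdual) m = f ((a : A) *: m).
Proof. by []. Qed.

End LinearDual.

Section RingDual.
Variables (R : pzRingType) (P : lmodType R^c).

(* Hom_R(P, R) for a right R-module P, a left R-module by (a f)(x) = a (f x) *)
Definition rdual : Type := {linear P -> (R^c)^o}.

HB.instance Definition _ := gen_eqMixin rdual.
HB.instance Definition _ := gen_choiceMixin rdual.

Let ev (f : rdual) (x : P) : R := f x.

Let mk (g : P -> R)
  (H : forall (b : R^c) (x y : P), g (b *: x + y) = g x * (b : R) + g y) : rdual :=
  HB.pack (g : P -> (R^c)^o) (GRing.isLinear.Build R^c P (R^c)^o *:%R g H).

Let evP (f : rdual) (b : R^c) x y : ev f (b *: x + y) = ev f x * (b : R) + ev f y.
Proof. exact: (linearP f). Qed.

Let rdual_ext (f g : rdual) : ev f =1 ev g -> f = g.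
Proof. by move=> fg; apply: linear_ext => m; exact: fg. Qed.

Fact rdual0_linear (b : R^c) (x y : P) : (0 : R) = 0 * (b : R) + 0.
Proof. by rewrite mul0r addr0. Qed.
Fact rdualN_linear (f : rdual) (b : R^c) (x y : P) :
  - ev f (b *: x + y) = - ev f x * (b : R) + - ev f y.
Proof. by rewrite evP opprD mulNr. Qed.
Fact rdualD_linear (f g : rdual) (b : R^c) (x y : P) :
  ev f (b *: x + y) + ev g (b *: x + y) =
  (ev f x + ev g x) * (b : R) + (ev f y + ev g y).
Proof. by rewrite !evP mulrDl addrACA. Qed.
Fact rdualZ_linear (a : R) (f : rdual) (b : R^c) (x y : P) :
  a * ev f (b *: x + y) = a * ev f x * (b : R) + a * ev f y.
Proof. by rewrite evP mulrDr mulrA. Qed.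

Let zero := mk rdual0_linear.
Let opp f := mk (rdualN_linear f).
Let add f g := mk (rdualD_linear f g).
Let scl (a : R) f := mk (rdualZ_linear a f).

Fact rdual_addA : associative add.
Proof. by move=> f g h; apply: rdual_ext => x; apply: addrA. Qed.
Fact rdual_addC : commutative add.
Proof. by move=> f g; apply: rdual_ext => x; apply: addrC. Qed.
Fact rdual_add0 : left_id zero add.
Proof. by move=> f; apply: rdual_ext => x; apply: add0r. Qed.
Fact rdual_addN : left_inverse zero opp add.
Proof. by move=> f; apply: rdual_ext => x; apply: addNr. Qed.

HB.instance Definition _ :=
  GRing.isZmodule.Build rdual rdual_addA rdual_addC rdual_add0 rdual_addN.

Fact rdual_scaleA a b f : scl a (scl b f) = scl (a * b) f.
Proof. by apply: rdual_ext => x; apply: mulrA. Qed.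
Fact rdual_scale1 : left_id 1 scl.
Proof. by move=> f; apply: rdual_ext => x; apply: mul1r. Qed.
Fact rdual_scaleDr : right_distributive scl +%R.
Proof. by move=> a f g; apply: rdual_ext => x; apply: mulrDr. Qed.
Fact rdual_scaleDl f : {morph scl^~ f : a b / a + b}.
Proof. by move=> a b; apply: rdual_ext => x; apply: mulrDl. Qed.

HB.instance Definition _ := GRing.Zmodule_isLmodule.Build R rdual
  rdual_scaleA rdual_scale1 rdual_scaleDr rdual_scaleDl.

Lemma rdual_scaleE (a : R) (f : rdual) (x : P) :
  (a *: f : rdual) x = a * (f x : R) :> R.
Proof. by []. Qed.

End RingDual.

Section Projective.
Variable R : pzRingType.

Definition projective (P : lmodType R) : Prop :=
  forall (M N : lmodType R) (g : {linear M -> N}) (f : {linear P -> N}),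
    (forall y, exists x, g x = y) ->
    exists h : {linear P -> M}, forall x, g (h x) = f x.

Definition superfluous (M : lmodType R) (K : set M) : Prop :=
  forall S : {pred M}, submod_closed S ->
    (forall x, exists s t, [/\ s \in S, K t & x = s + t]) -> forall x, x \in S.

(* p is a projective cover of the submodule T of M *)
Definition projective_cover (P M : lmodType R) (p : {linear P -> M}) (T : set M) : Prop :=
  [/\ projective P, range p = T & superfluous [set x | p x = 0]].

(* P1 -> P0 -> M -> 0 is a minimal projective presentation *)
Definition min_proj_presentation (P1 P0 M : lmodType R)
    (p1 : {linear P1 -> P0}) (p0 : {linear P0 -> M}) : Prop :=
  projective_cover p0 setT /\ projective_cover p1 [set x | p0 x = 0].

End Projective.

Section Preprojective.
Variables (k : fieldType) (A : algType k).

(* N is isomorphic to Tr D M: for a minimal projective presentation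
   P1 -> P0 -> D M -> 0 of right A-modules, N is a cokernel of
   Hom_A(P0, A) -> Hom_A(P1, A) *)
Definition is_AR_translate_inv (M N : lmodType A) : Prop :=
  exists (P1 P0 : lmodType A^c) (p1 : {linear P1 -> P0}) (p0 : {linear P0 -> kdual M}),
    min_proj_presentation p1 p0 /\
    exists q : {linear rdual P1 -> N}, range q = setT /\
      forall f : rdual P1, q f = 0 <->
        exists g : rdual P0, forall x, f x = g (p1 x).

(* N is isomorphic to tau^{-n} M *)
Fixpoint is_AR_translate_inv_iter (n : nat) (M N : lmodType A) : Prop :=
  if n is n'.+1 then
    exists L, is_AR_translate_inv_iter n' M L /\ is_AR_translate_inv L N
  else mod_iso M N.

(* M lies in add { tau^{-n} A | n >= 0 } *)
Definition preprojective (M : lmodType A) : Prop :=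
  exists (r : nat) (X : 'I_r -> lmodType A) (M' : lmodType A),
    (forall c, exists n, is_AR_translate_inv_iter n A^o (X c)) /\
    mod_iso (M * M')%type (dsum X).

Definition ind_preprojective (J : Type) (N : J -> lmodType A) : Prop :=
  [/\ forall j, preprojective (N j) /\ indecomposable (N j),
      forall j j', mod_iso (N j) (N j') -> j = j'
    & forall M : lmodType A, preprojective M -> indecomposable M ->
        exists j, mod_iso M (N j)].

End Preprojective.

Definition regular_weight (k : fieldType) (Q : quiver) (v : vert Q -> k) : Prop :=
  forall N : lmodType (pathalg k Q), fin_dim N -> indecomposable N ->
    \sum_(i : vert Q) v i * (mdim_at (path_idem k i) N)%:R != 0.

(* Main.v *)
From HB Require Import structures.
From mathcomp Require Import all_boot all_order all_algebra.
From mathcomp Require Import boolp classical_sets functions cardinality.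
From mathcomp Require Import zify.
Require Import Defs.

Set Implicit Arguments.
Unset Strict Implicit.
Unset Printing Implicit Defensive.

Import GRing.Theory Num.Theory Order.TTheory.
Local Open Scope ring_scope.
Arguments coef : simpl never.

(** Let Pi be the preprojective algebra of Q, graded by the number of starred arrows, and for
   x = (m, j) let N_x = Pi_m e_j be the part of Pi e_j with m starred arrows.  The nonzero N_x are
   the indecomposable preprojective A-modules: a homomorphism N_x -> N_y is the right
   multiplication by an element of Pi, so that End(N_x) = k, and computing the transpose of the
   dual of Pi_m with the path basis of Pi_m gives Pi_(m+1) = tau^-1 Pi_m.

   Let a be an arrow of the double quiver with tail j, and let x.a be (m, head a) or
   (m + 1, head a).  The trace of the weight on N_x is nonzero because v is regular, and the image
   of f |-> (z |-> \sum_b (b f_b(z) - f_b(b z))) is the annihilator of Hom(N_(x.a), N_x) for the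
   trace pairing.  Hence there are maps F^a_b : N_x -> N_(x.a) with
   \sum_b (b F^a_b(z) - F^a_b(b z)) = v z a, and nonvanishing traces make the universal map
   N_x^Q1 -> E_x = \bigoplus_a N_(x.a) that they define behave as in an almost split sequence.

   Rescaling the F^a by constants lam gives an action of the Heisenberg algebra on the sum of the
   N_x tensor N_x, where starred arrows act through the F^a on the left factor and through right
   multiplication by a on the second one.  The map phi : u |-> u (1 tensor 1) is inverted by maps
   psi_l(w, n), constructed by induction on the length l of the second factor w by means of the
   universal property of E_x.  So the multiplicity space of N_x in the algebra is N_x, and it is
   e_i N_x in the projective module at i. *)

(** * Linear algebra over quotient rings *)

(** The argument makes no Dynkin distinction and uses no Krull-Schmidt theorem. For Dynkin quivers
    N_(m,j) vanishes for large m ([dead]); a last nonzero piece is injective, and there x |-> (x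
    a)_a may have a kernel. The universal property of E_x survives because the trace of the weight
    is nonzero ([rkilled_dies]).

    The constants [lam] are forced. In the Heisenberg algebra the weighted relation rho must commute
    with starred arrows, and rho acts by n tensor w |-> \sum_a lam n a tensor w a. The two orders of
    composition differ only along an arrow followed by its reverse, by a constant ([FA_commute]);
    [lam] turns this constant into the sign of the arrow, so that the preprojective relation in the
    second factor cancels the sum. This requires the constant to be nonzero, a second trace argument
    ([FA_const_neq0]).

    Acyclicity gives an injective rank on vertices, and maps are built one vertex at a time, upwards
    or downwards ([vertex_recursion]). Homological facts, such as exactness of the mesh complex of
    Pi or projectivity of kernels over kQ, are reduced to dividing paths by arrows and to explicit
    extensions. *)

Section LinearPredicate.
Variables (k : fieldType).
Implicit Types U V W : lmodType k.

(** Linearity stays a predicate on bare functions: most maps below come from choice or from a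
    recursion and are never bundled. *)
Lemma lin0 U V (f : U -> V) : linear f -> f 0 = 0.
Proof. by move=> fl; have := fl (-1) 0 0; rewrite scaler0 addr0 scaleN1r addNr. Qed.
Lemma linD U V (f : U -> V) : linear f -> forall x y, f (x + y) = f x + f y.
Proof. by move=> fl x y; have := fl 1 x y; rewrite !scale1r. Qed.
Lemma linZ U V (f : U -> V) : linear f -> forall c x, f (c *: x) = c *: f x.
Proof. by move=> fl c x; have := fl c x 0; rewrite !addr0 lin0 // addr0. Qed.
Lemma linN U V (f : U -> V) : linear f -> forall x, f (- x) = - f x.
Proof. by move=> fl x; rewrite -scaleN1r linZ // scaleN1r. Qed.
Lemma linB U V (f : U -> V) : linear f -> forall x y, f (x - y) = f x - f y.
Proof. by move=> fl x y; rewrite linD // linN. Qed.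
Lemma lin_sum U V (f : U -> V) : linear f -> forall I (r : seq I) (P : pred I) (F : I -> U),
  f (\sum_(i <- r | P i) F i) = \sum_(i <- r | P i) f (F i).
Proof. by move=> fl I r P F; exact: (big_morph f (linD fl) (lin0 fl)). Qed.

Lemma lin_comp U V W (f : V -> W) (g : U -> V) : linear f -> linear g -> linear (fun x => f (g x)).
Proof. by move=> fl gl c x y; rewrite gl fl. Qed.
Lemma lin_add U V (f g : U -> V) : linear f -> linear g -> linear (fun x => f x + g x).
Proof. by move=> fl gl c x y; rewrite gl fl scalerDr addrACA. Qed.
Lemma lin_sub U V (f g : U -> V) : linear f -> linear g -> linear (fun x => f x - g x).
Proof. by move=> fl gl c x y; rewrite gl fl scalerBr opprD addrACA. Qed.
Lemma lin_scale U V (f : U -> V) c : linear f -> linear (fun x => c *: f x).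
Proof. by move=> fl d x y; rewrite fl scalerDr !scalerA mulrC. Qed.
Lemma lin_zero U V : linear (fun _ : U => 0 : V).
Proof. by move=> c x y; rewrite scaler0 addr0. Qed.
Lemma lin_id U : linear (fun x : U => x).
Proof. by []. Qed.
Lemma lin_bigsum U V I (r : seq I) (P : pred I) (F : I -> U -> V) :
  (forall i, P i -> linear (F i)) -> linear (fun x => \sum_(i <- r | P i) F i x).
Proof.
move=> Fl c x y; rewrite scaler_sumr -big_split /=.
by apply: eq_bigr => i /Fl ->.
Qed.
Lemma lin_scalel U V (f : U -> k^o) (v : V) : linear f -> linear (fun x => (f x : k) *: v).
Proof. by move=> fl c x y; rewrite fl scalerDl -scalerA. Qed.

Lemma lin_if U V (b : bool) (f : U -> V) : linear f -> linear (fun x => if b then f x else 0).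
Proof. by case: b => // _; exact: lin_zero. Qed.

End LinearPredicate.

Section RingQuotientModule.
Variables (k : fieldType) (R : algType k) (S : set R).

(** The quotient is so far only a ring; its k-space structure is multiplication by the images of the
    scalars. *)
Let scl (c : k) (x : ringquot S) : ringquot S := quot_map S (c%:A) * x.

Fact ringquot_scaleA a b v : scl a (scl b v) = scl (a * b) v.
Proof. by rewrite /scl mulrA -rmorphM -scalerAl mul1r scalerA. Qed.
Fact ringquot_scale1 : left_id 1 scl.
Proof. by move=> x; rewrite /scl scale1r rmorph1 mul1r. Qed.
Fact ringquot_scaleDr : right_distributive scl +%R.
Proof. by move=> a x y; rewrite /scl mulrDr. Qed.
Fact ringquot_scaleDl v : {morph scl^~ v : a b / a + b}.
Proof. by move=> a b; rewrite /scl scalerDl rmorphD mulrDl. Qed.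

HB.instance Definition _ := GRing.Zmodule_isLmodule.Build k (ringquot S)
  ringquot_scaleA ringquot_scale1 ringquot_scaleDr ringquot_scaleDl.

Lemma quot_scaleE (c : k) (x : ringquot S) : c *: x = quot_map S (c%:A) * x.
Proof. by []. Qed.

Lemma quot_mapZ (c : k) (x : R) : quot_map S (c *: x) = c *: quot_map S x.
Proof. by rewrite quot_scaleE -rmorphM -scalerAl mul1r. Qed.

Lemma quot_map_linear : linear (quot_map S : (R : lmodType k) -> (ringquot S : lmodType k)).
Proof. by move=> c x y; rewrite rmorphD /= quot_mapZ. Qed.

Lemma quot_scaleAl (c : k) (x y : ringquot S) : c *: (x * y) = (c *: x) * y.
Proof. by rewrite !quot_scaleE mulrA. Qed.

(** Scalars act through the left factor, so this is the centrality of their images, inherited from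
    [R] through representatives. *)
Lemma quot_scaleAr (c : k) (x y : ringquot S) : c *: (x * y) = x * (c *: y).
Proof.
have [x' <-] := quot_map_surj x; have [y' <-] := quot_map_surj y.
by rewrite -rmorphM -!quot_mapZ -rmorphM scalerAr.
Qed.

Lemma quot_mulr_linear (y : ringquot S) : linear (fun x : ringquot S => (x * y : ringquot S)).
Proof. by move=> c x x'; rewrite mulrDl quot_scaleAl. Qed.
Lemma quot_mull_linear (x : ringquot S) : linear (fun y : ringquot S => (x * y : ringquot S)).
Proof. by move=> c y y'; rewrite mulrDr quot_scaleAr. Qed.

Lemma quot_lift (V : lmodType k) (f : R -> V) : linear f ->
  (forall x, ideal_gen S x -> f x = 0) ->
  exists g : ringquot S -> V, linear g /\ forall x, g (quot_map S x) = f x.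
Proof.
move=> fl f0; have /choice[s sP] := @quot_map_surj R S.
have fE x : f (s (quot_map S x)) = f x.
  apply/eqP; rewrite -subr_eq0 -linB //; apply/eqP/f0/quot_map_eq0.
  by rewrite rmorphB /= sP subrr.
exists (fun y => f (s y)); split=> // c x y.
by rewrite -[x]sP -[y]sP -quot_map_linear !fE fl.
Qed.

Lemma ideal_gen_sub (J : set R) : two_sided_ideal J -> (S `<=` J)%classic ->
  forall x, ideal_gen S x -> J x.
Proof. by move=> JI SJ x; apply. Qed.

Lemma ideal_gen_mem x : S x -> ideal_gen S x.
Proof. by move=> Sx J _; apply. Qed.

End RingQuotientModule.

Section Endomorphisms.
Variables (k : fieldType) (V : lmodType k).

Definition endo_pred : {pred V -> V} := fun f => `[< linear f >].

Fact endo_submod : submod_closed endo_pred.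
Proof.
split; first by apply/asboolP; exact: lin_zero.
move=> c f g /asboolP fl /asboolP gl; apply/asboolP => d x y.
by rewrite /= !fctE fl gl !scalerDr !scalerA mulrC addrACA.
Qed.

HB.instance Definition _ :=
  GRing.isSubmodClosed.Build k (V -> V) endo_pred (GRing.submod_closed_semi endo_submod).

(** The k-linear maps form a k-space of their own here, so that [path_ext] can take values in them
    with composition as product. *)
Record endo := Endo { endo_val :> V -> V; endo_predP : endo_val \in endo_pred }.

HB.instance Definition _ := [isSub for endo_val].
HB.instance Definition _ := [Choice of endo by <:].
HB.instance Definition _ := [SubChoice_isSubLmodule of endo by <:].

Lemma endo_linear (f : endo) : linear f.
Proof. by apply/asboolP; exact: endo_predP. Qed.

Definition mk_endo (f : V -> V) (fl : linear f) : endo := Endo (asboolT fl : f \in endo_pred).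

Definition endo_comp (f g : endo) : endo :=
  mk_endo (lin_comp (endo_linear f) (endo_linear g)).

Lemma endo_ext (f g : endo) : (forall x, f x = g x) -> f = g.
Proof. by move=> fg; apply: val_inj; apply: funext. Qed.

Lemma endo_comp_linl (g : endo) : linear (fun f : endo => endo_comp f g).
Proof. by move=> c f f'; apply: endo_ext. Qed.
Lemma endo_comp_linr (f : endo) : linear (endo_comp f).
Proof. by move=> c g g'; apply: endo_ext => x; exact: endo_linear. Qed.
Lemma endo_compA : associative endo_comp.
Proof. by move=> f g h; exact: endo_ext. Qed.
Lemma endoDE (f g : endo) x : (f + g) x = f x + g x. Proof. by []. Qed.
Lemma endoZE c (f : endo) x : (c *: f) x = c *: f x. Proof. by []. Qed.

End Endomorphisms.

(** * Path algebras *)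

Section PathAlgebraTools.
Variables (k : fieldType) (Q : quiver).
Local Notation B := (pathalg k Q).
Local Notation E := (@path_idem k Q).
Local Notation X := (@path_arrow k Q).
Implicit Types (p q : qpath Q) (f g : B) (a b : arrow Q) (i j : vert Q).

Lemma val_pcat p q : ptgt p = psrc q -> val (pcat p q) = (psrc p, parrows p ++ parrows q).
Proof.
move=> pq; rewrite val_insubd ifT //= is_path_cat; apply/andP; split.
  exact: (valP p).
by rewrite -/(ptgt p) pq; exact: (valP q).
Qed.

Lemma parrows_pcat p q : ptgt p = psrc q -> parrows (pcat p q) = parrows p ++ parrows q.
Proof. by move=> pq; rewrite {1}/parrows val_pcat. Qed.

Lemma ptgt_pcat p q : ptgt p = psrc q -> ptgt (pcat p q) = ptgt q.
Proof.
by move=> pq; rewrite {1}/ptgt /psrc /parrows val_pcat //= end_of_cat -/(ptgt p) pq.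
Qed.

Lemma psrc_pcat p q : ptgt p = psrc q -> psrc (pcat p q) = psrc p.
Proof. by move=> pq; rewrite {1}/psrc val_pcat. Qed.

Lemma plen_pcat p q : ptgt p = psrc q -> plen (pcat p q) = (plen p + plen q)%N.
Proof. by move=> pq; rewrite {1}/plen /parrows val_pcat //= size_cat. Qed.

Lemma pcat_triv p i : ptgt p = i -> pcat p (ptriv i) = p.
Proof.
by move=> pi; apply: val_inj; rewrite val_pcat //= cats0 [RHS]surjective_pairing.
Qed.

Lemma triv_pcat p i : psrc p = i -> pcat (ptriv i) p = p.
Proof.
by move=> <-; apply: val_inj; rewrite val_pcat // [RHS]surjective_pairing.
Qed.

Lemma qpath_indl (Pr : qpath Q -> Prop) : (forall i, Pr (ptriv i)) ->
  (forall a p, qhead a = psrc p -> Pr p -> Pr (pcat (parrow a) p)) -> forall p, Pr p.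
Proof.
move=> P0 PS [[i s] ps]; elim: s i ps => [|a s IHs] i ps.
  by rewrite (_ : exist _ _ _ = ptriv i) //; exact: val_inj.
have /= /andP[/eqP ia ps'] := ps.
rewrite (_ : exist _ _ _ = pcat (parrow a) (exist _ (qhead a, s) ps')).
  by apply: PS => //; exact: IHs.
by apply: val_inj; rewrite val_pcat //= -ia.
Qed.

Lemma arrow_pathbase a p : X a * pathbase k p =
  if qhead a == psrc p then pathbase k (pcat (parrow a) p) else 0.
Proof. exact: pathbaseM. Qed.

Lemma pathbase_arrow p a : pathbase k p * X a =
  if ptgt p == qtail a then pathbase k (pcat p (parrow a)) else 0.
Proof. exact: pathbaseM. Qed.

Lemma idem_pathbase i p : E i * pathbase k p = if i == psrc p then pathbase k p else 0.
Proof. by rewrite /path_idem pathbaseM; case: eqP => // ip; rewrite triv_pcat. Qed.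

Lemma pathbase_idem i p : pathbase k p * E i = if ptgt p == i then pathbase k p else 0.
Proof. by rewrite /path_idem pathbaseM; case: eqP => // ip; rewrite pcat_triv. Qed.

Lemma idemM i j : E i * E j = if i == j then E i else 0.
Proof. by rewrite {2}/path_idem idem_pathbase; case: eqP => // ->. Qed.

Lemma idem_arrow i a : E i * X a = if i == qtail a then X a else 0.
Proof. exact: idem_pathbase. Qed.

Lemma arrow_idem i a : X a * E i = if qhead a == i then X a else 0.
Proof. exact: pathbase_idem. Qed.

Lemma coef_base p q : coef (pathbase k p) q = (q == p)%:R.
Proof. by []. Qed.

Lemma coef_sum I (r : seq I) (P : pred I) (F : I -> B) p :
  coef (\sum_(i <- r | P i) F i) p = \sum_(i <- r | P i) coef (F i) p.
Proof. by apply: (big_morph (fun f => coef f p)). Qed.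

Lemma idem_sum : \sum_(i : vert Q) E i = 1 :> B.
Proof.
apply: pathalg_ext => p; rewrite coef_sum coef1.
under eq_bigr => i _ do rewrite coef_base.
have [p0|p0] := eqVneq (plen p) 0%N.
  have -> : p = ptriv (psrc p) by rewrite -(ptake_len p) p0 ptake0.
  rewrite (bigD1 (psrc p)) //= eqxx big1 ?addr0 // => i ip.
  by case: eqP => // /(congr1 (@psrc Q)) pi; case/eqP: ip; exact: esym pi.
rewrite big1 // => i _; case: eqP => // pi; move: p0.
by rewrite pi.
Qed.

Lemma supp_exists f : exists s : seq (qpath Q),
  uniq s /\ forall p, (p \in s) = (coef f p != 0).
Proof.
have /finite_seqP[s sE] := dsum_finite f.
exists (undup s); split; first exact: undup_uniq.
move=> p; rewrite mem_undup; apply/idP/idP => [ps|nz].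
  have : [set` s]%classic p by [].
  by rewrite -sE.
have : [set i | dsum_fun f i != 0]%classic p by [].
by rewrite sE.
Qed.

Definition supp f : seq (qpath Q) := sval (cid (supp_exists f)).
Lemma supp_uniq f : uniq (supp f). Proof. by rewrite /supp; case: cid => s []. Qed.
Lemma mem_supp f (p : qpath Q) : (p \in supp f) = (coef f p != 0).
Proof. by rewrite /supp; case: cid => s []. Qed.

Section LinearExtension.
Variables (V : lmodType k) (g : qpath Q -> V).

Definition lext f : V := \sum_(p <- supp f) coef f p *: g p.

(** Two elements can thus be expanded over one common list, which is how linearity of [lext] is
    obtained. *)
Lemma lext_seq f s : uniq s -> (forall p, coef f p != 0 -> p \in s) ->
  lext f = \sum_(p <- s) coef f p *: g p.
Proof.
move=> us sub.
rewrite [RHS](bigID (fun p => coef f p != 0)) /= [X in _ + X]big1 ?addr0; last first.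
  by move=> p /negbNE/eqP ->; rewrite scale0r.
rewrite -big_filter /lext; apply: perm_big; apply: uniq_perm.
- exact: supp_uniq.
- exact: filter_uniq.
by move=> p; rewrite mem_supp mem_filter andb_idr //; exact: sub.
Qed.

Lemma lext_linear : linear lext.
Proof.
move=> c f f'; pose s := undup (supp f ++ supp f').
have us : uniq s by exact: undup_uniq.
have sP p : coef f p != 0 \/ coef f' p != 0 -> p \in s.
  by rewrite mem_undup mem_cat !mem_supp => -[->|->]; rewrite ?orbT.
rewrite (@lext_seq f s) ?(@lext_seq f' s) ?(@lext_seq (c *: f + f') s) //.
- rewrite scaler_sumr -big_split /=; apply: eq_bigr => p _.
  by rewrite coefD coefZ scalerDl scalerA.
- move=> p; rewrite coefD coefZ => nz; apply: sP.
  case: (eqVneq (coef f p) 0) => [z|]; last by left.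
  by right; move: nz; rewrite z mulr0 add0r.
- by move=> p nz; apply: sP; right.
- by move=> p nz; apply: sP; left.
Qed.

Lemma lext_base p : lext (pathbase k p) = g p.
Proof.
rewrite (@lext_seq _ [:: p]) //; first by rewrite big_seq1 coef_base eqxx scale1r.
by move=> q; rewrite coef_base inE; case: (q == p) => //; rewrite eqxx.
Qed.

End LinearExtension.

Lemma pathalg_expand f : f = \sum_(p <- supp f) coef f p *: pathbase k p.
Proof.
apply: pathalg_ext => q; rewrite coef_sum.
under eq_bigr => p _ do rewrite coefZ coef_base.
have [qs|] := boolP (q \in supp f).
  rewrite (bigD1_seq q) ?supp_uniq //= eqxx mulr1 big1 ?addr0 // => p /negPf.
  by rewrite eq_sym => ->; rewrite mulr0.
rewrite mem_supp negbK => /eqP z; rewrite z big_seq big1 // => p ps.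
by case: eqP => qp; rewrite ?mulr0 // mulr1 -qp.
Qed.

Lemma pathalg_ind (Pr : B -> Prop) : Pr 0 -> (forall f g, Pr f -> Pr g -> Pr (f + g)) ->
  (forall c f, Pr f -> Pr (c *: f)) -> (forall p, Pr (pathbase k p)) -> forall f, Pr f.
Proof.
move=> P0 PD PZ Pp f; rewrite (pathalg_expand f).
by apply: (big_ind Pr) => // p _; apply: PZ.
Qed.

Lemma pathalg_indl (Pr : B -> Prop) : Pr 0 -> (forall f g, Pr f -> Pr g -> Pr (f + g)) ->
  (forall c f, Pr f -> Pr (c *: f)) -> (forall i, Pr (E i)) ->
  (forall a f, Pr f -> Pr (X a * f)) -> forall f, Pr f.
Proof.
move=> P0 PD PZ PE PX; apply: pathalg_ind => //; apply: qpath_indl => // a p ap.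
by move=> /(PX a); rewrite arrow_pathbase ap eqxx.
Qed.

Lemma lin_ext_base (V : lmodType k) (F G : B -> V) : linear F -> linear G ->
  (forall p, F (pathbase k p) = G (pathbase k p)) -> forall f, F f = G f.
Proof.
move=> Fl Gl FG; apply: pathalg_ind => //.
- by rewrite !lin0.
- by move=> f g FGf FGg; rewrite !linD // FGf FGg.
- by move=> c f FGf; rewrite !linZ // FGf.
Qed.

Section UniversalProperty.
Variables (V : lmodType k) (mul : V -> V -> V).
Hypothesis mul_linl : forall y, linear (mul ^~ y).
Hypothesis mul_linr : forall x, linear (mul x).
Hypothesis mulA : associative mul.
Variables (e : vert Q -> V) (x : arrow Q -> V).
Hypothesis eM : forall i j, mul (e i) (e j) = if i == j then e i else 0.
Hypothesis exM : forall i a, mul (e i) (x a) = if i == qtail a then x a else 0.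
Hypothesis xeM : forall i a, mul (x a) (e i) = if qhead a == i then x a else 0.

(** The product is folded starting from the last arrow, so [mul] needs no unit; it may be an
    opposite product or a composition of operators. *)
Definition path_img (p : qpath Q) : V :=
  if rev (parrows p) is a :: s then foldl (fun y b => mul (x b) y) (x a) s else e (psrc p).

Lemma path_img_cons a p : qhead a = psrc p ->
  path_img (pcat (parrow a) p) = mul (x a) (path_img p).
Proof.
move=> ap; rewrite /path_img /psrc /parrows val_pcat //= rev_cons.
case: p ap => -[i s] /= ps; rewrite /psrc /parrows /= => ai.
case: (rev s) (revK s) => [|b s'] sE /=; first by rewrite xeM ai eqxx.
by rewrite -cats1 foldl_cat.
Qed.

Definition path_ext : B -> V := lext path_img.

Lemma path_ext_linear : linear path_ext. Proof. exact: lext_linear. Qed.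
Lemma path_ext_idem i : path_ext (E i) = e i.
Proof. by rewrite /path_ext lext_base. Qed.
Lemma path_ext_arrow a : path_ext (X a) = x a.
Proof. by rewrite /path_ext lext_base. Qed.

Lemma path_ext_cons a f : path_ext (X a * f) = mul (x a) (path_ext f).
Proof.
move: f; apply: (lin_ext_base (F := fun f => path_ext (X a * f))).
- by move=> c f g; rewrite mulrDr -scalerAr path_ext_linear.
- exact: (lin_comp (mul_linr (x a)) path_ext_linear).
move=> p; rewrite arrow_pathbase /path_ext lext_base; case: eqP => [ap|ap].
  by rewrite lext_base path_img_cons.
rewrite lin0; last exact: lext_linear.
(* Both sides vanish when [a] does not end at the source of [p]: the idempotent at that source can
   be inserted in front of the image of [p]. *)
suff -> : path_img p = mul (e (psrc p)) (path_img p).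
  by rewrite mulA xeM; case: eqP => // _; rewrite (lin0 (mul_linl _)).
elim/qpath_indl: p {ap} => [i|b p bp _]; first by rewrite /path_img /= eM eqxx.
by rewrite path_img_cons // mulA exM psrc_pcat //= eqxx.
Qed.

Lemma path_extE i f : path_ext (E i * f) = mul (e i) (path_ext f).
Proof.
move: f; apply: (lin_ext_base (F := fun f => path_ext (E i * f))).
- by move=> c f g; rewrite mulrDr -scalerAr path_ext_linear.
- exact: (lin_comp (mul_linr (e i)) path_ext_linear).
elim/qpath_indl => [j|b p bp _].
  by rewrite idemM !path_ext_idem eM; case: eqP => _; rewrite ?path_ext_idem ?(lin0 path_ext_linear).
have -> : pathbase k (pcat (parrow b) p) = X b * pathbase k p.
  by rewrite arrow_pathbase bp eqxx.
rewrite mulrA idem_arrow !path_ext_cons mulA exM.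
by case: eqP => _; rewrite ?path_ext_cons // mul0r (lin0 path_ext_linear) (lin0 (mul_linl _)).
Qed.

Lemma path_extM f g : path_ext (f * g) = mul (path_ext f) (path_ext g).
Proof.
elim/pathalg_indl: f => [|f f' IH IH'|c f IH|i|a f IH].
- by rewrite mul0r !(lin0 path_ext_linear) (lin0 (mul_linl _)).
- by rewrite mulrDl !(linD path_ext_linear) IH IH' (linD (mul_linl _)).
- by rewrite -scalerAl !(linZ path_ext_linear) IH (linZ (mul_linl _)).
- by rewrite path_extE path_ext_idem.
- by rewrite -mulrA !path_ext_cons IH mulA.
Qed.

End UniversalProperty.

(** Removal of a leading arrow [a]. As a vector space the path algebra is the direct sum of the
    lines spanned by the vertex idempotents and of the right ideals generated by the arrows, so this
    is a left division ([ldiv_decomp]). *)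
Definition ldiv_path (a : arrow Q) (p : qpath Q) : B :=
  if parrows p is b :: s then if b == a then pathbase k (pdrop 1 p) else 0 else 0.

Definition ldiv a f : B := lext (ldiv_path a) f.

Lemma ldiv_linear a : linear (ldiv a). Proof. exact: lext_linear. Qed.

Lemma pdrop_cons a p : qhead a = psrc p -> pdrop 1 (pcat (parrow a) p) = p.
Proof.
move=> ap; apply: val_inj; set q := pcat _ _.
transitivity (end_of (psrc q) (take 1 (parrows q)), drop 1 (parrows q)); first by [].
rewrite parrows_pcat // psrc_pcat //= drop0 take0 /end_of /= ap.
exact/esym/surjective_pairing.
Qed.

Lemma ldiv_arrow a b f : ldiv a (X b * f) = if b == a then E (qhead a) * f else 0.
Proof.
move: f; apply: (lin_ext_base (F := fun f => ldiv a (X b * f))).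
- by move=> c f g; rewrite mulrDr -scalerAr ldiv_linear.
- by case: eqP => _ c f g; rewrite ?scaler0 ?addr0 // mulrDr -scalerAr.
move=> p; rewrite arrow_pathbase; case: (b =P a) => [->|ba]; last first.
  case: eqP => [bp|_]; last by rewrite (lin0 (ldiv_linear a)).
  rewrite /ldiv lext_base /ldiv_path parrows_pcat //=.
  by case: eqP.
rewrite idem_pathbase; case: eqP => [ap|_]; last by rewrite (lin0 (ldiv_linear a)).
by rewrite /ldiv lext_base /ldiv_path parrows_pcat //= eqxx pdrop_cons.
Qed.

Lemma ldiv_idem a i : ldiv a (E i) = 0.
Proof. by rewrite /ldiv lext_base. Qed.

Lemma ldiv_decomp f : exists c : vert Q -> k,
  f = \sum_i c i *: E i + \sum_a X a * ldiv a f.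
Proof.
elim/pathalg_indl: f => [|f g [c cE] [d dE]|c f [d dE]|i|b f _].
- exists (fun=> 0); rewrite big1 => [|i _]; last by rewrite scale0r.
  by rewrite big1 ?addr0 // => a _; rewrite (lin0 (ldiv_linear a)) mulr0.
- exists (fun i => c i + d i); rewrite {1}cE {1}dE addrACA -!big_split /=.
  congr (_ + _); apply: eq_bigr => ? _; first by rewrite scalerDl.
  by rewrite (linD (ldiv_linear _)) mulrDr.
- exists (fun i => c * d i); rewrite {1}dE scalerDr !scaler_sumr.
  congr (_ + _); apply: eq_bigr => ? _; first by rewrite scalerA.
  by rewrite (linZ (ldiv_linear _)) scalerAr.
- exists (fun j => (j == i)%:R); rewrite (bigD1 i) //= eqxx scale1r.
  rewrite big1 => [|j /negPf ->]; last by rewrite scale0r.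
  by rewrite big1 ?addr0 // => a _; rewrite ldiv_idem mulr0.
- exists (fun=> 0); rewrite big1 => [|i _]; last by rewrite scale0r.
  rewrite add0r (bigD1 b) //= ldiv_arrow eqxx big1 ?addr0 => [|a ab].
    by rewrite mulrA arrow_idem eqxx.
  by rewrite ldiv_arrow eq_sym (negPf ab) mulr0.
Qed.

End PathAlgebraTools.

(** Idempotents and arrows generate the path algebra, so stability under them on both sides
    suffices. *)
Lemma generated_ideal (k : fieldType) (Q : quiver) (J : set (pathalg k Q)) :
  J 0 -> (forall x y, J x -> J y -> J (x + y)) -> (forall c x, J x -> J (c *: x)) ->
  (forall i x, J x -> J (path_idem k i * x)) -> (forall i x, J x -> J (x * path_idem k i)) ->
  (forall a x, J x -> J (path_arrow k a * x)) -> (forall a x, J x -> J (x * path_arrow k a)) ->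
  two_sided_ideal J.
Proof.
move=> J0 JD JZ JEl JEr JXl JXr.
have Jl g f : J f -> J (g * f).
  elim/pathalg_indl: g f => [|g h IHg IHh|c g IH|i|a g IH] f Jf.
  - by rewrite mul0r.
  - by rewrite mulrDl; apply: JD; auto.
  - by rewrite -scalerAl; apply: JZ; auto.
  - by auto.
  - by rewrite -mulrA; auto.
have Jr g f : J f -> J (f * g).
  elim/pathalg_indl: g f => [|g h IHg IHh|c g IH|i|a g IH] f Jf.
  - by rewrite mulr0.
  - by rewrite mulrDr; apply: JD; auto.
  - by rewrite -scalerAr; apply: JZ; auto.
  - by auto.
  - by rewrite mulrA; auto.
split=> // [x y Jx Jy|a x b Jx]; last by auto.
by apply: JD => //; rewrite -scaleN1r; exact: JZ.
Qed.

(** * The preprojective algebra *)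

Section Preprojective.
Variables (k : fieldType) (Q : quiver).
Notation DQ := (double_quiver Q).
Notation B := (pathalg k DQ).
Notation V := (vert DQ).
Notation A := (arrow DQ).
Notation X a := (path_arrow k (a : A)).
Notation E i := (path_idem k (i : V)).
Implicit Types (a b : A) (i j : V).

Definition star (a : A) : A := match a with inl b => inr b | inr b => inl b end.
Definition sg (a : A) : k := if a is inl _ then 1 else -1.

Lemma starK : involutive star. Proof. by case. Qed.
Lemma qtail_star a : qtail (star a) = qhead a. Proof. by case: a. Qed.
Lemma qhead_star a : qhead (star a) = qtail a. Proof. by case: a. Qed.
Lemma sg_sqr a : sg a * sg a = 1. Proof. by case: a => /= _; rewrite ?mulrNN mulr1. Qed.
Lemma sg_neq0 a : sg a != 0. Proof. by case: a => /= _; rewrite ?oppr_eq0 oner_eq0. Qed.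

(** The sum of all the [rho i]; multiplying by idempotents recovers each of them, so this single
    relation presents the preprojective algebra. *)
Definition trho : B := \sum_(a : A) sg a *: (X a * X (star a)).

Definition ppa : Type := ringquot [set trho]%classic.
HB.instance Definition _ := GRing.PzRing.on ppa.
HB.instance Definition _ := GRing.Lmodule.copy ppa (ringquot [set trho]%classic).

Definition pq (f : B) : ppa := quot_map [set trho]%classic f.
Definition pe (i : V) : ppa := pq (E i).
Definition pa (a : A) : ppa := pq (X a).

Lemma pq_linear : linear pq. Proof. exact: quot_map_linear. Qed.
Lemma pqM f g : pq (f * g) = pq f * pq g. Proof. exact: rmorphM. Qed.
Lemma pq1 : pq 1 = 1. Proof. exact: rmorph1. Qed.
Lemma pq_surj (x : ppa) : exists f, pq f = x. Proof. exact: quot_map_surj. Qed.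

Lemma pZl c (x y : ppa) : c *: (x * y) = (c *: x) * y. Proof. exact: quot_scaleAl. Qed.
Lemma pZr c (x y : ppa) : c *: (x * y) = x * (c *: y). Proof. exact: quot_scaleAr. Qed.
Lemma pmulr_linear (y : ppa) : linear (fun x : ppa => x * y : ppa).
Proof. exact: quot_mulr_linear. Qed.
Lemma pmull_linear (x : ppa) : linear (fun y : ppa => x * y : ppa).
Proof. exact: quot_mull_linear. Qed.

Lemma peM i j : pe i * pe j = if i == j then pe i else 0.
Proof. by rewrite -pqM idemM; case: ifP => // _; exact: lin0 pq_linear. Qed.
Lemma pe_pa i a : pe i * pa a = if i == qtail a then pa a else 0.
Proof. by rewrite -pqM idem_arrow; case: ifP => // _; exact: lin0 pq_linear. Qed.
Lemma pa_pe i a : pa a * pe i = if qhead a == i then pa a else 0.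
Proof. by rewrite -pqM arrow_idem; case: ifP => // _; exact: lin0 pq_linear. Qed.
Lemma pe_tail a : pe (qtail a) * pa a = pa a. Proof. by rewrite pe_pa eqxx. Qed.
Lemma pa_head a : pa a * pe (qhead a) = pa a. Proof. by rewrite pa_pe eqxx. Qed.
Lemma pee i : pe i * pe i = pe i. Proof. by rewrite peM eqxx. Qed.

Lemma pe_sum : \sum_(i : V) pe i = 1.
Proof. by rewrite -pq1 -idem_sum (lin_sum pq_linear). Qed.

Lemma pe_decl (x : ppa) : x = \sum_(i : V) pe i * x.
Proof. by rewrite -mulr_suml pe_sum mul1r. Qed.
Lemma pe_decr (x : ppa) : x = \sum_(i : V) x * pe i.
Proof. by rewrite -mulr_sumr pe_sum mulr1. Qed.

Lemma pq_trho : pq trho = 0.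
Proof. by apply/quot_map_eq0; exact: ideal_gen_mem. Qed.

Lemma rho0 : \sum_(a : A) sg a *: (pa a * pa (star a)) = 0.
Proof.
rewrite -[RHS]pq_trho (lin_sum pq_linear).
by apply: eq_bigr => a _; rewrite (linZ pq_linear) pqM.
Qed.

Lemma ppa_ind (Pr : ppa -> Prop) : Pr 0 -> (forall x y, Pr x -> Pr y -> Pr (x + y)) ->
  (forall c x, Pr x -> Pr (c *: x)) -> (forall i, Pr (pe i)) ->
  (forall a x, Pr x -> Pr (pa a * x)) -> forall x, Pr x.
Proof.
move=> P0 PD PZ PE PX x; have [f <-] := pq_surj x.
elim/pathalg_indl: f => [|f g Pf Pg|c f Pf|i|a f Pf] //.
- by rewrite (linD pq_linear); exact: PD.
- by rewrite (linZ pq_linear); exact: PZ.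
- exact: PE.
- by rewrite pqM; exact: PX.
Qed.

Lemma idem_trho i : E i * trho = trho * E i.
Proof.
rewrite mulr_sumr mulr_suml; apply: eq_bigr => a _.
rewrite -scalerAr -scalerAl mulrA idem_arrow -mulrA arrow_idem qhead_star.
by rewrite eq_sym; case: ifP; rewrite ?mul0r ?mulr0.
Qed.

Lemma ldiv_trho a f : ldiv a (trho * f) = sg a *: (X (star a) * f).
Proof.
rewrite mulr_suml (lin_sum (ldiv_linear a)) (bigD1 a) //=.
rewrite big1 => [|b /negPf ba]; last first.
  by rewrite -scalerAl (linZ (ldiv_linear a)) -mulrA ldiv_arrow ba scaler0.
rewrite -scalerAl (linZ (ldiv_linear a)) -mulrA ldiv_arrow eqxx addr0.
by rewrite mulrA idem_arrow qtail_star eqxx.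
Qed.

(** The elements of the displayed form already make up a two-sided ideal: a left factor [X b] pushes
    the whole element into the second sum, whose coefficients need only lie in the ideal, and right
    factors are absorbed by [c] and [y]. *)
Lemma ideal_trho x : ideal_gen [set trho]%classic x ->
  exists c (y : A -> B), (forall a, pq (y a) = 0) /\ x = trho * c + \sum_(a : A) X a * y a.
Proof.
pose J : set B := [set x | exists c (y : A -> B), (forall a, pq (y a) = 0) /\
  x = trho * c + \sum_(a : A) X a * y a]%classic.
have Jx y : J y -> pq y = 0.
  case=> c [z [z0 ->]]; rewrite (linD pq_linear) pqM pq_trho mul0r add0r (lin_sum pq_linear) big1 //.
  by move=> a _; rewrite pqM z0 mulr0.
apply: (@ideal_gen_sub _ _ _ J); last first.
  move=> _ ->; exists 1, (fun=> 0); split; first by move=> a; exact: lin0 pq_linear.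
  by rewrite mulr1 big1 ?addr0 // => a _; rewrite mulr0.
apply: generated_ideal.
- exists 0, (fun=> 0); split; first by move=> a; exact: lin0 pq_linear.
  by rewrite mulr0 big1 ?addr0 // => a _; rewrite mulr0.
- move=> _ _ [c [y [y0 ->]]] [d [z [z0 ->]]]; exists (c + d), (fun a => y a + z a).
  split; first by move=> a; rewrite (linD pq_linear) y0 z0 addr0.
  rewrite addrACA mulrDr -big_split; congr (_ + _).
  by apply: eq_bigr => a _; rewrite mulrDr.
- move=> u _ [c [y [y0 ->]]]; exists (u *: c), (fun a => u *: y a).
  split; first by move=> a; rewrite (linZ pq_linear) y0 scaler0.
  rewrite scalerDr scalerAr scaler_sumr; congr (_ + _).
  by apply: eq_bigr => a _; rewrite scalerAr.
- move=> i _ [c [y [y0 ->]]]; exists (E i * c), (fun a => if i == qtail a then y a else 0).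
  split; first by move=> a; case: ifP => // _; exact: lin0 pq_linear.
  rewrite mulrDr !mulrA idem_trho mulr_sumr; congr (_ + _).
  by apply: eq_bigr => a _; rewrite mulrA idem_arrow; case: ifP; rewrite ?mul0r ?mulr0.
- move=> i _ [c [y [y0 ->]]]; exists (c * E i), (fun a => y a * E i).
  split; first by move=> a; rewrite pqM y0 mul0r.
  rewrite mulrDl -mulrA mulr_suml; congr (_ + _).
  by apply: eq_bigr => a _; rewrite mulrA.
- move=> b x' Jx'; exists 0, (fun a => if a == b then x' else 0).
  split; first by move=> a; case: ifP => _; [exact: Jx|exact: lin0 pq_linear].
  rewrite mulr0 add0r (bigD1 b) //= eqxx big1 ?addr0 // => a /negPf ->.
  by rewrite mulr0.
- move=> b _ [c [y [y0 ->]]]; exists (c * X b), (fun a => y a * X b).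
  split; first by move=> a; rewrite pqM y0 mul0r.
  rewrite mulrDl -mulrA mulr_suml; congr (_ + _).
  by apply: eq_bigr => a _; rewrite mulrA.
Qed.

(** Exactness of the mesh complex of Pi at its middle term. Lifted to the path algebra, the
    combination of the [z a] lies in the ideal, hence has the form of [ideal_trho]; dividing by each
    arrow reads off [z a]. *)
Lemma mesh_left (z : A -> ppa) : (forall a, pe (qhead a) * z a = z a) ->
  \sum_(a : A) pa a * z a = 0 -> exists c, forall a, z a = sg a *: (pa (star a) * c).
Proof.
move=> ez z0.
have /choice[f fz] : forall a, exists f, pq f = z a /\ E (qhead a) * f = f.
  move=> a; have [f fz] := pq_surj (z a); exists (E (qhead a) * f).
  by rewrite pqM fz ez mulrA idemM eqxx.
have : pq (\sum_(a : A) X a * f a) = 0.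
  rewrite (lin_sum pq_linear) -[RHS]z0; apply: eq_bigr => a _.
  by rewrite pqM (fz a).1.
move=> /quot_map_eq0/ideal_trho[c [y [y0 xE]]]; exists (pq c) => a.
have := congr1 (ldiv a) xE.
rewrite (linD (ldiv_linear a)) ldiv_trho !(lin_sum (ldiv_linear a)).
rewrite (bigD1 a) //= [Y in _ + Y = _]big1 => [|b /negPf ba]; last by rewrite ldiv_arrow ba.
rewrite [Y in _ = _ + Y](bigD1 a) //= [Y in _ = _ + (_ + Y)]big1 => [|b /negPf ba]; last first.
  by rewrite ldiv_arrow ba.
rewrite !ldiv_arrow eqxx !addr0 (fz a).2 => /(congr1 pq).
rewrite (fz a).1 (linD pq_linear) (linZ pq_linear) !pqM y0 mulr0 addr0 => ->.
by [].
Qed.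

Section Dagger.
Let mul (x y : ppa) : ppa := y * x.

(** The anti-automorphism that exchanges each arrow with its reverse, built as an algebra map into
    the opposite product. It fixes every term of [trho], since reversing the product and starring
    both factors cancel each other. It transports statements about left multiplication to the
    right. *)
Fact dagger_exists : exists d : ppa -> ppa,
  [/\ linear d, forall a, d (pa a) = pa (star a), forall i, d (pe i) = pe i
    & forall x y, d (x * y) = d y * d x].
Proof.
pose d0 := path_ext mul pe (fun a => pa (star a)).
have ml y : linear (mul ^~ y) by exact: pmull_linear.
have mr x : linear (mul x) by exact: pmulr_linear.
have mA : associative mul by move=> x y z; rewrite /mul mulrA.
have eM i j : mul (pe i) (pe j) = if i == j then pe i else 0.
  by rewrite /mul peM eq_sym; case: eqP => // ->.
have exM i a : mul (pe i) (pa (star a)) = if i == qtail a then pa (star a) else 0.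
  by rewrite /mul pa_pe qhead_star eq_sym.
have xeM i a : mul (pa (star a)) (pe i) = if qhead a == i then pa (star a) else 0.
  by rewrite /mul pe_pa qtail_star eq_sym.
have dM x y : d0 (x * y) = d0 y * d0 x by exact: (path_extM ml mr mA eM exM xeM).
have dl : linear d0 by exact: path_ext_linear.
have d0rho : d0 trho = 0.
  rewrite (lin_sum dl) -[RHS]rho0.
  apply: eq_bigr => a _; rewrite (linZ dl) dM /d0 !path_ext_arrow.
  by rewrite starK.
have [x /(@ideal_gen_sub _ _ _ [set x | d0 x = 0]%classic) dJ|d [dlin dE]] :=
  @quot_lift _ _ [set trho]%classic _ _ dl.
  apply: dJ; last by move=> _ ->.
  split; first by rewrite /= lin0.
    by move=> y z /= y0 z0; rewrite (linB dl) y0 z0 subrr.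
  by move=> y z t /= z0; rewrite !dM z0 mul0r mulr0.
exists d; split=> //.
- by move=> a; rewrite dE /d0 path_ext_arrow.
- by move=> i; rewrite dE /d0 path_ext_idem.
move=> x y; have [f <-] := pq_surj x; have [g <-] := pq_surj y.
by rewrite -pqM !dE dM.
Qed.

Definition dagger : ppa -> ppa := sval (cid dagger_exists).

Lemma dagger_linear : linear dagger.
Proof. by rewrite /dagger; case: cid => d []. Qed.
Lemma dagger_pa a : dagger (pa a) = pa (star a).
Proof. by rewrite /dagger; case: cid => d []. Qed.
Lemma dagger_pe i : dagger (pe i) = pe i.
Proof. by rewrite /dagger; case: cid => d []. Qed.
Lemma daggerM x y : dagger (x * y) = dagger y * dagger x.
Proof. by rewrite /dagger; case: cid => d []. Qed.

Lemma daggerK : involutive dagger.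
Proof.
move=> x; elim/ppa_ind: x => [|x y xE yE|c x xE|i|a x xE].
- by rewrite !(lin0 dagger_linear).
- by rewrite !(linD dagger_linear) xE yE.
- by rewrite !(linZ dagger_linear) xE.
- by rewrite !dagger_pe.
- by rewrite !daggerM !dagger_pa starK xE.
Qed.

Lemma mesh_right (z : A -> ppa) : (forall a, z a * pe (qtail a) = z a) ->
  \sum_(a : A) z a * pa a = 0 -> exists c, forall a, z a = sg (star a) *: (c * pa (star a)).
Proof.
move=> ze z0; have [||c cE] := @mesh_left (fun a => dagger (z (star a))).
- by move=> a; rewrite -{1}(dagger_pe (qhead a)) -daggerM -qtail_star ze.
- rewrite -[RHS](lin0 dagger_linear) -[in RHS]z0 (lin_sum dagger_linear).
  rewrite (reindex_inj (can_inj starK)) /=; apply: eq_bigr => a _.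
  by rewrite starK daggerM dagger_pa.
exists (dagger c) => a; have := congr1 dagger (cE (star a)).
by rewrite starK daggerK (linZ dagger_linear) daggerM dagger_pa.
Qed.

End Dagger.

(** * A fine grading of the preprojective algebra *)

Section Degree.
Notation G := ({ffun arrow Q -> int} * int)%type.

(** An arrow and its reverse always add up to [omega], so [trho] is homogeneous. The last coordinate
    counts stars; the first one separates the arrows ([darr_inj]), which later forces a commutator
    to be a scalar. *)
Definition darr (a : A) : G :=
  match a with
  | inl b => ([ffun c => (c == b)%:R], 0)
  | inr b => ([ffun c => - (c == b)%:R], 1)
  end.

Definition dpath (p : qpath DQ) : G := \sum_(a <- parrows p) darr a.

Lemma dpath_cons a p : qhead a = psrc p -> dpath (pcat (parrow a) p) = darr a + dpath p.
Proof. by move=> ap; rewrite /dpath parrows_pcat //= big_cons. Qed.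

Lemma dpath_cat p q : ptgt p = psrc q -> dpath (pcat p q) = dpath p + dpath q.
Proof. by move=> pq'; rewrite /dpath parrows_pcat //= big_cat. Qed.

Lemma dpath_triv i : dpath (ptriv i) = 0.
Proof. by rewrite /dpath big_nil. Qed.

(** A predicate on degrees covers the star degree, the length and the full degree at once. *)
Definition prB (S : pred G) (f : B) : B :=
  lext (fun p => if S (dpath p) then pathbase k p else 0) f.

Lemma prB_linear S : linear (prB S). Proof. exact: lext_linear. Qed.
Lemma prB_base S p : prB S (pathbase k p) = if S (dpath p) then pathbase k p else 0.
Proof. exact: lext_base. Qed.

Lemma prB_arrowl S a f : prB S (X a * f) = X a * prB (fun d => S (darr a + d)) f.
Proof.
move: f; apply: (lin_ext_base (F := fun f => prB S (X a * f))).
- by move=> c f g; rewrite mulrDr -scalerAr prB_linear.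
- by move=> c f g; rewrite prB_linear mulrDr scalerAr.
move=> p; rewrite prB_base fun_if mulr0 arrow_pathbase; case: eqP => [ap|_].
  by rewrite prB_base dpath_cons.
by rewrite (lin0 (prB_linear S)); case: ifP.
Qed.

Lemma prB_arrowr S a f : prB S (f * X a) = prB (fun d => S (d + darr a)) f * X a.
Proof.
move: f; apply: (lin_ext_base (F := fun f => prB S (f * X a))).
- by move=> c f g; rewrite mulrDl -scalerAl prB_linear.
- by move=> c f g; rewrite prB_linear mulrDl scalerAl.
move=> p; rewrite prB_base (fun_if (fun x => x * X a)) mul0r pathbase_arrow.
case: eqP => [pa'|_].
  by rewrite prB_base dpath_cat // {2}/dpath /= big_seq1.
by rewrite (lin0 (prB_linear S)); case: ifP.
Qed.

Lemma prB_ideml S i f : prB S (E i * f) = E i * prB S f.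
Proof.
move: f; apply: (lin_ext_base (F := fun f => prB S (E i * f))).
- by move=> c f g; rewrite mulrDr -scalerAr prB_linear.
- by move=> c f g; rewrite prB_linear mulrDr scalerAr.
move=> p; rewrite prB_base fun_if mulr0 idem_pathbase; case: eqP => [ap|_].
  by rewrite prB_base.
by rewrite (lin0 (prB_linear S)); case: ifP.
Qed.

Lemma prB_idemr S i f : prB S (f * E i) = prB S f * E i.
Proof.
move: f; apply: (lin_ext_base (F := fun f => prB S (f * E i))).
- by move=> c f g; rewrite mulrDl -scalerAl prB_linear.
- by move=> c f g; rewrite prB_linear mulrDl scalerAl.
move=> p; rewrite prB_base (fun_if (fun x => x * E i)) mul0r pathbase_idem; case: eqP => [ap|_].
  by rewrite prB_base.
by rewrite (lin0 (prB_linear S)); case: ifP.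
Qed.

Definition omega : G := (0, 1).

Lemma darr_star a : darr a + darr (star a) = omega.
Proof.
case: a => b; rewrite /darr /omega /=; congr (_, _); apply/ffunP => c; rewrite !ffunE.
  by rewrite subrr.
by rewrite addNr.
Qed.

Lemma prB_trho S : prB S trho = if S omega then trho else 0.
Proof.
have -> : prB S trho = \sum_(a : A) if S omega then sg a *: (X a * X (star a)) else 0.
  rewrite (lin_sum (prB_linear S)); apply: eq_bigr => a _.
  rewrite (linZ (prB_linear S)) prB_arrowl /path_arrow prB_base.
  rewrite {1}/dpath /= big_seq1 darr_star.
  by case: ifP => _ //; rewrite mulr0 scaler0.
by case: ifP => // _; rewrite big1.
Qed.

Fact pr_exists S : exists g : ppa -> ppa, linear g /\ forall f, g (pq f) = pq (prB S f).
Proof.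
apply: quot_lift; first exact: (lin_comp pq_linear (prB_linear S)).
(* The claim is proved for all [S] simultaneously, because multiplication by an arrow shifts [S]. *)
move=> x /(@ideal_gen_sub _ _ _ [set x | forall S, pq (prB S x) = 0]%classic) H.
apply: H; last first.
  move=> _ -> S'; rewrite prB_trho; case: ifP => _; last exact: lin0 pq_linear.
  exact: pq_trho.
apply: generated_ideal => /=.
- by move=> S'; rewrite (lin0 (prB_linear _)) (lin0 pq_linear).
- by move=> y z y0 z0 S'; rewrite (linD (prB_linear _)) (linD pq_linear) y0 z0 addr0.
- by move=> c y y0 S'; rewrite (linZ (prB_linear _)) (linZ pq_linear) y0 scaler0.
- by move=> i y y0 S'; rewrite prB_ideml pqM y0 mulr0.
- by move=> i y y0 S'; rewrite prB_idemr pqM y0 mul0r.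
- by move=> a y y0 S'; rewrite prB_arrowl pqM y0 mulr0.
- by move=> a y y0 S'; rewrite prB_arrowr pqM y0 mul0r.
Qed.

Definition pr S : ppa -> ppa := sval (cid (pr_exists S)).

Lemma pr_linear S : linear (pr S). Proof. by rewrite /pr; case: cid => g []. Qed.
Lemma pr_pq S f : pr S (pq f) = pq (prB S f). Proof. by rewrite /pr; case: cid => g []. Qed.

Lemma pr_pal S a x : pr S (pa a * x) = pa a * pr (fun d => S (darr a + d)) x.
Proof. by have [f <-] := pq_surj x; rewrite -pqM !pr_pq prB_arrowl pqM. Qed.
Lemma pr_par S a x : pr S (x * pa a) = pr (fun d => S (d + darr a)) x * pa a.
Proof. by have [f <-] := pq_surj x; rewrite -pqM !pr_pq prB_arrowr pqM. Qed.
Lemma pr_pel S i x : pr S (pe i * x) = pe i * pr S x.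
Proof. by have [f <-] := pq_surj x; rewrite -pqM !pr_pq prB_ideml pqM. Qed.
Lemma pr_per S i x : pr S (x * pe i) = pr S x * pe i.
Proof. by have [f <-] := pq_surj x; rewrite -pqM !pr_pq prB_idemr pqM. Qed.
Lemma pr_pe S i : pr S (pe i) = if S 0 then pe i else 0.
Proof.
rewrite pr_pq prB_base dpath_triv; case: ifP => // _; exact: lin0 pq_linear.
Qed.
Lemma pr_path S p : pr S (pq (pathbase k p)) = if S (dpath p) then pq (pathbase k p) else 0.
Proof. by rewrite pr_pq prB_base; case: ifP => // _; exact: lin0 pq_linear. Qed.

Lemma pr_ext S S' x : S =1 S' -> pr S x = pr S' x.
Proof. by move=> SS; congr (pr _ _); apply: funext. Qed.

Lemma lin_ext_path (U : lmodType k) (F H : ppa -> U) : linear F -> linear H ->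
  (forall p, F (pq (pathbase k p)) = H (pq (pathbase k p))) -> F =1 H.
Proof.
move=> Fl Hl FH x; have [f <-] := pq_surj x; move: f.
apply: (lin_ext_base (F := fun f => F (pq f))) => //.
  exact: lin_comp Fl pq_linear.
exact: lin_comp Hl pq_linear.
Qed.

Lemma pr_pr S S' x : pr S (pr S' x) = pr (fun d => S d && S' d) x.
Proof.
move: x; apply: lin_ext_path; first exact: lin_comp (pr_linear _) (pr_linear _).
  exact: pr_linear.
move=> p; rewrite [pr S' _]pr_path [RHS]pr_path.
by case: (S' _); rewrite ?andbT ?andbF ?pr_path ?(lin0 (pr_linear _)).
Qed.

Lemma pr_id (S : pred G) x : (forall d, S d) -> pr S x = x.
Proof.
move=> ST; move: x; apply: (lin_ext_path (H := id)); [exact: pr_linear|exact: lin_id|].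
by move=> p; rewrite pr_path ST.
Qed.

Lemma pr_none (S : pred G) x : (forall p, ~~ S (dpath p)) -> pr S x = 0.
Proof.
move=> S0; move: x; apply: lin_ext_path; [exact: pr_linear|exact: lin_zero|].
by move=> p; rewrite pr_path (negPf (S0 p)).
Qed.

(** The effect of [dagger] on degrees: the additive extension of [darr a] |-> [darr (star a)]. *)
Definition ddag (d : G) : G := (- d.1, d.2 + \sum_c d.1 c).

Lemma ddag_is_additive : {morph ddag : x y / x + y}.
Proof.
move=> [c m] [c' m']; rewrite /ddag /=; congr (_, _); first by rewrite opprD.
by rewrite addrACA -big_split /=; congr (_ + _); apply: eq_bigr => b _; rewrite !ffunE.
Qed.

Lemma ddag_darr a : ddag (darr a) = darr (star a).
Proof.
case: a => b; rewrite /ddag /darr /=; congr (_, _).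
- by apply/ffunP => c; rewrite !ffunE.
- rewrite add0r (bigD1 b) //= ffunE eqxx big1 ?addr0 // => c /negPf cb.
  by rewrite ffunE cb.
- by apply/ffunP => c; rewrite !ffunE opprK.
- rewrite (bigD1 b) //= ffunE eqxx big1 ?addr0 ?subrr // => c /negPf cb.
  by rewrite ffunE cb oppr0.
Qed.

Lemma dagger_pr S x : dagger (pr S x) = pr (fun d => S (ddag d)) (dagger x).
Proof.
suff dp p : forall S, pr S (dagger (pq (pathbase k p))) =
    if S (ddag (dpath p)) then dagger (pq (pathbase k p)) else 0.
  move: x; apply: (lin_ext_path (F := fun x => dagger (pr S x))).
  - exact: lin_comp dagger_linear (pr_linear _).
  - exact: lin_comp (pr_linear _) dagger_linear.
  move=> p; rewrite pr_path dp; set d := dpath p.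
  have -> : ddag (ddag d) = d.
    case: d => c m; rewrite /ddag /= opprK; congr (_, _).
    under [Y in _ + Y]eq_bigr do rewrite ffunE.
    by rewrite sumrN addrK.
  by case: ifP => // _; exact: lin0 dagger_linear.
have d0 : ddag 0 = 0 by have := ddag_is_additive 0 0; rewrite addr0 => /eqP; rewrite -subr_eq0 opprD addNKr oppr_eq0 => /eqP.
elim/qpath_indl: p => [i|a p ap IH] S'.
  by rewrite dagger_pe pr_pe dpath_triv d0.
have -> : pathbase k (pcat (parrow a) p) = X a * pathbase k p.
  by rewrite arrow_pathbase ap eqxx.
rewrite pqM daggerM dagger_pa pr_par IH dpath_cons // ddag_is_additive ddag_darr addrC.
by case: ifP; rewrite ?mul0r.
Qed.

Lemma degree_support (x : ppa) : exists s : seq G, uniq s /\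
  forall S, pr S x = \sum_(d <- s | S d) pr (pred1 d) x.
Proof.
have [f <-] := pq_surj x; pose s := undup (map dpath (supp f)).
exists s; split=> [|S]; first exact: undup_uniq.
rewrite (pathalg_expand f) (lin_sum pq_linear) (lin_sum (pr_linear S)).
under [RHS]eq_bigr => d _ do rewrite (lin_sum (pr_linear (pred1 d))).
rewrite exchange_big /= !big_seq; apply: eq_bigr => p ps.
rewrite (linZ pq_linear) (linZ (pr_linear S)) pr_path.
have us : uniq s by exact: undup_uniq.
have dps : dpath p \in s by rewrite mem_undup map_f.
rewrite big_mkcond (bigD1_seq (dpath p)) //= (linZ (pr_linear _)) pr_path /= eqxx.
rewrite big1 ?addr0 => [|d /negPf dp]; last first.
  by rewrite (linZ (pr_linear _)) pr_path /= eq_sym dp scaler0; case: ifP.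
by case: ifP => // _; rewrite scaler0.
Qed.

End Degree.

End Preprojective.

(* Finite-dimensional subspaces are represented by projectors pi onto them. *)
Record fdim (k : fieldType) (V : lmodType k) (pi : V -> V) := Fdim {
  fdn : nat;
  fdb : 'I_fdn -> V;
  fdc : 'I_fdn -> V -> k;
  fdc_linear : forall i, linear (fdc i : V -> k^o);
  fdcb : forall i j, fdc i (fdb j) = (i == j)%:R;
  fdc_pi : forall i x, fdc i (pi x) = fdc i x;
  fdpi : forall x, pi x = \sum_i fdc i x *: fdb i;
  fdb_pi : forall i, pi (fdb i) = fdb i }.

Arguments fdb {k V pi}.
Arguments fdc {k V pi}.

Lemma fdcZ (k : fieldType) (V : lmodType k) (pi : V -> V) (F : fdim pi) l c x :
  fdc F l (c *: x) = c * fdc F l x.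
Proof. exact: (linZ (fdc_linear l)). Qed.

(** * Finite-dimensional subspaces *)

Section FiniteDimension.
Variables (k : fieldType).
Implicit Types (V L : lmodType k).

Lemma basis_from_span V (pi : V -> V) (s : set V) n (b : 'I_n -> V) :
  linear pi -> (forall x, pi (pi x) = pi x) ->
  (forall i, s (b i)) -> (forall i, pi (b i) = b i) ->
  (forall x, exists c : 'I_n -> k, pi x = \sum_i c i *: b i) ->
  exists F : fdim pi, forall i, s (fdb F i).
Proof.
move=> pl pp sb pb spb.
pose Sp m := exists b : 'I_m -> V, [/\ forall i, s (b i), forall i, pi (b i) = b i
  & forall x, exists c : 'I_m -> k, pi x = \sum_i c i *: b i].
have exSp : exists m, `[< Sp m >] by exists n; apply/asboolP; exists b.
case: (ex_minnP exSp) => {sb pb spb b}m /asboolP[{n}c [sc pc spc]] mmin.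
have free (d : 'I_m -> k) : \sum_i d i *: c i = 0 -> forall j, d j = 0.
  move=> d0 j; apply: contrapT => dj.
  case: m c sc pc spc mmin d d0 j dj => [|m] c sc pc spc mmin d d0 j dj; first by case: j {dj}.
  suff /asboolP/mmin : Sp m by rewrite ltnn.
  exists (fun i => c (lift j i)); split=> // x; have [e eE] := spc x.
  exists (fun i => e (lift j i) - e j * (d j)^-1 * d (lift j i)).
  have cj : c j = - \sum_(i < m) ((d j)^-1 * d (lift j i)) *: c (lift j i).
    move: d0; rewrite (bigD1_ord j) //= => /eqP; rewrite addr_eq0 => /eqP d0.
    have -> : c j = (d j)^-1 *: (d j *: c j) by rewrite scalerA mulVf ?scale1r //; apply/eqP.
    rewrite d0 scalerN scaler_sumr; congr (- _); apply: eq_bigr => i _.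
    by rewrite scalerA.
  rewrite eE (bigD1_ord j) //= cj scalerN scaler_sumr -sumrN -big_split /=.
  apply: eq_bigr => i _; rewrite scalerA addrC scalerBl; congr (_ - _ *: _).
  by rewrite mulrA.
have /choice[co coE] : forall x, exists d : 'I_m -> k, pi x = \sum_i d i *: c i := spc.
have uni x (d : 'I_m -> k) : pi x = \sum_i d i *: c i -> forall i, co x i = d i.
  move=> dE i; apply/eqP; rewrite -subr_eq0; apply/eqP.
  apply: (free (fun i => co x i - d i)).
  under eq_bigr => l _ do rewrite scalerBl.
  by rewrite sumrB -coE -dE subrr.
have colin i : linear ((fun x => co x i) : V -> k^o).
  move=> a x y; apply: (uni _ (fun i => a * co x i + co y i)).
  rewrite pl !coE scaler_sumr -big_split /=; apply: eq_bigr => l _.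
  by rewrite scalerDl scalerA.
have cob i j : co (c j) i = (i == j)%:R.
  apply: (uni _ (fun l => (l == j)%:R)).
  rewrite pc (bigD1 j) //= eqxx scale1r big1 ?addr0 // => l /negPf ->.
  by rewrite scale0r.
have copi i x : co (pi x) i = co x i by apply: uni; rewrite pp.
by exists (@Fdim k V pi m c (fun i x => co x i) colin cob copi coE pc).
Qed.

Section Trace.
Variables (V : lmodType k) (pi : V -> V) (F : fdim pi).

Definition ftr (g : V -> V) : k := \sum_i fdc F i (g (fdb F i)).

Lemma ftr_sub g h : ftr (fun x => g x - h x) = ftr g - ftr h.
Proof. by rewrite -sumrB; apply: eq_bigr => i _ /=; rewrite (linB (fdc_linear i)). Qed.
Lemma ftr_scale c g : ftr (fun x => c *: g x) = c * ftr g.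
Proof. by rewrite big_distrr; apply: eq_bigr => i _ /=; rewrite (linZ (fdc_linear i)). Qed.
Lemma ftr_sum I (r : seq I) (P : pred I) (g : I -> V -> V) :
  ftr (fun x => \sum_(i <- r | P i) g i x) = \sum_(i <- r | P i) ftr (g i).
Proof.
rewrite /ftr exchange_big /=; apply: eq_bigr => i _.
exact: (lin_sum (fdc_linear i)).
Qed.
Lemma ftr_eq g h : (forall x, pi x = x -> g x = h x) -> ftr g = ftr h.
Proof. by move=> gh; apply: eq_bigr => i _; rewrite gh // fdb_pi. Qed.
Lemma ftr_id : ftr id = (fdn F)%:R.
Proof.
rewrite /ftr; under eq_bigr => i _ do rewrite fdcb eqxx.
by rewrite sumr_const card_ord.
Qed.

Lemma fd_functional z : pi z = z -> z != 0 ->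
  exists zeta : V -> k, linear (zeta : V -> k^o) /\ zeta z = 1.
Proof.
move=> zz nz; have [i ci] : exists i, fdc F i z != 0.
  apply: contrapT => H; case/negP: nz; rewrite -zz (fdpi F) big1 // => i _.
  case: (eqVneq (fdc F i z) 0) => [->|ci]; first by rewrite scale0r.
  by case: H; exists i.
exists (fun x => (fdc F i z)^-1 * fdc F i x); split; last by rewrite mulVf.
exact: (@lin_scale _ V k^o _ _ (fdc_linear i)).
Qed.

(** Choose values on the basis and extend linearly; stability of [R] under combinations does the
    rest. Values need not be unique, so this also yields sections and lifts. *)
Lemma linear_selection L (R : V -> L -> Prop) :
  R 0 0 -> (forall c u u' y y', R u y -> R u' y' -> R (c *: u + u') (c *: y + y')) ->
  (forall u, pi u = u -> exists y, R u y) ->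
  exists phi : V -> L, linear phi /\ forall x, R (pi x) (phi x).
Proof.
move=> R0 Rl Rt.
have /choice[y yP] : forall i, exists y, R (fdb F i) y by move=> i; apply: Rt; exact: fdb_pi.
exists (fun x => \sum_i fdc F i x *: y i); split.
  by apply: lin_bigsum => i _; exact: (lin_scalel _ (fdc_linear i)).
move=> x; rewrite (fdpi F x).
apply: (big_ind2 R) => // [u v u' v' H H'|i _].
  by have := Rl 1 _ _ _ _ H H'; rewrite !scale1r.
by have := Rl (fdc F i x) _ _ _ _ (yP i) R0; rewrite !addr0.
Qed.

End Trace.

Lemma ftr_cycle V V' (pi : V -> V) (pi' : V' -> V') (F : fdim pi) (F' : fdim pi')
    (g : V -> V') (h : V' -> V) : linear g -> linear h ->
  (forall x, pi x = x -> pi' (g x) = g x) -> (forall x, pi' x = x -> pi (h x) = h x) ->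
  ftr F (fun x => h (g x)) = ftr F' (fun x => g (h x)).
Proof.
move=> gl hl gp hp.
transitivity (\sum_i \sum_j fdc F' j (g (fdb F i)) * fdc F i (h (fdb F' j))).
  apply: eq_bigr => i _; rewrite -{1}[g _]gp ?fdb_pi // (fdpi F') (lin_sum hl).
  rewrite (lin_sum (fdc_linear i)); apply: eq_bigr => j _.
  by rewrite (linZ hl) (linZ (fdc_linear i)).
rewrite exchange_big /=; apply: eq_bigr => j _.
rewrite -{2}[h (fdb F' j)]hp ?fdb_pi // (fdpi F) (lin_sum gl) (lin_sum (fdc_linear j)).
by apply: eq_bigr => i _; rewrite (linZ gl) (linZ (fdc_linear j)) mulrC.
Qed.

(** Read [C q phi u y] as: [y] is an admissible value at [u], in the piece of [q], for a map that
    agrees with [phi] on the pieces of lower rank. Once [phi] is known there, [C q phi] is a total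
    linear relation on a finite-dimensional space, and [linear_selection] picks the next values. *)
Lemma vertex_recursion V L (T : finType) (rk : T -> nat) (pi : T -> V -> V)
    (F : forall q, fdim (pi q)) (C : T -> (V -> L) -> V -> L -> Prop) :
  injective rk -> (forall q, linear (pi q)) ->
  (forall p q x, pi p (pi q x) = if p == q then pi q x else 0) ->
  (forall q phi phi' u y, (forall p x, (rk p < rk q)%N -> phi (pi p x) = phi' (pi p x)) ->
     pi q u = u -> C q phi u y -> C q phi' u y) ->
  (forall q phi, linear phi -> C q phi 0 0) ->
  (forall q phi c u u' y y', linear phi -> C q phi u y -> C q phi u' y' ->
     C q phi (c *: u + u') (c *: y + y')) ->
  (forall q phi, linear phi ->
     (forall p x, (rk p < rk q)%N -> C p phi (pi p x) (phi (pi p x))) ->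
     forall u, pi q u = u -> exists y, C q phi u y) ->
  exists phi : V -> L, linear phi /\ forall q x, C q phi (pi q x) (phi (pi q x)).
Proof.
move=> rkI pl pM dep C0 Cl tot.
suff H R : exists phi : V -> L, linear phi /\
    forall q x, (rk q < R)%N -> C q phi (pi q x) (phi (pi q x)).
  have [phi [pli pC]] := H (\max_q rk q).+1; exists phi; split=> // q x.
  by apply: pC; rewrite ltnS; exact: leq_bigmax.
elim: R => [|R [phi [phil phiC]]]; first by exists (fun=> 0); split=> //; exact: lin_zero.
have [[q0 q0R]|nq] := pselect (exists q0, rk q0 = R); last first.
  exists phi; split=> // q x; rewrite ltnS leq_eqVlt => /orP[/eqP qR|]; last exact: phiC.
  by case: nq; exists q.
have [|||psi [psil psiC]] := @linear_selection V (pi q0) (F q0) L (C q0 phi).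
- exact: C0.
- by move=> *; exact: Cl.
- by apply: tot => // p x; rewrite q0R; exact: phiC.
pose phi' x := phi (x - pi q0 x) + psi (pi q0 x).
have phi'q0 x : phi' (pi q0 x) = psi (pi q0 x).
  by rewrite /phi' pM eqxx subrr lin0 // add0r.
have phi'p p x : p != q0 -> phi' (pi p x) = phi (pi p x).
  by move=> /negPf pq; rewrite /phi' pM eq_sym pq (lin0 psil) subr0 addr0.
have ph p x : (rk p < R)%N -> phi (pi p x) = phi' (pi p x).
  by move=> pR; rewrite phi'p //; apply: contraTneq pR => ->; rewrite q0R ltnn.
exists phi'; split.
  apply: lin_add; last exact: lin_comp psil (pl q0).
  by apply: (lin_comp phil); apply: lin_sub => //; exact: lin_id.
move=> q x; rewrite ltnS leq_eqVlt => /orP[/eqP qR|qR].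
  have -> : q = q0 by apply: rkI; rewrite qR.
  rewrite phi'q0; apply: (@dep _ phi).
  - by move=> p y; rewrite q0R; exact: ph.
  - by rewrite pM eqxx.
  by have := psiC (pi q0 x); rewrite pM eqxx.
rewrite -ph //; apply: (@dep _ phi).
- by move=> p y pq; apply: ph; exact: ltn_trans qR.
- by rewrite pM eqxx.
exact: phiC.
Qed.

End FiniteDimension.

(** * Commutators and the trace pairing *)

Section MatrixDuality.
Variables (k : fieldType) (n n' : nat) (I : finType).
Variables (B : I -> 'M[k]_n) (C : I -> 'M[k]_n').

(** For the trace pairing, the adjoint of F |-> \sum_i (F_i C_i - B_i F_i) is H |-> (C_i H - H
    B_i)_i, so the image of the first map is the annihilator of the kernel of the second. A column
    of the cokernel matrix, reshaped, is such an [H]. *)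
Lemma commutator_image (w : 'M[k]_(n, n')) :
  (forall H : 'M[k]_(n', n), (forall i, C i *m H = H *m B i) -> \tr (w *m H) = 0) ->
  exists F : I -> 'M[k]_(n, n'), w = \sum_i (F i *m C i - B i *m F i).
Proof.
move=> wH; pose D i := lin_mulmxr (C i) - lin_mulmx (B i) : 'M_(n * n').
have DE i (F : 'M_(n, n')) : mxvec F *m D i = mxvec (F *m C i - B i *m F).
  by rewrite mulmxBr !mul_vec_lin linearB.
have [/sub_sumsmxP[u uE]|] := boolP (mxvec w <= \sum_i D i)%MS.
  exists (fun i => vec_mx (u i)); rewrite -[w]mxvecK uE linear_sum; apply: eq_bigr => i _ /=.
  by rewrite -[u i in LHS]vec_mxK DE mxvecK.
rewrite submxE => /eqP nz; case: nz; apply/rowP => c; rewrite mxE [RHS]mxE.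
pose S := (\sum_i D i)%MS.
pose H : 'M[k]_(n', n) := \matrix_(j, i) cokermx S (mxvec_index i j) c.
have trH (X : 'M_(n, n')) : \sum_j mxvec X 0 j * cokermx S j c = \tr (X *m H).
  rewrite (reindex _ (curry_mxvec_bij n n')) /=.
  transitivity (\sum_(p : 'I_n * 'I_n') mxvec X 0 (mxvec_index p.1 p.2) *
    cokermx S (mxvec_index p.1 p.2) c); first by apply: eq_bigr => -[i j] _.
  rewrite -(pair_bigA _ (fun i j => mxvec X 0
    (mxvec_index i j) * cokermx S (mxvec_index i j) c)) /=.
  apply: eq_bigr => i _; rewrite mxE; apply: eq_bigr => j _.
  by rewrite mxvecE [H j i]mxE.
rewrite trH; apply: wH => i; apply/matrixP => a b.
have D0 : D i *m cokermx S = 0 by apply/eqP; rewrite -submxE; apply: (sumsmx_sup i).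
(* Testing against this matrix unit isolates the entry (a, b) of C_i H - H B_i. *)
have := trH (delta_mx b a *m C i - B i *m delta_mx b a).
have -> : \sum_j mxvec (delta_mx b a *m C i - B i *m delta_mx b a) 0 j * cokermx S j c = 0.
  by have := congr1 (fun M : 'M_(1, _) => M 0 c) (congr1 (mulmx (mxvec (delta_mx b a))) D0);
    rewrite mulmxA DE mulmx0 !mxE.
move/esym/eqP; rewrite mulmxBl linearB /= subr_eq0 -!mulmxA [X in _ == X]mxtrace_mulC -mulmxA.
have trd (Y : 'M[k]_(n', n)) : \tr (delta_mx b a *m Y) = Y a b.
  rewrite /mxtrace (bigD1 b) //= mxE (bigD1 a) //= mxE !eqxx mul1r.
  rewrite big1 => [|j /negPf ja]; last by rewrite mxE ja andbF mul0r.
  rewrite addr0 big1 ?addr0 // => j /negPf jb; rewrite mxE big1 // => l _.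
  by rewrite mxE jb mul0r.
by rewrite !trd => /eqP.
Qed.

End MatrixDuality.

Section TraceDuality.
Variables (k : fieldType) (V V' : lmodType k) (pi : V -> V) (pi' : V' -> V').
Variables (F : fdim pi) (F' : fdim pi').

Definition mmap (M : 'M[k]_(fdn F, fdn F')) (x : V) : V' :=
  \sum_l fdc F l x *: (\sum_l' M l l' *: fdb F' l').

Lemma mmap_linear M : linear (mmap M).
Proof. by apply: lin_bigsum => l _; exact: (lin_scalel _ (fdc_linear l)). Qed.

Lemma mmap_base M l : mmap M (fdb F l) = \sum_l' M l l' *: fdb F' l'.
Proof.
rewrite /mmap (bigD1 l) //= fdcb eqxx scale1r [Y in _ + Y]big1 ?addr0 // => i /negPf il.
by rewrite fdcb il scale0r.
Qed.

Lemma fdc_mmap M l l' : fdc F' l' (mmap M (fdb F l)) = M l l'.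
Proof.
rewrite mmap_base (lin_sum (fdc_linear l')) (bigD1 l') //=.
rewrite fdcZ fdcb eqxx mulr1 big1 ?addr0 // => i /negPf il.
by rewrite fdcZ fdcb eq_sym il mulr0.
Qed.

Lemma mmap_pi M x : linear pi' -> pi' (mmap M x) = mmap M x.
Proof.
move=> pl; rewrite /mmap (lin_sum pl); apply: eq_bigr => l _; rewrite (linZ pl) (lin_sum pl).
by congr (_ *: _); apply: eq_bigr => l' _; rewrite (linZ pl) fdb_pi.
Qed.

End TraceDuality.

Lemma fd_eq (k : fieldType) (V V' : lmodType k) (pi : V -> V) (F : fdim pi) (g h : V -> V') :
  linear g -> linear h -> (forall l, g (fdb F l) = h (fdb F l)) ->
  forall x, pi x = x -> g x = h x.
Proof.
move=> gl hl gh x <-; rewrite (fdpi F) (lin_sum gl) (lin_sum hl); apply: eq_bigr => l _.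
by rewrite (linZ gl) (linZ hl) gh.
Qed.

Lemma fd_coord_eq (k : fieldType) (V : lmodType k) (pi : V -> V) (F : fdim pi) x y :
  pi x = x -> pi y = y -> (forall l, fdc F l x = fdc F l y) -> x = y.
Proof. by move=> xx yy xy; rewrite -xx -yy !(fdpi F); apply: eq_bigr => l _; rewrite xy. Qed.

(* The image of the commutator map is the annihilator, for the trace pairing, of the
   homomorphisms in the opposite direction. *)
Lemma trace_duality (k : fieldType) (V V' : lmodType k) (pi : V -> V) (pi' : V' -> V')
    (F : fdim pi) (F' : fdim pi') (I : finType) (bo : I -> V -> V) (co : I -> V' -> V')
    (w : V -> V') :
  linear pi -> linear pi' ->
  (forall i, linear (bo i)) -> (forall i, linear (co i)) -> linear w ->
  (forall i x, pi x = x -> pi (bo i x) = bo i x) ->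
  (forall i x, pi' x = x -> pi' (co i x) = co i x) ->
  (forall x, pi x = x -> pi' (w x) = w x) ->
  (forall h : V' -> V, linear h -> (forall y, pi (h y) = h y) ->
     (forall i y, pi' y = y -> h (co i y) = bo i (h y)) -> ftr F (fun x => h (w x)) = 0) ->
  exists f : I -> V -> V', [/\ forall i, linear (f i), forall i x, pi' (f i x) = f i x
   & forall x, pi x = x -> w x = \sum_i (co i (f i x) - f i (bo i x))].
Proof.
move=> pl pl' bl cl wl bp cp wp wh.
pose mat1 i : 'M[k]_(fdn F) := \matrix_(l, l') fdc F l' (bo i (fdb F l)).
pose mat2 i : 'M[k]_(fdn F') := \matrix_(l, l') fdc F' l' (co i (fdb F' l)).
pose W : 'M[k]_(fdn F, fdn F') := \matrix_(l, l') fdc F' l' (w (fdb F l)).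
have b1 i l : bo i (fdb F l) = \sum_l' mat1 i l l' *: fdb F l'.
  by rewrite -[LHS]bp ?fdb_pi // (fdpi F); apply: eq_bigr => l' _; rewrite mxE.
have b2 i l : co i (fdb F' l) = \sum_l' mat2 i l l' *: fdb F' l'.
  by rewrite -[LHS]cp ?fdb_pi // (fdpi F'); apply: eq_bigr => l' _; rewrite mxE.
have bW l : w (fdb F l) = \sum_l' W l l' *: fdb F' l'.
  by rewrite -[LHS]wp ?fdb_pi // (fdpi F'); apply: eq_bigr => l' _; rewrite mxE.
have [H HC|f fE] := @commutator_image k _ _ I mat1 mat2 W.
  have hl := mmap_linear H.
  rewrite -[RHS](wh (mmap H)) //.
  - apply: eq_bigr => l _; rewrite mxE bW (lin_sum hl) (lin_sum (fdc_linear l)).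
    by apply: eq_bigr => l' _; rewrite (linZ hl) fdcZ fdc_mmap.
  - by move=> y; exact: mmap_pi.
  move=> i y; move: y; apply: (fd_eq (F := F') (g := fun y => mmap H (co i y)) (h := fun y => bo i (mmap H y))).
  - exact: lin_comp.
  - exact: lin_comp.
  move=> l; apply: (fd_coord_eq (F := F)) => [||l'].
  - exact: mmap_pi.
  - by rewrite bp // mmap_pi.
  have := congr1 (fun M : 'M_(_, _) => M l l') (HC i); rewrite !mxE => E.
  rewrite b2 (lin_sum hl) (lin_sum (fdc_linear l')).
  rewrite mmap_base (lin_sum (bl i)) (lin_sum (fdc_linear l')).
  transitivity (\sum_j mat2 i l j * H j l').
    by apply: eq_bigr => j _; rewrite (linZ hl) fdcZ fdc_mmap.
  by rewrite E; apply: eq_bigr => j _; rewrite (linZ (bl i)) fdcZ [mat1 i j l']mxE.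
exists (fun i => mmap (f i)); split=> [i|i x|]; [exact: mmap_linear|exact: mmap_pi|].
have fl i := mmap_linear (F := F) (F' := F') (f i).
apply: (fd_eq (F := F) wl).
  by apply: lin_bigsum => i _; apply: lin_sub; exact: lin_comp.
move=> l; apply: (fd_coord_eq (F := F')) => [||l'].
- by rewrite wp // fdb_pi.
- rewrite (lin_sum pl'); apply: eq_bigr => i _.
  by rewrite (linB pl') cp ?mmap_pi.
have := congr1 (fun M : 'M_(_, _) => M l l') fE; rewrite [LHS]mxE => ->.
rewrite summxE (lin_sum (fdc_linear l')); apply: eq_bigr => i _.
rewrite !mxE (linB (fdc_linear l')); congr (_ - _).
  rewrite mmap_base (lin_sum (cl i)) (lin_sum (fdc_linear l')).
  by apply: eq_bigr => j _; rewrite (linZ (cl i)) fdcZ [mat2 i j l']mxE.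
rewrite b1 (lin_sum (fl i)) (lin_sum (fdc_linear l')).
by apply: eq_bigr => j _; rewrite (linZ (fl i)) fdcZ fdc_mmap.
Qed.

(** * The modules N_(m,j) *)

Section Rank.
Variables (Q : quiver) (Qacyc : quiver_acyclic Q).

Definition adj (x y : vert Q) := [exists a : arrow Q, (qtail a == x) && (qhead a == y)].

Lemma connect_path x y : connect adj x y -> exists p : qpath Q, psrc p = x /\ ptgt p = y.
Proof.
case/connectP => s; elim: s x => [|z s IHs] x /=; first by move=> _ ->; exists (ptriv x).
case/andP=> /existsP[a /andP[/eqP ax /eqP az]] /IHs IH /IH[p [pz py]].
exists (pcat (parrow a) p); have ap : ptgt (parrow a) = psrc p by rewrite pz -az.
by rewrite psrc_pcat // ptgt_pcat.
Qed.

(** The number of predecessors grows along arrows by acyclicity; the enumeration of the vertices,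
    smaller than the factor [#|vert Q|], breaks ties and gives injectivity. *)
Lemma rank_exists : exists r : vert Q -> nat, injective r /\
  forall a : arrow Q, (r (qtail a) < r (qhead a))%N.
Proof.
pose r0 i := #|[set p | connect adj p i]|.
have r0lt (a : arrow Q) : (r0 (qtail a) < r0 (qhead a))%N.
  have aa : connect adj (qtail a) (qhead a).
    by apply/connect1/existsP; exists a; rewrite !eqxx.
  apply/proper_card/properP; split.
    by apply/fintype.subsetP => p; rewrite !inE => /connect_trans; apply.
  exists (qhead a); rewrite !inE ?connect0 //; apply/negP => /connect_path[p [ph pt]].
  have ap : ptgt (parrow a) = psrc p by rewrite ph.
  have := Qacyc (p := pcat (parrow a) p).
  by rewrite psrc_pcat // ptgt_pcat // plen_pcat // => /(_ (esym pt)).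
exists (fun i => r0 i * #|vert Q| + enum_rank i)%N; split.
  move=> i j /(congr1 (modn^~ #|vert Q|)); rewrite !modnMDl !modn_small //.
  by move=> /val_inj/enum_rank_inj.
move=> a; have := ltn_ord (enum_rank (qtail a)); have := r0lt a.
set m := r0 _; set n := r0 _; set N := #|_|; move=> mn eN.
apply: (@leq_trans (m.+1 * N)%N); first by rewrite mulSn addnC ltn_add2r.
by apply: leq_trans (leq_addr _ _); rewrite leq_mul2r mn orbT.
Qed.

Definition rk : vert Q -> nat := sval (cid rank_exists).
Lemma rk_inj : injective rk. Proof. by rewrite /rk; case: cid => r []. Qed.
Lemma rk_lt (a : arrow Q) : (rk (qtail a) < rk (qhead a))%N.
Proof. by rewrite /rk; case: cid => r []. Qed.

End Rank.

Section Pieces.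
Variables (k : fieldType) (Q : quiver) (Qacyc : quiver_acyclic Q).
Notation DQ := (double_quiver Q).
Notation V := (vert DQ).
Notation A := (arrow DQ).
Notation P := (ppa k Q).
Notation pe i := (@pe k Q i).
Notation pa a := (@pa k Q a).
Notation pl b := (pa (inl b)).
Notation ps b := (pa (inr b)).
Notation base p := (pq (pathbase k p)).
Notation rk := (rk Qacyc).
Implicit Types (a : A) (b : arrow Q) (i j q : V) (x y z : P) (m : int).

Definition stard (a : A) : int := (darr a).2.
Definition starp (p : qpath DQ) : int := (dpath p).2.

Lemma stardl b : stard (inl b) = 0. Proof. by []. Qed.
Lemma stardr b : stard (inr b) = 1. Proof. by []. Qed.

Lemma starp_triv i : starp (ptriv i) = 0.
Proof. by rewrite /starp dpath_triv. Qed.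
Lemma starp_cons a p : qhead a = psrc p -> starp (pcat (parrow a) p) = stard a + starp p.
Proof. by move=> ap; rewrite /starp dpath_cons. Qed.

Lemma starp_ge0 p : 0 <= starp p.
Proof.
elim/qpath_indl: p => [i|a p ap IH]; first by rewrite starp_triv.
by rewrite starp_cons //; apply: addr_ge0 => //; case: a {ap}.
Qed.

Definition prs m := @pr k Q (fun d => d.2 == m).
Definition nx m j x : P := prs m x * pe j.
(* membership in the module N_(m,j) of the header *)
Definition inN m j x := nx m j x = x.

Lemma prs_linear m : linear (prs m). Proof. exact: pr_linear. Qed.
Lemma nx_linear m j : linear (nx m j).
Proof. exact: lin_comp (pmulr_linear _) (prs_linear m). Qed.
Lemma prs_pal m a x : prs m (pa a * x) = pa a * prs (m - stard a) x.
Proof.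
rewrite /prs pr_pal; congr (_ * _); apply: pr_ext => d /=.
by rewrite -/(stard a) [RHS]eq_sym subr_eq [RHS]eq_sym addrC.
Qed.
Lemma prs_par m a x : prs m (x * pa a) = prs (m - stard a) x * pa a.
Proof.
rewrite /prs pr_par; congr (_ * _); apply: pr_ext => d /=.
by rewrite -/(stard a) [RHS]eq_sym subr_eq [RHS]eq_sym.
Qed.
Lemma prs_pel m i x : prs m (pe i * x) = pe i * prs m x. Proof. exact: pr_pel. Qed.
Lemma prs_per m i x : prs m (x * pe i) = prs m x * pe i. Proof. exact: pr_per. Qed.
Lemma prs_prs m m' x : prs m (prs m' x) = if m == m' then prs m x else 0.
Proof.
rewrite /prs pr_pr; case: eqP => [->|mm]; first by apply: pr_ext => d; rewrite andbb.
by apply: pr_none => p; apply/negP => /andP[/eqP e1 /eqP e2]; apply: mm; rewrite -e1.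
Qed.

Lemma nx_idem m j x : nx m j (nx m j x) = nx m j x.
Proof. by rewrite /nx prs_per prs_prs eqxx -!mulrA pee. Qed.
Lemma inN_nx m j x : inN m j (nx m j x). Proof. exact: nx_idem. Qed.
Lemma nx_pel m j i x : nx m j (pe i * x) = pe i * nx m j x.
Proof. by rewrite /nx prs_pel mulrA. Qed.
Lemma nx_pal m j a x : nx m j (pa a * x) = pa a * nx (m - stard a) j x.
Proof. by rewrite /nx prs_pal mulrA. Qed.

Lemma inN0 m j : inN m j 0. Proof. exact: lin0 (nx_linear m j). Qed.
Lemma inND m j x y : inN m j x -> inN m j y -> inN m j (x + y).
Proof. by rewrite /inN (linD (nx_linear m j)) => -> ->. Qed.
Lemma inNZ m j c x : inN m j x -> inN m j (c *: x).
Proof. by rewrite /inN (linZ (nx_linear m j)) => ->. Qed.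
Lemma inNB m j x y : inN m j x -> inN m j y -> inN m j (x - y).
Proof. by rewrite /inN (linB (nx_linear m j)) => -> ->. Qed.
Lemma inN_sum m j I (r : seq I) (R : pred I) (F : I -> P) :
  (forall l : I, R l -> inN m j (F l)) -> inN m j (\sum_(l <- r | R l) F l).
Proof. by move=> H; apply: big_ind => //; [exact: inN0|exact: inND]. Qed.
Lemma inN_pel m j i x : inN m j x -> inN m j (pe i * x).
Proof. by rewrite /inN nx_pel => ->. Qed.
Lemma inN_pal m j a x : inN m j x -> inN (m + stard a) j (pa a * x).
Proof. by rewrite /inN nx_pal addrK => ->. Qed.
Lemma inN_pl m j b x : inN m j x -> inN m j (pl b * x).
Proof. by move=> /(inN_pal (inl b)); rewrite stardl addr0. Qed.
Lemma inN_ps m j b x : inN m j x -> inN (m + 1) j (ps b * x).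
Proof. by move=> /(inN_pal (inr b)). Qed.
Lemma inN_pe m j x : inN m j x -> x * pe j = x.
Proof. by move=> <-; rewrite -mulrA pee. Qed.
Lemma inN_prs m j x : inN m j x -> prs m x = x.
Proof. by move=> <-; rewrite /nx prs_per prs_prs eqxx. Qed.
Lemma inN_par m j a x : inN m j x -> inN (m + stard a) (qhead a) (x * pa a).
Proof.
by move=> xN; rewrite /inN /nx prs_par addrK (inN_prs xN) -mulrA pa_head.
Qed.
Lemma inN_par0 m j a x : inN m j x -> qtail a != j -> x * pa a = 0.
Proof. by move=> /inN_pe <- /negPf aj; rewrite -mulrA pe_pa eq_sym aj mulr0. Qed.

Lemma prs_base m p : prs m (base p) = if starp p == m then base p else 0.
Proof. exact: pr_path. Qed.
Lemma pe_base i p : pe i * base p = if i == psrc p then base p else 0.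
Proof. by rewrite -pqM idem_pathbase; case: ifP => // _; exact: lin0 (@pq_linear k Q). Qed.
Lemma base_pe p i : base p * pe i = if ptgt p == i then base p else 0.
Proof. by rewrite -pqM pathbase_idem; case: ifP => // _; exact: lin0 (@pq_linear k Q). Qed.
Lemma nx_base m j p : nx m j (base p) = if (starp p == m) && (ptgt p == j) then base p else 0.
Proof. by rewrite /nx prs_base; case: ifP => _; rewrite ?mul0r // base_pe. Qed.
Lemma base_cons a p : qhead a = psrc p -> base (pcat (parrow a) p) = pa a * base p.
Proof. by move=> ap; rewrite -pqM arrow_pathbase ap eqxx. Qed.

Lemma inN_base m j p : starp p = m -> ptgt p = j -> inN m j (base p).
Proof. by move=> <- <-; rewrite /inN nx_base !eqxx. Qed.

Lemma inN_neg m j x : m < 0 -> inN m j x -> x = 0.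
Proof.
move=> m0 <-; rewrite /nx [prs m x]pr_none ?mul0r // => p.
by rewrite -/(starp p); apply: contraTneq m0 => <-; rewrite -leNgt starp_ge0.
Qed.

(** Paths are peeled from the left. The starred case carries no induction hypothesis, because the
    remaining factor lies in the previous piece N_(m-1,j). *)
Lemma N_ind m j (Pr : P -> Prop) : Pr 0 -> (forall x y, Pr x -> Pr y -> Pr (x + y)) ->
  (forall c x, Pr x -> Pr (c *: x)) -> (m = 0 -> Pr (pe j)) ->
  (forall b x, inN m j x -> pe (qhead b) * x = x -> Pr x -> Pr (pl b * x)) ->
  (forall b x, inN (m - 1) j x -> pe (qtail b) * x = x -> Pr (ps b * x)) ->
  forall x, inN m j x -> Pr x.
Proof.
move=> P0 PD PZ Pe Pl Ps x <-; have [f <-] := pq_surj x.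
elim/pathalg_ind: f => [|f g IHf IHg|c f IH|p].
- have -> : pq (0 : pathalg k DQ) = 0 by exact: lin0 (@pq_linear k Q).
  by rewrite (lin0 (nx_linear m j)).
- by rewrite (linD (@pq_linear k Q)) (linD (nx_linear m j)); exact: PD.
- by rewrite (linZ (@pq_linear k Q)) (linZ (nx_linear m j)); exact: PZ.
rewrite nx_base; case: ifP => // /andP[/eqP pm /eqP pj].
elim/qpath_indl: p pm pj => [i|[b|b] p bp IH].
- by rewrite starp_triv => m0 ij; rewrite -[base _]/(pe (ptgt (ptriv i))) ij; exact: Pe.
- rewrite starp_cons // ptgt_pcat // add0r base_cons // => pm pj.
  by apply: Pl; [exact: inN_base|rewrite pe_base ifT //; exact/eqP/bp|exact: IH].
rewrite starp_cons // ptgt_pcat // base_cons // => pm pj.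
by apply: Ps; [apply: inN_base => //; rewrite -pm addrC addKr|rewrite pe_base ifT //; exact/eqP/bp].
Qed.

(** A plain arrow raises the rank, and a starred one lowers it by at most the maximal rank; hence
    few stars force a short path, and the pieces of Pi are finite-dimensional. *)
Lemma plen_bound (p : qpath DQ) : exists n : nat, (starp p = n%:Z) /\
  (plen p <= n * (\max_i rk i).+1 + \max_i rk i)%N.
Proof.
set R := \max_i rk i; have rR i : (rk i <= R)%N by exact: leq_bigmax.
(* Including the ranks of both ends makes the inequality stable under adding an arrow on the
   left. *)
suff [n [-> H]] : exists n : nat, starp p = n%:Z /\
    (plen p + rk (psrc p) <= n * R.+1 + rk (ptgt p))%N.
  exists n; split=> //; apply: leq_trans (leq_addr (rk (psrc p)) _) (leq_trans H _).
  by rewrite leq_add2l.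
elim/qpath_indl: p => [i|[b|b] p bp [n [pn IH]]].
- by exists 0%N; rewrite starp_triv.
- exists n; rewrite starp_cons // psrc_pcat // ptgt_pcat // plen_pcat // pn; split=> //.
  have e1 : psrc (parrow (inl b : A)) = qtail b by [].
  have e2 : psrc p = qhead b by rewrite -bp.
  have e3 : plen (parrow (inl b : A)) = 1%N by [].
  by move: IH (rk_lt Qacyc b); rewrite e1 e2 e3; lia.
exists n.+1; rewrite starp_cons // psrc_pcat // ptgt_pcat // plen_pcat // pn; split; first by rewrite stardr; lia.
have e1 : psrc (parrow (inr b : A)) = qhead b by [].
have e3 : plen (parrow (inr b : A)) = 1%N by [].
by move: IH (rR (qhead b)); rewrite e1 e3 mulSn; lia.
Qed.

Lemma paths_finite L : exists s : seq (qpath DQ), forall p, (plen p <= L)%N -> p \in s.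
Proof.
pose t : seq (seq A) := flatten [seq map val (enum {:n.-tuple A}) | n <- iota 0 L.+1].
exists (pmap insub [seq (i, u) | i <- enum V, u <- t]) => p pL.
rewrite mem_pmap_sub /=; apply/allpairsP; exists (val p); split=> //.
- by rewrite mem_enum.
- apply/flattenP; exists (map val (enum {:(plen p).-tuple A})).
    by apply/mapP; exists (plen p) => //; rewrite mem_iota.
  by apply/mapP; exists (in_tuple (val p).2) => //; rewrite mem_enum.
exact: surjective_pairing.
Qed.

Lemma path_fdim (m : int) (pi : P -> P) (S : pred (qpath DQ)) : linear pi ->
  (forall p, pi (base p) = if S p then base p else 0) -> (forall p, S p -> starp p = m) ->
  exists F : fdim pi, forall l, exists p, S p /\ fdb F l = base p.
Proof.
move=> pl' piE Sm; set R := (\max_i rk i)%N.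
have [s sP] := paths_finite (`|m|%N * R.+1 + R).
pose s' := filter S s.
have Ss p : S p -> p \in s'.
  move=> Sp; rewrite mem_filter Sp; apply: sP; have [n [pn]] := plen_bound p.
  by rewrite -(Sm _ Sp) pn absz_nat.
have pp x : pi (pi x) = pi x.
  move: x; apply: lin_ext_path => [||p]; [exact: lin_comp|by []|].
  by rewrite piE; case: ifP => Sp; rewrite ?piE ?Sp // (lin0 pl').
have span x : exists c : 'I_(size s') -> k, pi x = \sum_l c l *: base (tnth (in_tuple s') l).
  have [f <-] := pq_surj x.
  elim/pathalg_ind: f => [|f g [c cE] [d dE]|c f [d dE]|p].
  - exists (fun=> 0); have -> : pq (0 : pathalg k DQ) = 0 by exact: lin0 (@pq_linear k Q).
    by rewrite (lin0 pl') big1 // => l _; rewrite scale0r.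
  - exists (fun l => c l + d l); rewrite (linD (@pq_linear k Q)) (linD pl') cE dE -big_split.
    by apply: eq_bigr => l _; rewrite scalerDl.
  - exists (fun l => c * d l); rewrite (linZ (@pq_linear k Q)) (linZ pl') dE scaler_sumr.
    by apply: eq_bigr => l _; rewrite scalerA.
  rewrite piE; case: ifP => Sp; last first.
    by exists (fun=> 0); rewrite big1 // => l _; rewrite scale0r.
  have /tnthP[l pE] : p \in in_tuple s' by exact: Ss.
  exists (fun n => (n == l)%:R); rewrite (bigD1 l) //= eqxx scale1r big1 ?addr0 => [|n /negPf ->].
    by rewrite pE.
  by rewrite scale0r.
have [|||F FP] := @basis_from_span k _ pi [set y | exists p, S p /\ y = base p]%classic (size s')
   (fun l => base (tnth (in_tuple s') l)) pl' pp.
- move=> l; exists (tnth (in_tuple s') l); split=> //.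
  by have := mem_tnth l (in_tuple s'); rewrite mem_filter => /andP[].
- by move=> l; have := mem_tnth l (in_tuple s'); rewrite mem_filter piE => /andP[->].
- exact: span.
by exists F.
Qed.

Lemma nx_fdim m j : exists F : fdim (nx m j), forall l, exists p,
  [/\ starp p = m, ptgt p = j & fdb F l = base p].
Proof.
have [F FP] := @path_fdim m (nx m j) (fun p => (starp p == m) && (ptgt p == j))
  (nx_linear m j) (nx_base m j) (fun p H => eqP (proj1 (andP H))).
by exists F => i; have [p [/andP[/eqP ? /eqP ?] ?]] := FP i; exists p.
Qed.

Lemma nxe_linear i m j : linear (fun x => pe i * nx m j x).
Proof. exact: lin_comp (pmull_linear _) (nx_linear m j). Qed.

Lemma nxe_fdim i m j : exists F : fdim (fun x => pe i * nx m j x), forall l, exists p,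
  [/\ psrc p = i, starp p = m, ptgt p = j & fdb F l = base p].
Proof.
have [|p|F FP] := @path_fdim m _
  (fun p => [&& psrc p == i, starp p == m & ptgt p == j]) (@nxe_linear i m j).
- move=> p; rewrite nx_base; case: ifP => _; last by rewrite andbF mulr0.
  by rewrite pe_base eq_sym andbT.
- by case/and3P => _ /eqP.
by exists F => l; have [p [/and3P[/eqP ? /eqP ? /eqP ?] ?]] := FP l; exists p.
Qed.

Definition fdN m j : fdim (nx m j) := sval (cid (nx_fdim m j)).
Definition fdNe i m j : fdim (fun x => pe i * nx m j x) := sval (cid (nxe_fdim i m j)).

Lemma nxe_orth m j p q x :
  pe p * nx m j (pe q * nx m j x) = if p == q then pe q * nx m j x else 0.
Proof. by rewrite nx_pel nx_idem mulrA peM; case: eqP => [->|]; rewrite ?mul0r. Qed.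

Lemma pe_pl b x : pe (qtail b) * (pl b * x) = pl b * x.
Proof. by rewrite mulrA (pe_tail _ (inl b : A)). Qed.
Lemma pe_ps b x : pe (qhead b) * (ps b * x) = ps b * x.
Proof. by rewrite mulrA (pe_tail _ (inr b : A)). Qed.
Lemma pl_pe b x : pl b * (pe (qhead b) * x) = pl b * x.
Proof. by rewrite mulrA (pa_head _ (inl b : A)). Qed.
Lemma ps_pe b x : ps b * (pe (qtail b) * x) = ps b * x.
Proof. by rewrite mulrA (pa_head _ (inr b : A)). Qed.
Lemma pl_pe0 b q x : pe q * x = x -> qhead b != q -> pl b * x = 0.
Proof. by move=> <- /negPf bq; rewrite mulrA (pa_pe k q (inl b : A)) bq mul0r. Qed.
Lemma ps_pe0 b q x : pe q * x = x -> qtail b != q -> ps b * x = 0.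
Proof. by move=> <- /negPf bq; rewrite mulrA (pa_pe k q (inr b : A)) bq mul0r. Qed.

Lemma sum_arrows (U : zmodType) (F : A -> U) :
  \sum_(a : A) F a = \sum_(b : arrow Q) F (inl b) + \sum_(b : arrow Q) F (inr b).
Proof. by rewrite big_sumType. Qed.

Lemma rhoE x : \sum_(b : arrow Q) pl b * (ps b * x) = \sum_(b : arrow Q) ps b * (pl b * x).
Proof.
have := congr1 (fun y => y * x) (rho0 k Q); rewrite sum_arrows mul0r mulrDl !mulr_suml.
move=> /eqP; rewrite addr_eq0 -sumrN => /eqP H.
transitivity (\sum_(b : arrow Q) sg k (inl b) *: (pl b * pa (star (inl b))) * x).
  by apply: eq_bigr => b _; rewrite scale1r mulrA.
by rewrite H; apply: eq_bigr => b _; rewrite scaleN1r mulNr opprK mulrA.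
Qed.

(* [f] is a cocycle dual to the mesh relation; it factors through left multiplication by the
   starred arrows.  This is the adjunction between the Auslander-Reiten translations. *)
Lemma mesh_lift m j m' j' (f : arrow Q -> P -> P) :
  (forall b, linear (f b)) -> (forall b x, inN m j x -> inN m' j' (f b x)) ->
  (forall b x, inN m j x -> pe (qhead b) * f b x = f b x) ->
  (forall b x, inN m j x -> f b x = f b (pe (qtail b) * x)) ->
  (forall x, inN m j x -> \sum_b pl b * f b x = \sum_b f b (pl b * x)) ->
  exists g : P -> P, [/\ linear g, forall x, inN m j x -> inN (m' - 1) j' (g x),
    forall q x, inN m j x -> g (pe q * x) = pe q * g x,
    forall b x, inN m j x -> g (pl b * x) = pl b * g x
    & forall b x, inN m j x -> f b x = ps b * g x].
Proof.
move=> fl fN fe ft fr.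
(* Conditions on the value of the lift at the vertex [q]: starred arrows ending at [q] must
   reproduce [f], and plain arrows ending at [q] must match the values already chosen at their
   tails. *)
pose C q (phi : P -> P) u y := [/\ inN (m' - 1) j' y, pe q * y = y,
   forall b, qtail b = q -> ps b * y = f b u
   & forall b, qhead b = q -> pl b * y = phi (pl b * u)].
have Nu q u : pe q * nx m j u = u -> inN m j u /\ pe q * u = u.
  by move=> <-; split; [apply/inN_pel/inN_nx|rewrite mulrA pee].
have [||||||phi [phil phiC]] := @vertex_recursion k _ P V rk (fun q x => pe q * nx m j x)
   (fun q => fdNe q m j) C (@rk_inj _ Qacyc).
- by move=> q; exact: nxe_linear.
- by move=> p q x; exact: nxe_orth.
- move=> q phi phi' u y pp /Nu[uN uq] [yN yq y1 y2]; split=> // b bq.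
  have lt : (rk (qtail b) < rk q)%N by rewrite -bq; exact: rk_lt.
  by have := pp _ (pl b * u) lt; rewrite y2 // (inN_pl b uN) pe_pl.
- move=> q phi phil; split; first exact: inN0.
  + by rewrite mulr0.
  + by move=> b _; rewrite mulr0 (lin0 (fl b)).
  + by move=> b _; rewrite mulr0 (lin0 phil).
- move=> q phi c u u' y y' phil [yN yq y1 y2] [yN' yq' y1' y2']; split.
  + by apply: inND => //; exact: inNZ.
  + by rewrite mulrDr -pZr yq yq'.
  + by move=> b bq; rewrite mulrDr -pZr y1 // y1' // fl.
  + by move=> b bq; rewrite !mulrDr -!pZr y2 // y2' // phil.
- move=> q phi phil phiC u /Nu[uN uq].
  pose z (a : A) := match a with inl b => if qtail b == q then f b u else 0
     | inr b => if qhead b == q then - phi (pl b * u) else 0 end.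
  have Ct b : qhead b = q -> [/\ inN (m' - 1) j' (phi (pl b * u)),
      pe (qtail b) * phi (pl b * u) = phi (pl b * u)
      & ps b * phi (pl b * u) = f b (pl b * u)].
    move=> bq; have := phiC (qtail b) (pl b * u).
    rewrite (inN_pl b uN) pe_pl -bq => /(_ (rk_lt Qacyc b))[h1 h2 h3 h4].
    by split=> //; apply: h3.
  have [||c cE] := @mesh_left _ _ z.
  + case=> b /=; case: eqP => // bq; rewrite ?mulr0 //; first exact: fe.
    by rewrite mulrN; case: (Ct b bq) => _ ->.
  (* The relation that [mesh_left] asks for: by [Ct] the starred part is -\sum_b f_b(b u), which
     cancels the plain part by [fr]. *)
  + rewrite sum_arrows /=.
    have -> : \sum_b pl b * z (inl b) = \sum_b pl b * f b u.
      apply: eq_bigr => b _ /=; case: eqP => // /eqP bq.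
      by rewrite (ft b u uN) -uq mulrA peM (negPf bq) mul0r (lin0 (fl b)).
    rewrite fr // -big_split /= big1 // => b _; case: eqP => [bq|/eqP bq].
      by case: (Ct b bq) => _ _ bE; rewrite mulrN bE subrr.
    by rewrite (pl_pe0 uq bq) mulr0 addr0 (lin0 (fl b)).
  exists (pe q * nx (m' - 1) j' c); split.
  + exact/inN_pel/inN_nx.
  + by rewrite mulrA pee.
  + move=> b bq; have := cE (inl b); rewrite /= bq eqxx scale1r => fE.
    rewrite -bq ps_pe -{1}[m' - 1]/(m' - stard (inr b)) -nx_pal -fE.
    exact: fN.
  + move=> b bq; have := cE (inr b); rewrite /= bq eqxx scaleN1r => /oppr_inj fE.
    rewrite -bq pl_pe fE -[RHS](_ : nx (m' - 1) j' (pl b * c) = _).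
      by rewrite nx_pal subr0.
    by rewrite -fE; case: (Ct b bq).
have phiN q x : inN m j x -> C q phi (pe q * x) (phi (pe q * x)).
  by move=> xN; have := phiC q x; rewrite xN.
have phie q x : inN m j x -> phi (pe q * x) = pe q * phi x.
  move=> xN; rewrite [in RHS](pe_decl x) (lin_sum phil) mulr_sumr (bigD1 q) //=.
  case: (phiN q x xN) => _ -> _ _; rewrite big1 ?addr0 // => p pq'.
  by case: (phiN p x xN) => _ <- _ _; rewrite mulrA peM eq_sym (negPf pq') mul0r.
exists phi; split=> //.
- move=> x xN; rewrite (pe_decl x) (lin_sum phil); apply: inN_sum => q _.
  by case: (phiN q x xN).
- move=> b x xN; rewrite -(pl_pe b x); case: (phiN (qhead b) x xN) => _ _ _ <- //.
  by rewrite phie // pl_pe.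
- move=> b x xN; rewrite ft //; case: (phiN (qtail b) x xN) => _ _ <- // _.
  by rewrite phie // ps_pe.
Qed.

Record Nhom (m : int) j (m' : int) j' (h : P -> P) : Prop := MkNhom {
  Nhom_linear : linear h;
  Nhom_N : forall x, inN m j x -> inN m' j' (h x);
  Nhom_e : forall q x, inN m j x -> h (pe q * x) = pe q * h x;
  Nhom_l : forall b x, inN m j x -> h (pl b * x) = pl b * h x }.

(** Induction on the stars. For m = 0 the module is A e_j and h is determined by h(e_j). In degree m
    + 1, the maps x |-> h(b^* x) satisfy the hypotheses of [mesh_lift] by the preprojective
    relation, so h(b^* x) = b^* g(x) for a homomorphism g on N_(m,j), which is a right
    multiplication already. *)
Lemma Nhom_right m j h : forall m' j', Nhom m j m' j' h ->
  exists u, [/\ inN (m' - m) j' u, pe j * u = u & forall x, inN m j x -> h x = x * u].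
Proof.
move=> m' j'; have [m0|] := leP 0 m; last first.
  move=> m0 H; exists 0; split; [exact: inN0|by rewrite mulr0|move=> x /(inN_neg m0) ->].
  by rewrite mul0r (lin0 (Nhom_linear H)).
rewrite -(gez0_abs m0); elim: `|m|%N m' h => [|n IHn] {m m0} m' h [hl hN he hb].
  have ejN : inN 0 j (pe j) by rewrite /inN /nx /prs pr_pe /= pee.
  exists (h (pe j)); split; first by rewrite subr0; exact: hN.
    by rewrite -he // pee.
  suff H x : inN 0 j x -> inN 0 j x /\ h x = x * h (pe j) by move=> x /H[].
  elim/N_ind => [|y z [yN yE] [zN zE]|c y [yN yE]|_|b y yN _ [_ yE]|b y yN _].
  - by rewrite (lin0 hl) mul0r; split=> //; exact: inN0.
  - by rewrite (linD hl) yE zE mulrDl; split=> //; exact: inND.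
  - by rewrite (linZ hl) yE pZl; split=> //; exact: inNZ.
  - by rewrite -he // pee.
  - by rewrite hb // yE mulrA; split=> //; exact: inN_pl.
  - by rewrite (inN_neg _ yN) // mulr0 mul0r (lin0 hl); split=> //; exact: inN0.
have nn : n.+1%:Z - 1 = n by lia.
have psN b x : inN n j x -> inN n.+1%:Z j (ps b * x).
  by move=> /(inN_ps b); rewrite (_ : n%:Z + 1 = n.+1) //; lia.
have [|||||g [gl gN ge gb gs]] := @mesh_lift n j m' j' (fun b x => h (ps b * x)).
- by move=> b; exact: lin_comp hl (pmull_linear _).
- by move=> b x xN; apply/hN/psN.
- by move=> b x xN; rewrite -he ?pe_ps //; exact: psN.
- by move=> b x xN; rewrite ps_pe.
- move=> x xN; rewrite -(lin_sum hl) -rhoE (lin_sum hl); apply: eq_bigr => b _.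
  by rewrite hb //; exact: psN.
have [|u [uN ju uE]] := IHn (m' - 1) g; first by split.
exists u; split=> //; first by move: uN; rewrite (_ : m' - 1 - n%:Z = m' - n.+1%:Z) //; lia.
move=> x xN; suff [] : inN n.+1%:Z j x /\ h x = x * u by [].
move: x xN; apply: N_ind => [|y z [yN yE] [zN zE]|c y [yN yE]||b y yN _ [_ yE]|b y].
- by rewrite (lin0 hl) mul0r; split=> //; exact: inN0.
- by rewrite (linD hl) yE zE mulrDl; split=> //; exact: inND.
- by rewrite (linZ hl) yE pZl; split=> //; exact: inNZ.
- by [].
- by rewrite hb // yE mulrA; split=> //; exact: inN_pl.
- by rewrite nn => yN _; rewrite gs // uE // mulrA; split=> //; exact: psN.
Qed.

(** A path of positive length without stars strictly raises the rank. *)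
Lemma N0_rank i j x : ~~ (rk i < rk j)%N -> inN 0 j x -> pe i * x = x ->
  exists c, x = (if i == j then c *: pe j else 0).
Proof.
move=> ij <- <-; have [f <-] := pq_surj x.
elim/pathalg_ind: f => [|f g [c IHf] [d IHg]|c f [d IH]|p].
- exists 0; have -> : pq (0 : pathalg k DQ) = 0 by exact: lin0 (@pq_linear k Q).
  by rewrite (lin0 (nx_linear _ _)) mulr0 scale0r; case: ifP.
- exists (c + d); rewrite (linD (@pq_linear k Q)) (linD (nx_linear _ _)) mulrDr IHf IHg.
  by case: ifP => _; rewrite ?addr0 // scalerDl.
- exists (c * d); rewrite (linZ (@pq_linear k Q)) (linZ (nx_linear _ _)) -pZr IH.
  by case: ifP => _; rewrite ?scaler0 // scalerA.
rewrite nx_base; case: ifP => [/andP[/eqP p0 /eqP pj]|_]; last first.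
  by exists 0; rewrite mulr0 scale0r; case: ifP.
rewrite pe_base; case: eqP => [pi|_]; last by exists 0; rewrite scale0r; case: ifP.
have : (rk (psrc p) < rk (ptgt p))%N \/ exists q, p = ptriv q.
  elim/qpath_indl: p p0 {pj pi} => [q|[b|b] p bp IH]; first by right; exists q.
    rewrite starp_cons // add0r psrc_pcat // ptgt_pcat // => /IH H; left.
    move: bp => /= bp; have := rk_lt Qacyc b; rewrite bp.
    case: H => [H1 H2|[q ->] //]; exact: ltn_trans H1.
  by rewrite starp_cons // => H; have := starp_ge0 p; move: H; rewrite stardr; lia.
case=> [|[q pt]]; first by rewrite -pi pj (negPf ij).
exists 1; have [iq jq] : i = q /\ j = q by rewrite pi -pj pt.
by rewrite iq jq eqxx scale1r pt.
Qed.

Lemma inN_pej j : inN 0 j (pe j).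
Proof. by rewrite /inN /nx /prs pr_pe /= pee. Qed.

Lemma Nend_scalar m j h : Nhom m j m j h -> exists c, forall x, inN m j x -> h x = c *: x.
Proof.
move=> /Nhom_right[u []]; rewrite subrr => uN ju hE.
have [c] := N0_rank (negbT (ltnn _)) uN ju; rewrite eqxx => uE.
by exists c => x xN; rewrite hE // uE -pZr (inN_pe xN).
Qed.

Definition dead m j := forall x, inN m j x -> x = 0.

(* A homomorphism into N_(m,j), prescribed at the vertex l to be the rank one map given by zeta
   and y0, and zero at the vertices before l; T is a submodule in which the arrows can be
   divided out. *)
Lemma extend_hom n i m j l y0 (zeta : P -> k) (T : P -> Prop) :
  linear (zeta : P -> k^o) -> pe l * y0 = y0 -> T y0 -> (forall b, pl b * y0 = 0) ->
  (forall c x y, T x -> T y -> T (c *: x + y)) -> (forall x, T x -> inN m j x) ->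
  (forall q (y : arrow Q -> P), (forall b, qhead b = q -> T (y b) /\ pe (qtail b) * y b = y b) ->
    exists x, [/\ T x, pe q * x = x & forall b, qhead b = q -> pl b * x = y b]) ->
  exists phi, [/\ Nhom n i m j phi, forall x, inN n i x -> T (phi x),
    forall u, inN n i u -> pe l * u = u -> phi u = zeta u *: y0
    & forall q u, (rk q < rk l)%N -> inN n i u -> pe q * u = u -> phi u = 0].
Proof.
move=> zl ly0 Ty0 y00 Tl TN Tdiv.
have T0 : T 0 by have := Tl (-1) _ _ Ty0 Ty0; rewrite scaleN1r addNr.
(* Zero below [l], prescribed at [l]; above [l] the divisibility of [T] supplies a value compatible
   with all plain arrows ending at [q]. *)
pose C q (phi : P -> P) u y := [/\ (rk q < rk l)%N -> y = 0, q = l -> y = zeta u *: y0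
  & (rk l < rk q)%N -> [/\ T y, pe q * y = y
   & forall b, qhead b = q -> pl b * y = phi (pl b * u)]].
have Nu q u : pe q * nx n i u = u -> inN n i u /\ pe q * u = u.
  by move=> <-; split; [apply/inN_pel/inN_nx|rewrite mulrA pee].
have CT q phi u y : C q phi u y -> T y /\ pe q * y = y.
  move=> [h1 h2 h3]; have [qi|/h3[]//|/(@rk_inj _ Qacyc) qi] := ltngtP (rk q) (rk l).
    by rewrite h1 // mulr0.
  by rewrite h2 // qi -pZr ly0; split=> //; rewrite -[_ *: _]addr0; exact: Tl.
have [||||||phi [phil phiC]] := @vertex_recursion k _ P V rk (fun q x => pe q * nx n i x)
   (fun q => fdNe q n i) C (@rk_inj _ Qacyc).
- by move=> q; exact: nxe_linear.
- by move=> p q x; exact: nxe_orth.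
- move=> q phi phi' u y pp /Nu[uN uq] [y1 y2 y3]; split=> // /y3[y4 y5 y6]; split=> // b bq.
  have lt : (rk (qtail b) < rk q)%N by rewrite -bq; exact: rk_lt.
  by have := pp _ (pl b * u) lt; rewrite y6 // (inN_pl b uN) pe_pl.
- move=> q phi phil; split=> // [_|_]; first by rewrite (lin0 zl) scale0r.
  by split=> *; rewrite ?mulr0 ?(lin0 phil).
- move=> q phi c u u' y y' phil [y1 y2 y3] [y1' y2' y3']; split.
  + by move=> qi; rewrite y1 // y1' // scaler0 addr0.
  + by move=> qi; rewrite y2 // y2' // zl scalerDl scalerA.
  + move=> qi; have [h1 h2 h3] := y3 qi; have [h1' h2' h3'] := y3' qi; split.
    * exact: Tl.
    * by rewrite mulrDr -pZr h2 h2'.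
    * by move=> b bq; rewrite !mulrDr -!pZr h3 // h3' // phil.
- move=> q phi phil phiC u /Nu[uN uq].
  have [qi|lq|/(@rk_inj _ Qacyc) qi] := ltngtP (rk q) (rk l).
  + by exists 0; split=> //; [move=> qi'; rewrite qi' ltnn in qi|move=> /ltnW; rewrite leqNgt qi].
  + have [b bq|x [Tx xq xb]] := Tdiv q (fun b => phi (pl b * u)).
      have := phiC (qtail b) (pl b * u); rewrite (inN_pl b uN) pe_pl -bq => /(_ (rk_lt Qacyc b)).
      exact: CT.
    exists x; split=> // [|qi]; first by move=> /ltnW; rewrite leqNgt lq.
    by rewrite qi ltnn in lq.
  + by exists (zeta u *: y0); split=> //; rewrite qi ltnn.
have phiN q x : inN n i x -> C q phi (pe q * x) (phi (pe q * x)).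
  by move=> xN; have := phiC q x; rewrite xN.
have TD x y : T x -> T y -> T (x + y) by move=> Tx Ty; rewrite -[x]scale1r; exact: Tl.
have phiT x : inN n i x -> T (phi x).
  move=> xN; rewrite (pe_decl x) (lin_sum phil); apply: (big_ind T) => // q _.
  by case: (CT _ _ _ _ (phiN q x xN)).
have phie q x : inN n i x -> phi (pe q * x) = pe q * phi x.
  move=> xN; rewrite [in RHS](pe_decl x) (lin_sum phil) mulr_sumr (bigD1 q) //=.
  rewrite (CT _ _ _ _ (phiN q x xN)).2 big1 ?addr0 // => p pq'.
  by rewrite -(CT _ _ _ _ (phiN p x xN)).2 mulrA peM eq_sym (negPf pq') mul0r.
exists phi; split=> //.
- split=> //; first by move=> x /phiT/TN.
  move=> b x xN; rewrite -(pl_pe b x) -[in RHS](pl_pe b (phi x)) -phie //.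
  have lth := rk_lt Qacyc b; have [h1 h2 h3] := phiN (qhead b) x xN.
  have bN : inN n i (pl b * (pe (qhead b) * x)) by apply/inN_pl/inN_pel.
  have := phiN (qtail b) _ bN; rewrite pe_pl => -[t1 t2 t3].
  have [hi|/h3[_ _ ->]//|/(@rk_inj _ Qacyc) hi] := ltngtP (rk (qhead b)) (rk l).
    by rewrite h1 // mulr0 t1 //; exact: ltn_trans lth hi.
  by rewrite h2 // -pZr y00 scaler0 t1 // -hi.
- by move=> u uN lu; have [_ /(_ erefl)] := phiN l u uN; rewrite lu.
by move=> q u ql uN qu; have [/(_ ql)] := phiN q u uN; rewrite qu.
Qed.

(* The rank one endomorphism through z must be a scalar. *)
Lemma left_killed_dead m j i z : inN m j z -> pe i * z = z -> z != 0 ->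
  (forall a, pa a * z = 0) -> dead (m + 1) j.
Proof.
move=> zN iz nz z0.
have iz' : pe i * nx m j z = z by rewrite zN.
have [zeta [zl zz]] := fd_functional (fdNe i m j) iz' nz.
(* Here [T] is the set of elements killed by all starred arrows. The extended map fixes [z], so,
   being scalar, it is the identity; its values lie in [T], hence starred arrows vanish on N_(m,j)
   and nothing is left in N_(m+1,j). *)
have [|||||phi [phiH phiT phii phi0]] := @extend_hom m j m j i z zeta
  (fun y => inN m j y /\ forall b, ps b * y = 0) zl iz.
- by [].
- by [].
- move=> c x y [xN x0] [yN y0]; split; first by apply: inND => //; exact: inNZ.
  by move=> b; rewrite mulrDr -pZr x0 y0 scaler0 addr0.
- by move=> x [].
- move=> q y yP.
  pose w (a : A) := if a is inr b then (if qhead b == q then - y b else 0) else 0.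
  have [||c cE] := @mesh_left _ _ w.
  + case=> b /=; rewrite ?mulr0 //; case: eqP => // bq; last by rewrite mulr0.
    by rewrite mulrN; case: (yP b bq) => _ ->.
  + rewrite big1 // => -[b|b] _ /=; first by rewrite mulr0.
    case: eqP => [/yP[[_ y0] _]|]; last by rewrite mulr0.
    by rewrite mulrN y0 oppr0.
  exists (pe q * nx m j c); split; first split.
  + exact/inN_pel/inN_nx.
  + move=> b; have [bq|bq] := eqVneq (qtail b) q; last first.
      by apply: ps_pe0 bq; rewrite mulrA pee.
    have := cE (inl b); rewrite /= scale1r => fE.
    rewrite -bq ps_pe (_ : m = m + 1 - stard (inr b)); last by rewrite stardr addrK.
    by rewrite -nx_pal -fE (lin0 (nx_linear _ _)).
  + by rewrite mulrA pee.
  + move=> b bq; have := cE (inr b); rewrite /= bq eqxx scaleN1r => /oppr_inj fE.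
    rewrite -bq pl_pe fE -[RHS](_ : nx m j (pl b * c) = _); first by rewrite nx_pal subr0.
    by rewrite -fE; case: (yP b bq) => -[].
have [c phiE] := Nend_scalar phiH.
have c1 : c = 1.
  move: (phii z zN iz); rewrite zz phiE // => /eqP; rewrite -subr_eq0 -scalerBl scaler_eq0.
  by rewrite (negPf nz) orbF subr_eq0 => /eqP.
have star0 b x : inN m j x -> ps b * x = 0.
  by move=> xN; have [_] := phiT x xN; rewrite phiE // c1 scale1r; apply.
apply: N_ind => // [x y -> ->|d x ->|m1|b x _ _ ->|b x xN _].
- by rewrite addr0.
- by rewrite scaler0.
- by case/eqP: nz; apply: inN_neg zN; lia.
- by rewrite mulr0.
- by apply: star0; move: xN; rewrite addrK.
Qed.
End Pieces.

(** * Socles of injective pieces and elements killed on the right *)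

Section RightKilled.
Variables (k : fieldType) (Q : quiver) (Qacyc : quiver_acyclic Q).
Notation DQ := (double_quiver Q).
Notation V := (vert DQ).
Notation A := (arrow DQ).
Notation P := (ppa k Q).
Notation pe i := (@pe k Q i).
Notation pa a := (@pa k Q a).
Notation pl b := (pa (inl b)).
Notation ps b := (pa (inr b)).
Notation rk := (rk Qacyc).
Notation dead := (@dead k Q).
Notation fdNe := (@fdNe k Q Qacyc).
Implicit Types (a : A) (b : arrow Q) (i j q : V) (x y z : P) (m : int).

(** The obstruction to solving b x = y_b for all b at once is \sum_b b^* y_b, an element of
    N_(m+1,j) = 0. This is injectivity of N_(m,j) in the form used below. *)
Lemma dead_div m j : dead (m + 1) j -> forall q (y : arrow Q -> P),
  (forall b, qhead b = q -> inN m j (y b) /\ pe (qtail b) * y b = y b) ->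
  exists x, [/\ inN m j x, pe q * x = x & forall b, qhead b = q -> pl b * x = y b].
Proof.
move=> dj q y yP.
pose w (a : A) := if a is inr b then (if qhead b == q then - y b else 0) else 0.
have [||c cE] := @mesh_left _ _ w.
- case=> b /=; rewrite ?mulr0 //; case: eqP => // bq; last by rewrite mulr0.
  by rewrite mulrN; case: (yP b bq) => _ ->.
- apply: dj; apply: inN_sum => -[b|b] _ /=; first by rewrite mulr0; exact: inN0.
  case: eqP => [/yP[yN _]|_]; last by rewrite mulr0; exact: inN0.
  by rewrite mulrN -scaleN1r; apply/inNZ/inN_ps.
exists (pe q * nx m j c); split; first exact/inN_pel/inN_nx.
  by rewrite mulrA pee.
move=> b bq; have := cE (inr b); rewrite /= bq eqxx scaleN1r => /oppr_inj fE.
rewrite -bq pl_pe fE -[RHS](_ : nx m j (pl b * c) = _); first by rewrite nx_pal subr0.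
by rewrite -fE; case: (yP b bq).
Qed.

Lemma extend_hom_dead n i m j l y0 (zeta : P -> k) : dead (m + 1) j ->
  linear (zeta : P -> k^o) -> pe l * y0 = y0 -> inN m j y0 -> (forall b, pl b * y0 = 0) ->
  exists phi, [/\ Nhom n i m j phi,
    forall u, inN n i u -> pe l * u = u -> phi u = zeta u *: y0
    & forall q u, (rk q < rk l)%N -> inN n i u -> pe q * u = u -> phi u = 0].
Proof.
move=> dj zl ly0 y0N y00.
have [|||phi [h1 h2 h3 h4]] := @extend_hom k Q Qacyc n i m j l y0 zeta (inN m j) zl ly0 y0N y00.
- by move=> c x y xN yN; apply: inND => //; exact: inNZ.
- by [].
- exact: dead_div.
by exists phi.
Qed.

(* The socle of an injective piece is simple. *)
Lemma dead_socle m j l1 l2 s1 s2 : dead (m + 1) j ->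
  inN m j s1 -> pe l1 * s1 = s1 -> s1 != 0 -> (forall b, pl b * s1 = 0) ->
  inN m j s2 -> pe l2 * s2 = s2 -> s2 != 0 -> (forall b, pl b * s2 = 0) ->
  l1 = l2 /\ exists c, s2 = c *: s1.
Proof.
move=> dj.
(* Were [s'] at a vertex of smaller rank than that of [s], the extended rank one map would fix [s]
   and kill [s'], which no scalar does. *)
have key l s l' s' : inN m j s -> pe l * s = s -> s != 0 -> (forall b, pl b * s = 0) ->
    inN m j s' -> pe l' * s' = s' -> s' != 0 -> ~~ (rk l' < rk l)%N.
  move=> sN ls s0 sb s'N ls' s'0; apply/negP => lt.
  have ls1 : pe l * nx m j s = s by rewrite sN.
  have [zeta [zl zs]] := fd_functional (fdNe l m j) ls1 s0.
  have [phi [/Nend_scalar H h2 h3]] := extend_hom_dead m j dj zl ls sN sb.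
  have [//|c cE] := H; have := h3 _ _ lt s'N ls'; rewrite cE // => /eqP.
  rewrite scaler_eq0 (negPf s'0) orbF => /eqP c0.
  by have := h2 _ sN ls; rewrite zs cE // c0 scale0r scale1r => /eqP; rewrite eq_sym (negPf s0).
move=> s1N ls1 s10 s1b s2N ls2 s20 s2b.
have k12 := key l1 s1 l2 s2 s1N ls1 s10 s1b s2N ls2 s20.
have k21 := key l2 s2 l1 s1 s2N ls2 s20 s2b s1N ls1 s10.
have /(@rk_inj _ Qacyc) l12 : rk l1 = rk l2 by apply/eqP; rewrite -leqNgt in k12; rewrite -leqNgt in k21; rewrite eqn_leq k12.
split=> //; subst l2.
have ls1' : pe l1 * nx m j s1 = s1 by rewrite s1N.
have [zeta0 [zl0 zs0]] := fd_functional (fdNe l1 m j) ls1' s10.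
(* If [s2] were not a multiple of [s1], a functional vanishing on [s1] with value 1 on [s2] would
   give an endomorphism that kills [s1] and fixes [s2], again not a scalar. *)
apply: contrapT => nc; pose s3 := s2 - zeta0 s2 *: s1.
have s30 : s3 != 0.
  apply/eqP => /eqP; rewrite subr_eq0 => /eqP s2E; apply: nc; exists (zeta0 s2); exact: s2E.
have ls3 : pe l1 * nx m j s3 = s3.
  by rewrite (inNB s2N (inNZ _ s1N)) /s3 mulrBr -pZr ls1 ls2.
have [zeta1 [zl1 zs1]] := fd_functional (fdNe l1 m j) ls3 s30.
pose zeta x := zeta1 (x - zeta0 x *: s1).
have zl : linear (zeta : P -> k^o).
  apply: (lin_comp zl1); apply: lin_sub; [exact: lin_id|exact: lin_scalel].
have z1 : zeta s1 = 0 by rewrite /zeta zs0 scale1r subrr (lin0 zl1).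
have [phi [/Nend_scalar H h2 h3]] := extend_hom_dead m j dj zl ls2 s2N s2b.
have [//|c cE] := H; have := h2 _ s1N ls1; rewrite z1 scale0r cE // => /eqP.
rewrite scaler_eq0 (negPf s10) orbF => /eqP c0.
by have := h2 _ s2N ls2; rewrite /zeta zs1 scale1r cE // c0 scale0r => /eqP; rewrite eq_sym (negPf s20).
Qed.

(* Injective pieces with the same socle coincide. *)
Lemma dead_same_socle m i m' i' l z z' : dead (m + 1) i -> dead (m' + 1) i' ->
  inN m i z -> pe l * z = z -> z != 0 -> (forall b, pl b * z = 0) ->
  inN m' i' z' -> pe l * z' = z' -> z' != 0 -> (forall b, pl b * z' = 0) ->
  m = m' /\ i = i'.
Proof.
(* Injectivity gives homomorphisms in both directions that are nonzero on the common socle vertex.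
   By [Nhom_right] they come from nonzero elements, whose star numbers and end vertices leave only
   equality. *)
have key n j n' j' s s' : dead (n' + 1) j' ->
    inN n j s -> pe l * s = s -> s != 0 ->
    inN n' j' s' -> pe l * s' = s' -> s' != 0 -> (forall b, pl b * s' = 0) ->
    exists u, [/\ inN (n' - n) j' u, pe j * u = u & u != 0].
  move=> dj sN ls s0 s'N ls' s'0 s'b.
  have ls1 : pe l * nx n j s = s by rewrite sN.
  have [zeta [zl zs]] := fd_functional (fdNe l n j) ls1 s0.
  have [phi [/Nhom_right H h2 _]] := extend_hom_dead n j dj zl ls' s'N s'b.
  have [//|u [uN ju uE]] := H; exists u; split=> //; apply: contra_neq s'0 => u0.
  by have := h2 _ sN ls; rewrite zs scale1r uE // u0 mulr0.
move=> d1 d2 zN lz z0 zb z'N lz' z'0 z'b.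
have [u [uN ju u0]] := key m i m' i' z z' d2 zN lz z0 z'N lz' z'0 z'b.
have [v [vN jv v0]] := key m' i' m i z' z d1 z'N lz' z'0 zN lz z0 zb.
have mm : m = m'.
  have [lt|le] := ltP (m' - m) 0; first by rewrite (inN_neg lt uN) eqxx in u0.
  have [lt'|le'] := ltP (m - m') 0; first by rewrite (inN_neg lt' vN) eqxx in v0.
  by lia.
subst m'; rewrite !subrr in uN vN; split=> //; apply: contrapT => /eqP ii.
have [lt|ge] := boolP (rk i < rk i')%N.
  have ge : ~~ (rk i' < rk i)%N by rewrite -leqNgt ltnW.
  have [c] := N0_rank ge vN jv; rewrite eq_sym (negPf ii) => v00.
  by rewrite v00 eqxx in v0.
have [c] := N0_rank ge uN ju; rewrite (negPf ii) => u00.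
by rewrite u00 eqxx in u0.
Qed.

Definition homog x := exists d, pr (pred1 d) x = x.
Definition rkilled x := forall a, x * pa a = 0.

Lemma homog_pal a x : homog x -> homog (pa a * x).
Proof.
move=> [d dx]; exists (darr a + d); rewrite pr_pal -{2}dx; congr (_ * _).
by apply: pr_ext => e /=; rewrite (inj_eq (addrI _)).
Qed.
Lemma rkilled_l y x : rkilled x -> rkilled (y * x).
Proof. by move=> xk a; rewrite -mulrA xk mulr0. Qed.
Lemma rkilled_comp d i x : rkilled x -> rkilled (pr (pred1 d) (pe i * x)).
Proof.
move=> /(rkilled_l (pe i)) xk a; have := pr_par (pred1 (d + darr a)) a (pe i * x).
rewrite xk (lin0 (pr_linear _)) => H; rewrite [RHS]H; congr (_ * _).
by apply: pr_ext => e /=; rewrite (inj_eq (addIr _)).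
Qed.
Lemma inN_pr m j (S : pred _) x : inN m j x -> inN m j (pr S x).
Proof.
move=> xN; rewrite /inN /nx /prs -!pr_per (inN_pe xN) -[in RHS](inN_prs xN) /prs !pr_pr.
by apply: pr_ext => d; rewrite andbC.
Qed.

Lemma comp_nonzero x : x != 0 -> exists i d, pr (pred1 d) (pe i * x) != 0.
Proof.
move=> nz; apply: contrapT => H; case/eqP: nz.
rewrite (pe_decl x) big1 // => i _; have [s [_ sE]] := degree_support (pe i * x).
rewrite -(@pr_id _ _ predT (pe i * x)) // sE big1 // => d _.
by apply/eqP/negPn/negP => dn; apply: H; exists i, d.
Qed.

(** [dagger] turns an element killed on the right into one killed on the left, which by
    [left_killed_dead] is a socle element of an injective piece. Homogeneity of [x] provides the
    star number [s] of that piece. *)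
Lemma rkilled_dagger m i j x : inN m j x -> pe i * x = x -> homog x -> rkilled x -> x != 0 ->
  exists s, [/\ dead (s + 1) i, inN s i (dagger x), pe j * dagger x = dagger x,
     dagger x != 0 & forall b, pl b * dagger x = 0].
Proof.
move=> xN ix [d dx] xk nz; set z := dagger x.
have jz : pe j * z = z by rewrite -(dagger_pe k j) -daggerM (inN_pe xN).
have zi : z * pe i = z by rewrite -(dagger_pe k i) -daggerM ix.
have zk a : pa a * z = 0.
  by rewrite -(starK a) -(dagger_pa k (star a)) -daggerM xk (lin0 (@dagger_linear k Q)).
have nzz : z != 0.
  by apply: contra_neq nz => z0; rewrite -(daggerK x) -/z z0 (lin0 (@dagger_linear k Q)).
have [s zN] : exists s, inN s i z.
  exists (ddag d).2; rewrite /inN /nx -pr_per zi.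
  rewrite {2}/z -dx dagger_pr -/z; rewrite -[in RHS](@pr_id _ _ predT z) // pr_pr.
  rewrite -[in LHS](@pr_id _ _ predT z) // /z -{1}dx dagger_pr !pr_pr.
  apply: pr_ext => e /=; rewrite !andbT; apply: andb_idl => /eqP <-.
  case: e => c e /=; apply/eqP; under [Y in _ = _ + Y]eq_bigr do rewrite ffunE.
  by rewrite sumrN addrK.
exists s; split=> //; exact: (left_killed_dead Qacyc zN jz nzz zk).
Qed.

(** After [dagger] both are socle elements of injective pieces at the same vertex [j], so the pieces
    coincide and the elements are proportional. *)
Lemma rkilled_unique m m' i i' j x x' :
  inN m j x -> pe i * x = x -> homog x -> rkilled x -> x != 0 ->
  inN m' j x' -> pe i' * x' = x' -> homog x' -> rkilled x' -> x' != 0 ->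
  i = i' /\ exists c, x' = c *: x.
Proof.
move=> xN ix hx kx nx xN' ix' hx' kx' nx'.
have [s [d1 d2 d3 d4 d5]] := rkilled_dagger xN ix hx kx nx.
have [s' [d1' d2' d3' d4' d5']] := rkilled_dagger xN' ix' hx' kx' nx'.
have [ss ii] := dead_same_socle d1 d1' d2 d3 d4 d5 d2' d3' d4' d5'.
subst s' i'; split=> //.
have [_ [c cE]] := dead_socle d1 d2 d3 d4 d5 d2' d3' d4' d5'.
by exists c; rewrite -(daggerK x') cE (linZ (@dagger_linear k Q)) daggerK.
Qed.

(** Take a homogeneous counterexample [y] whose left vertex has least rank. Plain arrows kill it by
    minimality, so by [left_killed_dead] some starred arrow does not. But b^* y is again killed on
    the right and ends at [j], so [rkilled_unique] puts it at the vertex of [y], against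
    acyclicity. *)
Lemma rkilled_alive m j x : ~ dead (m + 1) j -> inN m j x -> rkilled x -> x = 0.
Proof.
move=> alive xN xk; apply: contrapT => /eqP nz.
pose good n := exists i y, [/\ rk i = n, inN m j y, pe i * y = y, y != 0 & homog y /\ rkilled y].
have exg : exists n, `[< good n >].
  have [i [d nzd]] := comp_nonzero nz.
  exists (rk i); apply/asboolP; exists i, (pr (pred1 d) (pe i * x)); split=> //.
  - exact/inN_pr/inN_pel.
  - by rewrite pr_pel mulrA pee.
  - split; last exact: rkilled_comp.
    by exists d; rewrite pr_pr; apply: pr_ext => e; rewrite andbb.
case: (ex_minnP exg) => n /asboolP[i [y [ni yN iy ny [hy ky]]]] nmin.
have yb b : pl b * y = 0.
  have [bi|bi] := eqVneq (qhead b) i; last exact: pl_pe0 iy bi.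
  apply: contrapT => /eqP nzb; have : (n <= rk (qtail b))%N.
    apply: nmin; apply/asboolP; exists (qtail b), (pl b * y); split=> //.
    - exact: inN_pl.
    - exact: pe_pl.
    - by split; [exact: homog_pal|exact: rkilled_l].
  by rewrite -ni -bi leqNgt rk_lt.
have [[b nzb]|ny'] := pselect (exists b, ps b * y != 0); last first.
  apply: alive; apply: (left_killed_dead Qacyc yN iy ny) => -[b|b]; first exact: yb.
  by apply/eqP/negPn/negP => nzb; apply: ny'; exists b.
have bi : qtail b = i by apply/eqP; apply: contraNT nzb => bi; apply/eqP; exact: ps_pe0 iy bi.
have [ii _] := rkilled_unique yN iy hy ky ny (inN_ps b yN) (pe_ps b y)
  (homog_pal (inr b) hy) (rkilled_l (ps b) ky) nzb.
by have := rk_lt Qacyc b; rewrite bi ii ltnn.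
Qed.

(** Homogeneous components of elements killed on the right are again such, and [rkilled_unique]
    makes them proportional. If there are none, [z0] is 0. *)
Lemma rkilled_line m j : exists i z0, [/\ inN m j z0, pe i * z0 = z0, forall b, pl b * z0 = 0
  & forall x, inN m j x -> rkilled x -> exists c, x = c *: z0].
Proof.
have [[i [y [yN iy ny hy ky]]]|no] := pselect (exists i y,
    [/\ inN m j y, pe i * y = y, y != 0, homog y & rkilled y]).
  exists i, y; split=> // [b|x xN xk].
    apply: contrapT => /eqP nzb.
    have bi : qhead b = i by apply/eqP; apply: contraNT nzb => bi; apply/eqP; exact: pl_pe0 iy bi.
    have [ii _] := rkilled_unique yN iy hy ky ny (inN_pl b yN) (pe_pl b y)
      (homog_pal (inl b) hy) (rkilled_l (pl b) ky) nzb.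
    by have := rk_lt Qacyc b; rewrite bi -ii ltnn.
  have cmp i' d : exists c, pr (pred1 d) (pe i' * x) = c *: y.
    have [->|nz] := eqVneq (pr (pred1 d) (pe i' * x)) 0; first by exists 0; rewrite scale0r.
    have h1 : inN m j (pr (pred1 d) (pe i' * x)) by exact/inN_pr/inN_pel.
    have h2 : pe i' * pr (pred1 d) (pe i' * x) = pr (pred1 d) (pe i' * x).
      by rewrite pr_pel mulrA pee.
    have h3 : homog (pr (pred1 d) (pe i' * x)).
      by exists d; rewrite pr_pr; apply: pr_ext => e; rewrite andbb.
    have [_ [c cE]] := rkilled_unique yN iy hy ky ny h1 h2 h3 (rkilled_comp d i' xk) nz.
    by exists c.
  rewrite (pe_decl x); apply: (big_ind (fun x => exists c, x = c *: y)).
  - by exists 0; rewrite scale0r.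
  - by move=> _ _ [c ->] [d ->]; exists (c + d); rewrite scalerDl.
  move=> i' _; have [s [_ sE]] := degree_support (pe i' * x).
  rewrite -(@pr_id _ _ predT (pe i' * x)) // sE; apply: (big_ind (fun x => exists c, x = c *: y)) => //.
  - by exists 0; rewrite scale0r.
  - by move=> _ _ [c ->] [d ->]; exists (c + d); rewrite scalerDl.
exists j, 0; split=> [||b|x xN xk]; rewrite ?mulr0 //; first exact: inN0.
exists 0; rewrite scaler0; apply: contrapT => /eqP /comp_nonzero[i [d nz]].
apply: no; exists i, (pr (pred1 d) (pe i * x)); split=> //.
- exact/inN_pr/inN_pel.
- by rewrite pr_pel mulrA pee.
- by exists d; rewrite pr_pr; apply: pr_ext => e; rewrite andbb.
- exact: rkilled_comp.
Qed.

End RightKilled.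

(** * The maps F^a *)

Section Cocycles.
Variables (k : fieldType) (Q : quiver) (Qacyc : quiver_acyclic Q).
Notation DQ := (double_quiver Q).
Notation V := (vert DQ).
Notation A := (arrow DQ).
Notation P := (ppa k Q).
Notation pe i := (@pe k Q i).
Notation pa a := (@pa k Q a).
Notation pl b := (pa (inl b)).
Notation ps b := (pa (inr b)).
Notation base p := (pq (pathbase k p)).
Notation rk := (rk Qacyc).
Notation G Q := ({ffun arrow Q -> int} * int)%type.
Notation fdN := (@fdN k Q Qacyc).
Implicit Types (a : A) (b : arrow Q) (i j q : V) (x y z : P) (m : int).

(** An element of \bigoplus_b Hom_k(e_t(b) N, e_h(b) N'): its maps go against left multiplication by
    b. Up to sign, [dl] is the dual of the complex that computes Hom_A(N', N). *)
Record cocycle m j m' j' (F : arrow Q -> P -> P) : Prop := MkCocycle {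
  cocycle_linear : forall b, linear (F b);
  cocycle_N : forall b x, inN m j x -> inN m' j' (F b x);
  cocycle_head : forall b x, inN m j x -> pe (qhead b) * F b x = F b x;
  cocycle_tail : forall b x, inN m j x -> F b x = F b (pe (qtail b) * x) }.

Definition dl (F : arrow Q -> P -> P) x := \sum_(b : arrow Q) (pl b * F b x - F b (pl b * x)).

Lemma pel_linear i : linear (fun x : P => pe i * x : P). Proof. exact: pmull_linear. Qed.
Lemma pal_linear a : linear (fun x : P => pa a * x : P). Proof. exact: pmull_linear. Qed.
Lemma par_linear a : linear (fun x : P => x * pa a : P). Proof. exact: pmulr_linear. Qed.

(** [trace_duality] is applied to the arrows together with the vertex idempotents, so that the test
    maps are exactly the A-linear ones; compressing the solution by idempotents removes the
    idempotent terms afterwards. *)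
Lemma cocycle_solve m j m' j' w : linear w -> (forall x, inN m j x -> inN m' j' (w x)) ->
  (forall q x, inN m j x -> w (pe q * x) = pe q * w x) ->
  (forall h, Nhom m' j' m j h -> ftr (fdN m j) (fun x => h (w x)) = 0) ->
  exists F, cocycle m j m' j' F /\ forall x, inN m j x -> dl F x = w x.
Proof.
move=> wl wN we wh.
pose op (t : arrow Q + V) (x : P) := match t with inl b => pl b * x | inr q => pe q * x end.
have opl t : linear (op t) by case: t => c; exact: pmull_linear.
have opN n l t x : inN n l x -> inN n l (op t x).
  by case: t => c; [exact: inN_pl|exact: inN_pel].
have [|||h hl hN hc|f [fl fN fE]] := @trace_duality k _ _ _ _ (fdN m j) (fdN m' j') _ op op w
  (nx_linear m j) (nx_linear m' j') opl opl wl.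
- by move=> t x; exact: opN.
- by move=> t x; exact: opN.
- exact: wN.
- apply: wh; split=> // [x _|q x xN|b x xN]; first exact: hN.
    exact: (hc (inr q)).
  exact: (hc (inl b)).
have fN' t x : inN m' j' (f t x) by exact: fN.
exists (fun b x => pe (qhead b) * f (inl b) (pe (qtail b) * x)); split.
  split=> [b|b x _|b x _|b x _].
  - apply: (lin_comp (pel_linear _)); apply: (lin_comp (fl _)); exact: pel_linear.
  - exact: inN_pel.
  - by rewrite mulrA pee.
  - by rewrite [pe _ * (pe _ * x)]mulrA pee.
move=> x xN; rewrite [RHS]pe_decl.
transitivity (\sum_q pe q * w (pe q * x)); last first.
  by apply: eq_bigr => q _; rewrite we // mulrA pee.
transitivity (\sum_q \sum_t (pe q * op t (f t (pe q * x)) - pe q * f t (op t (pe q * x)))); last first.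
  apply: eq_bigr => q _; rewrite fE ?mulr_sumr; last exact: inN_pel.
  by apply: eq_bigr => i _; rewrite mulrBr.
rewrite exchange_big big_sumType /= [Y in _ = _ + Y]big1 ?addr0 => [|q _]; last first.
  rewrite big1 // => p _; have [->|/negPf pq] := eqVneq p q; rewrite !mulrA !peM ?eqxx ?subrr //.
  by rewrite [q == p]eq_sym pq !mul0r (lin0 (fl _)) mulr0 subr0.
apply: eq_bigr => b _; rewrite sumrB; congr (_ - _).
  rewrite (bigD1 (qtail b)) //= big1 ?addr0 => [|q /negPf qb]; last first.
    by rewrite mulrA (pe_pa k q (inl b : A)) /= qb mul0r.
  by rewrite pe_pl pl_pe.
rewrite pe_pl (bigD1 (qhead b)) //= pl_pe big1 ?addr0 // => q qb.
rewrite mulrA (pa_pe k q (inl b : A)) /= eq_sym (negPf qb) mul0r (lin0 (fl _)) mulr0.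
by [].
Qed.

Lemma fdN_base m j (l : 'I_(fdn (fdN m j))) :
  exists p, [/\ starp p = m, ptgt p = j & fdb (fdN m j) l = base p].
Proof. by move: l; rewrite /fdN; case: cid => F /= FP l; exact: FP. Qed.

Lemma pr_deg_base d (p : qpath DQ) : dpath p = d -> pr (pred1 d) (base p) = base p.
Proof. by move=> pd; rewrite pr_path /= pd eqxx. Qed.

Lemma fdc_homog m j (l : 'I_(fdn (fdN m j))) d e x :
  pr (pred1 d) x = x -> pr (pred1 e) (fdb (fdN m j) l) = fdb (fdN m j) l ->
  e != d -> fdc (fdN m j) l x = 0.
Proof.
move=> dx el ed; have [s xE] : exists s : 'I_(fdn (fdN m j)) -> G Q,
   forall n, pr (pred1 (s n)) (fdb (fdN m j) n) = fdb (fdN m j) n.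
  have /choice[s sP] : forall n, exists d, pr (pred1 d) (fdb (fdN m j) n) = fdb (fdN m j) n.
    by move=> n; have [p [_ _ ->]] := fdN_base n; exists (dpath p); exact: pr_deg_base.
  by exists s.
have ee' (d1 d2 : G Q) (y : P) : d1 != d2 -> pr (pred1 d1) y = y -> pr (pred1 d2) y = 0.
  move=> ab <-; rewrite pr_pr; apply: pr_none => p /=; apply/negP => /andP[/eqP -> /eqP ba].
  by rewrite ba eqxx in ab.
have c0 : fdc (fdN m j) l (nx m j x) = fdc (fdN m j) l x by exact: fdc_pi.
rewrite -c0.
have -> : nx m j x = \sum_n (if s n == d then fdc (fdN m j) n x *: fdb (fdN m j) n else 0).
  have -> : nx m j x = pr (pred1 d) (nx m j x).
    by rewrite -[in LHS]dx /nx pr_per /prs !pr_pr; congr (_ * _); apply: pr_ext => f; rewrite andbC.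
  rewrite (fdpi (fdN m j)) (lin_sum (pr_linear _)); apply: eq_bigr => i _.
  rewrite (linZ (pr_linear _)); case: eqP => [<-|/eqP sd]; first by rewrite xE.
  by rewrite (ee' (s i)) ?scaler0.
rewrite (lin_sum (fdc_linear l)) big1 // => i _; case: eqP => [sd|_]; last first.
  exact: lin0 (fdc_linear l).
rewrite fdcZ fdcb; case: eqP => [li|]; last by rewrite mulr0.
have nz : fdb (fdN m j) i != 0.
  apply/eqP => b0; have := fdcb i i; rewrite b0 (lin0 (fdc_linear i)) eqxx.
  by move/eqP; rewrite eq_sym oner_eq0.
have := ee' e (s i) (fdb (fdN m j) i); rewrite xE -li el li sd ed => /(_ isT erefl) b0.
by rewrite b0 eqxx in nz.
Qed.

(** [F'] is the component of [F] for which b F_b has degree [D], hence F_b itself has degree [D]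
    minus that of b. It is read off on the homogeneous basis of paths. *)
Lemma cocycle_homog m j m' j' F (D : G Q) : cocycle m j m' j' F ->
  exists F', cocycle m j m' j' F' /\ forall b d x, inN m j x -> pr (pred1 d) x = x ->
    F' b x = pr (pred1 (d + D - darr (inl b : A))) (F b x).
Proof.
move=> [Fl FN Fh Ft]; pose B := fdN m j.
have /choice[s sP] : forall n, exists d, pr (pred1 d) (fdb B n) = fdb B n.
  by move=> n; have [p [_ _ ->]] := fdN_base n; exists (dpath p); exact: pr_deg_base.
pose F' b x := \sum_l fdc B l x *: pr (pred1 (s l + D - darr (inl b : A))) (F b (fdb B l)).
have F'l b : linear (F' b).
  by apply: lin_bigsum => l _; exact: (lin_scalel _ (fdc_linear l)).
have F'E b d x : inN m j x -> pr (pred1 d) x = x ->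
    F' b x = pr (pred1 (d + D - darr (inl b : A))) (F b x).
  move=> xN dx; rewrite -[in RHS]xN (fdpi B) (lin_sum (Fl b)) (lin_sum (pr_linear _)).
  apply: eq_bigr => l _; rewrite (linZ (Fl b)) (linZ (pr_linear _)).
  have [->//|sd] := eqVneq (s l) d.
  by rewrite (fdc_homog dx (sP l) sd) !scale0r.
have bN l : inN m j (fdb B l) by exact: fdb_pi.
exists F'; split=> //; split=> // [b x xN|b x xN|b x xN].
- by apply: inN_sum => l _; apply/inNZ/inN_pr/FN.
- rewrite mulr_sumr; apply: eq_bigr => l _; rewrite -pZr -pr_pel Fh //.
- move: x xN; apply: (fd_eq (F := B) (F'l b) (lin_comp (F'l b) (pel_linear _))) => l.
  have dl1 : pr (pred1 (s l)) (pe (qtail b) * fdb B l) = pe (qtail b) * fdb B l.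
    by rewrite pr_pel sP.
  rewrite (F'E b (s l)) // (F'E b (s l)) //; last exact: inN_pel.
  by rewrite -Ft.
Qed.

Section Weight.
Variable v : V -> k.

Definition vm x : P := \sum_(i : V) v i *: (pe i * x).

Lemma vm_linear : linear vm.
Proof. by apply: lin_bigsum => i _; apply: lin_scale; exact: pel_linear. Qed.
Lemma vmM x y : vm (x * y) = vm x * y.
Proof. by rewrite mulr_suml; apply: eq_bigr => i _; rewrite mulrA pZl. Qed.
Lemma vm_pe q x : vm (pe q * x) = v q *: (pe q * x).
Proof.
rewrite /vm (bigD1 q) //= mulrA pee big1 ?addr0 // => i /negPf iq.
by rewrite mulrA peM iq mul0r scaler0.
Qed.
Lemma pe_vm q x : pe q * vm x = v q *: (pe q * x).
Proof.
rewrite /vm mulr_sumr (bigD1 q) //= -pZr mulrA pee big1 ?addr0 // => i /negPf iq.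
by rewrite -pZr mulrA peM eq_sym iq mul0r scaler0.
Qed.
Lemma inN_vm m j x : inN m j x -> inN m j (vm x).
Proof. by move=> xN; apply: inN_sum => i _; apply/inNZ/inN_pel. Qed.
Lemma pr_vm S x : pr S (vm x) = vm (pr S x).
Proof.
rewrite (lin_sum (pr_linear S)); apply: eq_bigr => i _.
by rewrite (linZ (pr_linear S)) pr_pel.
Qed.

(** The element defining [h] would have -1 stars or, for a plain arrow, would be a combination of
    paths of kQ from its head to its tail; both are impossible. *)
Lemma Nhom_back m a h : Nhom (m + stard a) (qhead a) m (qtail a) h ->
  forall x, inN (m + stard a) (qhead a) x -> h x = 0.
Proof.
move=> /(Nhom_right Qacyc)[u [uN hu uE]] x xN; rewrite uE //.
suff -> : u = 0 by rewrite mulr0.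
case: a hu uN {uE xN} => b hu; last by apply: inN_neg; rewrite stardr; lia.
rewrite stardl addr0 subrr => uN; have lt := rk_lt Qacyc b.
have ge : ~~ (rk (qhead b) < rk (qtail b))%N by rewrite -leqNgt ltnW.
have [c ->] := N0_rank ge uN hu.
by case: eqP => // bb; rewrite bb ltnn in lt.
Qed.

(** By [Nhom_back] the trace condition of [cocycle_solve] is satisfied trivially. Passing to the
    component of degree [darr a] keeps the equation, whose right side is homogeneous. *)
Lemma arrow_cocycle_exists m a : exists F, [/\ cocycle m (qtail a) (m + stard a) (qhead a) F,
  forall x, inN m (qtail a) x -> dl F x = vm (x * pa a)
  & forall b d x, inN m (qtail a) x -> pr (pred1 d) x = x ->
      pr (pred1 (d + darr a - darr (inl b : A))) (F b x) = F b x].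
Proof.
have [||||F [FC FE]] := @cocycle_solve m (qtail a) (m + stard a) (qhead a) (fun x => vm (x * pa a)).
- exact: lin_comp vm_linear (par_linear a).
- by move=> x xN; apply: inN_vm; exact: (inN_par _ xN).
- by move=> q x xN; rewrite -mulrA vm_pe pe_vm.
- move=> h hH; rewrite /ftr big1 // => l _.
  rewrite (Nhom_back hH) ?(lin0 (fdc_linear l)) //.
  by apply: inN_vm; apply: (@inN_par k Q m (qtail a)); exact: fdb_pi.
have [F' [FC' F'E]] := cocycle_homog (darr a) FC; exists F'; split=> // [x xN|b d x xN dx].
  move: x xN; apply: (fd_eq (F := fdN m (qtail a)) (h := fun x => vm (x * pa a))).
  - apply: lin_bigsum => b _; apply: lin_sub.
      exact: lin_comp (pal_linear _) (cocycle_linear FC' b).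
    exact: lin_comp (cocycle_linear FC' b) (pal_linear _).
  - exact: lin_comp vm_linear (par_linear a).
  move=> l; have xN : inN m (qtail a) (fdb (fdN m (qtail a)) l) by exact: fdb_pi.
  have [p [_ _ pE]] := fdN_base l; have := pr_deg_base (erefl (dpath p)); rewrite -pE.
  move: (fdb _ _) xN (dpath p) => {pE} x xN d dx.
  transitivity (pr (pred1 (d + darr a)) (dl F x)).
    rewrite (lin_sum (pr_linear _)); apply: eq_bigr => b _.
    rewrite (linB (pr_linear _)) (F'E b d) // (F'E b (darr (inl b : A) + d)); first last.
    + rewrite pr_pal -{2}dx; congr (_ * _); apply: pr_ext => e /=.
      by rewrite (inj_eq (addrI _)).
    + exact: inN_pl.
    congr (_ - _); last by congr (pr (pred1 _) _); rewrite addrAC [_ + d]addrC addrK.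
    rewrite pr_pal; congr (_ * _); apply: pr_ext => e /=.
    by rewrite eq_sym subr_eq eq_sym [e + _]addrC.
  rewrite FE // pr_vm pr_par; congr (vm (_ * _)); rewrite -{2}dx; apply: pr_ext => e /=.
  by rewrite (inj_eq (addIr _)).
by rewrite (F'E b d) // pr_pr; apply: pr_ext => e; rewrite andbb.
Qed.

Definition FA m a : arrow Q -> P -> P := sval (cid (arrow_cocycle_exists m a)).

Lemma FA_cocycle m a : cocycle m (qtail a) (m + stard a) (qhead a) (FA m a).
Proof. by rewrite /FA; case: cid => F []. Qed.
Lemma FA_dl m a x : inN m (qtail a) x -> dl (FA m a) x = vm (x * pa a).
Proof. by rewrite /FA; case: cid => F [] /= _ H _; exact: H. Qed.
Lemma FA_homog m a b d x : inN m (qtail a) x -> pr (pred1 d) x = x ->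
  pr (pred1 (d + darr a - darr (inl b : A))) (FA m a b x) = FA m a b x.
Proof. by rewrite /FA; case: cid => F [] /= _ _; apply. Qed.
Lemma FA_linear m a b : linear (FA m a b).
Proof. exact: cocycle_linear (FA_cocycle m a) b. Qed.

Lemma pr_mulh e D y u : pr (pred1 e) y = y -> pr (pred1 (e + D)) (y * u) = y * pr (pred1 D) u.
Proof.
move=> ey; rewrite -ey; move: y {ey}.
apply: (lin_ext_path (F := fun y => pr (pred1 (e + D)) (pr (pred1 e) y * u))
  (H := fun y => pr (pred1 e) y * pr (pred1 D) u)).
- apply: (lin_comp (pr_linear _)); apply: (lin_comp (pmulr_linear u)); exact: pr_linear.
- exact: lin_comp (pmulr_linear _) (pr_linear _).
move=> p; rewrite pr_path /=; case: eqP => [<-|_]; last by rewrite !mul0r (lin0 (pr_linear _)).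
elim/qpath_indl: p => [i|a p ap IH].
  by rewrite dpath_triv add0r pr_pel.
rewrite base_cons // -!mulrA pr_pal -IH dpath_cons //; congr (_ * _).
by apply: pr_ext => d /=; rewrite -addrA (inj_eq (addrI _)).
Qed.

(** Path length as a function of the degree: a starred arrow contributes -1 to the sum and 2 through
    the star count. *)
Definition dlen (d : G Q) : int := \sum_c d.1 c + d.2 + d.2.

Lemma dlenD d e : dlen (d + e) = dlen d + dlen e.
Proof.
rewrite /dlen; have -> : \sum_c (d + e).1 c = \sum_c d.1 c + \sum_c e.1 c.
  by rewrite -big_split; apply: eq_bigr => c _; rewrite ffunE.
have H (a1 b1 c1 d1 : int) : a1 + b1 + (c1 + d1) + (c1 + d1) = a1 + c1 + c1 + (b1 + d1 + d1) by lia.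
exact: H.
Qed.

Lemma dlen_darr a : dlen (darr a) = 1.
Proof.
case: a => b; rewrite /dlen /= (bigD1 b) //= ffunE eqxx big1 => [|c /negPf cb].
- by rewrite !addr0.
- by rewrite ffunE cb.
- by [].
- by rewrite ffunE cb oppr0.
Qed.

Lemma dlen_dpath p : dlen (dpath p) = (plen p)%:Z.
Proof.
elim/qpath_indl: p => [i|a p ap IH].
  by rewrite dpath_triv /dlen /= big1 // => c _; rewrite ffunE.
rewrite dpath_cons // dlenD dlen_darr IH plen_pcat //.
Qed.

Lemma darr_inj : injective (@darr Q).
Proof.
move=> [b|b] [c|c] //= [] /ffunP/(_ b); rewrite !ffunE eqxx.
  by case: eqP => // ->.
by case: eqP => // ->.
Qed.

Lemma dpath_len0 p : dlen (dpath p) = 0 -> p = ptriv (psrc p).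
Proof. by rewrite dlen_dpath => -[p0]; rewrite -ptake0 -p0 ptake_len. Qed.

Lemma pr_len0 D u : dlen D = 0 ->
  exists c : V -> k, pr (pred1 D) u = (if D == 0 then \sum_i c i *: pe i else 0).
Proof.
move=> D0; have [f <-] := pq_surj u.
elim/pathalg_ind: f => [|f g [c cE] [d dE]|c f [d dE]|p].
- exists (fun=> 0); have -> : pq (0 : pathalg k DQ) = 0 by exact: lin0 (@pq_linear k Q).
  by rewrite (lin0 (pr_linear _)) big1 ?if_same // => i _; rewrite scale0r.
- exists (fun i => c i + d i); rewrite (linD (@pq_linear k Q)) (linD (pr_linear _)) cE dE.
  case: eqP => _; rewrite ?addr0 // -big_split; apply: eq_bigr => i _.
  by rewrite scalerDl.
- exists (fun i => c * d i); rewrite (linZ (@pq_linear k Q)) (linZ (pr_linear _)) dE.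
  case: eqP => _; rewrite ?scaler0 // scaler_sumr; apply: eq_bigr => i _.
  by rewrite scalerA.
rewrite pr_path /=; case: eqP => [pD|_]; last first.
  by exists (fun=> 0); rewrite big1 ?if_same // => i _; rewrite scale0r.
have pt : p = ptriv (psrc p) by apply: dpath_len0; rewrite pD.
have -> : D = 0 by rewrite -pD pt dpath_triv.
exists (fun i => (i == psrc p)%:R); rewrite eqxx (bigD1 (psrc p)) //= eqxx scale1r.
rewrite big1 ?addr0 => [|i /negPf ->]; last by rewrite scale0r.
by rewrite {1}pt.
Qed.

(* Composing the cocycles of two consecutive arrows a, a' in the two possible ways gives the same
   result, up to the mesh term when a' is the reverse of a. *)
Lemma FA_commute m a a' : qhead a = qtail a' -> exists c : k,
  (a' != star a -> c = 0) /\ forall b x, inN m (qtail a) x ->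
  FA (m + stard a) a' b (x * pa a) - FA m a b x * pa a' = c *: (ps b * x).
Proof.
move=> aa'; have C1 := FA_cocycle m a; have C2 := FA_cocycle (m + stard a) a'.
pose m' := m + stard a + stard a'.
pose D b x := FA (m + stard a) a' b (x * pa a) - FA m a b x * pa a'.
have xaN x : inN m (qtail a) x -> inN (m + stard a) (qtail a') (x * pa a).
  by move=> xN; rewrite -aa'; exact: (inN_par _ xN).
(* Both composites have the coboundary v x a a', so [mesh_lift] writes their difference as b^* g,
   with g a right multiplication by some [u]. *)
have D0 x : inN m (qtail a) x -> dl D x = 0.
  move=> xN; have := FA_dl (xaN x xN); have := FA_dl xN; rewrite /dl => E1 E2.
  transitivity (vm (x * pa a * pa a') - vm (x * pa a) * pa a'); last by rewrite vmM subrr.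
  rewrite -E1 -E2 mulr_suml -sumrB; apply: eq_bigr => b _; rewrite /D mulrBr mulrBl !mulrA.
  by rewrite !opprD !opprK addrACA.
have Dl b : linear (D b).
  apply: lin_sub; first exact: lin_comp (FA_linear _ _ _) (par_linear a).
  exact: lin_comp (par_linear a') (FA_linear _ _ _).
have [|||||g [gl gN ge gb gs]] := @mesh_lift k Q Qacyc m (qtail a) m' (qhead a') D.
- exact: Dl.
- move=> b x xN; apply: inNB; first by apply: (cocycle_N C2); exact: xaN.
  have H := cocycle_N C1 b xN; have H2 := inN_par a' H; exact: H2.
- move=> b x xN; rewrite mulrBr (cocycle_head C2); last exact: xaN.
  by rewrite mulrA (cocycle_head C1).
- move=> b x xN; rewrite /D (cocycle_tail C2) ?(cocycle_tail C1 b xN); last exact: xaN.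
  by rewrite mulrA.
- by move=> x xN; apply/eqP; rewrite -subr_eq0 -sumrB; apply/eqP; exact: D0.
have [u [uN ju uE]] : exists u, [/\ inN (m' - 1 - m) (qhead a') u, pe (qtail a) * u = u
    & forall x, inN m (qtail a) x -> g x = x * u] by apply: (Nhom_right Qacyc); split.
(* The degree of the relevant component of [u]. Its length is 1 + 1 - 2 = 0, so only a scalar at a
   vertex can survive, and only for d0 = 0, that is a' = [star a]. *)
pose d0 := darr a + darr a' - omega Q.
have len0 : dlen d0 = 0.
  have o2 : dlen (omega Q) = 2 by rewrite -(darr_star a) dlenD !dlen_darr.
  have := dlenD d0 (omega Q); rewrite subrK dlenD !dlen_darr o2; lia.
have [c cE] := pr_len0 u len0.
have DE b x : inN m (qtail a) x -> D b x = ps b * x * pr (pred1 d0) u.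
  move: x; apply: (fd_eq (F := fdN m (qtail a)) (Dl b)).
    exact: lin_comp (pmulr_linear _) (pal_linear _).
  move=> l; have xN : inN m (qtail a) (fdb (fdN m (qtail a)) l) by exact: fdb_pi.
  have [p [_ _ pE]] := fdN_base l; have := pr_deg_base (erefl (dpath p)); rewrite -pE.
  move: (fdb _ _) xN (dpath p) => {pE} x xN d dx.
  have sx : pr (pred1 (darr (inr b : A) + d)) (ps b * x) = ps b * x.
    by rewrite pr_pal -{2}dx; congr (_ * _); apply: pr_ext => e /=; rewrite (inj_eq (addrI _)).
  rewrite -(pr_mulh _ _ sx).
  have -> : ps b * x * u = D b x by rewrite -mulrA -uE // -gs.
  have -> : darr (inr b : A) + d + d0 = d + darr a + darr a' - darr (inl b : A).
    rewrite /d0 -(darr_star (inl b : A)) /=.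
    have H (W : zmodType) (p1 p2 p3 p4 p5 : W) :
        p1 + p2 + (p3 + p4 - (p5 + p1)) = p2 + p3 + p4 - p5.
      by rewrite opprD !addrA -!addrA [p1 + _]addrC !addrA subrK.
    exact: H.
  rewrite [RHS](linB (pr_linear _)); congr (_ - _).
    have xad : pr (pred1 (d + darr a)) (x * pa a) = x * pa a.
      by rewrite pr_par -{2}dx; congr (_ * _); apply: pr_ext => e /=; rewrite (inj_eq (addIr _)).
    by rewrite FA_homog //; exact: xaN.
  rewrite pr_par -(FA_homog b xN dx) pr_pr; congr (_ * _).
  move: (darr (inl b : A)) (darr a) (darr a') => p3 p1 p2; apply: pr_ext => e /=.
  by rewrite [d + p1 + p2 - p3]addrAC (inj_eq (addIr _)) ?andbb.
exists (if a' == star a then c (qtail a) else 0); split=> [/negPf -> //|b x xN].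
rewrite -/(D b x) DE // cE; have [aE|na] := eqVneq a' (star a).
  have -> : d0 = 0 by rewrite /d0 aE darr_star subrr.
  rewrite eqxx mulr_sumr (bigD1 (qtail a)) //= big1 ?addr0 => [|i ij].
    by rewrite -pZr -mulrA (inN_pe xN).
  by rewrite -pZr -mulrA -(inN_pe xN) -mulrA peM eq_sym (negPf ij) !mulr0 scaler0.
case: eqP => [/eqP|_]; last by rewrite mulr0 scale0r.
rewrite subr_eq0 -(darr_star a) (inj_eq (addrI _)) => /eqP/darr_inj aE.
by rewrite aE eqxx in na.
Qed.

End Weight.

End Cocycles.

(** * The middle terms E_x and their universal property *)

Section Middle.
Variables (k : fieldType) (Q : quiver) (Qacyc : quiver_acyclic Q).
Notation DQ := (double_quiver Q).
Notation V := (vert DQ).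
Notation A := (arrow DQ).
Notation P := (ppa k Q).
Notation pe i := (@pe k Q i).
Notation pa a := (@pa k Q a).
Notation pl b := (pa (inl b)).
Notation ps b := (pa (inr b)).
Notation dead := (@dead k Q).
Notation fdN := (@fdN k Q Qacyc).
Implicit Types (a : A) (b : arrow Q) (i j q : V) (x y z : P) (m : int).
Variable v : V -> k.
Notation FA := (FA Qacyc v).
Notation vm := (@vm k Q v).
Notation U := {ffun A -> P}.
Implicit Types (u : U).

Lemma left_decomp x : exists (c : V -> k) (z : A -> P), x = \sum_i c i *: pe i + \sum_a pa a * z a.
Proof.
elim/ppa_ind: x => [|x y [c [z ->]] [c' [z' ->]]|d x [c [z ->]]|i|a x _].
- exists (fun=> 0), (fun=> 0); rewrite !big1 ?addr0 // => [a _|i _]; first exact: mulr0.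
  exact: scale0r.
- exists (fun i => c i + c' i), (fun a => z a + z' a); rewrite addrACA -!big_split.
  by congr (_ + _); apply: eq_bigr => l _; rewrite ?scalerDl ?mulrDr.
- exists (fun i => d * c i), (fun a => d *: z a); rewrite scalerDr !scaler_sumr.
  by congr (_ + _); apply: eq_bigr => l _; rewrite ?scalerA ?pZr.
- exists (fun l => (l == i)%:R), (fun=> 0); rewrite (bigD1 i) //= eqxx scale1r.
  rewrite !big1 ?addr0 // => [a _|l /negPf ->]; [exact: mulr0|exact: scale0r].
exists (fun=> 0), (fun l => if l == a then x else 0); rewrite big1 => [|i _]; last exact: scale0r.
by rewrite (bigD1 a) //= eqxx big1 ?addr0 ?add0r // => l /negPf ->; rewrite mulr0.
Qed.

Lemma right_decomp x : exists (c : V -> k) (z : A -> P), x = \sum_i c i *: pe i + \sum_a z a * pa a.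
Proof.
have [c [z zE]] := left_decomp (dagger x); exists c, (fun a => dagger (z (star a))).
have dl := @dagger_linear k Q.
rewrite -[LHS]daggerK zE (linD dl) !(lin_sum dl); congr (_ + _).
  by apply: eq_bigr => i _; rewrite (linZ dl) dagger_pe.
rewrite (reindex_inj (inv_inj (@starK Q))); apply: eq_bigr => a _ /=.
by rewrite daggerM dagger_pa starK.
Qed.

Lemma stard_star a : stard a + stard (star a) = 1.
Proof. by case: a. Qed.

Definition piE m j u : U :=
  [ffun a => if qtail a == j then nx (m + stard a) (qhead a) (u a) else 0].
(* membership in the middle term E_x of the header, for x = (m, j) *)
Definition isE m j u := piE m j u = u.
Definition mapE (g : P -> P) u : U := [ffun a => g (u a)].
Definition singleE a x : U := [ffun a' => if a' == a then x else 0].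
Definition rE x : U := [ffun a => x * pa a].
Definition fE m j b x : U := [ffun a => if qtail a == j then FA m a b x else 0].
Definition QE u : P := \sum_(a : A) sg k a *: (u a * pa (star a)).

Lemma ffun_lin (W : lmodType k) (f : A -> W -> P) :
  (forall a, linear (f a)) -> linear (fun w => [ffun a => f a w] : U).
Proof. by move=> fl c x y; apply/ffunP => a; rewrite !ffunE fl. Qed.
Lemma app_linear a : linear (fun u : U => u a).
Proof. by move=> c x y; rewrite !ffunE. Qed.
Lemma piE_linear m j : linear (piE m j).
Proof.
apply: (ffun_lin (f := fun a (u : U) => if qtail a == j then nx (m + stard a) (qhead a) (u a) else 0)).
by move=> a; apply: lin_if; apply: (lin_comp (nx_linear _ _)); exact: app_linear.
Qed.
Lemma mapE_linear g : linear g -> linear (mapE g).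
Proof. by move=> gl; apply: ffun_lin => a; apply: (lin_comp gl); exact: app_linear. Qed.
Lemma singleE_linear a : linear (singleE a).
Proof. by apply: ffun_lin => a'; apply: lin_if; exact: lin_id. Qed.
Lemma rE_linear : linear rE.
Proof. by apply: ffun_lin => a; exact: pmulr_linear. Qed.
Lemma fE_linear m j b : linear (fE m j b).
Proof. by apply: ffun_lin => a; apply: lin_if; exact: FA_linear. Qed.
Lemma QE_linear : linear QE.
Proof.
apply: lin_bigsum => a _; apply: lin_scale.
exact: lin_comp (pmulr_linear _) (app_linear a).
Qed.

Lemma inE_intro m j u : (forall a, qtail a = j -> inN (m + stard a) (qhead a) (u a)) ->
  (forall a, qtail a != j -> u a = 0) -> isE m j u.
Proof.
move=> uN u0; apply/ffunP => a; rewrite ffunE; case: eqP => [/uN //|/eqP /u0 -> //].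
Qed.
Lemma inE_N m j u a : isE m j u -> qtail a = j -> inN (m + stard a) (qhead a) (u a).
Proof. by move=> uE aj; rewrite -uE ffunE aj eqxx /inN nx_idem. Qed.
Lemma inE_out m j u a : isE m j u -> qtail a != j -> u a = 0.
Proof. by move=> uE /negPf aj; rewrite -uE ffunE aj. Qed.
Lemma piE_idem m j u : isE m j (piE m j u).
Proof.
apply: inE_intro => a aj; rewrite ffunE; first by rewrite aj eqxx /inN nx_idem.
by rewrite (negPf aj).
Qed.

Lemma inE_lin m j c u u' : isE m j u -> isE m j u' -> isE m j (c *: u + u').
Proof. by move=> uE uE'; rewrite /isE piE_linear uE uE'. Qed.
Lemma inE0 m j : isE m j 0. Proof. exact: lin0 (piE_linear m j). Qed.
Lemma inEB m j u u' : isE m j u -> isE m j u' -> isE m j (u - u').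
Proof. by move=> uE uE'; rewrite /isE (linB (piE_linear m j)) uE uE'. Qed.
Lemma inED m j u u' : isE m j u -> isE m j u' -> isE m j (u + u').
Proof. by move=> uE uE'; rewrite /isE (linD (piE_linear m j)) uE uE'. Qed.
Lemma inE_sum m j I (s : seq I) (R : pred I) (F : I -> U) :
  (forall l : I, R l -> isE m j (F l)) -> isE m j (\sum_(l <- s | R l) F l).
Proof. by move=> FE; rewrite /isE (lin_sum (piE_linear m j)); apply: eq_bigr. Qed.
Lemma inE_map m j g u : linear g -> (forall n l x, inN n l x -> inN n l (g x)) ->
  isE m j u -> isE m j (mapE g u).
Proof.
move=> gl gN uE; apply: inE_intro => a aj; rewrite ffunE; first by apply: gN; exact: (inE_N uE aj).
by rewrite (inE_out uE aj) (lin0 gl).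
Qed.
Lemma inE_single m j a x : qtail a = j -> inN (m + stard a) (qhead a) x -> isE m j (singleE a x).
Proof.
move=> aj xN; apply: inE_intro => a' aj'; rewrite ffunE; last first.
  by case: eqP => // aa; rewrite aa aj eqxx in aj'.
by case: eqP => [->//|_]; exact: inN0.
Qed.
Lemma inE_r m j x : inN m j x -> isE m j (rE x).
Proof.
move=> xN; apply: inE_intro => a aj; rewrite ffunE; first exact: (inN_par a xN).
exact: (inN_par0 xN aj).
Qed.
Lemma inE_f m j b x : inN m j x -> isE m j (fE m j b x).
Proof.
move=> xN; apply: inE_intro => a aj; rewrite ffunE; last by rewrite (negPf aj).
by rewrite aj eqxx; apply: (cocycle_N (FA_cocycle Qacyc v m a)); rewrite aj.
Qed.
Lemma inE_pl m j b u : isE m j u -> isE m j (mapE (fun x => pl b * x) u).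
Proof. by apply: inE_map; [exact: pmull_linear|move=> *; exact: inN_pl]. Qed.
Lemma inN_Q m j u : isE m j u -> inN (m + 1) j (QE u).
Proof.
move=> uE; apply: inN_sum => a _; apply: inNZ.
have [aj|aj] := eqVneq (qtail a) j; last by rewrite (inE_out uE aj) mul0r; exact: inN0.
have := inN_par (star a) (inE_N uE aj); rewrite qhead_star aj -addrA stard_star.
by [].
Qed.

Lemma QE_r x : QE (rE x) = 0.
Proof.
transitivity (x * \sum_(a : A) sg k a *: (pa a * pa (star a))); last by rewrite rho0 mulr0.
by rewrite mulr_sumr; apply: eq_bigr => a _; rewrite ffunE -pZr mulrA.
Qed.
Lemma QE_map b u : QE (mapE (fun x => pl b * x) u) = pl b * QE u.
Proof. by rewrite mulr_sumr; apply: eq_bigr => a _; rewrite ffunE -pZr mulrA. Qed.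
Lemma QE_pe q u : QE (mapE (fun x => pe q * x) u) = pe q * QE u.
Proof. by rewrite mulr_sumr; apply: eq_bigr => a _; rewrite ffunE -pZr mulrA. Qed.
Lemma QE_vm u : QE (mapE vm u) = vm (QE u).
Proof.
rewrite [RHS](lin_sum (vm_linear v)); apply: eq_bigr => a _.
by rewrite ffunE (linZ (vm_linear v)) vmM.
Qed.
Lemma QE_single a x : QE (singleE a x) = sg k a *: (x * pa (star a)).
Proof.
rewrite /QE (bigD1 a) //= ffunE eqxx big1 ?addr0 // => a' /negPf aa.
by rewrite ffunE aa mul0r scaler0.
Qed.
Lemma mapE_single g a x : linear g -> mapE g (singleE a x) = singleE a (g x).
Proof. by move=> gl; apply/ffunP => a'; rewrite !ffunE; case: eqP => // _; exact: lin0. Qed.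
Lemma mapE_r g x : (forall y z, g (y * z) = g y * z) -> mapE g (rE x) = rE (g x).
Proof. by move=> gM; apply/ffunP => a; rewrite !ffunE gM. Qed.
Lemma mapE_rpl b x : mapE (fun x => pl b * x) (rE x) = rE (pl b * x).
Proof. by apply: (@mapE_r (fun x => pl b * x)) => y z; exact: mulrA. Qed.

Lemma fE_dl m j x : inN m j x ->
  \sum_b (mapE (fun x => pl b * x) (fE m j b x) - fE m j b (pl b * x)) = rE (vm x).
Proof.
move=> xN; apply/ffunP => a; rewrite sum_ffunE ffunE -vmM.
have [aj|aj] := eqVneq (qtail a) j; last first.
  rewrite (inN_par0 xN aj) (lin0 (vm_linear v)) big1 // => b _; rewrite !ffunE (negPf aj).
  by rewrite mulr0 subr0.
rewrite -(FA_dl Qacyc v (m := m)) ?aj //; apply: eq_bigr => b _; by rewrite !ffunE aj eqxx.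
Qed.

Lemma QE_ker m j u : isE m j u -> QE u = 0 -> exists x, inN m j x /\ u = rE x.
Proof.
move=> uE u0; have [|| c cE] := @mesh_right k Q (fun a => sg k (star a) *: u (star a)).
- move=> a; rewrite -pZl; congr (_ *: _).
  have [aj|aj] := eqVneq (qtail (star a)) j; last by rewrite (inE_out uE aj) mul0r.
  by rewrite -[qtail a]qhead_star; exact: (inN_pe (inE_N uE aj)).
- rewrite -[RHS]u0 /QE [RHS](reindex_inj (inv_inj (@starK Q))).
  by apply: eq_bigr => a _ /=; rewrite starK pZl.
have uc a : u a = c * pa a.
  have := cE (star a); rewrite !starK => /(congr1 (fun x => sg k a *: x)).
  by rewrite !scalerA sg_sqr !scale1r.
exists (nx m j c); split; first by rewrite /inN nx_idem.
apply/ffunP => a; rewrite ffunE; have [aj|aj] := eqVneq (qtail a) j; last first.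
  by rewrite (inE_out uE aj) /nx -mulrA pe_pa eq_sym (negPf aj) mulr0.
rewrite -(inE_N uE aj) uc /nx prs_par addrK -!mulrA pa_head.
by rewrite pe_pa aj eqxx.
Qed.

Lemma QE_surj m j y : 0 <= m -> inN (m + 1) j y -> exists u, isE m j u /\ QE u = y.
Proof.
move=> m0 yN; have [c [z zE]] := right_decomp y.
exists (piE m j [ffun a => sg k a *: z (star a)]); split; first exact: piE_idem.
rewrite -[RHS]yN zE (linD (nx_linear _ _)) !(lin_sum (nx_linear _ _)) big1 ?add0r => [|i _]; last first.
  rewrite (linZ (nx_linear _ _)) /nx [prs _ _]pr_pe /=; case: eqP => [|_]; first by lia.
  by rewrite mul0r scaler0.
rewrite /QE [RHS](reindex_inj (inv_inj (@starK Q))); apply: eq_bigr => a _ /=.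
rewrite !ffunE; have [aj|aj] := eqVneq (qtail a) j; last first.
  by rewrite mul0r scaler0 /nx prs_par -mulrA pa_pe qhead_star (negPf aj) mulr0.
rewrite (linZ (nx_linear _ _)) pZl scalerA sg_sqr scale1r /nx prs_par.
have -> : m + 1 - stard (star a) = m + stard a by have := stard_star a; lia.
by rewrite -!mulrA pa_pe pe_pa qhead_star qtail_star aj !eqxx.
Qed.

Lemma fdE_exists m j : exists F : fdim (piE m j), True.
Proof.
pose T : finType := {a : A & 'I_(fdn (fdN (m + stard a) (qhead a)))}.
pose bb (t : T) := if qtail (tag t) == j then singleE (tag t) (fdb (fdN _ _) (tagged t)) else 0.
have [||//|l|u|F _] := @basis_from_span k U (piE m j) setT #|T| (fun l => bb (enum_val l)).
- exact: piE_linear.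
- by move=> u; exact: piE_idem.
- rewrite /bb; case: eqP => [aj|_]; last exact: inE0.
  by apply: inE_single => //; exact: fdb_pi.
- exists (fun l => fdc (fdN _ _) (tagged (enum_val l)) (u (tag (enum_val l)))).
  transitivity (\sum_(t : T) fdc (fdN _ _) (tagged t) (u (tag t)) *: bb t); last first.
    by apply: reindex; exact: onW_bij (enum_val_bij _).
  rewrite -(sig_big_dep xpredT (fun _ _ => true)
    (fun a l => fdc (fdN (m + stard a) (qhead a)) l (u a) *:
       (if qtail a == j then singleE a (fdb (fdN _ _) l) else 0))).
  rewrite (eq_bigr (fun a => if qtail a == j then
      singleE a (nx (m + stard a) (qhead a) (u a)) else 0)); last first.
    move=> a _; case: eqP => _; last by rewrite big1 // => l _; rewrite scaler0.
    rewrite (fdpi (fdN (m + stard a) (qhead a))) (lin_sum (singleE_linear a)).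
    by apply: eq_bigr => l _; rewrite (linZ (singleE_linear a)).
  apply/ffunP => a; rewrite sum_ffunE (bigD1 a) //= [Y in _ + Y]big1 ?addr0.
    by rewrite ffunE; case: eqP => _; rewrite ffunE ?eqxx.
  by move=> a' /negPf aa; case: eqP => _; rewrite ffunE // eq_sym aa.
by exists F.
Qed.

Definition fdE m j : fdim (piE m j) := sval (cid (fdE_exists m j)).

Lemma E_split m j : 0 <= m -> ~ dead (m + 1) j -> exists (s : P -> U) (p : U -> P),
  [/\ linear s /\ linear p, forall y, inN (m + 1) j y -> QE (s y) = y,
      forall y, isE m j (s y),
      forall u, isE m j u -> u - s (QE u) = rE (p u) /\ inN m j (p u)
    & forall x, inN m j x -> p (rE x) = x].
Proof.
move=> m0 al.
have [||y yN|s [sl sP]] := @linear_selection k P (nx (m + 1) j) (fdN (m + 1) j) U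
  (fun y u => QE u = y /\ isE m j u).
- by split; [exact: lin0 QE_linear|exact: inE0].
- move=> c y y' u u' [yE uE] [yE' uE']; split; last exact: inE_lin.
  by rewrite QE_linear yE yE'.
- by have [u [uE yE]] := QE_surj m0 yN; exists u.
have sE y : inN (m + 1) j y -> QE (s y) = y by move=> yN; have [-> _] := sP y.
have [||u uE|p [pl pP]] := @linear_selection k U (piE m j) (fdE m j) P
  (fun u x => u - s (QE u) = rE x /\ inN m j x).
- split; last exact: inN0.
  by rewrite (lin0 QE_linear) (lin0 sl) (lin0 rE_linear) subr0.
- move=> c u u' x x' [rx xN] [rx' xN']; split; last by apply: inND => //; exact: inNZ.
  by rewrite QE_linear sl rE_linear -rx -rx' scalerBr opprD addrACA.
- have [||x [xN xE]] := @QE_ker m j (u - s (QE u)).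
  + by apply: inEB => //; have [] := sP (QE u).
  + by rewrite (linB QE_linear) sE ?subrr //; exact: inN_Q.
  by exists x.
have pE u : isE m j u -> u - s (QE u) = rE (p u) /\ inN m j (p u).
  by move=> uE; have := pP u; rewrite uE.
exists s, p; split=> // [y|x xN]; first by have [] := sP y.
have [] := pE _ (inE_r xN); rewrite QE_r (lin0 sl) subr0 => rp pN.
apply/eqP; rewrite eq_sym -subr_eq0; apply/eqP.
apply: (rkilled_alive Qacyc al); first exact: inNB.
by move=> a; have := congr1 (fun u : U => u a) rp; rewrite !ffunE mulrBl => ->; rewrite subrr.
Qed.

(** The coboundary of b |-> QE(f_b) is QE(rE(v x)) = 0, so [mesh_lift] factors this family through
    an endomorphism of N_(m,j), a scalar. *)
Lemma Qf_scalar m j : exists c, forall b x, inN m j x -> QE (fE m j b x) = c *: (ps b * x).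
Proof.
have [||||x xN|g [gl gN ge gb gs]] := @mesh_lift k Q Qacyc m j (m + 1) j (fun b x => QE (fE m j b x)).
- by move=> b; exact: lin_comp QE_linear (fE_linear _ _ _).
- by move=> b x xN; apply: inN_Q; exact: inE_f.
- move=> b x xN; rewrite -QE_pe; congr QE; apply/ffunP => a; rewrite !ffunE.
  case: eqP => [aj|_]; last exact: mulr0.
  by rewrite (cocycle_head (FA_cocycle Qacyc v m a)) ?aj.
- move=> b x xN; congr QE; apply/ffunP => a; rewrite !ffunE.
  case: eqP => [aj|//].
  by rewrite (cocycle_tail (FA_cocycle Qacyc v m a)) ?aj.
- apply/eqP; rewrite -subr_eq0 -sumrB; apply/eqP.
  transitivity (QE (rE (vm x))); last exact: QE_r.
  rewrite -(fE_dl xN) (lin_sum QE_linear); apply: eq_bigr => b _.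
  by rewrite (linB QE_linear) QE_map.
have [|c cE] := @Nend_scalar k Q Qacyc m j g.
  by split=> // x xN; have := gN x xN; rewrite addrK.
by exists c => b x xN; rewrite gs // cE // pZr.
Qed.

(** Besides v_i != 0, this is the only form in which regularity is used: the trace equals \sum_i v_i
    dim e_i N_(m,j) ([Nmod_chi]). *)
Hypothesis chi_reg : forall m j, ~ dead m j -> ftr (fdN m j) vm != 0.

Lemma dl_trace m j (F : arrow Q -> P -> P) : (forall b, linear (F b)) ->
  (forall b x, inN m j x -> inN m j (F b x)) -> ftr (fdN m j) (dl F) = 0.
Proof.
move=> Fl FN; rewrite ftr_sum big1 // => b _; rewrite ftr_sub.
rewrite (@ftr_cycle k P P _ _ (fdN m j) (fdN m j) (F b) (fun x => pl b * x)) ?subrr //.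
- exact: pmull_linear.
- by move=> x; exact: FN.
- by move=> x; exact: inN_pl.
Qed.

(** If c = 0, the maps f_b take values in the image of [rE], and composing with p gives a family on
    N_(m,j) whose coboundary is the weight. Coboundaries of such families have trace zero, against
    [chi_reg]. *)
Lemma Qf_neq0 m j c : 0 <= m -> ~ dead m j -> ~ dead (m + 1) j ->
  (forall b x, inN m j x -> QE (fE m j b x) = c *: (ps b * x)) -> c != 0.
Proof.
move=> m0 al al1 cE; apply/eqP => c0.
have [s [p [[sl pl'] sE sI pE pr]]] := E_split m0 al1.
have rp b x : inN m j x -> rE (p (fE m j b x)) = fE m j b x.
  move=> xN; have [] := pE _ (inE_f b xN); rewrite cE // c0 scale0r (lin0 sl) subr0.
  by move=> <-.
have pN b x : inN m j x -> inN m j (p (fE m j b x)).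
  by move=> xN; have [] := pE _ (inE_f b xN).
have := chi_reg al; rewrite (@ftr_eq _ _ _ _ _ (dl (fun b x => p (fE m j b x)))) => [|x xN].
  rewrite dl_trace ?eqxx // => b; exact: lin_comp pl' (fE_linear _ _ _).
apply/esym; rewrite -[RHS]pr; last exact: inN_vm.
rewrite -(fE_dl xN) (lin_sum pl'); apply: eq_bigr => b _; rewrite (linB pl'); congr (_ - _).
rewrite -[LHS]pr; last by apply: inN_pl; exact: pN.
by rewrite -mapE_rpl rp.
Qed.

(** If c = 0, there is a family [G] on E_x inducing, along [rE] and [QE], the families of a and of
    its reverse. Its coboundary [X1] has trace zero. Subtracting the weight on the component a gives
    [X], which maps E_x into the image of [rE] and kills that image, so it has trace zero too. Then
    the weight would have trace zero on N_(x.a). *)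
Lemma FA_const_neq0 m a c : 0 <= m -> ~ dead (m + 1) (qtail a) ->
  ~ dead (m + stard a) (qhead a) -> (forall b x, inN m (qtail a) x ->
    FA (m + stard a) (star a) b (x * pa a) - FA m a b x * pa (star a) = c *: (ps b * x)) ->
  c != 0.
Proof.
move=> m0 al al' cE; apply/eqP => c0; set j := qtail a in al cE.
have [s [p [[sl pl'] sE sI pE pr]]] := E_split m0 al.
pose kap (u : U) := singleE a (u a).
have kl : linear kap by exact: lin_comp (singleE_linear a) (app_linear a).
have kE u : isE m j u -> isE m j (kap u) by move=> uE; apply: inE_single => //; exact: (inE_N uE).
have C := FA_cocycle Qacyc v (m + stard a) (star a).
pose F b (u : U) := sg k a *: FA (m + stard a) (star a) b (u a).
have Fl b : linear (F b).
  by apply: lin_scale; exact: lin_comp (FA_linear _ _ _ _ _) (app_linear a).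
have uaN u : isE m j u -> inN (m + stard a) (qtail (star a)) (u a).
  by move=> uE; rewrite qtail_star; exact: (inE_N uE).
have FN b u : isE m j u -> inN (m + 1) j (F b u).
  move=> uE; apply: inNZ; have := cocycle_N C b (uaN u uE).
  by rewrite -addrA stard_star qhead_star.
have Fdl u : isE m j u ->
    \sum_b (pl b * F b u - F b (mapE (fun x => pl b * x) u)) = vm (QE (kap u)).
  move=> uE; rewrite QE_single (linZ (vm_linear v)) -(FA_dl Qacyc v (uaN u uE)) scaler_sumr.
  by apply: eq_bigr => b _; rewrite /F ffunE -pZr scalerBr.
pose f1 b (u : U) := kap (fE m j b (p u)).
have f1l b : linear (f1 b).
  by apply: (lin_comp kl); apply: (lin_comp (fE_linear _ _ _)).
have f1E b u : isE m j u -> isE m j (f1 b u).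
  by move=> uE; apply: kE; apply: inE_f; have [] := pE u uE.
(* [f1] is correct on the image of [rE]; the correction through the section s gives the right image
   under [QE], and c = 0 makes it vanish on the image of [rE]. *)
pose G b (u : U) := f1 b u + s (F b u - QE (f1 b u)).
have Gl b : linear (G b).
  apply: lin_add => //; apply: (lin_comp sl); apply: lin_sub => //.
  exact: lin_comp QE_linear (f1l b).
have GE b u : isE m j u -> isE m j (G b u) by move=> uE; apply: inED => //; exact: f1E.
have QG b u : isE m j u -> QE (G b u) = F b u.
  move=> uE; rewrite (linD QE_linear) sE ?subrKC //.
  by apply: inNB; [exact: FN|apply: inN_Q; exact: f1E].
have Gr b x : inN m j x -> G b (rE x) = kap (fE m j b x).
  move=> xN; rewrite /G /f1 pr // QE_single /F ffunE.
  have := cE b x xN; rewrite c0 scale0r => /eqP; rewrite subr_eq0 => /eqP ->.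
  by rewrite ffunE eqxx subrr (lin0 sl) addr0.
pose X1 u := \sum_b (mapE (fun x => pl b * x) (G b u) - G b (mapE (fun x => pl b * x) u)).
pose X u := X1 u - mapE vm (kap u).
have pll b : linear (mapE (fun x => pl b * x)) by apply: mapE_linear; exact: pmull_linear.
have vkl : linear (fun u => mapE vm (kap u)).
  by apply: (lin_comp (mapE_linear _)) => //; exact: vm_linear.
have X1l : linear X1.
  by apply: lin_bigsum => b _; apply: lin_sub; [exact: lin_comp (pll b) (Gl b)|exact: lin_comp (Gl b) (pll b)].
have Xl : linear X by apply: lin_sub.
have vkE u : isE m j u -> isE m j (mapE vm (kap u)).
  by move=> uE; apply: inE_map; [exact: vm_linear|exact: inN_vm|exact: kE].
have XE u : isE m j u -> isE m j (X u).
  move=> uE; apply: inEB; last exact: vkE.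
  apply: inE_sum => b _; apply: inEB; first by apply: inE_pl; exact: GE.
  by apply: GE; exact: inE_pl.
have QX u : isE m j u -> QE (X u) = 0.
  move=> uE; rewrite (linB QE_linear) QE_vm -Fdl // (lin_sum QE_linear).
  apply/eqP; rewrite subr_eq0; apply/eqP; apply: eq_bigr => b _.
  rewrite (linB QE_linear) QE_map !QG //; exact: inE_pl.
have Xr x : inN m j x -> X (rE x) = 0.
  move=> xN; apply/eqP; rewrite subr_eq0; apply/eqP.
  rewrite /kap ffunE mapE_single; last exact: vm_linear.
  rewrite -(FA_dl Qacyc v xN) (lin_sum (singleE_linear a)); apply: eq_bigr => b _.
  rewrite (linB (singleE_linear a)) Gr // mapE_rpl Gr; last exact: inN_pl.
  rewrite /kap mapE_single; last exact: pmull_linear.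
  by rewrite !ffunE eqxx.
(* [X] is [rE] after p X, and cyclicity turns its trace into that of p X [rE] = 0. *)
have trX : ftr (fdE m j) X = 0.
  rewrite (@ftr_eq _ _ _ _ _ (fun u => rE (p (X u)))) => [|u uE]; last first.
    by have [] := pE _ (XE u uE); rewrite QX // (lin0 sl) subr0.
  rewrite (@ftr_cycle k U P _ _ (fdE m j) (fdN m j) (fun u => p (X u)) rE).
  - rewrite (@ftr_eq _ _ _ _ _ (fun=> 0)) => [|x xN]; last by rewrite Xr // (lin0 pl').
    by rewrite /ftr big1 // => l _; exact: lin0 (fdc_linear l).
  - exact: lin_comp pl' Xl.
  - exact: rE_linear.
  - by move=> u uE; have [] := pE _ (XE u uE).
  - by move=> x; exact: inE_r.
have tr1 : ftr (fdE m j) X1 = 0.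
  rewrite ftr_sum big1 // => b _; rewrite ftr_sub.
  rewrite (@ftr_cycle k U U _ _ (fdE m j) (fdE m j) (G b) (mapE (fun x => pl b * x))) ?subrr //.
  - by move=> u; exact: GE.
  - by move=> u; exact: inE_pl.
have := chi_reg al'; move: trX; rewrite ftr_sub tr1 sub0r => /eqP; rewrite oppr_eq0 => /eqP.
rewrite (@ftr_eq _ _ _ _ _ (fun u => singleE a (vm (u a)))) => [|u uE]; last first.
  by rewrite /kap mapE_single //; exact: vm_linear.
rewrite (@ftr_cycle k U P _ _ (fdE m j) (fdN (m + stard a) (qhead a)) (fun u => vm (u a)) (singleE a)).
- rewrite (@ftr_eq _ _ _ _ _ vm) => [->|x xN]; first by rewrite eqxx.
  by rewrite ffunE eqxx.
- exact: lin_comp (vm_linear v) (app_linear a).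
- exact: singleE_linear.
- by move=> u uE; apply: inN_vm; exact: (inE_N uE).
- by move=> x; exact: inE_single.
Qed.

End Middle.

(** * The universal property of E_x *)

Section Universal.
Variables (k : fieldType) (Q : quiver) (Qacyc : quiver_acyclic Q).
Notation DQ := (double_quiver Q).
Notation V := (vert DQ).
Notation A := (arrow DQ).
Notation P := (ppa k Q).
Notation pe i := (@pe k Q i).
Notation pa a := (@pa k Q a).
Notation pl b := (pa (inl b)).
Notation ps b := (pa (inr b)).
Notation rk := (rk Qacyc).
Notation dead := (@dead k Q).
Notation fdN := (@fdN k Q Qacyc).
Implicit Types (a : A) (b : arrow Q) (i j q : V) (x y z : P) (m : int).
Variable v : V -> k.
Notation vm := (@vm k Q v).
Notation U := {ffun A -> P}.
Notation fE := (fE Qacyc v).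
Notation fdE := (@fdE k Q Qacyc).
Notation QE := (@QE k Q).
Notation rE := (@rE k Q).
Notation isE := (@isE k Q).
Implicit Types (u : U).

Hypothesis vnz : forall i : V, v i != 0.
Hypothesis chi_reg : forall m j, ~ dead m j -> ftr (fdN m j) vm != 0.

Definition lE (y : P) u : U := mapE (fun x => y * x) u.

Lemma lE_linear y : linear (lE y). Proof. by apply: mapE_linear; exact: pmull_linear. Qed.
Lemma lEM y z u : lE y (lE z u) = lE (y * z) u.
Proof. by apply/ffunP => a; rewrite !ffunE mulrA. Qed.
Lemma lE0 u : lE 0 u = 0.
Proof. by apply/ffunP => a; rewrite !ffunE mul0r. Qed.
Lemma lE_r y x : lE y (rE x) = rE (y * x).
Proof. by apply/ffunP => a; rewrite !ffunE mulrA. Qed.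
Lemma lE_dec u : u = \sum_(q : V) lE (pe q) u.
Proof.
apply/ffunP => a; rewrite sum_ffunE [LHS]pe_decl; apply: eq_bigr => q _.
by rewrite ffunE.
Qed.
Lemma inE_pe m j q u : isE m j u -> isE m j (lE (pe q) u).
Proof. by apply: inE_map; [exact: pmull_linear|move=> *; exact: inN_pel]. Qed.
Lemma fE_head m j b x : inN m j x -> lE (pe (qhead b)) (fE m j b x) = fE m j b x.
Proof.
move=> xN; apply/ffunP => a; rewrite !ffunE; case: eqP => [aj|_]; last exact: mulr0.
by rewrite (cocycle_head (FA_cocycle Qacyc v m a)) ?aj.
Qed.
Lemma fE_tail m j b x : inN m j x -> fE m j b x = fE m j b (pe (qtail b) * x).
Proof.
move=> xN; apply/ffunP => a; rewrite !ffunE; case: eqP => // aj.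
by rewrite (cocycle_tail (FA_cocycle Qacyc v m a)) ?aj.
Qed.
Lemma pe_fix q p x : pe q * x = x -> p != q -> pe p * x = 0.
Proof. by move=> <- /negPf pq; rewrite mulrA peM pq mul0r. Qed.
Lemma vm_fix q x : pe q * x = x -> vm x = v q *: x.
Proof. by move=> xq; rewrite -xq vm_pe. Qed.
Lemma lE_plE b u : lE (pe (qtail b)) (lE (pl b) u) = lE (pl b) u.
Proof. by rewrite lEM pe_pa /= eqxx. Qed.

(** If N_(m+1,j) = 0, both sides vanish and 1 is as good as any constant. *)
Lemma Qf_const m j : 0 <= m -> ~ dead m j ->
  exists c, c != 0 /\ forall b x, inN m j x -> QE (fE m j b x) = c *: (ps b * x).
Proof.
move=> m0 al; have [dd|al1] := EM (dead (m + 1) j); last first.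
  have [c cE] := Qf_scalar Qacyc v m j; exists c; split=> //.
  exact: (Qf_neq0 chi_reg m0 al al1 cE).
exists 1; split=> [|b x xN]; first exact: oner_neq0.
have -> : QE (fE m j b x) = 0 by apply: dd; apply: inN_Q; exact: inE_f.
have -> : ps b * x = 0 by apply: dd; exact: inN_ps.
by rewrite scaler0.
Qed.

(** The data for writing an element of e_q E_x by plain arrows applied to elements at vertices of
    higher rank and by values of the f_b ([dsumE]). *)
Definition dec m j q (uu : arrow Q -> U) (mm : arrow Q -> P) :=
  (forall b, isE m j (uu b) /\ lE (pe (qhead b)) (uu b) = uu b) /\
  (forall b, [/\ inN m j (mm b), pe (qtail b) * mm b = mm b & qhead b != q -> mm b = 0]).

Definition dsumE m j q (uu : arrow Q -> U) (mm : arrow Q -> P) : U :=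
  \sum_(b : arrow Q | qtail b == q) lE (pl b) (uu b) + \sum_b fE m j b (mm b).

Lemma r_dec m j q n : inN m j n -> pe q * n = n ->
  dec m j q (fun b => fE m j b n) (fun b => - (pl b * n)) /\
  rE (vm n) = dsumE m j q (fun b => fE m j b n) (fun b => - (pl b * n)).
Proof.
move=> nN nq; split.
  split=> b; first by split; [exact: inE_f|exact: fE_head].
  split=> [|| bq]; last by rewrite (pl_pe0 nq bq) oppr0.
    by rewrite -scaleN1r; apply/inNZ/inN_pl.
  by rewrite mulrN pe_pl.
rewrite -(fE_dl Qacyc v nN) sumrB /dsumE; congr (_ + _).
  rewrite [LHS](bigID (fun b => qtail b == q)) /= [Y in _ + Y]big1 ?addr0 // => b bq.
  rewrite fE_tail // (pe_fix nq bq) (lin0 (fE_linear _ _ _ _ _)).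
  exact: lin0 (lE_linear _).
by rewrite -sumrN; apply: eq_bigr => b _; rewrite (linN (fE_linear _ _ _ _ _)).
Qed.

Lemma dec_lin m j q c uu mm uu' mm' : dec m j q uu mm -> dec m j q uu' mm' ->
  dec m j q (fun b => c *: uu b + uu' b) (fun b => c *: mm b + mm' b) /\
  dsumE m j q (fun b => c *: uu b + uu' b) (fun b => c *: mm b + mm' b) =
  c *: dsumE m j q uu mm + dsumE m j q uu' mm'.
Proof.
move=> [uE mE] [uE' mE']; split; first split=> b.
- have [[u1 u2] [u1' u2']] := (uE b, uE' b); split; first exact: inE_lin.
  by rewrite lE_linear u2 u2'.
- have [[m1 m2 m3] [m1' m2' m3']] := (mE b, mE' b); split=> [||bq].
  + by apply: inND => //; exact: inNZ.
  + by rewrite mulrDr -pZr m2 m2'.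
  + by rewrite m3 // m3' // scaler0 addr0.
rewrite /dsumE scalerDr addrACA !scaler_sumr -!big_split.
by congr (_ + _); apply: eq_bigr => b _; rewrite ?lE_linear ?fE_linear.
Qed.

(** Write [QE u] by plain and starred arrows. Plain terms lift by [QE_surj]; starred ones are c^-1
    times QE(f_b). What remains is rE(n), and rE(n) = v_q^-1 rE(v n) decomposes by [r_dec]. *)
Lemma E_dec m j q u : 0 <= m -> ~ dead m j -> isE m j u -> lE (pe q) u = u ->
  exists uu mm, dec m j q uu mm /\ u = dsumE m j q uu mm.
Proof.
move=> m0 al uE uq; have [c [c0 cE]] := Qf_const m0 al.
have QN := inN_Q uE.
have [d [z zE]] := left_decomp (QE u).
have Qq : pe q * QE u = QE u by rewrite -QE_pe -/(lE _ _) uq.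
pose w a := nx (m + 1 - stard a) j (pe (qhead a) * z a).
have QuE : QE u = \sum_(a | qtail a == q) pa a * w a.
  rewrite -Qq -[X in _ * X]QN zE (linD (nx_linear _ _)) !(lin_sum (nx_linear _ _)) mulrDr big1 => [|i _]; last first.
    rewrite (linZ (nx_linear _ _)) /nx [prs _ _]pr_pe /=; case: eqP => [|_]; first by lia.
    by rewrite mul0r scaler0.
  rewrite mulr0 add0r mulr_sumr [RHS]big_mkcond; apply: eq_bigr => a _.
  rewrite nx_pal mulrA pe_pa eq_sym; case: eqP => _; last by rewrite mul0r.
  by rewrite /w nx_pel mulrA pa_pe eqxx.
have wN a : inN (m + 1 - stard a) j (w a) by rewrite /inN nx_idem.
have we a : pe (qhead a) * w a = w a by rewrite /w nx_pel mulrA pee.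
have /choice[u1 u1P] : forall b, exists u1, [/\ isE m j u1, lE (pe (qhead b)) u1 = u1
    & QE u1 = w (inl b)].
  move=> b; have wb : inN (m + 1) j (w (inl b)) by have := wN (inl b); rewrite subr0.
  have [u1 [u1E u1w]] := QE_surj m0 wb.
  exists (lE (pe (qhead b)) u1); split; first exact: inE_pe.
    by rewrite lEM pee.
  by rewrite QE_pe u1w; exact: (we (inl b)).
pose m1 b := if qhead b == q then c^-1 *: w (inr b) else 0.
have dec1 : dec m j q u1 m1.
  split=> b; first by have [] := u1P b.
  split; rewrite /m1; [|case: eqP => _; last exact: mulr0|by move/negPf ->].
    case: eqP => _; last exact: inN0.
    by apply: inNZ; have := wN (inr b); rewrite /stard /= addrK.
  by rewrite -pZr; congr (_ *: _); exact: (we (inr b)).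
have [|| n [nN nr]] := @QE_ker k Q m j (u - dsumE m j q u1 m1).
- apply: inEB => //; apply: inED; apply: inE_sum => b _.
    by apply: inE_pl; have [] := u1P b.
  by apply: inE_f; have [_ /(_ b)[]] := dec1.
- rewrite (linB (@QE_linear k Q)) (linD (@QE_linear k Q)) !(lin_sum (@QE_linear k Q)).
  apply/eqP; rewrite subr_eq0 QuE; apply/eqP.
  rewrite big_mkcond sum_arrows /= -!big_mkcond /=; congr (_ + _).
    by apply: eq_bigr => b _; rewrite QE_map; have [_ _ ->] := u1P b.
  rewrite big_mkcond; apply: eq_bigr => b _; rewrite cE; last by have [_ /(_ b)[]] := dec1.
  rewrite /m1; case: eqP => _; last by rewrite mulr0 scaler0.
  by rewrite -pZr scalerA divff // scale1r.
have nq : u - dsumE m j q u1 m1 = rE (pe q * n).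
  rewrite -lE_r -nr (linB (lE_linear _)) uq; congr (_ - _); rewrite (linD (lE_linear _)) !(lin_sum (lE_linear _)).
  congr (_ + _); apply: eq_bigr => b.
    by move/eqP <-; rewrite lE_plE.
  rewrite /m1; case: eqP => [<- _|_ _]; first by rewrite fE_head //; apply: inNZ; have := wN (inr b); rewrite /stard /= addrK.
  by rewrite !(lin0 (fE_linear _ _ _ _ _)) (lin0 (lE_linear _)).
have [dec2 E2] := r_dec (inN_pel q nN) (etrans (mulrA _ _ _) (congr1 (fun x => x * n) (pee k q))).
have [dec3 E3] := dec_lin (v q)^-1 dec2 dec1.
do 2!eexists; split; first exact: dec3.
have vE : (v q)^-1 *: rE (vm (pe q * n)) = rE (pe q * n).
  by rewrite vm_pe (linZ (@rE_linear k Q)) scalerA (mulVf (vnz q)) scale1r.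
rewrite E3 -E2 vE; apply/eqP; rewrite -subr_eq; apply/eqP; exact: nq.
Qed.

Lemma rank_ind (Pr : V -> Prop) :
  (forall q, (forall p, (rk q < rk p)%N -> Pr p) -> Pr q) -> forall q, Pr q.
Proof.
move=> IH q; have [n] := ubnP (\max_i rk i - rk q)%N.
elim: n q => // n IHn q qn; apply: IH => p qp; apply: IHn.
have : (rk p <= \max_i rk i)%N by exact: leq_bigmax.
by lia.
Qed.

Lemma E_gen m j (R : U -> Prop) : 0 <= m -> ~ dead m j -> R 0 ->
  (forall c u u', R u -> R u' -> R (c *: u + u')) ->
  (forall b x, inN m j x -> R (fE m j b x)) ->
  (forall b u, isE m j u -> R u -> R (lE (pl b) u)) -> forall u, isE m j u -> R u.
Proof.
move=> m0 al R0 Rl Rf Rb.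
have RD u u' : R u -> R u' -> R (u + u') by move=> Ru Ru'; rewrite -[u]scale1r; exact: Rl.
have Rs I (s : seq I) (T : pred I) (F : I -> U) : (forall l, T l -> R (F l)) -> R (\sum_(l <- s | T l) F l).
  by move=> RF; elim/big_ind: _.
suff H q u : isE m j u -> lE (pe q) u = u -> R u.
  move=> u uE; rewrite [u]lE_dec; apply: Rs => q _; apply: (H q); first exact: inE_pe.
  by rewrite lEM pee.
move: u; elim/rank_ind: q => q IH u uE uq.
have [uu [mm [[d1 d2] ->]]] := E_dec m0 al uE uq.
apply: RD; apply: Rs => b bq; last by apply: Rf; have [] := d2 b.
have [ub ue] := d1 b; apply: Rb => //; apply: (IH (qhead b)) => //.
by rewrite -(eqP bq) rk_lt.
Qed.

(** Apply [QE] to the relation: [mesh_left] produces n, which determines the [mm] and determines the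
    [uu] up to the image of [rE]. So the only ambiguity of a decomposition is that of [r_dec]
    together with elements coming through [rE]. *)
Lemma E_kernel m j q uu mm : 0 <= m -> ~ dead m j -> dec m j q uu mm ->
  dsumE m j q uu mm = 0 -> exists n nn, [/\ inN m j n, pe q * n = n,
    forall b, qtail b == q -> [/\ uu b = fE m j b n + rE (nn b), inN m j (nn b)
      & pe (qhead b) * nn b = nn b],
    forall b, mm b = - (pl b * n)
    & rE (vm n + \sum_(b : arrow Q | qtail b == q) pl b * nn b) = 0].
Proof.
move=> m0 al [d1 d2] s0; have [c [c0 cE]] := Qf_const m0 al.
pose z a := match a with inl b => if qtail b == q then QE (uu b) else 0 | inr b => c *: mm b end.
have [||n0 n0E] := @mesh_left k Q z.
- case=> b /=; last by rewrite -pZr; have [_ ->] := d2 b.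
  by case: eqP => _; rewrite ?mulr0 // -QE_pe -/(lE _ _); have [_ ->] := d1 b.
- rewrite sum_arrows /= -[RHS](lin0 (@QE_linear k Q)) -s0 (linD (@QE_linear k Q)).
  rewrite !(lin_sum (@QE_linear k Q)) [in RHS]big_mkcond; congr (_ + _); apply: eq_bigr => b _.
    by case: eqP => _; rewrite ?mulr0 ?QE_map.
  by rewrite cE ?pZr //; have [] := d2 b.
pose n := c^-1 *: (pe q * nx m j n0).
have nN : inN m j n by apply/inNZ/inN_pel; rewrite /inN nx_idem.
have nq : pe q * n = n by rewrite -pZr mulrA pee.
have mE b : mm b = - (pl b * n).
  have [mN mt mq] := d2 b; have [bq|bq] := eqVneq (qhead b) q; last first.
    by rewrite mq // (pl_pe0 nq bq) oppr0.
  have := n0E (inr b); rewrite /= scaleN1r => /(congr1 (fun x => c^-1 *: nx m j x)).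
  rewrite (linZ (nx_linear _ _)) mN scalerA mulVf // scale1r => ->.
  rewrite (linN (nx_linear _ _)) nx_pal subr0 scalerN; congr (- _).
  by rewrite /n -pZr mulrA pa_pe /= bq eqxx.
have QuE b : qtail b == q -> QE (uu b) = QE (fE m j b n).
  move=> bq; have [ub _] := d1 b; rewrite -[LHS](inN_Q ub) cE //.
  have := n0E (inl b); rewrite /= bq scale1r => ->.
  rewrite nx_pal addrK /n -pZr scalerA divff // scale1r.
  by rewrite mulrA pa_pe /= bq.
have /choice[nn nnP] : forall b, exists nb, qtail b == q ->
    [/\ uu b = fE m j b n + rE nb, inN m j nb & pe (qhead b) * nb = nb].
  move=> b; case: eqP => [/eqP bq|_]; last by exists 0.
  have [ub ue] := d1 b; have [||nb [nbN nbE]] := @QE_ker k Q m j (uu b - fE m j b n).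
  - by apply: inEB => //; exact: inE_f.
  - by rewrite (linB (@QE_linear k Q)) QuE // subrr.
  exists (pe (qhead b) * nb) => _; split; first 1 last.
  - exact: inN_pel.
  - by rewrite mulrA pee.
  by rewrite -lE_r -nbE (linB (lE_linear _)) ue fE_head // addrC subrK.
exists n, nn; split=> //; rewrite -s0 (linD (@rE_linear k Q)).
have [_ ->] := r_dec nN nq; rewrite /dsumE (lin_sum (@rE_linear k Q)) addrAC -big_split.
congr (_ + _); last by apply: eq_bigr => b _; rewrite mE.
by apply: eq_bigr => b bq; have [-> _ _] := nnP b bq; rewrite (linD (lE_linear _)) lE_r.
Qed.

Lemma fdEe_exists m j q : exists F : fdim (fun u => lE (pe q) (piE m j u)), True.
Proof.
have [|u|//|l|u|F _] := @basis_from_span k U (fun u => lE (pe q) (piE m j u)) setT _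
  (fun l => lE (pe q) (fdb (fdE m j) l)).
- exact: lin_comp (lE_linear _) (piE_linear _ _).
- rewrite (_ : piE m j (lE (pe q) (piE m j u)) = lE (pe q) (piE m j u)) ?lEM ?pee //.
  by apply: inE_pe; exact: piE_idem.
- by rewrite (_ : piE m j _ = lE (pe q) (fdb (fdE m j) l)) ?lEM ?pee //; apply: inE_pe; exact: fdb_pi.
- exists (fun l => fdc (fdE m j) l u); rewrite [in LHS](fdpi (fdE m j)).
  by rewrite (lin_sum (lE_linear _)); apply: eq_bigr => l _; rewrite (linZ (lE_linear _)).
by exists F.
Qed.

Section UP.
Variables (m : int) (j : V) (L : lmodType k) (Bl : arrow Q -> L -> L).
Variables (f' : arrow Q -> P -> L) (g' : P -> L).
Hypotheses (m0 : 0 <= m) (al : ~ dead m j).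
Hypotheses (Bll : forall b, linear (Bl b)) (fl : forall b, linear (f' b)) (gl : linear g').
Hypothesis ft : forall b x, inN m j x -> f' b x = f' b (pe (qtail b) * x).
Hypothesis gb : forall b x, inN m j x -> g' (pl b * x) = Bl b (g' x).
Hypothesis fg : forall x, inN m j x ->
  \sum_b (Bl b (f' b x) - f' b (pl b * x)) = g' (vm x).

(** The value at [u] forced by one decomposition of [u]. Other decompositions might force other
    values, so this is a relation; inside [universal_map] it turns out to be functional. *)
Definition UPrel q (phi : U -> L) u (y : L) := exists uu mm, [/\ dec m j q uu mm,
  u = dsumE m j q uu mm &
  y = \sum_(b : arrow Q | qtail b == q) Bl b (phi (uu b)) + \sum_b f' b (mm b)].

Lemma UPrel_lin q phi c u u' (y y' : L) : linear phi -> UPrel q phi u y -> UPrel q phi u' y' ->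
  UPrel q phi (c *: u + u') (c *: y + y').
Proof.
move=> pl' [uu [mm [d -> ->]]] [uu' [mm' [d' -> ->]]]; have [d2 E2] := dec_lin c d d'.
do 2!eexists; split; [exact: d2|by rewrite E2|].
rewrite scalerDr addrACA !scaler_sumr -!big_split.
by congr (_ + _); apply: eq_bigr => b _; rewrite ?pl' ?Bll ?fl.
Qed.

Lemma UPrel0 q phi : linear phi -> UPrel q phi 0 0.
Proof.
move=> pl'; exists (fun=> 0), (fun=> 0); split.
- split=> b; first by split; [exact: inE0|exact: lin0 (lE_linear _)].
  by split=> //; [exact: inN0|exact: mulr0].
- rewrite /dsumE !big1 ?addr0 // => b _; first exact: lin0 (fE_linear _ _ _ _ _).
  exact: lin0 (lE_linear _).
- rewrite !big1 ?addr0 // => b _; first exact: lin0 (fl b).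
  by rewrite (lin0 pl') (lin0 (Bll b)).
Qed.

(** [h] is first chosen from the top vertex downwards, without knowing that the forced values are
    unique. A second downward induction ([rec]) proves it: by [E_kernel], the value forced on 0 is
    g' of an element killed by [rE]. The required identities follow by comparing decompositions. *)
Lemma universal_map : (forall x, inN m j x -> rE x = 0 -> g' x = 0) ->
  exists h : U -> L, [/\ linear h, forall b x, inN m j x -> h (fE m j b x) = f' b x,
    forall b u, isE m j u -> lE (pe (qhead b)) u = u -> h (lE (pl b) u) = Bl b (h u)
    & forall x, inN m j x -> h (rE x) = g' x].
Proof.
move=> gr; pose pi q u := lE (pe q) (piE m j u).
have piE' q u : isE m j u -> lE (pe q) u = u -> pi q u = u by rewrite /pi => ->.
have piP q u : isE m j (pi q u) /\ lE (pe q) (pi q u) = pi q u.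
  by split; [apply: inE_pe; exact: piE_idem|rewrite lEM pee].
have piF q : fdim (pi q) by have [F _] := cid (fdEe_exists m j q).
(* The rank is reversed because a decomposition at [q] refers to the heads of the arrows leaving
   [q]. *)
pose rk' q := (\max_i rk i - rk q)%N.
have rkM q : (rk q <= \max_i rk i)%N by exact: leq_bigmax.
have [||||||q phi phil _ u uq|h [hl hC]] := @vertex_recursion k U L V rk' pi piF UPrel.
- move=> p q; rewrite /rk' => pq; apply: (rk_inj (Qacyc := Qacyc)); have := rkM p; have := rkM q; lia.
- by move=> q; exact: lin_comp (lE_linear _) (piE_linear _ _).
- move=> p q u; rewrite /pi; have -> : piE m j (pi q u) = pi q u by case: (piP q u).
  by rewrite lEM peM; case: eqP => [->|_]; [|exact: lE0].
- move=> q phi phi' u y pp uq [uu [mm [d uE yE]]]; exists uu, mm; split=> //.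
  rewrite yE; congr (_ + _); apply: eq_bigr => b /eqP bq; congr (Bl b _).
  have [d1 _] := d; have [ub ue] := d1 b.
  rewrite -(piE' (qhead b) (uu b)) //; apply: pp; rewrite /rk' -bq.
  by have := rk_lt Qacyc b; have := rkM (qhead b); lia.
- by move=> q phi phil; exact: UPrel0.
- by move=> q phi c u u' y y' phil; exact: UPrel_lin.
- have [uE uq'] : isE m j u /\ lE (pe q) u = u by rewrite -uq.
  by have [uu [mm [d uE']]] := E_dec m0 al uE uq'; eexists; exists uu, mm; split.
have hC' q u : isE m j u -> lE (pe q) u = u -> UPrel q h u (h u).
  by move=> uE uq; have := hC q u; rewrite piE'.
have rec q : [/\ forall b x, qhead b = q -> inN m j x -> pe (qtail b) * x = x -> h (fE m j b x) = f' b x,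
    forall b u, qtail b = q -> isE m j u -> lE (pe (qhead b)) u = u -> h (lE (pl b) u) = Bl b (h u)
    & forall x, inN m j x -> pe q * x = x -> h (rE x) = g' x].
  elim/rank_ind: q => q IH.
  have IH1 b x : qtail b == q -> inN m j x -> pe q * x = x -> h (fE m j b x) = f' b x.
    move=> /eqP bq xN xq; have [|H _ _] := IH (qhead b); first by rewrite -bq rk_lt.
    by apply: H => //; rewrite bq.
  have WD (y : L) : UPrel q h 0 y -> y = 0.
    move=> [uu [mm [d s0 ->]]]; have [n [nn [nN nq uuE mmE rn]]] := E_kernel m0 al d (esym s0).
    have nnN : inN m j (vm n + \sum_(b : arrow Q | qtail b == q) pl b * nn b).
      apply: inND; first exact: inN_vm.
      by apply: inN_sum => b bq; apply: inN_pl; have [] := uuE b bq.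
    rewrite -[RHS](gr _ nnN rn) (linD gl) -fg // (lin_sum gl) sumrB addrAC; congr (_ + _); last first.
      by rewrite -sumrN; apply: eq_bigr => b _; rewrite mmE (linN (fl b)).
    rewrite [in RHS](bigID (fun b => qtail b == q)) /= [Y in _ + Y + _]big1 ?addr0; last first.
      by move=> b bq; rewrite ft // (pe_fix nq bq) (lin0 (fl b)) (lin0 (Bll b)).
    rewrite -big_split; apply: eq_bigr => b bq; have [-> nbN nbe] := uuE b bq.
    have [|_ _ H3] := IH (qhead b); first by rewrite -(eqP bq) rk_lt.
    by rewrite (linD hl) IH1 // H3 // (linD (Bll b)) gb.
  have UU u (y y' : L) : UPrel q h u y -> UPrel q h u y' -> y = y'.
    move=> C1 C2; apply/eqP; rewrite eq_sym -subr_eq0; apply/eqP; apply: WD.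
    by rewrite -(subrr u) -![_ - _]addrC -!scaleN1r; exact: UPrel_lin.
  have H1 b x : qhead b = q -> inN m j x -> pe (qtail b) * x = x -> h (fE m j b x) = f' b x.
    move=> bq xN xt; apply: UU; first by apply: hC'; [exact: inE_f|rewrite -bq fE_head].
    exists (fun=> 0), (fun b' => if b' == b then x else 0); split.
    - split=> b'; first by split; [exact: inE0|exact: lin0 (lE_linear _)].
      case: eqP => [->|_]; first by split=> //; rewrite bq eqxx.
      by split=> //; [exact: inN0|exact: mulr0].
    - rewrite /dsumE big1 => [|b' _]; last exact: lin0 (lE_linear _).
      rewrite add0r (bigD1 b) //= eqxx big1 ?addr0 // => b' /negPf ->.
      exact: lin0 (fE_linear _ _ _ _ _).
    - rewrite big1 => [|b' _]; last by rewrite (lin0 hl) (lin0 (Bll b')).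
      rewrite add0r (bigD1 b) //= eqxx big1 ?addr0 // => b' /negPf ->.
      exact: lin0 (fl b').
  have H2 b u : qtail b = q -> isE m j u -> lE (pe (qhead b)) u = u -> h (lE (pl b) u) = Bl b (h u).
    move=> bq uE uh; apply: UU; first by apply: hC'; [exact: inE_pl|rewrite -bq lE_plE].
    exists (fun b' => if b' == b then u else 0), (fun=> 0); split.
    - split=> b'.
        case: eqP => [->//|_]; by split; [exact: inE0|exact: lin0 (lE_linear _)].
      by split=> //; [exact: inN0|exact: mulr0].
    - rewrite /dsumE [Y in _ + Y]big1 => [|b' _]; last exact: lin0 (fE_linear _ _ _ _ _).
      rewrite addr0 (bigD1 b) ?bq //= eqxx big1 ?addr0 // => b' /andP[_ /negPf ->].
      exact: lin0 (lE_linear _).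
    - rewrite [Y in _ + Y]big1 => [|b' _]; last exact: lin0 (fl b').
      rewrite addr0 (bigD1 b) ?bq //= eqxx big1 ?addr0 // => b' /andP[_ /negPf ->].
      by rewrite (lin0 hl) (lin0 (Bll b')).
  split=> // n nN nq.
  have : h (rE (vm n)) = g' (vm n).
    have [d E] := r_dec nN nq; apply: UU.
      by apply: hC'; [apply/inE_r/inN_vm|rewrite lE_r pe_vm nq (vm_fix nq)].
    do 2!eexists; split; [exact: d|exact: E|].
    rewrite -fg // sumrB; congr (_ + _); last first.
      by rewrite -sumrN; apply: eq_bigr => b _; rewrite (linN (fl b)).
    rewrite [LHS](bigID (fun b => qtail b == q)) /= [Y in _ + Y]big1 ?addr0; last first.
      by move=> b bq; rewrite ft // (pe_fix nq bq) (lin0 (fl b)) (lin0 (Bll b)).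
    by apply: eq_bigr => b bq; rewrite IH1.
  (* At the vertex [q] the weight is the nonzero scalar v_q and can be cancelled. *)
  rewrite (vm_fix nq) (linZ (@rE_linear k Q)) (linZ hl) (linZ gl).
  by apply: scalerI.
exists h; split=> // [b x xN|b u|x xN].
- rewrite fE_tail // ft //; have [H _ _] := rec (qhead b); apply: H => //; first exact: inN_pel.
  by rewrite mulrA pee.
- by have [_ H _] := rec (qtail b); exact: H.
rewrite [x]pe_decl (lin_sum (@rE_linear k Q)) (lin_sum hl) (lin_sum gl).
apply: eq_bigr => q _; have [_ _ H] := rec q; apply: H; first exact: inN_pel.
by rewrite mulrA pee.
Qed.

(* The case where N_(m+1,j) = 0: subtract from f' the image under g' of a cocycle of N_(m,j) whose
   coboundary differs from the weight only by a rank one map onto the socle. *)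
Lemma rkilled_dies : forall x, inN m j x -> rE x = 0 -> g' x = 0.
Proof.
have kx x : rE x = 0 -> rkilled x.
  by move=> rx a; have := congr1 (fun u : U => u a) rx; rewrite !ffunE.
have [dd|al1] := EM (dead (m + 1) j); last first.
  by move=> x xN /kx rx; rewrite (@rkilled_alive k Q Qacyc m j x al1 xN rx) (lin0 gl).
have [i [z0 [z0N z0i z0b z0E]]] := @rkilled_line k Q Qacyc m j.
suff g0 : g' z0 = 0.
  by move=> x xN /kx rx; have [c ->] := z0E x xN rx; rewrite (linZ gl) g0 scaler0.
have [->|nz] := eqVneq z0 0; first exact: lin0 gl.
have [ze0 [ze0l ze01]] := fd_functional (fdN m j) z0N nz.
pose ze x := ze0 (pe i * x).
have zel : linear (ze : P -> k^o) by exact: lin_comp ze0l (pel_linear i).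
have ze1 : ze z0 = 1 by rewrite /ze z0i.
pose X := ftr (fdN m j) vm.
have X0 : X != 0 by exact: chi_reg.
(* [X] times a rank one map of trace 1 is subtracted, so [w] has trace zero; as endomorphisms are
   scalars, this is all that [cocycle_solve] asks for. *)
pose w x := vm x - (X * ze x) *: z0.
have wl : linear w.
  apply: lin_sub; first exact: vm_linear.
  by apply: lin_scalel; exact: (@lin_scale k P k^o ze X zel).
have [x xN|q x xN|h hH|F'' [F''C F''E]] := @cocycle_solve k Q Qacyc m j m j w wl.
- by apply: inNB; [exact: inN_vm|exact: inNZ].
- rewrite /w vm_pe mulrBr pe_vm -pZr; congr (_ - _).
  rewrite /ze mulrA peM; have [<-|iq] := eqVneq i q; first by rewrite z0i.
  by rewrite mul0r (lin0 ze0l) mulr0 scale0r (pe_fix z0i) ?scaler0 // eq_sym.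
- have [c hc] := Nend_scalar Qacyc hH.
  rewrite (@ftr_eq _ _ _ _ _ (fun x => c *: w x)) => [|x xN]; last first.
    by apply: hc; apply: inNB; [exact: inN_vm|exact: inNZ].
  rewrite ftr_scale ftr_sub -/X; suff -> : ftr (fdN m j) (fun x => (X * ze x) *: z0) = X.
    by rewrite subrr mulr0.
  rewrite /ftr -[RHS]mulr1 -ze1 -{2}z0N (fdpi (fdN m j)) (lin_sum zel) mulr_sumr.
  apply: eq_bigr => l _; rewrite fdcZ (linZ zel) /=.
  by rewrite -mulrA; congr (_ * _); exact: mulrC.
have [F''l F''N F''h F''t] := F''C.
pose f3 b x := f' b x - g' (F'' b x).
have f3l b : linear (f3 b) by apply: lin_sub => //; exact: lin_comp gl (F''l b).
have f3t b x : inN m j x -> f3 b x = f3 b (pe (qtail b) * x) by move=> xN; rewrite /f3 ft // F''t.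
have f3E x : inN m j x -> \sum_b (Bl b (f3 b x) - f3 b (pl b * x)) = (X * ze x) *: g' z0.
  move=> xN; transitivity (g' (vm x) - g' (dl F'' x)).
    rewrite -fg // (lin_sum gl) -sumrB; apply: eq_bigr => b _.
    have H (W : zmodType) (p1 p2 p3 p4 : W) : p1 - p2 - (p3 - p4) = p1 - p3 - (p2 - p4).
      by rewrite !opprD !opprK addrACA.
    by rewrite /f3 (linB (Bll b)) (linB gl) gb; [exact: H|exact: F''N].
  by rewrite F''E // /w (linB gl) (linZ gl) opprB addrC subrK.
(* Downward induction: by injectivity ([dead_div]) there is n at [q] whose product with b is the
   tail component of x and which the other plain arrows kill; since [ze] vanishes at n, the equation
   [f3E] at n reduces to f3_b(x) = 0. *)
have f30 q b x : (rk i < rk q)%N -> qhead b = q -> inN m j x -> f3 b x = 0.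
  move: b x; elim/rank_ind: q => q IH b x iq bq xN.
  rewrite f3t //; pose y b' := if b' == b then pe (qtail b) * x else 0.
  have [|n [nN nq nE]] := @dead_div k Q m j dd q y.
    move=> b' _; rewrite /y; case: eqP => [->|_]; last by split; [exact: inN0|exact: mulr0].
    by split; [exact: inN_pel|rewrite mulrA pee].
  have := f3E n nN; rewrite /ze (pe_fix nq); last by apply: contraTneq iq => ->; rewrite ltnn.
  rewrite (lin0 ze0l) mulr0 scale0r sumrB big1 => [|b' _]; last first.
    have [bq'|bq'] := eqVneq (qtail b') q; last first.
      by rewrite f3t // (pe_fix nq bq') (lin0 (f3l _)) (lin0 (Bll _)).
    have lt : (rk q < rk (qhead b'))%N by rewrite -bq' rk_lt.
    by rewrite (IH (qhead b')) ?(lin0 (Bll b')) //; exact: ltn_trans lt.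
  rewrite sub0r => /eqP; rewrite oppr_eq0 (bigD1 b) //= big1 ?addr0.
    by rewrite nE // /y eqxx => /eqP.
  move=> b' /negPf bb; have [bq'|bq'] := eqVneq (qhead b') q.
    by rewrite nE // /y bb (lin0 (f3l _)).
  by rewrite (pl_pe0 nq bq') (lin0 (f3l _)).
(* At [z0] the left side vanishes, as plain arrows kill [z0] and [f3] is zero above its vertex; X
   g'(z0) = 0 remains. *)
have := f3E z0 z0N; rewrite ze1 mulr1 big1 => [/esym/eqP|b _].
  by rewrite scaler_eq0 (negPf X0) => /eqP.
rewrite z0b (lin0 (f3l b)) subr0; have [bi|bi] := eqVneq (qtail b) i; last first.
  by rewrite f3t // (pe_fix z0i bi) (lin0 (f3l _)) (lin0 (Bll _)).
by rewrite (f30 (qhead b)) ?(lin0 (Bll b)) // -bi rk_lt.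
Qed.

End UP.

End Universal.

(** * The quiver Heisenberg algebra *)

Section Heisenberg.
Variables (k : fieldType) (Q : quiver) (Qacyc : quiver_acyclic Q).
Notation DQ := (double_quiver Q).
Notation V := (vert DQ).
Notation A := (arrow DQ).
Notation P := (ppa k Q).
Notation pe i := (@pe k Q i).
Notation pa a := (@pa k Q a).
Notation pl b := (pa (inl b)).
Notation ps b := (pa (inr b)).
Notation dead := (@dead k Q).
Notation fdN := (@fdN k Q Qacyc).
Implicit Types (a : A) (b : arrow Q) (i j q : V) (x y z : P) (m : int).
Variable v : vert Q -> k.
Notation FA := (FA Qacyc v).
Notation vm := (@vm k Q v).
Notation B := (pathalg k DQ).
Notation E i := (path_idem k (i : V)).
Notation X a := (path_arrow k (a : A)).

HB.instance Definition _ := GRing.Lmodule.copy (@qHeis k Q v) (ringquot (range (@eta k Q v))).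
Notation La := (@qHeis k Q v).

Definition hq (f : B) : La := quot_map (range (@eta k Q v)) f.
Definition he i : La := hq (E i).
Definition ha a : La := hq (X a).
Definition hrho : La := hq (@wrho k Q v).

Lemma hq_linear : linear hq. Proof. exact: quot_map_linear. Qed.
Lemma hqM f g : hq (f * g) = hq f * hq g. Proof. exact: rmorphM. Qed.
Lemma hq1 : hq 1 = 1. Proof. exact: rmorph1. Qed.
Lemma hq_surj (x : La) : exists f, hq f = x. Proof. exact: quot_map_surj. Qed.
Lemma hZl c (x y : La) : c *: (x * y) = (c *: x) * y. Proof. exact: quot_scaleAl. Qed.
Lemma hZr c (x y : La) : c *: (x * y) = x * (c *: y). Proof. exact: quot_scaleAr. Qed.
Lemma hmulr_linear (y : La) : linear (fun x : La => x * y : La).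
Proof. exact: quot_mulr_linear. Qed.
Lemma hmull_linear (x : La) : linear (fun y : La => x * y : La).
Proof. exact: quot_mull_linear. Qed.
Lemma heM i j : he i * he j = if i == j then he i else 0.
Proof. by rewrite /he -hqM idemM; case: eqP => // _; exact: lin0 hq_linear. Qed.
Lemma he_ha i a : he i * ha a = if i == qtail a then ha a else 0.
Proof. by rewrite /he -hqM idem_arrow; case: eqP => // _; exact: lin0 hq_linear. Qed.
Lemma ha_he i a : ha a * he i = if qhead a == i then ha a else 0.
Proof. by rewrite /he -hqM arrow_idem; case: eqP => // _; exact: lin0 hq_linear. Qed.

Lemma ha_rho a : ha a * hrho = hrho * ha a.
Proof.
apply/eqP; rewrite -subr_eq0 -!hqM -(linB hq_linear); apply/eqP.
by apply/quot_map_eq0; apply: ideal_gen_mem; exists a.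
Qed.

Definition brho : B := \sum_(b : arrow Q) (X (inl b) * X (inr b) - X (inr b) * X (inl b)).

Lemma idem_brho i : E i * brho = @rho k Q i.
Proof.
rewrite mulr_sumr /rho; under eq_bigr do rewrite mulrBr !mulrA !idem_arrow /=.
rewrite sumrB [in RHS]big_mkcond [Y in _ = _ - Y]big_mkcond.
by congr (_ - _); apply: eq_bigr => b _; rewrite eq_sym; case: eqP; rewrite ?mul0r.
Qed.

Lemma brho_idem i : brho * E i = E i * brho.
Proof.
rewrite mulr_sumr mulr_suml; apply: eq_bigr => b _.
rewrite mulrBr mulrBl !mulrA !idem_arrow -!mulrA !arrow_idem /=.
by rewrite ![i == _]eq_sym; do 2!case: eqP => _; rewrite ?mulr0 ?mul0r.
Qed.

Lemma wrhoE : (@wrho k Q v) = \sum_i (v i)^-1 *: (E i * brho).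
Proof. by apply: eq_bigr => i _; rewrite idem_brho. Qed.

Lemma idem_wrho i : E i * (@wrho k Q v) = (v i)^-1 *: (E i * brho).
Proof.
rewrite wrhoE mulr_sumr (bigD1 i) //= -scalerAr mulrA idemM eqxx big1 ?addr0 // => l li.
by rewrite -scalerAr mulrA idemM eq_sym (negPf li) mul0r scaler0.
Qed.

Lemma wrho_idem i : (@wrho k Q v) * E i = E i * (@wrho k Q v).
Proof.
rewrite idem_wrho wrhoE mulr_suml (bigD1 i) //= -scalerAl -mulrA brho_idem mulrA idemM eqxx.
rewrite big1 ?addr0 // => l /negPf li.
by rewrite -scalerAl -mulrA brho_idem mulrA idemM li mul0r scaler0.
Qed.

Lemma he_rho i : he i * hrho = hrho * he i.
Proof. by rewrite -!hqM wrho_idem. Qed.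

Hypothesis vnz : forall i : V, v i != 0.

Lemma brhoE : brho = \sum_i v i *: (E i * (@wrho k Q v)).
Proof.
rewrite -[LHS]mul1r -idem_sum mulr_suml; apply: eq_bigr => i _.
by rewrite idem_wrho scalerA mulfV // scale1r.
Qed.

Lemma rho_sum (y : La) :
  \sum_(b : arrow Q) (ha (inl b) * (ha (inr b) * y) - ha (inr b) * (ha (inl b) * y)) =
  \sum_i v i *: (he i * (hrho * y)).
Proof.
transitivity (hq brho * y).
  rewrite (lin_sum hq_linear) mulr_suml; apply: eq_bigr => b _.
  by rewrite (linB hq_linear) !hqM mulrBl !mulrA.
rewrite brhoE (lin_sum hq_linear) mulr_suml; apply: eq_bigr => i _.
by rewrite (linZ hq_linear) hqM -hZl mulrA.
Qed.

Hypothesis chi_reg : forall m j, ~ dead m j -> ftr (fdN m j) vm != 0.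

Definition cA m a : k := sval (cid (FA_commute Qacyc v m (esym (qtail_star a)))).
Lemma cAE m a b x : inN m (qtail a) x ->
  FA (m + stard a) (star a) b (x * pa a) - FA m a b x * pa (star a) = cA m a *: (ps b * x).
Proof.
by have [_ H] := svalP (cid (FA_commute Qacyc v m (esym (qtail_star a)))); exact: H.
Qed.
(** [cA] is known to be nonzero only next to nonzero modules; where it vanishes, 1 stands in so that
    the recursion of [mu] can divide. *)
Definition cA' m a : k := if cA m a == 0 then 1 else cA m a.
Lemma cA'_neq0 m a : cA' m a != 0.
Proof. by rewrite /cA'; case: ifP => [_|/negbT //]; exact: oner_neq0. Qed.

(** For fixed b, the step (a, m) |-> ([star a], m + [stard a]) runs through (b, 0), (b^*, 0), (b,
    1), (b^*, 1) and so on. [t] numbers this chain, and [mu] solves the equation [lamE] along it. *)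
Definition chain b (t : nat) : A := if odd t then inr b else inl b.
Fixpoint mu b (t : nat) : k :=
  if t is t'.+1 then sg k (chain b t') / (cA' (t'./2)%:Z (chain b t') * mu b t') else 1.
Definition lam a m : k :=
  match a with inl b => mu b (`|m|%N.*2) | inr b => mu b (`|m|%N.*2.+1) end.

Lemma mu_neq0 b t : mu b t != 0.
Proof.
elim: t => [|t IH] /=; first exact: oner_neq0.
by rewrite mulf_neq0 ?sg_neq0 // invr_neq0 // mulf_neq0 ?cA'_neq0.
Qed.
Lemma lam_neq0 a m : lam a m != 0. Proof. by case: a => b; exact: mu_neq0. Qed.

Lemma muS b t : mu b t.+1 * (mu b t * cA' (t./2)%:Z (chain b t)) = sg k (chain b t).
Proof.
rewrite /= [mu b t * _]mulrC mulfVK //.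
by rewrite mulf_neq0 ?mu_neq0 ?cA'_neq0.
Qed.

Lemma lamE m a : 0 <= m -> lam (star a) (m + stard a) * (lam a m * cA' m a) = sg k a.
Proof.
case: m => // n _; case: a => b.
  have := muS b n.*2; rewrite /chain odd_double doubleK => <-.
  by rewrite addr0.
have E1 : chain b n.*2.+1 = inr b by rewrite /chain /= odd_double.
have E2 : n.*2.+1./2 = n by rewrite /= uphalf_double.
have := muS b n.*2.+1; rewrite E1 E2 => <-.
suff -> : lam (star (inr b)) (n%:Z + stard (inr b : A)) = mu b n.*2.+2 by [].
by rewrite (_ : n%:Z + stard (inr b : A) = n.+1%:Z) // /stard /=; lia.
Qed.

Lemma alive_ge0 m j : ~ dead m j -> 0 <= m.
Proof. by move=> al; rewrite leNgt; apply/negP => m0; apply: al => x; exact: inN_neg. Qed.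

Lemma lam_cA m a : ~ dead (m + 1) (qtail a) -> ~ dead (m + stard a) (qhead a) -> 0 <= m ->
  lam (star a) (m + stard a) * (lam a m * cA m a) = sg k a.
Proof.
move=> al al' m0; rewrite -(lamE a m0) /cA'; case: eqP => // c0.
have := FA_const_neq0 chi_reg m0 al al' (fun b x => @cAE m a b x).
by rewrite c0 eqxx.
Qed.

Notation Z := (int -> V -> (P -> k) -> P).
Implicit Types (ze : Z) (om : P -> k).
Notation lin om := (linear (om : P -> k^o)).

Definition opl (y : P) ze : Z := fun m j om => y * ze m j om.
(** On tensors: n tensor w |-> \sum_a lam F^a_b(n) tensor w a, right multiplication on the second
    factor becoming precomposition of the form. The idempotents make the path relations hold on all
    of [Z], not only on [good] functions. *)
Definition ops b ze : Z := fun m j om => pe (qhead b) *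
  \sum_(a : A | qhead a == j) lam a (m - stard a) *:
    FA (m - stard a) a b (pe (qtail b) *
      ze (m - stard a) (qtail a) (fun w => om (w * pa a))).
Definition op a : Z -> Z := match a with inl b => opl (pl b) | inr b => ops b end.

Lemma ZDE ze ze' m j om : (ze + ze' : Z) m j om = ze m j om + ze' m j om.
Proof. by []. Qed.
Lemma ZZE c ze m j om : (c *: ze : Z) m j om = c *: ze m j om.
Proof. by []. Qed.
Lemma Zext ze ze' : (forall m j om, ze m j om = ze' m j om) -> ze = ze'.
Proof. by move=> H; do 3!apply: funext => ?. Qed.
Lemma opl_linear y : linear (opl y).
Proof. by move=> c ze ze'; apply: Zext => m j om; exact: pmull_linear. Qed.
Lemma ops_linear b : linear (ops b).
Proof.
move=> c ze ze'; apply: Zext => m j om.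
have H : linear (fun z : {ffun A -> P} => pe (qhead b) *
    \sum_(a : A | qhead a == j) lam a (m - stard a) *: FA (m - stard a) a b (pe (qtail b) * z a)).
  apply: (lin_comp (pel_linear _)); apply: lin_bigsum => a _; apply: lin_scale.
  apply: (lin_comp (FA_linear _ _ _ _ _)); apply: (lin_comp (pel_linear _)).
  exact: app_linear.
pose F (zz : Z) : {ffun A -> P} := [ffun a : A => zz (m - stard a) (qtail a) (fun w => om (w * pa a))].
have FE (zz : Z) : ops b zz m j om = pe (qhead b) * \sum_(a : A | qhead a == j) lam a (m - stard a) *:
    FA (m - stard a) a b (pe (qtail b) * F zz a).
  by congr (_ * _); apply: eq_bigr => a _; rewrite ffunE.
rewrite -[RHS]/(c *: ops b ze m j om + ops b ze' m j om) !FE -H; congr (_ * _).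
by apply: eq_bigr => a _; rewrite !ffunE.
Qed.
Lemma op_linear a : linear (op a).
Proof. by case: a => b; [exact: opl_linear|exact: ops_linear]. Qed.

Definition opE i : endo Z := mk_endo (opl_linear (pe i)).
Definition opX a : endo Z := mk_endo (op_linear a).
Definition act : B -> endo Z := path_ext (@endo_comp k Z) opE opX.

Lemma act_linear : linear act. Proof. exact: path_ext_linear. Qed.
Lemma act_ev_linear ze m j om : linear (fun f => act f ze m j om).
Proof. by move=> c f g; rewrite act_linear endoDE endoZE ZDE ZZE. Qed.
Lemma act_idem i : act (E i) = opE i. Proof. exact: path_ext_idem. Qed.
Lemma act_arrow a : act (X a) = opX a. Proof. exact: path_ext_arrow. Qed.
Lemma actM f g : act (f * g) = endo_comp (act f) (act g).
Proof.
apply: path_extM.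
- exact: endo_comp_linl.
- exact: endo_comp_linr.
- exact: endo_compA.
- move=> i j; apply: endo_ext => z /=; apply: Zext => m l om; rewrite /opl mulrA peM.
  by case: eqP => // _; exact: mul0r.
- move=> i [b|b]; apply: endo_ext => z /=; apply: Zext => m l om; rewrite /opl /ops mulrA.
    by rewrite pe_pa; case: eqP => // _; exact: mul0r.
  by rewrite peM; case: eqP => [->//|_]; exact: mul0r.
move=> i [b|b]; apply: endo_ext => z /=; apply: Zext => m l om; rewrite /opl /ops.
  by rewrite mulrA pa_pe; case: eqP => // _; exact: mul0r.
case: eqP => [<-|bi].
  by congr (_ * _); apply: eq_bigr => a _; rewrite mulrA pee.
rewrite big1 ?mulr0 // => a _; rewrite mulrA peM; case: eqP => // _.
by rewrite mul0r (lin0 (FA_linear _ _ _ _ _)) scaler0.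
Qed.

(** Singles out the functions that behave like families of tensors in N_x tensor N_x. The operators
    preserve them, and the Heisenberg relations are verified only on them. *)
Record good ze : Prop := MkGood {
  good_N : forall m j om, inN m j (ze m j om);
  good_lin : forall m j c om om', lin om -> lin om' ->
    ze m j (fun w => c * om w + om' w) = c *: ze m j om + ze m j om';
  good_loc : forall m j om om', lin om -> lin om' ->
    (forall w, inN m j w -> om w = om' w) -> ze m j om = ze m j om' }.

Lemma good_opl y ze : (forall m j x, inN m j x -> inN m j (y * x)) -> good ze -> good (opl y ze).
Proof.
move=> yN [zN zl zloc]; split=> [m j om|m j c om om' ol ol'|m j om om' ol ol' oo].
- exact: yN.
- by rewrite /opl zl // mulrDr pZr.
- by rewrite /opl (zloc m j om om').
Qed.

Lemma om_par a om : lin om -> lin (fun w => om (w * pa a)).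
Proof. by move=> ol; exact: lin_comp ol (par_linear a). Qed.

Lemma ops_good b ze m j om : good ze -> ops b ze m j om =
  \sum_(a : A | qhead a == j) lam a (m - stard a) *:
    FA (m - stard a) a b (ze (m - stard a) (qtail a) (fun w => om (w * pa a))).
Proof.
move=> [zN _ _]; rewrite /ops mulr_sumr; apply: eq_bigr => a _.
have C := FA_cocycle Qacyc v (m - stard a) a.
have aN := zN (m - stard a) (qtail a) (fun w => om (w * pa a)).
by rewrite -pZr -(cocycle_tail C) // (cocycle_head C).
Qed.

Lemma good_ops b ze : good ze -> good (ops b ze).
Proof.
move=> gz; have [zN zl zloc] := gz; split=> [m j om|m j c om om' ol ol'|m j om om' ol ol' oo].
- rewrite ops_good //; apply: inN_sum => a /eqP <-; apply: inNZ.
  by have := cocycle_N (FA_cocycle Qacyc v (m - stard a) a) b (zN _ _ (fun w => om (w * pa a)));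
  rewrite subrK.
- rewrite !ops_good // scaler_sumr -big_split; apply: eq_bigr => a _ /=.
  by rewrite zl ?(FA_linear Qacyc v) ?scalerDr ?scalerA ?[c * _]mulrC //; exact: om_par.
- rewrite !ops_good //; apply: eq_bigr => a /eqP aj; congr (_ *: FA _ _ _ _).
  apply: zloc; [exact: om_par|exact: om_par|move=> w wN; apply: oo].
  by have := inN_par a wN; rewrite subrK aj.
Qed.

Lemma good_op a ze : good ze -> good (op a ze).
Proof.
case: a => b; last exact: good_ops.
by apply: good_opl => m j x; exact: inN_pl.
Qed.

Lemma good0 : good (fun _ _ _ => 0).
Proof. by split=> [m j om|m j c om om' _ _|//]; [exact: inN0|rewrite scaler0 addr0]. Qed.

Lemma goodD c ze ze' : good ze -> good ze' -> good (c *: ze + ze').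
Proof.
move=> [zN zl zloc] [zN' zl' zloc']; split=> [m j om|m j d om om' ol ol'|m j om om' ol ol' oo].
- by apply: inND; [apply: inNZ; exact: zN|exact: zN'].
- rewrite -[LHS]/(c *: ze m j _ + ze' m j _) -[RHS]/(d *: (c *: ze m j om + ze' m j om) + (c *: ze m j om' + ze' m j om')).
  by rewrite zl // zl' // !scalerDr !scalerA [c * d]mulrC addrACA.
- rewrite -[LHS]/(c *: ze m j om + ze' m j om) -[RHS]/(c *: ze m j om' + ze' m j om').
  by rewrite (zloc m j om om') // (zloc' m j om om').
Qed.

Lemma good_act f ze : good ze -> good (act f ze).
Proof.
move=> gz; elim/pathalg_indl: f => [|f g gf gg|c f gf|i|a f gf].
- by rewrite (lin0 act_linear); exact: good0.
- by rewrite (linD act_linear) endoDE -[act f ze]scale1r; exact: goodD.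
- by rewrite (linZ act_linear) endoZE -[c *: _]addr0; apply: goodD => //; exact: good0.
- by rewrite act_idem /=; apply: good_opl => // m j x; exact: inN_pel.
- by rewrite actM act_arrow /=; exact: good_op.
Qed.

(** The action of the weighted relation ([act_wrho]), which moves both tensor factors by the same
    arrow. *)
Definition rop ze : Z := fun m j om => \sum_(a : A | qhead a == j) lam a (m - stard a) *:
  (ze (m - stard a) (qtail a) (fun w => om (w * pa a)) * pa a).

(** Commuting plain with starred operators applies [dl] to the F^a, which [FA_dl] turns into the
    weight times right multiplication by a. *)
Lemma act_brho ze m j om : good ze -> act brho ze m j om = vm (rop ze m j om).
Proof.
move=> gz; have -> : act brho ze m j om =
    \sum_b (pl b * ops b ze m j om - ops b (opl (pl b) ze) m j om).
  rewrite (lin_sum (act_ev_linear ze m j om)); apply: eq_bigr => b _.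
  by rewrite (linB (act_ev_linear ze m j om)) !actM !act_arrow.
rewrite (lin_sum (vm_linear v)).
transitivity (\sum_b \sum_(a : A | qhead a == j) lam a (m - stard a) *:
   (pl b * FA (m - stard a) a b (ze (m - stard a) (qtail a) (fun w => om (w * pa a)))
   - FA (m - stard a) a b (pl b * ze (m - stard a) (qtail a) (fun w => om (w * pa a))))).
  apply: eq_bigr => b _; rewrite !ops_good //; last exact: (@good_op (inl b)).
  rewrite mulr_sumr -sumrB; apply: eq_bigr => a _; by rewrite -pZr scalerBr.
rewrite exchange_big; apply: eq_bigr => a _; rewrite -scaler_sumr (linZ (vm_linear v)).
by congr (_ *: _); apply: (FA_dl Qacyc v); exact: good_N.
Qed.

Lemma act_wrho ze m j om : good ze -> act (@wrho k Q v) ze m j om = rop ze m j om.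
Proof.
move=> gz; rewrite wrhoE (lin_sum (act_ev_linear ze m j om)) [RHS]pe_decl.
apply: eq_bigr => i _; rewrite (linZ (act_ev_linear ze m j om)) actM act_idem.
rewrite -[endo_comp _ _ _ _ _ _]/(pe i * act brho ze m j om) act_brho // pe_vm scalerA mulVf //.
by rewrite scale1r.
Qed.

Lemma good_rop ze : good ze -> good (rop ze).
Proof.
move=> gz; have -> : rop ze = act (@wrho k Q v) ze by apply: Zext => m j om; rewrite act_wrho.
exact: good_act.
Qed.

(** Over pairs of consecutive arrows the difference consists of the commutators of [FA_commute].
    Only an arrow followed by its reverse contributes, with a constant that [lam_cA] turns into a
    sign, and the signed sum is the preprojective relation inside [om]. *)
Lemma ops_rop b ze m j om : good ze -> lin om -> ops b (rop ze) m j om = rop (ops b ze) m j om.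
Proof.
move=> gz ol; apply/eqP; rewrite -subr_eq0; apply/eqP; have [zN zl zloc] := gz.
rewrite ops_good; last exact: good_rop.
rewrite /rop -sumrB.
pose n a := ze (m - 1) j (fun w => om (w * pa a * pa (star a))).
transitivity (\sum_(a : A | qtail a == j)
   (lam (star a) (m - 1 + stard a) * (lam a (m - 1) * cA (m - 1) a)) *: (ps b * n a)); last first.
  have [m1|m1] := ltP (m - 1) 0.
    by apply: big1 => a _; rewrite /n (inN_neg m1 (zN _ _ _)) mulr0 scaler0.
  (* [lam_cA] requires nonzero neighbours; in the remaining cases the terms vanish by themselves. *)
  have [dd|al] := EM (dead m j).
    apply: big1 => a _; rewrite (_ : ps b * n a = 0) ?scaler0 //; apply: dd.
    by have := inN_ps b (zN (m - 1) j (fun w => om (w * pa a * pa (star a)))); rewrite subrK.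
  have z0 : ze (m - 1) j (fun=> 0) = 0.
    have := zl (m - 1) j (-1) (fun=> 0) (fun=> 0) (@lin_zero k P k^o) (@lin_zero k P k^o).
    rewrite scaleN1r addNr => <-; apply: zloc; [exact: (@lin_zero k P k^o)| |].
      by move=> c x y /=; rewrite mulr0 addr0 scaler0 addr0.
    by move=> w _; rewrite mulr0 addr0.
  transitivity (ps b * \sum_(a : A | qtail a == j) sg k a *: n a).
    rewrite mulr_sumr; apply: eq_bigr => a /eqP aj; rewrite -pZr.
    have [dd|al'] := EM (dead (m - 1 + stard a) (qhead a)); last first.
      by rewrite lam_cA // aj subrK.
    suff -> : n a = 0 by rewrite mulr0 !scaler0.
    rewrite -z0; apply: zloc; [|exact: (@lin_zero k P k^o)|].
      exact: (om_par a (om_par (star a) ol)).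
    move=> w wN; rewrite (_ : w * pa a = 0) ?mul0r ?(lin0 ol) //; apply: dd.
    exact: (inN_par a wN).
  suff -> : \sum_(a : A | qtail a == j) sg k a *: n a = 0 by rewrite mulr0.
  have H (s : seq A) : \sum_(a <- s | qtail a == j) sg k a *: n a =
      ze (m - 1) j (fun w => \sum_(a <- s | qtail a == j) sg k a * om (w * pa a * pa (star a))).
    elim: s => [|a s IH].
      by rewrite big_nil -z0; congr (ze _ _ _); apply: funext => w; rewrite big_nil.
    have -> : (fun w => \sum_(a0 <- a :: s | qtail a0 == j) sg k a0 * om (w * pa a0 * pa (star a0))) =
       if qtail a == j then (fun w => sg k a * om (w * pa a * pa (star a)) +
          \sum_(a <- s | qtail a == j) sg k a * om (w * pa a * pa (star a)))
       else (fun w => \sum_(a <- s | qtail a == j) sg k a * om (w * pa a * pa (star a))).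
      by apply: funext => w; rewrite big_cons; case: ifP.
    rewrite big_cons IH; case: ifP => // _; rewrite zl //.
      exact: (om_par a (om_par (star a) ol)).
    by apply: (@lin_bigsum k P k^o) => a' _; apply: (@lin_scale k P k^o); exact: (om_par a' (om_par (star a') ol)).
  rewrite H -z0; apply: zloc.
  - by apply: (@lin_bigsum k P k^o) => a' _; apply: (@lin_scale k P k^o); exact: (om_par a' (om_par (star a') ol)).
  - exact: (@lin_zero k P k^o).
  move=> w wN; transitivity (om (w * \sum_(a : A) sg k a *: (pa a * pa (star a)))).
    rewrite mulr_sumr (lin_sum ol) big_mkcond; apply: eq_bigr => a _.
    rewrite -pZr (linZ ol) mulrA; case: eqP => // /eqP aj.
    by rewrite (inN_par0 wN aj) mul0r (lin0 ol) scaler0.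
  by rewrite rho0 mulr0 (lin0 ol).
transitivity (\sum_(a' : A | qhead a' == j) \sum_(a : A | qhead a == qtail a')
   (lam a' (m - stard a') * lam a (m - stard a' - stard a)) *:
   (FA (m - stard a') a' b
      (ze (m - stard a' - stard a) (qtail a) (fun w => om (w * pa a * pa a')) * pa a) -
    FA (m - stard a' - stard a) a b
      (ze (m - stard a' - stard a) (qtail a) (fun w => om (w * pa a * pa a'))) * pa a')).
  apply: eq_bigr => a' _; rewrite ops_good // -scalerBr (lin_sum (FA_linear Qacyc v _ _ _)).
  rewrite mulr_suml -sumrB scaler_sumr; apply: eq_bigr => a _.
  by rewrite (linZ (FA_linear Qacyc v _ _ _)) -pZl -scalerBr scalerA.
rewrite (reindex_inj (inv_inj (@starK Q))).
apply: eq_big => [a|a aj]; first by rewrite qhead_star.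
rewrite (bigD1 a); last by rewrite qtail_star.
have mE : m - stard (star a) = m - 1 + stard a by have := stard_star a; lia.
have nE : m - 1 + stard a - stard a = m - 1 by rewrite addrK.
have tE : qtail a = j by apply/eqP; rewrite -qhead_star.
rewrite mE nE cAE; last exact: zN.
rewrite scalerA -mulrA tE big1 => [|a1 /andP[/eqP aa na]]; first exact: addr0.
have [c [c0 cE]] := FA_commute Qacyc v (m - 1 + stard a - stard a1) aa.
have := cE b _ (zN (m - 1 + stard a - stard a1) (qtail a1) (fun w => om (w * pa a1 * pa (star a)))).
rewrite subrK => ->; rewrite c0 ?scale0r ?scaler0 //.
by apply: contraNneq na => /(congr1 (@star Q)); rewrite !starK => ->.
Qed.

(** The element 1 tensor 1, that is \sum_j e_j tensor e_j. *)
Definition ze0 : Z := fun m j om => if m == 0 then om (pe j) *: pe j else 0.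

Lemma good_ze0 : good ze0.
Proof.
split=> [m j om|m j c om om' ol ol'|m j om om' ol ol' oo]; rewrite /ze0; case: eqP => [m0|_] //.
- by rewrite m0; apply: inNZ; exact: inN_pej.
- exact: inN0.
- by rewrite scalerDl scalerA.
- by rewrite scaler0 addr0.
- by rewrite oo // m0; exact: inN_pej.
Qed.

(* [phi u] represents the element u (1 tensor 1) of the direct sum of the N_x tensor N_x, a tensor
   n tensor w being seen as the map sending a linear form om to om(w) n. *)
Lemma phi_exists : exists phi : La -> Z, [/\ linear phi,
  forall m j om, lin om -> phi 1 m j om = ze0 m j om,
  forall a u m j om, lin om -> phi (ha a * u) m j om = op a (phi u) m j om,
  forall i u m j om, lin om -> phi (he i * u) m j om = pe i * phi u m j om
  & forall u, good (phi u)].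
Proof.
pose J : set B := [set f | forall ze m j om, good ze -> lin om -> act f ze m j om = 0]%classic.
have op_loc a ze ze' : good ze -> good ze' -> (forall m j om, lin om -> ze m j om = ze' m j om) ->
    forall m j om, lin om -> op a ze m j om = op a ze' m j om.
  move=> gz gz' zz m j om ol; case: a => b /=; first by rewrite /opl zz.
  rewrite !ops_good //; apply: eq_bigr => a _; rewrite zz //; exact: om_par.
have act_loc f ze ze' : good ze -> good ze' -> (forall m j om, lin om -> ze m j om = ze' m j om) ->
    forall m j om, lin om -> act f ze m j om = act f ze' m j om.
  move=> gz gz' zz; elim/pathalg_indl: f => [|f g Hf Hg|c f Hf|i|a f Hf] m j om ol.
  - by rewrite !(lin0 act_linear).
  - by rewrite !(linD act_linear) !endoDE !ZDE Hf ?Hg.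
  - by rewrite !(linZ act_linear) !endoZE !ZZE Hf.
  - by rewrite act_idem /= /opl zz.
  - by rewrite actM act_arrow /=; apply: op_loc => //; exact: good_act.
have JI : two_sided_ideal J.
  split=> [|f g Jf Jg|f g h Jg] ze m j om gz ol.
  - by rewrite (lin0 act_linear).
  - by rewrite (linB (act_ev_linear ze m j om)) Jf ?Jg ?subrr.
  - rewrite !actM /=; have gh := good_act h gz.
    rewrite (act_loc f (act g (act h ze)) (fun _ _ _ => 0)) //.
    + exact: (congr1 (fun z : Z => z m j om) (lin0 (endo_linear (act f)))).
    + exact: good_act.
    + exact: good0.
    + by move=> m' j' om' ol'; apply: Jg.
have Jeta : (range (@eta k Q v) `<=` J)%classic.
  move=> _ [a _ <-] ze m j om gz ol; rewrite /eta (linB (act_ev_linear ze m j om)) !actM act_arrow.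
  rewrite -[LHS]/(op a (act (@wrho k Q v) ze) m j om - act (@wrho k Q v) (op a ze) m j om).
  have -> : act (@wrho k Q v) ze = rop ze by apply: Zext => m' j' om'; rewrite act_wrho.
  rewrite act_wrho; last exact: good_op.
  case: a => b /=; last by rewrite ops_rop ?subrr.
  rewrite /opl /rop mulr_sumr; apply/eqP; rewrite subr_eq0; apply/eqP.
  by apply: eq_bigr => a _; rewrite -pZr mulrA.
(* The relations hold at linear forms only, so other values are discarded before descending to the
   quotient. *)
pose clip (z : Z) : Z := fun m j om => if `[< lin om >] then z m j om else 0.
have clipl : linear clip.
  move=> c z z'; apply: Zext => m j om.
  rewrite -[RHS]/(c *: clip z m j om + clip z' m j om) /clip.
  by case: ifP => // _; rewrite scaler0 addr0.
have f0l : linear (fun f : B => clip (act f ze0)).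
  by move=> c f g; rewrite act_linear endoDE endoZE; exact: clipl.
have [f /(ideal_gen_sub JI Jeta) Jf|phi [phil phiE]] := @quot_lift k B (range (@eta k Q v)) Z _ f0l.
  apply: Zext => m j om; rewrite /clip; case: ifP => // /asboolP ol.
  exact: Jf good_ze0 ol.
have phiE' f m j om : lin om -> phi (hq f) m j om = act f ze0 m j om.
  by move=> ol; rewrite phiE /clip; case: ifP => // /asboolP.
have gphi f : good (phi (hq f)).
  have [zN zl zloc] := good_act f good_ze0.
  rewrite phiE; split=> [m j om|m j c om om' ol ol'|m j om om' ol ol' oo]; rewrite /clip.
  - by case: ifP => _; [exact: zN|exact: inN0].
  - rewrite !asboolT //; first exact: zl.
    by apply: (@lin_add k P k^o) => //; exact: (@lin_scale k P k^o).
  - by rewrite !asboolT //; exact: zloc.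
exists phi; split=> // [m j om ol|a u m j om ol|i u m j om ol|u].
- rewrite -hq1 phiE' // -idem_sum (lin_sum (act_ev_linear ze0 m j om)) [RHS]pe_decl.
  by apply: eq_bigr => i _; rewrite act_idem.
- have [f <-] := hq_surj u; rewrite /ha -hqM phiE' // actM act_arrow /=.
  apply: op_loc => //; first exact: good_act good_ze0.
  by move=> m' j' om' ol'; rewrite phiE'.
- have [f <-] := hq_surj u; rewrite /he -hqM phiE' // actM act_idem /=.
  by rewrite phiE'.
by have [f <-] := hq_surj u.
Qed.

End Heisenberg.

(** * The maps psi_l, constructed by length *)

Section Levels.
Variables (k : fieldType) (Q : quiver) (Qacyc : quiver_acyclic Q).
Notation DQ := (double_quiver Q).
Notation V := (vert DQ).
Notation A := (arrow DQ).
Notation P := (ppa k Q).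
Notation pe i := (@pe k Q i).
Notation pa a := (@pa k Q a).
Notation pl b := (pa (inl b)).
Notation ps b := (pa (inr b)).
Notation dead := (@dead k Q).
Notation fdN := (@fdN k Q Qacyc).
Implicit Types (a : A) (b : arrow Q) (i j q : V) (x y z : P) (m : int).
Variable v : vert Q -> k.
Notation FA := (FA Qacyc v).
Notation vm := (@vm k Q v).
Notation B := (pathalg k DQ).
Notation La := (@qHeis k Q v).
Notation he i := (@he k Q v i).
Notation ha a := (@ha k Q v a).
Notation hrho := (@hrho k Q v).
Notation lam := (@lam k Q Qacyc v).
Notation U := {ffun A -> P}.
Notation fE := (fE Qacyc v).
Notation rE := (@rE k Q).
Notation isE := (@isE k Q).
Notation lE := (@lE k Q).
Notation singleE := (@singleE k Q).
Notation lin om := (linear (om : P -> k^o)).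
Implicit Types (u : U) (om : P -> k) (l : int).
Hypothesis vnz : forall i : V, v i != 0.
Hypothesis chi_reg : forall m j, ~ dead m j -> ftr (fdN m j) vm != 0.

(** The composite Pi -> kQ -> Heisenberg algebra whose first map kills starred arrows; every term of
    [trho] has a starred factor. *)
Fact inc_exists : exists d : P -> La, [/\ linear d, forall b, d (pl b) = ha (inl b),
  forall i, d (pe i) = he i & forall x y, d (x * y) = d x * d y].
Proof.
pose xa (a : A) : La := if a is inl b then ha (inl b) else 0.
pose mul (x y : La) : La := x * y.
pose d0 := path_ext mul (fun i => he i) xa.
have dM (x y : B) : d0 (x * y) = d0 x * d0 y.
  apply: path_extM; rewrite /mul.
  - by move=> z; exact: hmulr_linear.
  - by move=> z; exact: hmull_linear.
  - exact: mulrA.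
  - exact: heM.
  - by move=> i [b|b]; rewrite /xa ?he_ha // mulr0; case: ifP.
  - by move=> i [b|b]; rewrite /xa ?ha_he // mul0r; case: ifP.
have dl : linear d0 by exact: path_ext_linear.
have d0rho : d0 (trho k Q) = 0.
  rewrite (lin_sum dl) big1 // => a _; rewrite (linZ dl) dM /d0 !path_ext_arrow.
  by case: a => b; rewrite /xa ?mulr0 ?mul0r scaler0.
have [x /(@ideal_gen_sub _ _ _ [set x | d0 x = 0]%classic) dJ|d [dlin dE]] :=
  @quot_lift _ _ [set trho k Q]%classic _ _ dl.
  apply: dJ; last by move=> _ ->.
  split; first by rewrite /= lin0.
    by move=> y z /= y0 z0; rewrite (linB dl) y0 z0 subrr.
  by move=> y z t /= z0; rewrite !dM z0 mulr0 mul0r.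
exists d; split=> //.
- by move=> b; rewrite dE /d0 path_ext_arrow.
- by move=> i; rewrite dE /d0 path_ext_idem.
move=> x y; have [f <-] := pq_surj x; have [g <-] := pq_surj y.
by rewrite -pqM !dE dM.
Qed.

Definition phi : La -> int -> V -> (P -> k) -> P := sval (cid (phi_exists vnz chi_reg)).
Lemma phiP : [/\ linear phi,
  forall m j om, lin om -> phi 1 m j om = ze0 m j om,
  forall a (x : La) m j om, lin om -> phi (ha a * x) m j om = op Qacyc v a (phi x) m j om,
  forall i (x : La) m j om, lin om -> phi (he i * x) m j om = pe i * phi x m j om
  & forall x : La, good (phi x)].
Proof. by rewrite /phi; case: cid. Qed.

Lemma phi_linear m j om : linear (fun x : La => phi x m j om).
Proof. by have [pl' _ _ _ _] := phiP; move=> c x y; rewrite pl'. Qed.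

Definition prl l := @pr k Q (fun d => dlen d == l).
Lemma prl_linear l : linear (prl l). Proof. exact: pr_linear. Qed.
Lemma prl_par l a x : prl l (x * pa a) = prl (l - 1) x * pa a.
Proof.
rewrite /prl pr_par; congr (_ * _); apply: pr_ext => d; rewrite /= dlenD dlen_darr.
by rewrite eq_sym [RHS]eq_sym subr_eq.
Qed.
Lemma prl_pel l i x : prl l (pe i * x) = pe i * prl l x. Proof. exact: pr_pel. Qed.
Lemma prl_nx l m j x : prl l (nx m j x) = nx m j (prl l x).
Proof.
rewrite /nx /prl pr_per /prs !pr_pr; congr (_ * _).
by apply: pr_ext => d; rewrite andbC.
Qed.
Lemma prl_prl l x : prl l (prl l x) = prl l x.
Proof. by rewrite /prl pr_pr; apply: pr_ext => d; rewrite andbb. Qed.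
Lemma prl_neg l x : l < 0 -> prl l x = 0.
Proof.
move=> l0; apply: pr_none => p; rewrite dlen_dpath; apply: contraTneq l0 => <-.
by rewrite -leNgt.
Qed.
Lemma nx_par m j a x : nx m j (x * pa a) =
  if qhead a == j then nx (m - stard a) (qtail a) x * pa a else 0.
Proof.
rewrite /nx prs_par -!mulrA pa_pe; case: eqP => _; last by rewrite mulr0.
by rewrite pe_pa eqxx.
Qed.

Definition W l m j w := inN m j w /\ prl l w = w.

Lemma W_lin l m j c w w' : W l m j w -> W l m j w' -> W l m j (c *: w + w').
Proof.
move=> [wN wl] [wN' wl']; split; first by apply: inND => //; exact: inNZ.
by rewrite prl_linear wl wl'.
Qed.
Lemma W0 l m j : W l m j 0.
Proof. by split; [exact: inN0|exact: lin0 (prl_linear l)]. Qed.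
Lemma W_par l m j a w : W (l - 1) m j w -> W l (m + stard a) (qhead a) (w * pa a).
Proof. by move=> [wN wl]; split; [exact: (inN_par a wN)|rewrite prl_par wl]. Qed.
Lemma W_pe l m j q w : W l m j w -> W l m j (pe q * w).
Proof. by move=> [wN wl]; split; [exact: inN_pel|rewrite prl_pel wl]. Qed.
Lemma W_proj l m j x : W l m j (nx m j (prl l x)).
Proof. by split; [rewrite /inN nx_idem|rewrite prl_nx prl_prl]. Qed.
Lemma W_fix l m j w : W l m j w -> nx m j (prl l w) = w.
Proof. by move=> [wN ->]. Qed.

Notation Psi := (int -> V -> P -> P -> La).
Implicit Types psi : Psi.

(** The key field is [lv_phi]: under [phi], the element psi(w, n) becomes n tensor w. The other
    fields express linearity in both arguments and compatibility with right idempotents. *)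
Record level l psi : Prop := MkLevel {
  lv_lin : forall m j c w w' n, W l m j w -> W l m j w' -> inN m j n ->
    psi m j (c *: w + w') n = c *: psi m j w n + psi m j w' n;
  lv_linear : forall m j w, linear (psi m j w);
  lv_pl : forall m j w n b, W l m j w -> inN m j n ->
    psi m j w (pl b * n) = ha (inl b) * psi m j w n;
  lv_pe : forall m j w n q, W l m j w -> inN m j n ->
    psi m j w (pe q * n) = he q * psi m j w n;
  lv_er : forall m j w n q, W l m j w -> inN m j n ->
    psi m j w n * he q = psi m j (pe q * w) n;
  lv_phi : forall m j w n m' j' om, W l m j w -> inN m j n -> lin om ->
    phi (psi m j w n) m' j' om = if (m' == m) && (j' == j) then om w *: n else 0 }.

Lemma lv0 l psi m j n : level l psi -> inN m j n -> psi m j 0 n = 0.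
Proof.
move=> L nN; have := lv_lin L 1 (W0 l m j) (W0 l m j) nN.
rewrite scaler0 addr0 scale1r -[X in X = _]addr0 => /addrI; exact: esym.
Qed.

(** The map E_x -> algebra induced by psi(w, -). Its component a will be lam psi'(w a, -), with psi'
    the next level. The last field normalises it where N_x = 0, since [E_gen] gives uniqueness only
    for nonzero N_x. *)
Record hmap m j psi w (h : U -> La) : Prop := MkHmap {
  hm_lin : linear h;
  hm_f : forall b n, inN m j n -> h (fE m j b n) = ha (inr b) * psi m j w n;
  hm_pl : forall b u, isE m j u -> h (lE (pl b) u) = ha (inl b) * h u;
  hm_pe : forall q u, isE m j u -> h (lE (pe q) u) = he q * h u;
  hm_r : forall n, inN m j n -> h (rE n) = hrho * psi m j w n;
  hm_dead : dead m j -> forall u, h u = 0 }.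

Lemma E_map_eq (L : lmodType k) (Bl : arrow Q -> L -> L) m j (g1 g2 : U -> L) : ~ dead m j ->
  linear g1 -> linear g2 -> (forall b n, inN m j n -> g1 (fE m j b n) = g2 (fE m j b n)) ->
  (forall b u, isE m j u -> g1 (lE (pl b) u) = Bl b (g1 u)) ->
  (forall b u, isE m j u -> g2 (lE (pl b) u) = Bl b (g2 u)) ->
  forall u, isE m j u -> g1 u = g2 u.
Proof.
move=> al l1 l2 gf g1b g2b; have m0 := alive_ge0 al.
apply: (E_gen vnz chi_reg (R := fun u => g1 u = g2 u) m0 al).
- by rewrite (lin0 l1) (lin0 l2).
- by move=> c u u' e e'; rewrite l1 l2 e e'.
- by move=> b n nN; exact: gf.
- by move=> b u uE e; rewrite g1b // g2b // e.
Qed.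

Lemma he_rhoA i (y : La) : he i * (hrho * y) = hrho * (he i * y).
Proof. by rewrite !mulrA he_rho. Qed.

(** This is [universal_map] for f'_b = b^* psi(w, -) and g' = rho psi(w, -). Its hypothesis on f'
    and g' is the identity between \sum_b (b b^* - b^* b) and the weight times rho. *)
Lemma hmap_exists l psi m j w : level l psi -> W l m j w -> exists h, hmap m j psi w h.
Proof.
move=> L wW; have [pN pl' pb pq' per pphi] := L.
have [dd|al] := EM (dead m j).
  exists (fun=> 0); split=> //.
  - exact: lin_zero.
  - by move=> b n /dd ->; rewrite (lin0 (pl' _ _ _)) mulr0.
  - by move=> b u _; rewrite mulr0.
  - by move=> b u _; rewrite mulr0.
  - by move=> n /dd ->; rewrite (lin0 (pl' _ _ _)) mulr0.
have m0 := alive_ge0 al.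
pose Bl b (y : La) : La := ha (inl b) * y.
pose f' b n : La := ha (inr b) * psi m j w n.
pose g' n : La := hrho * psi m j w n.
have Bll b : linear (Bl b) by exact: hmull_linear.
have fl b : linear (f' b) by apply: (lin_comp (hmull_linear _)); exact: pl'.
have gl : linear g' by apply: (lin_comp (hmull_linear _)); exact: pl'.
have ft b x : inN m j x -> f' b x = f' b (pe (qtail b) * x).
  by move=> xN; rewrite /f' pq' // mulrA ha_he /= eqxx.
have gb b x : inN m j x -> g' (pl b * x) = Bl b (g' x).
  by move=> xN; rewrite /g' pb // /Bl !mulrA ha_rho.
have fg x : inN m j x -> \sum_b (Bl b (f' b x) - f' b (pl b * x)) = g' (vm x).
  move=> xN; rewrite (lin_sum gl); transitivity (\sum_i v i *: (he i * (hrho * psi m j w x))).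
    by rewrite -(rho_sum vnz); apply: eq_bigr => b _; rewrite /f' pb.
  by apply: eq_bigr => i _; rewrite (linZ gl) /g' pq' // he_rhoA.
have gr := @rkilled_dies k Q Qacyc v chi_reg m j La Bl f' g' al Bll fl gl ft gb fg.
have [h [hl hf hb hr]] := @universal_map k Q Qacyc v vnz chi_reg m j La Bl f' g' m0 al Bll fl gl ft gb fg gr.
have he' q u : isE m j u -> h (lE (pe q) u) = he q * h u.
  move: u; apply: (E_gen vnz chi_reg (R := fun u => h (lE (pe q) u) = he q * h u) m0 al).
  - by rewrite (lin0 (lE_linear _)) !(lin0 hl) mulr0.
  - by move=> c u u' e e'; rewrite lE_linear !hl e e' mulrDr -hZr.
  - move=> b x xN; rewrite -(fE_head Qacyc v b xN) lEM peM.
    have [->|nb] := eqVneq q (qhead b).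
      by rewrite fE_head // hf // /f' mulrA he_ha /= eqxx.
    rewrite lE0 (lin0 hl) fE_head // hf // /f' mulrA he_ha /= (negPf nb).
    by rewrite mul0r.
  - move=> b u uE _; have -> : lE (pl b) u = lE (pl b) (lE (pe (qhead b)) u).
      by rewrite lEM pa_pe /= eqxx.
    rewrite [in RHS]hb ?lEM ?pee //; last exact: inE_pe.
    rewrite /Bl mulrA he_ha pe_pa /=; have [qb|nb] := eqVneq q (qtail b).
      by rewrite -lEM hb ?lEM ?pee //; exact: inE_pe.
    by rewrite !mul0r lE0 (lin0 hl).
exists h; split=> // b u uE.
have -> : lE (pl b) u = lE (pl b) (lE (pe (qhead b)) u) by rewrite lEM pa_pe /= eqxx.
rewrite hb ?lEM ?pee //; last exact: inE_pe.
by rewrite /Bl he' // mulrA ha_he /= eqxx.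
Qed.

Lemma hmap_lin l psi m j c w w' h1 h2 h3 : level l psi -> W l m j w -> W l m j w' ->
  hmap m j psi w h1 -> hmap m j psi w' h2 -> hmap m j psi (c *: w + w') h3 ->
  forall u, isE m j u -> h3 u = c *: h1 u + h2 u.
Proof.
move=> L wW wW' H1 H2 H3; have [dd|al] := EM (dead m j).
  by move=> u _; rewrite (hm_dead H1) // (hm_dead H2) // (hm_dead H3) // scaler0 addr0.
refine (@E_map_eq La (fun b (y : La) => ha (inl b) * y) m j h3 (fun u => c *: h1 u + h2 u) al _ _ _ _ _).
- exact: hm_lin H3.
- by apply: lin_add; [apply: lin_scale; exact: hm_lin H1|exact: hm_lin H2].
- move=> b n nN; rewrite (hm_f H3) // (hm_f H1) // (hm_f H2) // (lv_lin L) //.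
  by rewrite mulrDr -hZr.
- exact: hm_pl H3.
- by move=> b u uE; rewrite (hm_pl H1) // (hm_pl H2) // mulrDr -hZr.
Qed.

Lemma hmap0 l psi m j h : level l psi -> hmap m j psi 0 h -> forall u, isE m j u -> h u = 0.
Proof.
move=> L H; have [dd|al] := EM (dead m j); first by move=> u _; exact: (hm_dead H).
refine (@E_map_eq La (fun b (y : La) => ha (inl b) * y) m j h (fun=> 0) al _ _ _ _ _).
- exact: hm_lin H.
- exact: lin_zero.
- by move=> b n nN; rewrite (hm_f H) // (lv0 L) // mulr0.
- exact: hm_pl H.
- by move=> b u uE; rewrite mulr0.
Qed.

Lemma hmap_er l psi m j q w h h' : level l psi -> W l m j w ->
  hmap m j psi w h -> hmap m j psi (pe q * w) h' -> forall u, isE m j u -> h u * he q = h' u.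
Proof.
move=> L wW H H'; have [dd|al] := EM (dead m j).
  by move=> u _; rewrite (hm_dead H) // (hm_dead H') // mul0r.
refine (@E_map_eq La (fun b (y : La) => ha (inl b) * y) m j (fun u => h u * he q) h' al _ _ _ _ _).
- exact: lin_comp (hmulr_linear _) (hm_lin H).
- exact: hm_lin H'.
- by move=> b n nN; rewrite (hm_f H) // (hm_f H') // -mulrA (lv_er L).
- by move=> b u uE; rewrite (hm_pl H) // mulrA.
- exact: hm_pl H'.
Qed.

(** Both sides are compatible with plain arrows and agree on the generators f_b(n), where the claim
    is the definition of the starred operators. *)
Lemma hmap_phi l psi m j w h u m' j' om : level l psi -> W l m j w -> hmap m j psi w h ->
  isE m j u -> lin om -> phi (h u) m' j' om = \sum_(a : A | qtail a == j)
    if (m' == m + stard a) && (j' == qhead a) then (lam a m * om (w * pa a)) *: u a else 0.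
Proof.
move=> L wW H uE ol; have [pl' p1 pa' pe' pg] := phiP.
have [dd|al] := EM (dead m j).
  have -> : w = 0 by apply: dd; case: wW.
  rewrite (hm_dead H) // (lin0 (phi_linear m' j' om)) big1 // => a _.
  by case: ifP => // _; rewrite mul0r (lin0 ol) mulr0 scale0r.
pose g2 u := \sum_(a : A | qtail a == j)
    if (m' == m + stard a) && (j' == qhead a) then (lam a m * om (w * pa a)) *: u a else 0.
refine (@E_map_eq P (fun b y => pl b * y) m j (fun u => phi (h u) m' j' om) g2 al _ _ _ _ _ u uE).
- exact: lin_comp (phi_linear m' j' om) (hm_lin H).
- apply: lin_bigsum => a _; apply: lin_if; apply: lin_scale; exact: app_linear.
- move=> b n nN; rewrite (hm_f H) // pa' //.
  rewrite -[op _ _ _ _ _ _ _]/(ops Qacyc v b (phi (psi m j w n)) m' j' om) ops_good //.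
  rewrite big_mkcond /g2 [RHS]big_mkcond; apply: eq_bigr => a _.
  rewrite (lv_phi L) //; last exact: om_par.
  rewrite [j' == _]eq_sym -subr_eq [m' - _ == _]eq_sym [m == _]eq_sym.
  case: eqP => [_|_]; last by rewrite andbF if_same.
  rewrite andbT; case: eqP => [->|_]; case: eqP => [aj|_] //=.
  + by rewrite (linZ (FA_linear _ _ _ _ _)) scalerA ffunE aj eqxx.
  + by rewrite (lin0 (FA_linear _ _ _ _ _)) scaler0.
  + by rewrite (lin0 (FA_linear _ _ _ _ _)) scaler0.
  + by rewrite (lin0 (FA_linear _ _ _ _ _)) scaler0.
- by move=> b u' uE'; rewrite (hm_pl H) // pa'.
- move=> b u' uE'; rewrite /g2 mulr_sumr; apply: eq_bigr => a _.
  by case: ifP => _; rewrite ?mulr0 // ffunE -pZr.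
Qed.

Definition coherent l psi psi' := forall m j w n, W l m j w -> inN m j n ->
  (forall b, ha (inr b) * psi m j w n =
     \sum_(a : A | qtail a == j) lam a m *: psi' (m + stard a) (qhead a) (w * pa a) (FA m a b n)) /\
  hrho * psi m j w n =
     \sum_(a : A | qtail a == j) lam a m *: psi' (m + stard a) (qhead a) (w * pa a) (n * pa a).

(** The obstruction to the next level: for w of length l - 1, the preprojective relation multiplied
    by w is zero, and splitting off its last arrows must therefore give zero. *)
Definition mesh_ok l psi := forall m j w n (h : A -> U -> La), W (l - 1) m j w -> inN (m + 1) j n ->
  (forall a, qtail a = j -> hmap (m + stard a) (qhead a) psi (w * pa a) (h a)) ->
  \sum_(a : A | qtail a == j) sg k a *: ((lam (star a) (m + stard a))^-1 *: h a (singleE (star a) n)) = 0.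

Lemma single_starE m j a n : qtail a = j -> inN (m + 1) j n ->
  isE (m + stard a) (qhead a) (singleE (star a) n).
Proof.
move=> aj nN; apply: inE_single; first exact: qtail_star.
by rewrite -addrA stard_star qhead_star aj.
Qed.

Lemma sum_single m j u : isE m j u -> u = \sum_(a : A | qtail a == j) singleE a (u a).
Proof.
move=> uE; apply/ffunP => a; rewrite sum_ffunE big_mkcond (bigD1 a) //= big1 ?addr0 => [|a' aa].
  by rewrite ffunE eqxx; case: eqP => // /eqP aj; rewrite (inE_out uE aj).
by case: ifP => // _; rewrite ffunE eq_sym (negPf aa).
Qed.

(** By [N_ind] it suffices to take n = b^* x. Coherence expands both b^* rho psi(w, x) and rho b^*
    psi(w, x), which are equal; by [FA_commute] and the choice of [lam], the expansions differ by
    the required sum. *)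
Lemma mesh_step l psi psi' : level l psi -> level (l + 1) psi' -> coherent l psi psi' ->
  mesh_ok (l + 1) psi'.
Proof.
move=> L L' coh m j w n h; rewrite addrK => wW nN hh.
pose Th n := \sum_(a : A | qtail a == j)
  sg k a *: ((lam (star a) (m + stard a))^-1 *: h a (singleE (star a) n)).
rewrite -/(Th n).
have [m0|m0] := ltP m 0.
  rewrite /Th big1 // => a /eqP aj; have H := hh a aj.
  have w0 : w = 0 by have [wN _] := wW; exact: (inN_neg m0 wN).
  rewrite w0 mul0r in H; rewrite (hmap0 L' H) ?scaler0 //; exact: single_starE aj nN.
have [dd|al] := EM (dead (m + 1) j).
  rewrite (dd n nN) /Th big1 // => a /eqP aj.
  by rewrite (lin0 (singleE_linear _)) (lin0 (hm_lin (hh a aj))) !scaler0.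
have Thl : linear Th.
  apply: lin_bigsum => a /eqP aj; do 2!apply: lin_scale.
  exact: lin_comp (hm_lin (hh a aj)) (singleE_linear _).
move: nN; apply: (N_ind (Pr := fun n => Th n = 0)).
- exact: lin0 Thl.
- by move=> x y e e'; rewrite (linD Thl) e e' addr0.
- by move=> c x e; rewrite (linZ Thl) e scaler0.
- by lia.
- move=> b x xN _ e; rewrite -[RHS](mulr0 (ha (inl b))) -e mulr_sumr.
  apply: eq_bigr => a /eqP aj; rewrite -!hZr -(hm_pl (hh a aj)); last exact: (single_starE aj xN).
  by rewrite /lE mapE_single //; exact: pal_linear.
move=> b x; rewrite addrK => xN _.
have [c1 c2] := coh _ _ _ _ wW xN.
have : ha (inr b) * (hrho * psi m j w x) - hrho * (ha (inr b) * psi m j w x) = 0.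
  by rewrite !mulrA ha_rho subrr.
rewrite c2 c1 !mulr_sumr -sumrB => E0; rewrite -[RHS]E0; apply: eq_bigr => a /eqP aj.
have H := hh a aj; have C := FA_cocycle Qacyc v m a.
have xN' : inN m (qtail a) x by rewrite aj.
rewrite -!hZr -(hm_f H); last exact: (inN_par a xN).
rewrite -(hm_r H); last exact: (cocycle_N C b xN').
rewrite -scalerBr -(linB (hm_lin H)).
have -> : fE (m + stard a) (qhead a) b (x * pa a) - rE (FA m a b x) =
    cA Qacyc v m a *: singleE (star a) (ps b * x).
  apply/ffunP => a'; rewrite !ffunE; have [aa|aa] := eqVneq (qtail a') (qhead a); last first.
    rewrite (inN_par0 (cocycle_N C b xN') aa) subr0.
    case: eqP => [a'E|_]; last by rewrite scaler0.
    by rewrite a'E qtail_star eqxx in aa.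
  have [->|na] := eqVneq a' (star a); first by rewrite cAE.
  have [c [c0 cE]] := FA_commute Qacyc v m (esym aa).
  by rewrite cE // c0 // scale0r scaler0.
rewrite (linZ (hm_lin H)) !scalerA.
have [dy|ay] := EM (dead (m + stard a) (qhead a)); first by rewrite (hm_dead H) // !scaler0.
congr (_ *: _); rewrite -(lam_cA chi_reg _ ay m0) ?aj // mulrAC mulfV ?mul1r //.
exact: lam_neq0.
Qed.

(** Split w = \sum_a w_a a and define psi'(w, n) by the values of the maps of the w_a at n, placed
    in the component a and divided by lam. Two splittings differ by a relation \sum_a w_a a = 0,
    which by [mesh_right] is a multiple of the preprojective one and goes to 0 by [mesh_ok]. *)
Lemma level_step l psi : 0 <= l -> level l psi -> mesh_ok l psi ->
  exists psi', level (l + 1) psi' /\ coherent l psi psi'.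
Proof.
move=> l0 L mok.
have /choice[H0 H0P] : forall x : int * V * P, exists h : U -> La,
    linear h /\ (W l x.1.1 x.1.2 x.2 -> hmap x.1.1 x.1.2 psi x.2 h).
  move=> [[m j] w] /=; have [wW|nW] := EM (W l m j w); last by exists (fun=> 0); split=> //; exact: lin_zero.
  by have [h hh] := hmap_exists L wW; exists h; split=> //; exact: hm_lin hh.
pose H m j w := H0 (m, j, w).
have HP m j w : W l m j w -> hmap m j psi w (H m j w) by have [_] := H0P (m, j, w).
have HPl m j w : linear (H m j w) by have [] := H0P (m, j, w).
have Hlin m j c w w' u : W l m j w -> W l m j w' -> isE m j u ->
    H m j (c *: w + w') u = c *: H m j w u + H m j w' u.
  by move=> wW wW'; apply: (hmap_lin L wW wW'); apply: HP => //; exact: W_lin.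
have H00 m j u : isE m j u -> H m j 0 u = 0 by apply: (hmap0 L); apply: HP; exact: W0.
pose hs m' a w n : La := (lam a (m' - stard a))^-1 *: H (m' - stard a) (qtail a) w (singleE a n).
have sE m' j' a n : qhead a == j' -> inN m' j' n -> isE (m' - stard a) (qtail a) (singleE a n).
  by move=> /eqP aj nN; apply: inE_single => //; rewrite subrK aj.
have hslin m' j' a c w w' n : qhead a == j' -> inN m' j' n ->
    W l (m' - stard a) (qtail a) w -> W l (m' - stard a) (qtail a) w' ->
    hs m' a (c *: w + w') n = c *: hs m' a w n + hs m' a w' n.
  move=> aj nN wW wW'; rewrite /hs Hlin //; last exact: sE aj nN.
  by rewrite scalerDr !scalerA mulrC.
pose fam m' j' (wa : A -> P) := forall a, qhead a == j' -> W l (m' - stard a) (qtail a) (wa a).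
have WD m' j' (wa : A -> P) n : fam m' j' wa -> \sum_(a : A | qhead a == j') wa a * pa a = 0 ->
    inN m' j' n -> \sum_(a : A | qhead a == j') hs m' a (wa a) n = 0.
  move=> fw w0 nN; have [||c cE] := @mesh_right k Q (fun a => if qhead a == j' then wa a else 0).
  - by move=> a; case: ifP => [/fw[wN _]|_]; [exact: inN_pe wN|exact: mul0r].
  - by rewrite -[RHS]w0 [RHS]big_mkcond; apply: eq_bigr => a _; case: ifP => // _; rewrite mul0r.
  (* The element given by [mesh_right] may be cut down to the matching stars, vertex and length. *)
  pose q := nx (m' - 1) j' (prl (l - 1) c).
  have qW : W (l - 1) (m' - 1) j' q by exact: W_proj.
  have waE a : qhead a == j' -> wa a = sg k (star a) *: (q * pa (star a)).
    move=> aj; have := cE a; rewrite aj -{1}(W_fix (fw a aj)) => E1.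
    rewrite -(W_fix (fw a aj)) -[wa a](W_fix (fw a aj)).
    have E2 := congr1 (fun x => nx (m' - stard a) (qtail a) (prl l x)) E1.
    rewrite E2 (linZ (prl_linear l)) (linZ (nx_linear _ _)) prl_par nx_par qhead_star eqxx.
    rewrite /q qtail_star (eqP aj); congr (_ *: (nx _ _ _ * _)).
    by have := stard_star a; lia.
  rewrite (reindex_inj (inv_inj (@starK Q))).
  have Hm := mok (m' - 1) j' q n (fun a => H (m' - 1 + stard a) (qhead a) (q * pa a)) qW.
  rewrite subrK in Hm; rewrite -[RHS](Hm nN); last by move=> a aj; apply: HP; exact: (W_par a qW).
  apply: eq_big => [a|a aj]; first by rewrite qhead_star.
  rewrite waE // starK /hs qtail_star.
  have -> : m' - stard (star a) = m' - 1 + stard a by have := stard_star a; lia.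
  have W1 : W l (m' - 1 + stard a) (qhead a) (q * pa a) by exact: (W_par a qW).
  have := Hlin (m' - 1 + stard a) (qhead a) (sg k a) (q * pa a) 0 (singleE (star a) n) W1 (W0 _ _ _).
  rewrite addr0 => ->; last first.
    by apply: (single_starE (j := j')); [apply/eqP; rewrite -qhead_star|rewrite subrK].
  rewrite H00 ?addr0 ?scalerA 1?mulrC //.
  by apply: (single_starE (j := j')); [apply/eqP; rewrite -qhead_star|rewrite subrK].
have /choice[D0 D0P] : forall x : int * V * P, exists wa : A -> P, W (l + 1) x.1.1 x.1.2 x.2 ->
    fam x.1.1 x.1.2 wa /\ x.2 = \sum_(a : A | qhead a == x.1.2) wa a * pa a.
  move=> [[m' j'] w] /=; have [c [z zE]] := right_decomp w.
  exists (fun a => nx (m' - stard a) (qtail a) (prl l (z a))) => wW; split.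
    by move=> a _; exact: W_proj.
  rewrite -[LHS](W_fix wW) zE (linD (prl_linear _)) (linD (nx_linear _ _)).
  rewrite !(lin_sum (prl_linear _)) !(lin_sum (nx_linear _ _)) big1 ?add0r => [|i _].
    rewrite [RHS]big_mkcond; apply: eq_bigr => a _.
    by rewrite prl_par addrK nx_par.
  rewrite (linZ (prl_linear _)) /prl pr_pe (_ : (dlen 0 == l + 1) = false).
    by rewrite scaler0 (lin0 (nx_linear _ _)).
  have -> : dlen (0 : {ffun arrow Q -> int} * int) = 0.
    by have := dlenD (0 : {ffun arrow Q -> int} * int) 0; rewrite addr0; lia.
  by apply/negbTE; lia.
pose D m' j' w := D0 (m', j', w).
have DP m' j' w : W (l + 1) m' j' w -> fam m' j' (D m' j' w) /\
   w = \sum_(a : A | qhead a == j') D m' j' w a * pa a by exact: (D0P (m', j', w)).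
pose psi' : Psi := fun m' j' w n => \sum_(a : A | qhead a == j') hs m' a (D m' j' w a) n.
have psiE m' j' w (wa : A -> P) n : W (l + 1) m' j' w -> fam m' j' wa ->
    w = \sum_(a : A | qhead a == j') wa a * pa a -> inN m' j' n ->
    psi' m' j' w n = \sum_(a : A | qhead a == j') hs m' a (wa a) n.
  move=> wW fw wE nN; have [fD DE] := DP _ _ _ wW.
  have H1 : fam m' j' (fun a => -1 *: wa a + D m' j' w a).
    by move=> a aj; apply: W_lin; [exact: fw|exact: fD].
  have := WD _ _ _ n H1; have -> : \sum_(a : A | qhead a == j') (-1 *: wa a + D m' j' w a) * pa a = 0.
    rewrite (eq_bigr (fun a => D m' j' w a * pa a - wa a * pa a)).
      by rewrite sumrB -DE -wE subrr.
    by move=> a _; rewrite mulrDl scaleN1r mulNr addrC.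
  move=> /(_ erefl nN) H2; apply/eqP; rewrite -subr_eq0; apply/eqP; rewrite -[RHS]H2 -sumrB.
  apply: eq_bigr => a aj.
  by rewrite (hslin m' j' a (-1) (wa a) (D m' j' w a) n aj nN (fw a aj) (fD a aj)) scaleN1r addrC.
exists psi'; split; last first.
  move=> m j w n wW nN; have hw := HP _ _ _ wW.
  have pE a n' : qtail a == j -> inN (m + stard a) (qhead a) n' ->
      lam a m *: psi' (m + stard a) (qhead a) (w * pa a) n' = H m j w (singleE a n').
    move=> /eqP aj nN'.
    rewrite (psiE _ _ _ (fun a' => if a' == a then w else 0)) //.
    - rewrite (bigD1 a) //= eqxx big1 ?addr0 => [|a' /andP[a'j /negPf ->]].
        by rewrite /hs addrK aj scalerA mulfV ?scale1r //; exact: lam_neq0.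
      by rewrite /hs H00 ?scaler0 //; exact: sE a'j nN'.
    - have W1 : W (l + 1 - 1) m j w by rewrite addrK.
      exact: (W_par a W1).
    - by move=> a' _; case: eqP => [->|_]; [rewrite addrK aj|exact: W0].
    - rewrite (bigD1 a) //= eqxx big1 ?addr0 // => a' /andP[_ /negPf ->].
      exact: mul0r.
  split=> [b|].
    rewrite -(hm_f hw) // (sum_single (inE_f Qacyc v b nN)) (lin_sum (hm_lin hw)).
    apply: eq_bigr => a aj; rewrite pE //; first by rewrite ffunE aj.
    by apply: (cocycle_N (FA_cocycle Qacyc v m a)); rewrite (eqP aj).
  rewrite -(hm_r hw) // (sum_single (inE_r nN)) (lin_sum (hm_lin hw)).
  apply: eq_bigr => a aj; rewrite pE //; first by rewrite ffunE.
  exact: (inN_par a nN).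
split.
- move=> m j c w w' n wW wW' nN; have [fD DE] := DP _ _ _ wW; have [fD' DE'] := DP _ _ _ wW'.
  rewrite (psiE _ _ _ (fun a => c *: D m j w a + D m j w' a)) //.
  + rewrite scaler_sumr -big_split; apply: eq_bigr => a aj.
    by rewrite (hslin m j) //; [exact: fD|exact: fD'].
  + exact: W_lin.
  + by move=> a aj; apply: W_lin; [exact: fD|exact: fD'].
  + rewrite {1}DE {1}DE' scaler_sumr -big_split; apply: eq_bigr => a _.
    by rewrite mulrDl pZl.
- move=> m j w; apply: lin_bigsum => a aj.
  by apply: lin_scale; exact: lin_comp (HPl _ _ _) (singleE_linear a).
- move=> m j w n b wW nN; have [fD _] := DP _ _ _ wW; rewrite mulr_sumr; apply: eq_bigr => a aj.
  rewrite -hZr -(hm_pl (HP _ _ _ (fD a aj))); last exact: sE aj nN.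
  by rewrite /hs /lE mapE_single //; exact: pal_linear.
- move=> m j w n b wW nN; have [fD _] := DP _ _ _ wW; rewrite mulr_sumr; apply: eq_bigr => a aj.
  rewrite -hZr -(hm_pe (HP _ _ _ (fD a aj))); last exact: sE aj nN.
  by rewrite /hs /lE mapE_single //; exact: pel_linear.
- move=> m j w n q wW nN; have [fD DE] := DP _ _ _ wW.
  rewrite [RHS](psiE _ _ _ (fun a => pe q * D m j w a)) //.
  + rewrite mulr_suml; apply: eq_bigr => a aj; rewrite /hs -hZl; congr (_ *: _).
    exact: (hmap_er L (fD a aj) (HP _ _ _ (fD a aj)) (HP _ _ _ (W_pe q (fD a aj))) (sE _ _ _ _ aj nN)).
  + exact: W_pe.
  + by move=> a aj; exact: (W_pe q (fD a aj)).
  + by rewrite {1}DE mulr_sumr; apply: eq_bigr => a _; rewrite mulrA.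
move=> m j w n m' j' om wW nN ol; have [fD DE] := DP _ _ _ wW.
rewrite (lin_sum (phi_linear m' j' om)).
transitivity (\sum_(a : A | qhead a == j)
    if (m' == m) && (j' == j) then om (D m j w a * pa a) *: n else 0); last first.
  case: ifP => _; last by rewrite big1.
  by rewrite -scaler_suml -(lin_sum ol) -DE.
apply: eq_bigr => a aj; rewrite /hs (linZ (phi_linear m' j' om)).
rewrite (hmap_phi _ _ L (fD a aj) (HP _ _ _ (fD a aj)) (sE _ _ _ _ aj nN) ol).
rewrite (bigD1 a) //= big1 ?addr0 => [|a' /andP[_ /negPf aa]]; last first.
  by rewrite ffunE aa scaler0; case: ifP.
move/eqP: (aj) => /= ajE; rewrite subrK ajE ffunE eqxx; case: ifP => _; last exact: scaler0.
by rewrite scalerA mulKf //; exact: lam_neq0.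
Qed.

End Levels.

(** * The Heisenberg algebra in terms of the maps psi *)

Section Decomposition.
Variables (k : fieldType) (Q : quiver) (Qacyc : quiver_acyclic Q).
Notation DQ := (double_quiver Q).
Notation V := (vert DQ).
Notation A := (arrow DQ).
Notation P := (ppa k Q).
Notation pe i := (@pe k Q i).
Notation pa a := (@pa k Q a).
Notation pl b := (pa (inl b)).
Notation base p := (pq (pathbase k p)).
Notation dead := (@dead k Q).
Notation fdN := (@fdN k Q Qacyc).
Implicit Types (a : A) (i j q : V) (m : int).
Variable v : vert Q -> k.
Notation vm := (@vm k Q v).
Notation La := (@qHeis k Q v).
Notation hq := (@hq k Q v).
Notation he i := (@he k Q v i).
Notation ha a := (@ha k Q v a).
Notation lin om := (linear (om : P -> k^o)).
Implicit Types (om : P -> k) (l : int).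
Hypothesis vnz : forall i : V, v i != 0.
Hypothesis chi_reg : forall m j, ~ dead m j -> ftr (fdN m j) vm != 0.
Notation level := (level vnz chi_reg).
Notation coherent := (@coherent k Q Qacyc v).
Notation mesh_ok := (@mesh_ok k Q Qacyc v).
Notation phi := (phi vnz chi_reg).
Notation W := (@W k Q).
Notation Psi := (int -> V -> P -> P -> La).

Lemma prl0E (x : P) : exists c : V -> k, prl 0 x = \sum_i c i *: pe i.
Proof.
have [f <-] := pq_surj x.
elim/pathalg_ind: f => [|f g [c cE] [d dE]|c f [d dE]|p].
- exists (fun=> 0); have -> : pq (0 : pathalg k DQ) = 0 by exact: lin0 (@pq_linear k Q).
  by rewrite (lin0 (prl_linear _)) big1 // => i _; rewrite scale0r.
- exists (fun i => c i + d i); rewrite (linD (@pq_linear k Q)) (linD (prl_linear _)) cE dE.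
  by rewrite -big_split; apply: eq_bigr => i _; rewrite scalerDl.
- exists (fun i => c * d i); rewrite (linZ (@pq_linear k Q)) (linZ (prl_linear _)) dE.
  by rewrite scaler_sumr; apply: eq_bigr => i _; rewrite scalerA.
rewrite /prl pr_path; case: eqP => [/dpath_len0 pt|_]; last first.
  by exists (fun=> 0); rewrite big1 // => i _; rewrite scale0r.
exists (fun i => (i == psrc p)%:R); rewrite (bigD1 (psrc p)) //= eqxx scale1r.
by rewrite big1 ?addr0 => [|i /negPf ->]; [rewrite {1}pt|rewrite scale0r].
Qed.

Lemma W0E m j w : W 0 m j w -> exists c, w = (if m == 0 then c *: pe j else 0).
Proof.
move=> wW; have [c cE] := prl0E w; exists (c j); rewrite -[LHS](W_fix wW) cE.
rewrite (lin_sum (nx_linear _ _)) (bigD1 j) //= big1 => [|i ij].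
  rewrite addr0 (linZ (nx_linear _ _)) /nx [prs _ _]pr_pe /= eq_sym.
  by case: eqP => _; rewrite ?pee // mul0r scaler0.
rewrite (linZ (nx_linear _ _)) /nx [prs _ _]pr_pe /=.
by case: eqP => _; rewrite ?mul0r ?peM ?(negPf ij) scaler0.
Qed.

Definition inc : P -> La := sval (cid (@inc_exists k Q v)).
Lemma incP : [/\ linear inc, forall b, inc (pl b) = ha (inl b),
  forall i, inc (pe i) = he i & forall x y, inc (x * y) = inc x * inc y].
Proof. by rewrite /inc; case: cid. Qed.

Lemma phi_inc j n m' j' om : inN 0 j n -> lin om ->
  phi (inc n) m' j' om = if (m' == 0) && (j' == j) then om (pe j) *: n else 0.
Proof.
move=> + ol; have [il ib ie iM] := incP; have [pl' p1 pa' pe' pg] := phiP vnz chi_reg.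
have pz : phi (inc 0) m' j' om = 0 by rewrite (lin0 il) (lin0 (phi_linear _ _ m' j' om)).
move: n; apply: (N_ind (Pr := fun n => phi (inc n) m' j' om =
    if (m' == 0) && (j' == j) then om (pe j) *: n else 0)).
- by rewrite pz scaler0 if_same.
- move=> x y ex ey; rewrite (linD il) (linD (phi_linear _ _ m' j' om)) ex ey.
  by case: ifP => _; rewrite ?scalerDr ?addr0.
- move=> c x ex; rewrite (linZ il) (linZ (phi_linear _ _ m' j' om)) ex.
  by case: ifP => _; rewrite ?scaler0 // !scalerA mulrC.
- move=> _; rewrite ie -[he j]mulr1 pe' // p1 // /ze0; case: eqP => _ /=; last exact: mulr0.
  by rewrite -pZr peM eq_sym; case: eqP => [->|_] //; rewrite scaler0.
- move=> b x xN _ ex; rewrite iM ib pa' //= /opl ex.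
  by case: ifP => _; rewrite ?mulr0 // -pZr.
move=> b x xN _; have -> : x = 0 by apply: inN_neg xN.
by rewrite mulr0 pz scaler0 if_same.
Qed.

(** A second factor of length 0 is zero or a multiple of e_j with m = 0, and then n lies in A e_j,
    so products of images in the algebra suffice. The mesh condition concerns elements of length -1,
    all zero. *)
Lemma level0_exists : exists psi : Psi, level 0 psi /\ mesh_ok 0 psi /\
  forall i, psi 0 i (pe i) (pe i) = he i.
Proof.
have [il ib ie iM] := incP.
pose psi : Psi := fun m j w n => inc n * inc w.
have L : level 0 psi.
  split.
  - by move=> m j c w w' n _ _ _; rewrite /psi il mulrDr -hZr.
  - by move=> m j w; apply: (lin_comp (hmulr_linear _)); exact: il.
  - by move=> m j w n b _ _; rewrite /psi iM ib mulrA.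
  - by move=> m j w n q _ _; rewrite /psi iM ie mulrA.
  - move=> m j w n q wW _; have [c ->] := W0E wW; rewrite /psi -mulrA -ie -iM; congr (_ * inc _).
    case: eqP => _; last by rewrite mul0r mulr0.
    by rewrite -pZl -pZr !peM eq_sym; case: eqP => [->|].
  - move=> m j w n m' j' om wW nN ol; have [c wE] := W0E wW; move: wE.
    have [m0|_] := eqVneq m 0; last first.
      move=> ->; rewrite /psi (lin0 il) mulr0 (lin0 (phi_linear _ _ _ _ _)) (lin0 ol).
      by rewrite scale0r if_same.
    move=> ->; rewrite /psi -iM -pZr.
    rewrite m0 in nN *; rewrite (inN_pe nN) (linZ il) (linZ (phi_linear _ _ _ _ _)).
    rewrite (phi_inc _ _ nN ol) (linZ ol); case: ifP => _; last exact: scaler0.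
    by rewrite scalerA.
exists psi; split=> //; split=> [|i]; last by rewrite /psi !ie heM eqxx.
move=> m j w n h [_ w0] nN hh; rewrite big1 // => a /eqP aj.
have {}w0 : w = 0 by rewrite -w0 prl_neg.
have H := hh a aj; rewrite w0 mul0r in H.
by rewrite (hmap0 L H) ?scaler0 //; exact: (single_starE aj nN).
Qed.

Lemma levels_exist : exists psi : nat -> Psi,
  [/\ forall t : nat, level t%:Z (psi t), forall t : nat, coherent t%:Z (psi t) (psi t.+1)
    & forall i, psi 0%N 0 i (pe i) (pe i) = he i].
Proof.
have [psi0 [L0 [M0 psi0E]]] := level0_exists.
have /choice[S SP] : forall x : nat * Psi, exists psi' : Psi,
    level x.1%:Z x.2 -> mesh_ok x.1%:Z x.2 -> level (x.1%:Z + 1) psi' /\ coherent x.1%:Z x.2 psi'.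
  move=> [t psi] /=; have [[L M]|H] := EM (level t%:Z psi /\ mesh_ok t%:Z psi); last first.
    by exists psi => L M; case: H.
  have t0 : 0 <= t%:Z by [].
  by have [psi' H] := level_step t0 L M; exists psi'.
pose psi t := nat_rect (fun=> Psi) psi0 (fun t p => S (t, p)) t.
have inv t : level t%:Z (psi t) /\ mesh_ok t%:Z (psi t).
  elim: t => [//|t [L M]]; have [L' C] := SP (t, psi t) L M.
  have -> : t.+1%:Z = t%:Z + 1 by lia.
  by split=> //; exact: mesh_step L L' C.
exists psi; split=> // t; first by have [] := inv t.
by have [L M] := inv t; have [] := SP (t, psi t) L M.
Qed.

Definition psis : nat -> Psi := sval (cid levels_exist).
Lemma psis_level t : level t%:Z (psis t). Proof. by rewrite /psis; case: cid => ? []. Qed.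
Lemma psis_coh t : coherent t%:Z (psis t) (psis t.+1).
Proof. by rewrite /psis; case: cid => ? []. Qed.
Lemma psis0 i : psis 0%N 0 i (pe i) (pe i) = he i.
Proof. by rewrite /psis; case: cid => ? []. Qed.

(** The span contains the idempotents and is stable under left multiplication by arrows: plain ones
    by [lv_pl], starred ones by coherence, which leads from level t to t + 1. *)
Lemma La_span (R : La -> Prop) : R 0 -> (forall x y, R x -> R y -> R (x + y)) ->
  (forall t m j w n, W t%:Z m j w -> inN m j n -> R (psis t m j w n)) -> forall x : La, R x.
Proof.
(* The smallest additive set containing the values of psi; its closure properties are proved by
   using it as its own test predicate. *)
pose S (x : La) := forall R : La -> Prop, R 0 -> (forall x y, R x -> R y -> R (x + y)) ->
  (forall t m j w n, W t%:Z m j w -> inN m j n -> R (psis t m j w n)) -> R x.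
suff H : forall x, S x by move=> R0 RD Rp x; exact: H.
clear R.
have S0 : S 0 by move=> R' R0.
have SD x y : S x -> S y -> S (x + y) by move=> Sx Sy R' R0 RD Rp; apply: (RD); [apply: Sx|apply: Sy].
have Sp t m j w n : W t%:Z m j w -> inN m j n -> S (psis t m j w n).
  by move=> wW nN R' R0 RD Rp; exact: Rp.
have SZ c x : S x -> S (c *: x).
  move=> Sx; apply: (Sx (fun x => S (c *: x))) => [|y z Sy Sz|t m j w n wW nN].
  - by rewrite scaler0.
  - by rewrite scalerDr; exact: SD.
  by rewrite -(linZ (lv_linear (psis_level t) m j w)); apply: Sp => //; exact: inNZ.
have Ss I (s : seq I) (T : pred I) (F : I -> La) : (forall i : I, T i -> S (F i)) -> S (\sum_(i <- s | T i) F i).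
  by move=> FS; elim/big_ind: _.
have Sa a x : S x -> S (ha a * x).
  move=> Sx; apply: (Sx (fun x => S (ha a * x))) => [|y z Sy Sz|t m j w n wW nN].
  - by rewrite mulr0.
  - by rewrite mulrDr; exact: SD.
  case: a => b; first by rewrite -(lv_pl (psis_level t)) //; apply: Sp => //; exact: inN_pl.
  have [c1 _] := psis_coh wW nN; rewrite c1; apply: Ss => a /eqP aj; apply: SZ; apply: Sp.
    have -> : t.+1%:Z = t%:Z + 1 by lia.
    by apply: W_par; rewrite addrK; exact: wW.
  by apply: (cocycle_N (FA_cocycle Qacyc v m a)); rewrite aj.
move=> x; have [f <-] := hq_surj x; elim/pathalg_indl: f => [|f g Sf Sg|c f Sf|i|a f Sf].
- by rewrite (lin0 (@hq_linear k Q v)).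
- by rewrite (linD (@hq_linear k Q v)); exact: SD.
- by rewrite (linZ (@hq_linear k Q v)); exact: SZ.
- rewrite -[hq _]psis0; apply: Sp; last exact: inN_pej.
  split; first exact: inN_pej.
  rewrite /prl pr_pe; suff -> : dlen (0 : {ffun arrow Q -> int} * int) = 0 by [].
  by have := dlenD (0 : {ffun arrow Q -> int} * int) 0; rewrite addr0; lia.
- by rewrite hqM; exact: Sa.
Qed.

Section Coordinates.
(** Either e_i and its image, for the projective at i, or 1 and 1, for the whole algebra: one
    argument serves both parts of the theorem. *)
Variables (e : P) (eh : La) (F : forall m j, fdim (fun x => e * nx m j x)).
Hypothesis Fpath : forall m j (b : 'I_(fdn (F m j))), exists p : qpath DQ,
  [/\ starp p = m, ptgt p = j & fdb (F m j) b = base p].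
Hypothesis eW : forall l m j w, W l m j w -> W l m j (e * w).
Hypothesis eeh : forall t m j w n, W t%:Z m j w -> inN m j n ->
  psis t m j w n * eh = psis t m j (e * w) n.

Definition fpath m j (b : 'I_(fdn (F m j))) : qpath DQ := sval (cid (Fpath b)).
Lemma fpathP m j (b : 'I_(fdn (F m j))) :
  [/\ starp (fpath b) = m, ptgt (fpath b) = j & fdb (F m j) b = base (fpath b)].
Proof. by rewrite /fpath; case: cid. Qed.

Lemma W_fpath m j (b : 'I_(fdn (F m j))) : W (plen (fpath b))%:Z m j (base (fpath b)).
Proof.
have [pm pj pb] := fpathP b; split; first exact: inN_base.
by rewrite /prl pr_path dlen_dpath eqxx.
Qed.

Lemma e_fpath m j (b : 'I_(fdn (F m j))) : e * base (fpath b) = base (fpath b).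
Proof.
have [pm pj pb] := fpathP b; have := fdb_pi b; rewrite pb => E.
by have [wN _] := W_fpath b; rewrite -{1}wN.
Qed.

(** The coefficient of the basis path [b] in the second tensor factor; [PSI] puts [n] in front of
    that path. *)
Definition PHI m j (b : 'I_(fdn (F m j))) (x : La) : P := phi x m j (fdc (F m j) b).
Definition PSI m j (b : 'I_(fdn (F m j))) (n : P) : La :=
  psis (plen (fpath b)) m j (base (fpath b)) n.

Lemma PHI_linear m j (b : 'I_(fdn (F m j))) : linear (PHI b).
Proof. exact: phi_linear. Qed.
Lemma PSI_linear m j (b : 'I_(fdn (F m j))) : linear (PSI b).
Proof. exact: (lv_linear (psis_level _)). Qed.
Lemma PHI_N m j (b : 'I_(fdn (F m j))) x : inN m j (PHI b x).
Proof. by have [_ _ _ _ pg] := phiP vnz chi_reg; exact: good_N (pg x) _ _ _. Qed.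
Lemma PHI_pl m j (b : 'I_(fdn (F m j))) c x : PHI b (ha (inl c) * x) = pl c * PHI b x.
Proof.
have [_ _ pa' _ _] := phiP vnz chi_reg; rewrite /PHI pa' //.
exact: fdc_linear.
Qed.
Lemma PHI_pe m j (b : 'I_(fdn (F m j))) i x : PHI b (he i * x) = pe i * PHI b x.
Proof.
have [_ _ _ pe' _] := phiP vnz chi_reg; rewrite /PHI pe' //.
exact: fdc_linear.
Qed.
Lemma PSI_eh m j (b : 'I_(fdn (F m j))) n : inN m j n -> PSI b n * eh = PSI b n.
Proof. by move=> nN; rewrite eeh ?e_fpath //; exact: W_fpath. Qed.

Lemma PHI_PSI m j (b b' : 'I_(fdn (F m j))) n : inN m j n ->
  PHI b' (PSI b n) = if b' == b then n else 0.
Proof.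
move=> nN; rewrite /PHI (lv_phi (psis_level _)) //; [|exact: W_fpath|exact: fdc_linear].
have [_ _ <-] := fpathP b; rewrite !eqxx fdcb; case: eqP => _; last by rewrite scale0r.
exact: scale1r.
Qed.

Lemma PHI_psis m j (b : 'I_(fdn (F m j))) t m' j' w n : W t%:Z m' j' w -> inN m' j' n ->
  PHI b (psis t m' j' w n) = if (m == m') && (j == j') then fdc (F m j) b w *: n else 0.
Proof.
by move=> wW nN; rewrite /PHI (lv_phi (psis_level _)) //; exact: fdc_linear.
Qed.

(** The element w is homogeneous of length t, so basis paths of other lengths have coefficient 0;
    hence using each path at the level of its own length does no harm. *)
Lemma PSI_expand t m j w n : W t%:Z m j w -> inN m j n ->
  psis t m j (e * w) n = \sum_(b < fdn (F m j)) PSI b (fdc (F m j) b (e * w) *: n).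
Proof.
move=> wW nN; have ewW := eW wW; pose c b := fdc (F m j) b (e * w).
have cE : e * w = \sum_b c b *: fdb (F m j) b.
  have e2 : fdc (F m j) ^~ (e * w) = fdc (F m j) ^~ w.
    apply: funext => b; rewrite -[RHS]fdc_pi; congr (fdc _ _ (e * _)).
    by have [-> _] := wW.
  rewrite /c; under eq_bigr => b do rewrite (congr1 (fun f => f b) e2).
  by rewrite -(fdpi (F m j)); have [-> _] := wW.
have cl b : plen (fpath b) != t -> c b = 0.
  move=> bt; have [_ ewl] := ewW; rewrite /c -ewl cE (lin_sum (prl_linear _)).
  rewrite (lin_sum (fdc_linear b)) big1 // => b' _; rewrite (linZ (prl_linear _)).
  have [_ _ pb] := fpathP b'; rewrite pb /prl pr_path dlen_dpath; case: eqP => [[b't]|_].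
    rewrite -pb fdcZ fdcb; case: eqP => [bb|_]; last exact: mulr0.
    by rewrite bb b't eqxx in bt.
  by rewrite scaler0 (lin0 (fdc_linear b)).
have L := psis_level t.
have H (s : seq 'I_(fdn (F m j))) : W t%:Z m j (\sum_(b <- s | plen (fpath b) == t) c b *: base (fpath b)) /\
    psis t m j (\sum_(b <- s | plen (fpath b) == t) c b *: base (fpath b)) n =
    \sum_(b <- s | plen (fpath b) == t) c b *: psis t m j (base (fpath b)) n.
  elim: s => [|b s [IH1 IH2]]; first by rewrite !big_nil; split; [exact: W0|exact: lv0 L nN].
  rewrite !big_cons; case: eqP => // bt; have bW := W_fpath b; rewrite bt in bW.
  by split; [exact: W_lin|rewrite (lv_lin L) // IH2].
rewrite {1}cE (bigID (fun b => plen (fpath b) == t)) /= [Y in _ + Y]big1 ?addr0; last first.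
  by move=> b bt; rewrite cl // scale0r.
rewrite [RHS](bigID (fun b => plen (fpath b) == t)) /= [Y in _ = _ + Y]big1 ?addr0; last first.
  by move=> b bt; rewrite -/(c b) cl // scale0r (lin0 (PSI_linear b)).
have [_ H2] := H (index_enum _); rewrite (eq_bigr (fun b => c b *: base (fpath b))).
  rewrite H2; apply: eq_bigr => b /eqP bt; rewrite (linZ (PSI_linear b)) /PSI bt.
  by [].
by move=> b _; have [_ _ ->] := fpathP b.
Qed.

Lemma heis_decomp x : exists s : seq (int * V), uniq s /\
  (forall m j (b : 'I_(fdn (F m j))), (m, j) \notin s -> PHI b (x * eh) = 0) /\
  x * eh = \sum_(y <- s) \sum_(b < fdn (F y.1 y.2)) PSI b (PHI b (x * eh)).
Proof.
(* The list may be enlarged freely in the second claim, which lets the statement pass to sums. *)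
suff [s [s0 sE]] : exists s : seq (int * V), 
  (forall m j (b : 'I_(fdn (F m j))), (m, j) \notin s -> PHI b (x * eh) = 0) /\
  forall s', uniq s' -> {subset s <= s'} -> x * eh =
    \sum_(y <- s') \sum_(b < fdn (F y.1 y.2)) PSI b (PHI b (x * eh)).
  exists (undup s); split; first exact: undup_uniq.
  split=> [m j b|]; first by rewrite mem_undup; exact: s0.
  by apply: sE; [exact: undup_uniq|move=> y; rewrite mem_undup].
move: x; apply: La_span.
- exists [::]; rewrite mul0r; split=> [m j b _|s' _ _]; first exact: lin0 (PHI_linear b).
  rewrite big1 // => y _; rewrite big1 // => b _.
  by rewrite (lin0 (PHI_linear b)) (lin0 (PSI_linear b)).
- move=> x y [s [s0 sE]] [s' [s0' sE']]; exists (s ++ s'); split.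
    move=> m j b; rewrite mem_cat negb_or => /andP[ns ns'].
    by rewrite mulrDl (linD (PHI_linear b)) s0 // s0' // addr0.
  move=> s'' us sub; rewrite mulrDl {1}(sE s'') //; last first.
    by move=> z zs; apply: sub; rewrite mem_cat zs.
  rewrite {1}(sE' s'') //; last by move=> z zs; apply: sub; rewrite mem_cat zs orbT.
  rewrite -big_split; apply: eq_bigr => z _; rewrite -big_split; apply: eq_bigr => b _.
  by rewrite (linD (PHI_linear b)) (linD (PSI_linear b)).
move=> t m j w n wW nN; have ewW := eW wW; exists [:: (m, j)]; rewrite eeh //; split.
  move=> m' j' b; rewrite inE => /negPf mj; rewrite PHI_psis //.
  by move: mj; rewrite xpair_eqE => ->.
move=> s' us sub; have mjs : (m, j) \in s' by apply: sub; rewrite inE.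
rewrite (bigD1_seq (m, j)) //= [Y in _ + Y]big1 ?addr0 => [|[m' j'] /= mj].
  by rewrite {1}PSI_expand //; apply: eq_bigr => b _; rewrite PHI_psis // !eqxx.
rewrite big1 // => b _; rewrite PHI_psis //; move: mj; rewrite xpair_eqE => /negPf ->.
exact: lin0 (PSI_linear b).
Qed.

End Coordinates.

End Decomposition.

(** * The modules N_(m,j) over the path algebra *)

Section Modules.
Variable R : pzRingType.
Implicit Types U W M N : lmodType R.

Lemma mk_linear U W (f : U -> W) : linear f -> exists g : {linear U -> W}, g =1 f.
Proof.
move=> fl; pose g : {linear U -> W} := HB.pack f (GRing.isLinear.Build R U W *:%R f fl).
by exists g.
Qed.

Lemma mod_isoI U W (f : U -> W) (g : W -> U) : linear f -> cancel f g -> cancel g f -> mod_iso U W.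
Proof.
move=> fl fg gf; have [h hE] := mk_linear fl; exists h; exists g => x; rewrite hE.
  exact: fg.
exact: gf.
Qed.

Lemma mod_isoE U W : mod_iso U W -> exists (f : {linear U -> W}) (g : {linear W -> U}),
  cancel f g /\ cancel g f.
Proof.
case=> f [g fg gf]; have gl : linear g.
  by move=> a x y; apply: (can_inj fg); rewrite linearP !gf.
have [h hE] := mk_linear gl; exists f, h; split=> x; rewrite hE; [exact: fg|exact: gf].
Qed.

Lemma mod_iso_refl U : mod_iso U U.
Proof. by apply: (@mod_isoI U U id id) => // a x y. Qed.
Lemma mod_iso_sym U W : mod_iso U W -> mod_iso W U.
Proof. by move=> /mod_isoE[f [g [fg gf]]]; exists g; exists f. Qed.
Lemma mod_iso_trans U W M : mod_iso U W -> mod_iso W M -> mod_iso U M.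
Proof.
move=> /mod_isoE[f [g [fg gf]]] /mod_isoE[f' [g' [fg' gf']]].
apply: (@mod_isoI U M (fun x => f' (f x)) (fun x => g (g' x))).
- by move=> a x y; rewrite !linearP.
- by move=> x; rewrite fg' fg.
- by move=> x; rewrite gf gf'.
Qed.

End Modules.

Section Submodule.
Variables (R : pzRingType) (M : lmodType R) (S : M -> Prop).

Definition smclosed := S 0 /\ forall a x y, S x -> S y -> S (a *: x + y).
(** The closure proof is a parameter so that the submodule structure can be inferred from the
    predicate. *)
Definition sm_pred of smclosed : {pred M} := fun x => `[< S x >].
Variable HS : smclosed.

Fact sm_submod_closed : submod_closed (sm_pred HS).
Proof.
case: (HS) => S0 SD; split; first exact/asboolP.
by move=> a x y /asboolP Sx /asboolP Sy; apply/asboolP; exact: SD.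
Qed.

HB.instance Definition _ := GRing.isSubmodClosed.Build R M (sm_pred HS)
  (GRing.submod_closed_semi sm_submod_closed).

Record submod := Submod { smv : M; smv_pred : smv \in sm_pred HS }.
HB.instance Definition _ := [isSub for smv].
HB.instance Definition _ := [Choice of submod by <:].
HB.instance Definition _ := [SubChoice_isSubLmodule of submod by <:].

Definition smk x (Sx : S x) : submod := Submod (asboolT Sx : x \in sm_pred HS).
Lemma smvP (x : submod) : S (smv x). Proof. exact: asboolW (smv_pred x). Qed.
Lemma smv_linear : linear smv. Proof. by []. Qed.
Lemma smv_inj : injective smv. Proof. exact: val_inj. Qed.
Lemma smvD (x y : submod) : smv (x + y) = smv x + smv y. Proof. by []. Qed.
Lemma smvZ a (x : submod) : smv (a *: x) = a *: smv x. Proof. by []. Qed.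

End Submodule.

Section ActionModule.
Variables (R : pzRingType) (V : zmodType) (act : R -> V -> V).

Record act_axioms : Prop := ActAxioms {
  actA : forall a b x, act a (act b x) = act (a * b) x;
  act1x : forall x, act 1 x = x;
  actDr : forall a x y, act a (x + y) = act a x + act a y;
  actDl : forall x a b, act (a + b) x = act a x + act b x }.

Definition actmod of act_axioms : Type := V.
Variable H : act_axioms.
HB.instance Definition _ := GRing.Zmodule.on (actmod H).
Let scl (a : R) (x : actmod H) : actmod H := act a x.
Fact actmod_A a b x : scl a (scl b x) = scl (a * b) x. Proof. exact: (actA H). Qed.
Fact actmod_1 : left_id 1 scl. Proof. exact: (act1x H). Qed.
Fact actmod_Dr : right_distributive scl +%R. Proof. exact: (actDr H). Qed.
Fact actmod_Dl x : {morph scl^~ x : a b / a + b}. Proof. exact: (actDl H). Qed.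
HB.instance Definition _ := GRing.Zmodule_isLmodule.Build R (actmod H)
  actmod_A actmod_1 actmod_Dr actmod_Dl.
Lemma actmodE (a : R) (x : actmod H) : a *: x = act a x. Proof. by []. Qed.
End ActionModule.

(** M is the direct sum of the image of [f] and the kernel of [g]; one of them is zero, and it is
    not the image. *)
Lemma split_summand (R : pzRingType) (N M : lmodType R) (f : N -> M) (g : M -> N) :
  linear f -> linear g -> cancel f g -> indecomposable M -> (exists x : N, x != 0) ->
  mod_iso M N.
Proof.
move=> fl gl fg [_ indM] [x0 x0n].
have KS : smclosed (fun x : M => g x = 0).
  have g0 : g 0 = 0 by rewrite -(subrr 0) -scaleN1r addrC gl scaleN1r addNr.
  by split=> // a x y gx gy; rewrite gl gx gy scaler0 addr0.
have kx x : g (x - f (g x)) = 0.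
  by rewrite addrC -scaleN1r gl fg scaleN1r addNr.
have f0 : f 0 = 0 by rewrite -(subrr 0) -scaleN1r addrC fl scaleN1r addNr.
have fD x y : f (x + y) = f x + f y by rewrite -[x]scale1r fl !scale1r.
have gD x y : g (x + y) = g x + g y by rewrite -[x]scale1r gl !scale1r.
have iso : mod_iso M (N * submod KS)%type.
  apply: (@mod_isoI _ M (N * submod KS)%type (fun x => (g x, smk KS (kx x)))
    (fun y => f y.1 + smv y.2)).
  - move=> a x y; congr (_, _); first exact: gl.
    by apply: smv_inj; rewrite smvD smvZ /= gl fl scalerBr opprD addrACA.
  - by move=> x /=; rewrite addrC subrK.
  - move=> [x [y ySP]] /=; have gy : g y = 0 by exact: smvP (Submod ySP).
    have E : g (f x + y) = x by rewrite gD fg gy addr0.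
    by congr (_, _); [exact: E|apply: smv_inj; rewrite /= E addrC addKr].
have [N0|K0] := indM _ _ iso; first by rewrite (N0 x0) eqxx in x0n.
apply: (@mod_isoI _ M N g f gl _ fg) => x.
have E1 : x - f (g x) = 0 by exact: (congr1 (@smv _ _ _ KS) (K0 (smk KS (kx x)))).
by apply/esym/eqP; rewrite -subr_eq0 E1.
Qed.

Section Bases.
Variables (k : fieldType) (V : lmodType k).

(** The change of basis matrices satisfy M M' = 1, and the rank of M is at most its number of
    columns. *)
Lemma basis_size_le (S : set V) n n' :
  has_basis_of_size S n -> has_basis_of_size S n' -> (n <= n')%N.
Proof.
case=> b [bS bE] [b' [bS' bE']].
have /choice[c cE] : forall l, exists c : {ffun 'I_n' -> k}, b l = \sum_i c i *: b' i.
  by move=> l; have [c [cE _]] := bE' _ (bS l); exists c.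
have /choice[c' cE'] : forall l, exists c : {ffun 'I_n -> k}, b' l = \sum_i c i *: b i.
  by move=> l; have [c1 [c1E _]] := bE _ (bS' l); exists c1.
pose M := \matrix_(l < n, l' < n') c l l'; pose M' := \matrix_(l' < n', l < n) c' l' l.
have MM : M *m M' = 1%:M.
  apply/matrixP => l l'; have [c0 [_ c0u]] := bE _ (bS l).
  have H1 : c0 = [ffun l' => (M *m M') l l'].
    apply: c0u; rewrite cE; transitivity (\sum_i \sum_j (c l i * c' i j) *: b j).
      by apply: eq_bigr => i _; rewrite cE' scaler_sumr; apply: eq_bigr => j _; rewrite scalerA.
    rewrite exchange_big; apply: eq_bigr => j _; rewrite ffunE mxE scaler_suml.
    by apply: eq_bigr => i _; rewrite !mxE.
  have H2 : c0 = [ffun l' => (l == l')%:R].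
    apply: c0u; rewrite (bigD1 l) //= ffunE eqxx scale1r big1 ?addr0 // => j /negPf lj.
    by rewrite ffunE eq_sym lj scale0r.
  by have := congr1 (fun f : {ffun 'I_n -> k} => f l') (etrans (esym H1) H2); rewrite !ffunE => ->; rewrite mxE.
have := mxrankM_maxl M M'; rewrite MM mxrank1 => /leq_trans; apply.
exact: rank_leq_col.
Qed.

Lemma dimkE (S : set V) n : has_basis_of_size S n -> dimk S = n.
Proof.
move=> Hn; have : has_basis_of_size S (dimk S).
  by rewrite /dimk; case: xgetP => [m -> //|/(_ n)]; case.
move=> Hd; apply/eqP; rewrite eqn_leq; apply/andP; split.
  exact: (basis_size_le Hd Hn).
exact: (basis_size_le Hn Hd).
Qed.

Lemma has_basis_mk (S : set V) n (b : 'I_n -> V) (c : 'I_n -> V -> k) :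
  (forall l, S (b l)) -> (forall l, linear (c l : V -> k^o)) ->
  (forall l l', c l (b l') = (l == l')%:R) ->
  (forall x, S x -> x = \sum_l c l x *: b l) -> has_basis_of_size S n.
Proof.
move=> bS cl cb xE; exists b; split=> // x Sx; exists [ffun l => c l x]; split.
  by rewrite {1}(xE x Sx); apply: eq_bigr => l _; rewrite ffunE.
move=> c' ->; apply/ffunP => l; rewrite ffunE (lin_sum (cl l)) (bigD1 l) //=.
rewrite (linZ (cl l)) cb eqxx big1 ?addr0; first by rewrite /GRing.scale /= mulr1.
by move=> l' /negPf ll; rewrite (linZ (cl l)) cb eq_sym ll scaler0.
Qed.

End Bases.

Section PathModules.
Variables (k : fieldType) (Q : quiver).
Notation R := (pathalg k Q).
Notation E i := (path_idem k (i : vert Q)).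
Notation X b := (path_arrow k (b : arrow Q)).

Lemma scalA (M : lmodType R) c (r : R) (x : M) : (c *: r) *: x = c%:A *: (r *: x).
Proof. by rewrite scalerA -scalerAl mul1r. Qed.

Lemma mod_ind (M : lmodType R) (S : M -> Prop) : S 0 -> (forall x y, S x -> S y -> S (x + y)) ->
  (forall c x, S x -> S (c%:A *: x)) -> (forall i x, S x -> S (E i *: x)) ->
  (forall b x, S x -> S (X b *: x)) -> forall r x, S x -> S (r *: x).
Proof.
move=> S0 SD SZ SE SX r x Sx; elim/pathalg_indl: r => [|f g Sf Sg|c f Sf|i|a f Sf].
- by rewrite scale0r.
- by rewrite scalerDl; exact: SD.
- by rewrite scalA; exact: SZ.
- exact: SE.
- by rewrite -scalerA; exact: SX.
Qed.

Lemma mod_linear (M N : lmodType R) (f : M -> N) : (forall x y, f (x + y) = f x + f y) ->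
  (forall c x, f (c%:A *: x) = c%:A *: f x) -> (forall i x, f (E i *: x) = E i *: f x) ->
  (forall b x, f (X b *: x) = X b *: f x) -> linear f.
Proof.
move=> fD fZ fE fX r x y; rewrite fD; congr (_ + _).
have f0 : f 0 = 0 by have /eqP := fD 0 0; rewrite addr0 -subr_eq0 opprD addrA subrr sub0r oppr_eq0 => /eqP.
elim/pathalg_indl: r => [|g h Sf Sg|c g Sf|i|a g Sf].
- by rewrite !scale0r.
- by rewrite !scalerDl fD Sf Sg.
- by rewrite scalA fZ Sf [RHS]scalA.
- exact: fE.
- by rewrite -!scalerA fX Sf.
Qed.

Lemma mdim_at_iso (e : R) (M N : lmodType R) n : mod_iso M N ->
  @has_basis_of_size k (kspace M) (range (fun x : M => e *: x)) n -> mdim_at e N = n.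
Proof.
move=> /mod_isoE[f [g [fg gf]]] [b [bS bE]]; apply: dimkE.
exists (fun l => f (b l)); split=> [l|x [y _ yx]].
  by have [y _ <-] := bS l; exists (f y) => //; rewrite linearZ.
have [|c [cE cu]] := bE (g x); first by exists (g y) => //; rewrite -linearZ yx.
have H (c' : {ffun 'I_n -> k}) : x = \sum_i c' i *: (f (b i) : kspace N) <-> g x = \sum_i c' i *: (b i : kspace M).
  have E1 : f (\sum_i c' i *: (b i : kspace M)) = \sum_i c' i *: (f (b i) : kspace N).
    have Z (a : R) (z : M) : f (a *: z) = a *: f z by exact: linearZ.
    by rewrite (raddf_sum f); apply: eq_bigr => i _; exact: Z.
  by split=> [->|gx]; [rewrite -E1 fg|rewrite -E1 -gx gf].
by exists c; split=> [|c' /H]; [apply/H|exact: cu].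
Qed.

Lemma mdim_iso (M N : lmodType R) n : mod_iso M N ->
  @has_basis_of_size k (kspace M) setT n -> mdim N = n.
Proof.
move=> MN Hb; rewrite -(@mdim_at_iso 1 M N n MN).
  rewrite /mdim /mdim_at; congr dimk; apply/seteqP; split=> // x _.
  by exists x => //; rewrite scale1r.
have -> : range (fun x : M => 1 *: x) = setT; last exact: Hb.
by apply/seteqP; split=> // x _; exists x => //; rewrite scale1r.
Qed.

Section Simple.
Variable i : vert Q.
Let sact (r : R) (c : k) : k := coef r (ptriv i) * c.

Fact coef_trivM (f g : R) : coef (f * g) (ptriv i) = coef f (ptriv i) * coef g (ptriv i).
Proof.
have -> : coef (f * g) (ptriv i) =
  \sum_(n < 1) coef f (ptake n (ptriv i)) * coef g (pdrop n (ptriv i)) by [].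
have E1 : ptake 0 (ptriv i) = ptriv i by exact: val_inj.
have E2 : pdrop 0 (ptriv i) = ptriv i by exact: val_inj.
by rewrite big_ord1 E1 E2.
Qed.

Fact sact_axioms : act_axioms sact.
Proof.
split=> [a b x|x|a x y|x a b]; rewrite /sact.
- by rewrite coef_trivM mulrA.
- by rewrite (_ : coef 1 _ = 1) ?mul1r // [LHS]coef1.
- exact: mulrDr.
- by rewrite coefD mulrDl.
Qed.

Definition simple_mod : lmodType R := actmod sact_axioms.

Lemma simple_indec : indecomposable simple_mod.
Proof.
split; first by exists (1 : k); exact: oner_neq0.
move=> U W /mod_isoE[f [g [fg gf]]].
have [W0|/existsNP[w /eqP w0]] := EM (forall w : W, w = 0); [by right|left=> u].
pose c : k := g (u, 0); pose d : k := g (0, w).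
have d0 : d != 0.
  apply: contra_neq w0 => d0; have := gf (0, w); rewrite -/d d0.
  by rewrite (raddf0 f) => -[].
have H : ((c / d)%:A : R) *: (g (0, w)) = g (u, 0) :> simple_mod.
  rewrite actmodE /sact -/c -/d (_ : coef (c / d)%:A _ = c / d) ?divfK //.
  by rewrite coefZ [coef 1 _]coef1 mulr1.
have := congr1 f H; rewrite linearZ !gf => -[<- _].
by rewrite scaler0.
Qed.

Lemma simple_dim l : mdim_at (E l) simple_mod = (l == i).
Proof.
apply: dimkE; have [li|li] := eqVneq l i; last first.
  exists (fun l => 0); split=> [[]//|x [y _ <-]].
  exists [ffun=> 0]; split; last by move=> c' _; apply/ffunP => -[].
  rewrite big_ord0 actmodE /sact coef_base (_ : (ptriv i == ptriv l) = false) ?mul0r //.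
  by apply/negP => /eqP[il]; rewrite il eqxx in li.
apply: (@has_basis_mk k (kspace simple_mod) _ 1 (fun=> 1 : k) (fun _ x => x : k)).
- by move=> _; exists (1 : k) => //; rewrite actmodE /sact li coef_base eqxx mulr1.
- move=> _ c x y; rewrite -[c *: x]/(sact c%:A x) /sact (_ : coef c%:A _ = c) //.
  by rewrite coefZ [coef 1 _]coef1 mulr1.
- by move=> a b; rewrite !ord1.
move=> x _; rewrite big_ord1 -[RHS]/(sact x%:A 1) /sact.
by rewrite coefZ [coef 1 _]coef1 !mulr1.
Qed.

Lemma simple_fin : fin_dim simple_mod.
Proof.
exists 1%N; apply: (@has_basis_mk k (kspace simple_mod) _ 1 (fun=> 1 : k) (fun _ x => x : k)) => //.
- move=> _ c x y; rewrite -[c *: x]/(sact c%:A x) /sact (_ : coef c%:A _ = c) //.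
  by rewrite coefZ [coef 1 _]coef1 mulr1.
- by move=> a b; rewrite !ord1.
move=> x _; rewrite big_ord1 -[RHS]/(sact x%:A 1) /sact.
by rewrite coefZ [coef 1 _]coef1 !mulr1.
Qed.

End Simple.

(** Regularity at the simple module of the vertex, whose dimension vector is a unit vector. *)
Lemma regular_neq0 (v : vert Q -> k) : regular_weight v -> forall i, v i != 0.
Proof.
move=> vr i; have := vr _ (simple_fin i) (simple_indec i).
rewrite (bigD1 i) //= simple_dim eqxx mulr1 big1 ?addr0 // => l /negPf li.
by rewrite simple_dim li mulr0.
Qed.

End PathModules.

Section Preproj.
Variables (k : fieldType) (Q : quiver) (Qacyc : quiver_acyclic Q).
Notation DQ := (double_quiver Q).
Notation V := (vert DQ).
Notation A := (arrow DQ).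
Notation P := (ppa k Q).
Notation pe i := (@pe k Q i).
Notation pa a := (@pa k Q a).
Notation pl b := (pa (inl b)).
Notation rk := (rk Qacyc).
Notation dead := (@dead k Q).
Notation fdN := (@fdN k Q Qacyc).
Notation fdNe := (@fdNe k Q Qacyc).
Implicit Types (a : A) (b : arrow Q) (i j q : V) (x y z : P) (m : int).
Notation R := (pathalg k Q).
Notation E i := (path_idem k (i : vert Q)).
Notation X b := (path_arrow k (b : arrow Q)).

Definition pinc : {rmorphism pathalg k Q -> ppa k Q} :=
  quot_map [set trho k Q]%classic \o @path_embed k Q.
Definition PM : lmodType R := res_scalars pinc P^o.

Lemma pincE i : pinc (E i) = pe i.
Proof.
rewrite /pinc /= /path_idem path_embed_base; congr (pq (pathbase k _)).
exact: val_inj.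
Qed.
Lemma pincX b : pinc (X b) = pl b.
Proof.
rewrite /pinc /= /path_arrow path_embed_base; congr (pq (pathbase k _)).
exact: val_inj.
Qed.
Lemma path_embedZ c (r : R) : path_embed (c *: r) = c *: path_embed r.
Proof.
apply: pathalg_ext => q; rewrite coefZ !coef_embed; case: ifP => _; last by rewrite mulr0.
by rewrite coefZ.
Qed.
Lemma pincZ c (r : R) : pinc (c *: r) = c *: pinc r.
Proof. by rewrite /pinc /= path_embedZ; exact: quot_mapZ. Qed.
Lemma PM_scale (r : R) (x : PM) : r *: x = pinc r * x :> P. Proof. by []. Qed.
Lemma PM_scaleA c (x : PM) : (c%:A : R) *: x = c *: (x : P) :> P.
Proof. by rewrite PM_scale pincZ rmorph1 -pZl mul1r. Qed.
Lemma PM_scaleE i (x : PM) : E i *: x = pe i * x :> P. Proof. by rewrite PM_scale pincE. Qed.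
Lemma PM_scaleX b (x : PM) : X b *: x = pl b * x :> P. Proof. by rewrite PM_scale pincX. Qed.

Section PMsub.
Variables (S : PM -> Prop) (HS : smclosed S).
Implicit Types t : submod HS.
Lemma smE i t : smv (E i *: t) = pe i * smv t :> P.
Proof. by rewrite smvZ; exact: PM_scaleE. Qed.
Lemma smX b t : smv (X b *: t) = pl b * smv t :> P.
Proof. by rewrite smvZ; exact: PM_scaleX. Qed.
Lemma smA c t : smv ((c%:A : R) *: t) = c *: (smv t : P) :> P.
Proof. by rewrite smvZ; exact: PM_scaleA. Qed.
End PMsub.

Lemma PM_closed (S : P -> Prop) : S 0 -> (forall x y, S x -> S y -> S (x + y)) ->
  (forall c x, S x -> S (c *: x)) -> (forall i x, S x -> S (pe i * x)) ->
  (forall b x, S x -> S (pl b * x)) -> smclosed (S : PM -> Prop).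
Proof.
move=> S0 SD SZ SE SX; split=> // r x y Sx Sy; apply: (SD) => //.
apply: (@mod_ind k Q PM S) => // [c z Sz|i z Sz|b z Sz].
- by rewrite PM_scaleA; exact: SZ.
- by rewrite PM_scaleE; exact: SE.
- by rewrite PM_scaleX; exact: SX.
Qed.

Fact PI_closed m : smclosed (fun x : PM => prs m (x : P) = x).
Proof.
have pl' : linear (@prs k Q m) by exact: pr_linear.
apply: PM_closed => [|x y ex ey|c x ex|i x ex|b x ex].
- exact: lin0 pl'.
- by rewrite (linD pl') ex ey.
- by rewrite (linZ pl') ex.
- by rewrite prs_pel ex.
- by rewrite prs_pal subr0 ex.
Qed.
Fact N_closed m j : smclosed (fun x : PM => inN m j (x : P)).
Proof.
apply: PM_closed => [|x y|c x|i x|b x].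
- exact: inN0.
- exact: inND.
- exact: inNZ.
- exact: inN_pel.
- exact: inN_pl.
Qed.

Definition PImod m : lmodType R := submod (PI_closed m).
Definition Nmod m j : lmodType R := submod (N_closed m j).

Lemma Nmod_hom m j m' j' (f : Nmod m j -> Nmod m' j') : linear f ->
  exists u, [/\ inN (m' - m) j' u, pe j * u = u & forall x : Nmod m j, smv (f x) = smv x * u :> P].
Proof.
move=> fl; have f0 : f 0 = 0.
  by have := fl 1 0 0; rewrite scaler0 addr0 scale1r -[Y in Y = _]addr0 => /addrI <-.
have fZ (r : R) (x : Nmod m j) : f (r *: x) = r *: f x by have := fl r x 0; rewrite f0 !addr0.
pose sk x : Nmod m j := smk (N_closed m j) (nx_idem m j x : inN m j (nx m j x)).
pose h x : P := smv (f (sk x)).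
have hE (x : Nmod m j) : h (smv x) = smv (f x).
  by rewrite /h; congr (smv (f _)); apply: smv_inj; exact: smvP x.
have H : Nhom m j m' j' h.
  split=> [c x y|x xN|q x xN|b x xN].
  - have skD : sk (c *: x + y) = (c%:A : R) *: sk x + sk y.
      apply: smv_inj; transitivity ((c%:A : R) *: (smv (sk x) : PM) + smv (sk y) : P); last by [].
      by rewrite PM_scaleA; exact: nx_linear c x y.
    transitivity ((c%:A : R) *: (smv (f (sk x)) : PM) + smv (f (sk y)) : P); last by rewrite PM_scaleA.
    by rewrite /h skD fl.
  - exact: smvP.
  - have {1}-> : pe q * x = smv (E q *: (smk (N_closed m j) xN : Nmod m j)) by rewrite smE.
    rewrite hE fZ -[x in RHS]/(smv (smk (N_closed m j) xN : Nmod m j)) hE.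
    exact: smE.
  - have {1}-> : pl b * x = smv (X b *: (smk (N_closed m j) xN : Nmod m j)) by rewrite smX.
    rewrite hE fZ -[x in RHS]/(smv (smk (N_closed m j) xN : Nmod m j)) hE.
    exact: smX.
have [u [uN ju uE]] := Nhom_right Qacyc H; exists u; split=> // x.
by rewrite -hE uE //; exact: smvP.
Qed.

Lemma Nmod_end m j (f : Nmod m j -> Nmod m j) : linear f ->
  exists c : k, forall x : Nmod m j, f x = c%:A *: x.
Proof.
move=> /Nmod_hom[u [uN ju uE]]; rewrite subrr in uN.
have [c] := N0_rank (negbT (ltnn (rk j))) uN ju; rewrite eqxx => uc.
exists c => x; apply: smv_inj; rewrite uE uc smvZ -[RHS]/((c%:A : R) *: (smv x : PM)) PM_scaleA -pZr.
by rewrite (inN_pe (smvP x)).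
Qed.

Lemma Nmod_neq0 m j : ~ dead m j -> exists x : Nmod m j, x != 0.
Proof.
move=> /existsNP[x /not_implyP[xN /eqP x0]]; exists (smk (N_closed m j) xN).
by apply: contra_neq x0 => /(congr1 (@smv _ _ _ _)).
Qed.

(** The projector onto U is an endomorphism, hence a scalar; a nonzero W forces the scalar 0, and
    then U = 0. *)
Lemma Nmod_indec m j : ~ dead m j -> indecomposable (Nmod m j).
Proof.
move=> al; split; first exact: Nmod_neq0.
move=> U W /mod_isoE[f [g [fg gf]]].
pose e (x : Nmod m j) : Nmod m j := g ((f x).1, 0).
have el : linear e.
  move=> a x y; rewrite /e -linearP; congr (g _); rewrite linearP.
  by congr (_, _); rewrite /= scaler0 addr0.
have [c cE] := Nmod_end el.
have [W0|/existsNP[w /eqP w0]] := EM (forall w : W, w = 0); [by right|left=> u].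
have E1 : c%:A *: g (0, w) = 0.
  rewrite -cE /e gf; have -> : ((0, w).1, 0) = 0 :> U * W by [].
  exact: raddf0.
have c0 : c = 0.
  apply/eqP; apply: contra_neqT w0 => c0.
  have : (c^-1%:A : R) *: (c%:A *: g (0, w)) = 0 by rewrite E1 scaler0.
  rewrite scalerA -scalerAl mul1r scalerA mulVf // scale1r scale1r.
  by move=> /(congr1 f); rewrite gf (raddf0 f) => -[].
have : e (g (u, 0)) = 0 by rewrite cE c0 scale0r scale0r.
by rewrite /e gf /= => /(congr1 f); rewrite gf (raddf0 f) => -[].
Qed.

Lemma smv_klinear (S : PM -> Prop) (HS : smclosed S) : linear (fun x : kspace (submod HS) => smv x : P).
Proof. by move=> c x y; rewrite -(smA c (x : submod HS)). Qed.

Lemma submod_basis (S : PM -> Prop) (HS : smclosed S) (T : submod HS -> Prop) (pi : P -> P) (F : fdim pi)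
  (bS : forall l, S (fdb F l)) : (forall l, T (smk HS (bS l))) ->
  (forall x : submod HS, T x -> pi (smv x) = smv x) -> @has_basis_of_size k (kspace (submod HS)) T (fdn F).
Proof.
move=> bT Tpi; have sl := @smv_klinear S HS.
apply: (@has_basis_mk k (kspace (submod HS)) T (fdn F) (fun l => smk HS (bS l))
  (fun l (x : kspace (submod HS)) => fdc F l (smv x))) => //.
- by move=> l; exact: lin_comp (fdc_linear l) sl.
- by move=> l l'; exact: fdcb.
move=> x Tx; apply: smv_inj; rewrite (lin_sum sl) -{1}(Tpi x Tx) (fdpi F).
by apply: eq_bigr => l _; rewrite (linZ sl).
Qed.

Lemma Nmod_basis_at i m j :
  @has_basis_of_size k (kspace (Nmod m j)) (range (fun x : Nmod m j => E i *: x)) (fdn (fdNe i m j)).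
Proof.
have bN l : inN m j (fdb (fdNe i m j) l) by rewrite -fdb_pi; apply: inN_pel; rewrite /inN nx_idem.
have be l : pe i * fdb (fdNe i m j) l = fdb (fdNe i m j) l by rewrite -fdb_pi mulrA pee.
apply: (@submod_basis _ (N_closed m j) (range (fun x : Nmod m j => E i *: x)) _ (fdNe i m j) bN) => [l|x [y _ <-]].
  exists (smk (N_closed m j) (bN l)) => //; apply: smv_inj.
  exact: etrans (smE i (smk (N_closed m j) (bN l))) (be l).
have yN := smvP y; rewrite (smE i y) nx_pel mulrA pee.
by congr (_ * _); exact: yN.
Qed.

Lemma Nmod_basis m j : @has_basis_of_size k (kspace (Nmod m j)) setT (fdn (fdN m j)).
Proof.
have bN l : inN m j (fdb (fdN m j) l) by exact: fdb_pi.
apply: (@submod_basis _ (N_closed m j) setT _ (fdN m j) bN) => // x _.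
exact: (smvP x).
Qed.

(** By cyclicity the trace of e_i on N_(m,j) is dim e_i N_(m,j), so the trace of the weight is the
    regularity sum of an indecomposable module. *)
Lemma Nmod_chi (v : vert Q -> k) : regular_weight v ->
  forall m j, ~ dead m j -> ftr (fdN m j) (@vm k Q v) != 0.
Proof.
move=> vr m j al; have : fin_dim (Nmod m j) by eexists; exact: Nmod_basis.
move=> /vr/(_ (Nmod_indec al)); congr (_ != 0); rewrite ftr_sum; apply: eq_bigr => i _.
rewrite ftr_scale; congr (_ * _).
rewrite (mdim_at_iso (mod_iso_refl _) (Nmod_basis_at i m j)) -(ftr_id (fdNe i m j)).
apply/esym; rewrite (@ftr_cycle k P P _ _ (fdN m j) (fdNe i m j) (fun x => pe i * x) id) //.
- by apply: ftr_eq => x <-; rewrite mulrA pee.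
- exact: pel_linear.
- by move=> x xN; rewrite nx_pel xN mulrA pee.
- by move=> x <-; rewrite nx_pel nx_idem.
Qed.

End Preproj.

Section LinearMaps.
Variables (A0 : pzRingType) (U W : lmodType A0) (f : {linear U -> W}).
Lemma linS a x : f (a *: x) = a *: f x. Proof. exact: linearZ. Qed.
Lemma linDD x y : f (x + y) = f x + f y. Proof. exact: raddfD. Qed.
Lemma linSum I (r : seq I) (T : pred I) (F : I -> U) :
  f (\sum_(i <- r | T i) F i) = \sum_(i <- r | T i) f (F i).
Proof. exact: raddf_sum. Qed.
Lemma linBB x y : f (x - y) = f x - f y. Proof. exact: raddfB. Qed.
End LinearMaps.

(** * The inverse Auslander-Reiten translate of Pi_m *)

Section RightModules.
Variables (k : fieldType) (Q : quiver).
Notation R := (pathalg k Q).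
Notation eC i := (path_idem k (i : vert Q) : R^c).
Notation xC b := (path_arrow k (b : arrow Q) : R^c).

Definition kc (c : k) : R^c := (c%:A : R).
Fact kc_zmod : zmod_morphism kc. Proof. by move=> c d; rewrite /kc scalerBl. Qed.
Fact kc_monoid : monoid_morphism kc.
Proof.
split=> [|c d]; rewrite /kc; first exact: scale1r.
by rewrite -[RHS]/((d%:A : R) * c%:A) -scalerAl mul1r scalerA mulrC.
Qed.
HB.instance Definition _ := GRing.isZmodMorphism.Build k R^c kc kc_zmod.
HB.instance Definition _ := GRing.isMonoidMorphism.Build k R^c kc kc_monoid.

Section One.
Variable Y : lmodType R^c.
Implicit Types x y : Y.

Lemma rA (f g : R) x : (f : R^c) *: ((g : R^c) *: x) = ((g * f : R) : R^c) *: x :> Y.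
Proof. exact: scalerA. Qed.
Lemma rZ c (f : R) x : ((c *: f : R) : R^c) *: x = kc c *: ((f : R^c) *: x) :> Y.
Proof. by rewrite rA -scalerAr mulr1. Qed.
Lemma kcC c (f : R^c) x : f *: (kc c *: x) = kc c *: (f *: x).
Proof. by rewrite -rZ rA -scalerAl mul1r. Qed.
Lemma kcM c d x : kc c *: (kc d *: x) = kc (c * d) *: x.
Proof. by rewrite scalerA rmorphM. Qed.
Lemma kc1 x : kc 1 *: x = x. Proof. by rewrite rmorph1 scale1r. Qed.
Lemma kc0 x : kc 0 *: x = 0. Proof. by rewrite rmorph0 scale0r. Qed.
Lemma eCe i j x : eC i *: (eC j *: x) = if i == j then eC i *: x else 0.
Proof. by rewrite rA idemM eq_sym; case: eqP => [->|_] //; exact: scale0r. Qed.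
Lemma eCx i b x : eC i *: (xC b *: x) = if qhead b == i then xC b *: x else 0.
Proof. by rewrite rA arrow_idem; case: eqP => // _; exact: scale0r. Qed.
Lemma xCe i b x : xC b *: (eC i *: x) = if i == qtail b then xC b *: x else 0.
Proof. by rewrite rA idem_arrow; case: eqP => // _; exact: scale0r. Qed.
Lemma eC_sum x : x = \sum_i eC i *: x.
Proof.
rewrite -scaler_suml; have -> : \sum_i eC i = 1 by exact: (idem_sum k Q).
by rewrite scale1r.
Qed.

Lemma rmod_ind (S : Y -> Prop) : S 0 -> (forall x y, S x -> S y -> S (x + y)) ->
  (forall c x, S x -> S (kc c *: x)) -> (forall i x, S x -> S (eC i *: x)) ->
  (forall b x, S x -> S (xC b *: x)) -> forall (r : R^c) x, S x -> S (r *: x).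
Proof.
move=> S0 SD SZ SE SX r; elim/(@pathalg_indl k Q): r => [|f g Sf Sg|c f Sf|i|a f Sf] x Sx.
- by rewrite scale0r.
- by rewrite scalerDl; apply: (SD); [exact: Sf|exact: Sg].
- by rewrite rZ; apply: SZ; exact: Sf.
- exact: SE.
- by rewrite -rA; apply: Sf; exact: SX.
Qed.

(** Acting by [xC b] leads from the tail of b to its head, so modulo S everything at a vertex comes
    from vertices of smaller rank; induction on the rank takes the place of finite generation. *)
Lemma nakayama (Qacyc : quiver_acyclic Q) (S : Y -> Prop) : smclosed S ->
  (forall x, exists s (y : arrow Q -> Y), S s /\ x = s + \sum_b xC b *: y b) -> forall x, S x.
Proof.
move=> [S0 SZ] SR x; have SD y z : S y -> S z -> S (y + z).
  by move=> Sy Sz; rewrite -[y]scale1r; exact: SZ.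
have Sc r y : S y -> S (r *: y) by move=> Sy; rewrite -[_ *: y]addr0; exact: SZ.
have Ss I (s : seq I) (T : pred I) (F : I -> Y) : (forall i, T i -> S (F i)) -> S (\sum_(i <- s | T i) F i).
  by move=> FS; elim/big_ind: _.
suff H h z : S (eC h *: z) by rewrite [x]eC_sum; apply: Ss => i _; exact: H.
have [m] := ubnP (rk Qacyc h); elim: m h z => // m IHm h z hm.
have [s [y [Ss0 ->]]] := SR z; rewrite scalerDr scaler_sumr; apply: (SD); first exact: Sc.
apply: Ss => b _; rewrite eCx; case: eqP => // bh.
have -> : xC b *: y b = xC b *: (eC (qtail b) *: y b) by rewrite xCe eqxx.
apply: Sc; apply: IHm; have := rk_lt Qacyc b; rewrite bh; lia.
Qed.

End One.

Lemma rmod_linear (Y Z : lmodType R^c) (f : Y -> Z) : (forall x y, f (x + y) = f x + f y) ->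
  (forall c x, f (kc c *: x) = kc c *: f x) -> (forall i x, f (eC i *: x) = eC i *: f x) ->
  (forall b x, f (xC b *: x) = xC b *: f x) -> linear f.
Proof.
move=> fD fZ fE fX r x y; rewrite fD; congr (_ + _).
have f0 : f 0 = 0 by have /eqP := fD 0 0; rewrite addr0 -subr_eq0 opprD addrA subrr sub0r oppr_eq0 => /eqP.
move: x; elim/(@pathalg_indl k Q): r => [|g h Sf Sg|c g Sf|i|a g Sf] x.
- by rewrite !scale0r.
- by rewrite !scalerDl fD Sf Sg.
- by rewrite (rZ c g x) fZ Sf (rZ c g (f x)).
- exact: fE.
- by rewrite -!rA Sf fX.
Qed.

Lemma coker_iso (A0 : pzRingType) (W N N' : lmodType A0) (q : {linear W -> N}) (q' : {linear W -> N'}) :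
  range q = setT -> range q' = setT -> (forall f, q f = 0 <-> q' f = 0) -> mod_iso N N'.
Proof.
move=> qs qs' qq; have /choice[s sE] : forall y, exists x, q x = y.
  move=> y; have : (@classical_sets.setT N) y by [].
  by rewrite -qs => -[x _ xy]; exists x.
have /choice[s' sE'] : forall y, exists x, q' x = y.
  move=> y; have : (@classical_sets.setT N') y by [].
  by rewrite -qs' => -[x _ xy]; exists x.
have K x y : q x = q y <-> q' x = q' y.
  have := qq (x - y); rewrite !raddfB => -[h1 h2].
  split=> /eqP; rewrite -subr_eq0 => /eqP E; apply/eqP; rewrite -subr_eq0; apply/eqP.
    exact: h1.
  exact: h2.
apply: (@mod_isoI _ N N' (fun y => q' (s y)) (fun y => q (s' y))).
- by move=> a x y; rewrite -linearP; apply/K; rewrite linearP !sE.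
- by move=> y; rewrite -[RHS]sE; apply/K; rewrite sE'.
- by move=> y; rewrite -[RHS]sE'; apply/K; rewrite sE.
Qed.

End RightModules.

Section LeftDivision.
Variables (k : fieldType) (Q : quiver).
Notation E i := (path_idem k (i : vert Q)).
Lemma ldiv_head (a : arrow Q) f : E (qhead a) * ldiv a f = ldiv a f.
Proof.
have [c cE] := ldiv_decomp f; have dl := @ldiv_linear k Q a.
rewrite {2}cE (linD dl) !(lin_sum dl) [Y in _ = Y + _]big1 ?add0r; last first.
  by move=> i _; rewrite (linZ dl) ldiv_idem scaler0.
rewrite (bigD1 a) //= ldiv_arrow eqxx big1 ?addr0 // => b /negPf ba.
by rewrite ldiv_arrow ba.
Qed.
Lemma ldivMr (a : arrow Q) f i : ldiv a (f * E i) = ldiv a f * E i.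
Proof.
have [c cE] := ldiv_decomp f; have dl := @ldiv_linear k Q a.
set r := RHS; rewrite cE mulrDl !mulr_suml (linD dl) !(lin_sum dl) [Y in Y + _]big1 ?add0r; last first.
  move=> j _; rewrite -scalerAl idemM (linZ dl); case: eqP => _; last by rewrite (lin0 dl) scaler0.
  by rewrite ldiv_idem scaler0.
rewrite (bigD1 a) //= -mulrA ldiv_arrow eqxx mulrA ldiv_head /r big1 ?addr0 // => b /negPf ba.
by rewrite -mulrA ldiv_arrow ba.
Qed.
End LeftDivision.

(** * The transpose of the dual of Pi_n *)

Section TrD.
Variables (k : fieldType) (Q : quiver) (Qacyc : quiver_acyclic Q).
Notation DQ := (double_quiver Q).
Notation V := (vert DQ).
Notation A := (arrow DQ).
Notation P := (ppa k Q).
Notation pe i := (@pe k Q i).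
Notation pa a := (@pa k Q a).
Notation pl b := (pa (inl b)).
Notation ps b := (pa (inr b)).
Notation base p := (pq (pathbase k p)).
Implicit Types (b : arrow Q) (i j q : V) (y : P) (m : int).
Notation R := (pathalg k Q).
Notation eC i := (path_idem k (i : vert Q) : R^c).
Notation xC b := (path_arrow k (b : arrow Q) : R^c).
Notation E i := (path_idem k (i : vert Q)).
Notation X b := (path_arrow k (b : arrow Q)).
Notation kc := (@kc k Q).
Notation pinc := (@pinc k Q).
Variable n : nat.
Notation M := (@PImod k Q n%:Z).

Fact fdS_exists : exists F : fdim (@prs k Q n%:Z), forall l, exists p : qpath DQ, starp p = n%:Z /\ fdb F l = base p.
Proof.
have [|p|p /eqP|F FP] := @path_fdim k Q Qacyc n%:Z (@prs k Q n%:Z) (fun p => starp p == n%:Z).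
- exact: pr_linear.
- exact: prs_base.
- by [].
by exists F => l; have [p [/eqP pn pb]] := FP l; exists p.
Qed.
Definition fdS : fdim (@prs k Q n%:Z) := sval (cid fdS_exists).
Notation N := (fdn fdS).
Lemma fdS_base (l : 'I_N) : exists p : qpath DQ, starp p = n%:Z /\ fdb fdS l = base p.
Proof. by move: l; rewrite /fdS; case: cid. Qed.
Definition bp (l : 'I_N) : qpath DQ := sval (cid (fdS_base l)).
Definition src (l : 'I_N) : V := psrc (bp l).
Definition mb (l : 'I_N) : P := fdb fdS l.
Implicit Types l : 'I_N.
Lemma mb_src i l : pe i * mb l = if i == src l then mb l else 0.
Proof.
have [_ bE] : starp (bp l) = n%:Z /\ fdb fdS l = base (bp l) by exact: (svalP (cid (fdS_base l))).
by rewrite /mb bE pe_base.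
Qed.
Lemma mb_prs l : prs n%:Z (mb l) = mb l. Proof. exact: fdb_pi. Qed.
Definition mB l : M := smk (@PI_closed k Q n%:Z) (mb_prs l).
Lemma fdc_src i l (y : P) : fdc fdS l (pe i * y) = if i == src l then fdc fdS l y else 0.
Proof.
rewrite -fdc_pi prs_pel -[in RHS]fdc_pi; move: (prs n%:Z y) => {}y.
suff H y' : prs n%:Z y' = y' -> fdc fdS l (pe i * y') = if i == src l then fdc fdS l y' else 0.
  rewrite -fdc_pi prs_pel H; first by case: eqP => // _; exact: fdc_pi.
  by rewrite prs_prs eqxx.
apply: (fd_eq (F := fdS) (g := fun y => fdc fdS l (pe i * y) : k^o)
  (h := fun y => (if i == src l then fdc fdS l y else 0) : k^o)).
- exact: lin_comp (fdc_linear l) (pel_linear i).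
- apply: lin_if; exact: fdc_linear.
move=> l'; rewrite -/(mb l') mb_src; case: (i =P src l') => [->|il'].
  rewrite [in LHS]fdcb [fdc _ _ (mb _)]fdcb; case: (l =P l') => [->|_]; first by rewrite eqxx.
  by case: eqP.
rewrite [fdc _ _ (mb _)]fdcb (lin0 (fdc_linear l)); case: (l =P l') => [ll|_]; last by rewrite if_same.
by case: eqP => // il; rewrite il ll in il'.
Qed.

Lemma prs_pinc m (r : R) (y : P) : prs m (pinc r * y) = pinc r * prs m y.
Proof.
have pl' := @prs_linear k Q m.
elim/(@pathalg_indl k Q): r => [|f g Hf Hg|c f Hf|i|b f Hf].
- by rewrite rmorph0 !mul0r (lin0 pl').
- by rewrite rmorphD !mulrDl (linD pl') Hf Hg.
- by rewrite pincZ -!pZl (linZ pl') Hf.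
- by rewrite pincE prs_pel.
- by rewrite rmorphM pincX -!mulrA prs_pal subr0 Hf.
Qed.

Lemma pincB (f g : R) : pinc (f - g) = pinc f - pinc g.
Proof. exact: (raddfB pinc). Qed.
Lemma ps_mb0 b l : src l != qtail b -> ps b * mb l = 0.
Proof.
by move=> lb; apply: (@ps_pe0 k Q b (src l)); [rewrite mb_src eqxx|rewrite eq_sym].
Qed.
Lemma pl_mb0 b l : src l != qhead b -> pl b * mb l = 0.
Proof.
by move=> lb; apply: (@pl_pe0 k Q b (src l)); [rewrite mb_src eqxx|rewrite eq_sym].
Qed.
Lemma fdc_pl0 b l y : src l != qtail b -> fdc fdS l (pl b * y) = 0.
Proof. by rewrite -pe_pl fdc_src eq_sym => /negPf ->. Qed.

Notation sR b l l' := (fdc fdS l (pl b * mb l')).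

(* An exactness property of Pi in degree n + 1: a relation between the elements b^* m_l is a
   consequence of the preprojective relation. *)
Lemma syzygy (Ga : arrow Q -> 'I_N -> R) : (forall b l, Ga b l * E (qhead b) = Ga b l) ->
  (forall b l, src l != qtail b -> Ga b l = 0) ->
  \sum_b \sum_l pinc (Ga b l) * (ps b * mb l) = 0 ->
  exists G : 'I_N -> R, (forall l, G l * E (src l) = G l) /\
    forall b l, Ga b l = G l * X b - \sum_l' sR b l l' *: G l'.
Proof.
(* The coefficients are split by their left vertex s, on which a downward induction runs. *)
suff step s : forall Ga' : arrow Q -> 'I_N -> R, (forall b l, E s * Ga' b l = Ga' b l) ->
    (forall b l, Ga' b l * E (qhead b) = Ga' b l) -> (forall b l, src l != qtail b -> Ga' b l = 0) ->
    \sum_b \sum_l pinc (Ga' b l) * (ps b * mb l) = 0 ->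
    exists G : 'I_N -> R, (forall l, G l * E (src l) = G l) /\
    forall b l, Ga' b l = G l * X b - \sum_l' sR b l l' *: G l'.
  move=> Gh Gs Ga0; have /choice[G GP] : forall s, exists G : 'I_N -> R,
      (forall l, G l * E (src l) = G l) /\ forall b l,
      E s * Ga b l = G l * X b - \sum_l' sR b l l' *: G l'.
    move=> s; have [|||| G GP] := step s (fun b l => E s * Ga b l).
    - by move=> b l; rewrite mulrA idemM eqxx.
    - by move=> b l; rewrite -mulrA Gh.
    - by move=> b l /Gs ->; rewrite mulr0.
    - transitivity (pe s * \sum_b \sum_l pinc (Ga b l) * (ps b * mb l)); last by rewrite Ga0 mulr0.
      rewrite mulr_sumr; apply: eq_bigr => b _.
      by rewrite mulr_sumr; apply: eq_bigr => l _; rewrite rmorphM pincE -mulrA.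
    by exists G.
  exists (fun l => \sum_s G s l); split=> [l|b l].
    by rewrite mulr_suml; apply: eq_bigr => s _; case: (GP s).
  rewrite -[LHS]mul1r -(idem_sum k Q) mulr_suml.
  rewrite (eq_bigr _ (fun s _ => (GP s).2 b l)) sumrB mulr_suml; congr (_ - _).
  by rewrite exchange_big; apply: eq_bigr => l' _; rewrite scaler_sumr.
elim/(@rank_ind Q Qacyc): s => s IH {}Ga sG Gh Gs Ga0.
have /choice[c0 c0E] : forall bl : arrow Q * 'I_N, exists c : k, Ga bl.1 bl.2 =
    (if qhead bl.1 == s then c *: E s else 0) + \sum_(a : arrow Q | qtail a == s) X a * ldiv a (Ga bl.1 bl.2).
  move=> [b l] /=; have [c cE] := ldiv_decomp (Ga b l); exists (c s).
  transitivity (E s * Ga b l * E (qhead b)); first by rewrite sG Gh.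
  rewrite {1}cE mulrDr mulrDl !mulr_sumr !mulr_suml; congr (_ + _).
    rewrite (bigD1 s) //= big1 ?addr0 => [|i /negPf si]; last first.
      by rewrite -scalerAr idemM eq_sym si scaler0 mul0r.
    by rewrite -scalerAr -scalerAl idemM eqxx idemM eq_sym; case: eqP => // _; rewrite scaler0.
  rewrite [RHS]big_mkcond; apply: eq_bigr => a _; rewrite -!mulrA -ldivMr Gh mulrA idem_arrow eq_sym.
  by case: eqP => // _; rewrite mul0r.
pose c b l := if qhead b == s then c0 (b, l) else 0.
have cE b l : Ga b l = c b l *: E s + \sum_(a : arrow Q | qtail a == s) X a * ldiv a (Ga b l).
  by rewrite {1}(c0E (b, l)) /c /=; case: eqP; rewrite ?scale0r.
have cs b l : src l != qtail b -> c b l *: E s = 0.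
  move=> lb; have := cE b l; rewrite (Gs _ _ lb) big1 ?addr0 => [<- //|a _].
  by rewrite (lin0 (@ldiv_linear k Q a)) mulr0.
(* Splitting coefficients into constant parts and multiples of arrows turns the hypothesis into a
   relation \sum_a a z_a = 0 in Pi. [mesh_left] produces [y], whose coordinates [ga] become the
   constant parts of [G]. *)
pose S (a : arrow Q) := \sum_b \sum_l pinc (ldiv a (Ga b l)) * (ps b * mb l).
pose z (a : A) : P := match a with
  | inl b => if qtail b == s then S b else 0
  | inr b => if qhead b == s then pe (qtail b) * \sum_l c b l *: mb l else 0 end.
have [|| y yE] := @mesh_left k Q z.
- case=> b /=; case: eqP => _; rewrite ?mulr0 //; last by rewrite mulrA pee.
  rewrite mulr_sumr; apply: eq_bigr => b' _; rewrite mulr_sumr; apply: eq_bigr => l _.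
  by rewrite mulrA -pincE -rmorphM ldiv_head.
- rewrite sum_arrows -[RHS]Ga0.
  transitivity (\sum_b \sum_l (c b l *: (pe s * (ps b * mb l)) +
      \sum_(a : arrow Q | qtail a == s) pl a * (pinc (ldiv a (Ga b l)) * (ps b * mb l)))).
    rewrite addrC (eq_bigr _ (fun b _ => big_split _ _ _ _ _)) big_split; congr (_ + _).
      apply: eq_bigr => b _ /=; rewrite /c; case: eqP => [<-|_]; last first.
        by rewrite mulr0 big1 // => l _; rewrite scale0r.
      rewrite ps_pe mulr_sumr; apply: eq_bigr => l _.
      by rewrite -pZr pe_ps.
    transitivity (\sum_b \sum_(a : arrow Q | qtail a == s) \sum_l pl a * (pinc (ldiv a (Ga b l)) * (ps b * mb l))).
      rewrite [RHS]exchange_big [RHS]big_mkcond; apply: eq_bigr => a _; rewrite /z /S; case: eqP => _; last by rewrite mulr0.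
      by rewrite mulr_sumr; apply: eq_bigr => b _; rewrite mulr_sumr.
    by apply: eq_bigr => b _; rewrite exchange_big.
  apply: eq_bigr => b _; apply: eq_bigr => l _; rewrite {2}cE rmorphD rmorph_sum mulrDl mulr_suml.
  by rewrite pincZ pincE -pZl; congr (_ + _); apply: eq_bigr => a _; rewrite rmorphM pincX mulrA.
pose ga l := fdc fdS l (pe s * y).
have ga0 l : src l != s -> ga l = 0 by rewrite /ga fdc_src eq_sym => /negPf ->.
have gaE : prs n%:Z (pe s * y) = \sum_l ga l *: mb l by exact: fdpi.
have S1 (a : arrow Q) : qtail a = s -> S a = \sum_l ga l *: (ps a * mb l).
  move=> as_; have := yE (inl a); rewrite /= as_ eqxx scale1r => SE.
  have -> : S a = prs (n%:Z + 1) (S a).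
    rewrite (lin_sum (@prs_linear k Q _)); apply: eq_bigr => b _.
    rewrite (lin_sum (@prs_linear k Q _)); apply: eq_bigr => l _.
    by rewrite prs_pinc prs_pal stardr addrK mb_prs.
  rewrite SE -ps_pe as_ prs_pal stardr addrK gaE mulr_sumr.
  by apply: eq_bigr => l _; rewrite -pZr.
have cga b l : c b l *: E s = - \sum_l' (sR b l l' * ga l') *: E s.
  rewrite -scaler_suml -scaleNr; case: (eqVneq (src l) (qtail b)) => [lb|lb]; last first.
    by rewrite cs // big1 ?oppr0 ?scale0r // => l' _; rewrite fdc_pl0 ?mul0r.
  congr (_ *: _); case: (eqVneq (qhead b) s) => [bs|bs]; last first.
    rewrite /c (negPf bs) big1 ?oppr0 // => l' _; case: (eqVneq (src l') s) => [ls|ls].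
      by rewrite pl_mb0 ?(lin0 (fdc_linear l)) ?mul0r // ls eq_sym.
    by rewrite ga0 ?mulr0.
  have := congr1 (fdc fdS l) (yE (inr b)); rewrite /= bs eqxx fdc_src lb eqxx.
  rewrite (lin_sum (fdc_linear l)) (bigD1 l) //= fdcZ [fdc _ _ (mb l)]fdcb eqxx mulr1 big1 ?addr0; last first.
    by move=> l' /negPf ll; rewrite fdcZ [fdc _ _ (mb _)]fdcb eq_sym ll mulr0.
  move=> ->; rewrite fdcZ mulN1r; congr (- _).
  rewrite -fdc_pi -pl_pe bs prs_pal subr0 gaE mulr_sumr (lin_sum (fdc_linear l)).
  by apply: eq_bigr => l' _; rewrite -pZr fdcZ mulrC.
(* The quotients by an arrow a, corrected by [ga], satisfy the hypothesis at the head of a;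
   induction yields the parts of [G] that start with a. *)
have /choice[G GP] : forall a : arrow Q, exists G : 'I_N -> R, qtail a = s ->
    (forall l, G l * E (src l) = G l) /\ forall b l,
    ldiv a (Ga b l) - (if b == a then ga l *: E (qhead a) else 0) = G l * X b - \sum_l' sR b l l' *: G l'.
  move=> a; have [as_|as_] := EM (qtail a = s); last by exists (fun=> 0).
  have [|||||G GP] := IH (qhead a) _ (fun b l => ldiv a (Ga b l) - (if b == a then ga l *: E (qhead a) else 0)).
  - by rewrite -as_ rk_lt.
  - move=> b l; rewrite mulrBr ldiv_head; case: eqP => _; rewrite ?mulr0 //.
    by rewrite -scalerAr idemM eqxx.
  - move=> b l; rewrite mulrBl -ldivMr Gh; case: eqP => [->|_]; rewrite ?mul0r //.
    by rewrite -scalerAl idemM eqxx.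
  - move=> b l lb; rewrite Gs // (lin0 (@ldiv_linear k Q a)) sub0r; case: eqP => [ba|_]; last by rewrite oppr0.
    by rewrite ga0 ?scale0r ?oppr0 // -as_ -ba.
  - transitivity (S a - \sum_l ga l *: (ps a * mb l)); last by rewrite S1 // subrr.
    rewrite /S (bigD1 a isT) [Y in _ = Y - _](bigD1 a isT) addrAC; congr (_ + _).
      rewrite -sumrB; apply: eq_bigr => l _; rewrite eqxx pincB mulrBl pincZ pincE -pZl.
      by rewrite pe_ps.
    by apply: eq_bigr => b /andP[_ /negPf ba]; apply: eq_bigr => l _; rewrite ba subr0.
  by exists G.
exists (fun l => ga l *: E s + \sum_(a : arrow Q | qtail a == s) X a * G a l); split=> [l|b l].
  rewrite mulrDl mulr_suml; congr (_ + _).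
    case: (eqVneq (src l) s) => [->|ls]; first by rewrite -scalerAl idemM eqxx.
    by rewrite ga0 // !scale0r mul0r.
  by apply: eq_bigr => a /eqP /GP[H _]; rewrite -mulrA H.
have gE (a : arrow Q) : qtail a = s -> ldiv a (Ga b l) = (if b == a then ga l *: E (qhead a) else 0) +
    (G a l * X b - \sum_l' sR b l l' *: G a l').
  by move=> /GP[_ /(_ b l) <-]; rewrite addrC subrK.
rewrite {1}cE cga (eq_bigr (fun a => (if b == a then ga l *: X a else 0) +
  (X a * G a l * X b - \sum_l' sR b l l' *: (X a * G a l')))); last first.
  move=> a /eqP as_; rewrite gE // mulrDr mulrBr mulrA; congr (_ + (_ - _)).
    by case: eqP => _; rewrite ?mulr0 // -scalerAr arrow_idem eqxx.
  by rewrite mulr_sumr; apply: eq_bigr => l' _; rewrite -scalerAr.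
rewrite big_split sumrB /= mulrDl mulr_suml -scalerAl idem_arrow.
have -> : \sum_(a : arrow Q | qtail a == s) (if b == a then ga l *: X a else 0) = ga l *: (if s == qtail b then X b else 0).
  rewrite -big_mkcondr (eq_bigl (fun a : arrow Q => (qtail a == s) && (b == a))) //.
  case: (eqVneq s (qtail b)) => [->|sb].
    rewrite (big_pred1 b) // => a; rewrite [RHS]eq_sym /=; case: (b =P a) => [->|_]; rewrite ?eqxx ?andbF //.
  rewrite scaler0 big_pred0 // => a; apply/negP => /andP[/eqP as_ /eqP ba].
  by rewrite ba as_ eqxx in sb.
have -> : \sum_l' sR b l l' *: (ga l' *: E s + \sum_(a : arrow Q | qtail a == s) X a * G a l') =
    \sum_l' (sR b l l' * ga l') *: E s + \sum_(a : arrow Q | qtail a == s) \sum_l' sR b l l' *: (X a * G a l').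
  rewrite [Y in _ = _ + Y]exchange_big -big_split; apply: eq_bigr => l' _ /=.
  by rewrite scalerDr scalerA scaler_sumr.
rewrite opprD [RHS]addrACA; rewrite addrCA addrA addrC addrA [LHS]addrC.
by rewrite [RHS]addrAC; congr (_ - _); rewrite [RHS]addrAC.
Qed.

Notation D := (@kdual k R M).

Fact ds_exists l : exists d : D, forall x : M, d x = fdc fdS l (smv x) :> k.
Proof.
have dl : linear (fun x : kspace M => fdc fdS l (smv x) : k^o).
  move=> c x y; rewrite -[smv (c *: x + y)]/(smv ((c%:A : R) *: (x : M)) + smv (y : M)) smA.
  exact: fdc_linear.
by have [d dE] := mk_linear dl; exists d.
Qed.
Definition ds l : D := sval (cid (ds_exists l)).
Lemma dsE l (x : M) : ds l x = fdc fdS l (smv x) :> k.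
Proof. by rewrite /ds; case: cid. Qed.

Lemma D_ext (d d' : D) : (forall x : M, d x = d' x :> k) -> d = d'.
Proof. by move=> dd; apply: linear_ext. Qed.
Lemma DD (d d' : D) (x : M) : (d + d') x = d x + d' x :> k. Proof. by []. Qed.
Lemma DS (r : R^c) (d : D) (x : M) : (r *: d) x = d ((r : R) *: x) :> k. Proof. by []. Qed.
Lemma D_kc (d : D) c (x : M) : d ((c%:A : R) *: x) = c * (d x : k) :> k.
Proof. by have := linearP d c (x : kspace M) 0; rewrite !addr0 raddf0 addr0. Qed.
Lemma D_sum (d : D) I (s : seq I) (T : pred I) (F : I -> M) :
  d (\sum_(i <- s | T i) F i) = \sum_(i <- s | T i) (d (F i) : k) :> k.
Proof. exact: (raddf_sum d). Qed.
Lemma sumD I (s : seq I) (T : pred I) (F : I -> D) (x : M) :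
  (\sum_(i <- s | T i) F i) x = \sum_(i <- s | T i) (F i x : k) :> k.
Proof. by apply: (big_morph (fun d : D => d x : k)). Qed.

Lemma M_expand (x : M) : x = \sum_l (fdc fdS l (smv x))%:A *: mB l.
Proof.
have sS (s : seq 'I_N) : smv (\sum_(l <- s) (fdc fdS l (smv x))%:A *: mB l) =
    \sum_(l <- s) fdc fdS l (smv x) *: mb l :> P.
  elim: s => [|l s IH]; first by rewrite !big_nil.
  by rewrite !big_cons smvD -IH; congr (_ + _); exact: smA.
apply: smv_inj; rewrite sS -[LHS](smvP x : prs n%:Z (smv x) = smv x).
exact: fdpi.
Qed.

Lemma D_expand (d : D) (x : M) : d x = \sum_l fdc fdS l (smv x) * (d (mB l) : k) :> k.
Proof. by rewrite {1}[x]M_expand D_sum; apply: eq_bigr => l _; exact: D_kc. Qed.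

Lemma mB_E i l : E i *: mB l = if i == src l then mB l else 0.
Proof. by apply: smv_inj; rewrite smE mb_src; case: eqP. Qed.

Lemma ds_E i l : eC i *: ds l = if i == src l then ds l else 0.
Proof.
apply: D_ext => x; rewrite DS dsE smE fdc_src; case: eqP => _ //.
exact: esym (dsE _ _).
Qed.

Section Extension.
Variables (Y : lmodType R^c) (th : arrow Q -> 'I_N -> Y).
(** Arrows of kQ satisfy no relations, so any such family defines an extension of D by Y, with
    [xC b] acting through the extra term [TH b]. Lifting maps to these extensions replaces Ext
    computations. *)
Definition cocyc := (forall b l, eC (qhead b) *: th b l = th b l) /\
  (forall b l, src l != qtail b -> th b l = 0).
Hypothesis thC : cocyc.

Definition TH b (d : D) : Y := \sum_l kc (d (mB l)) *: th b l.

Lemma TH_add b d d' : TH b (d + d') = TH b d + TH b d'.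
Proof. by rewrite -big_split; apply: eq_bigr => l _; rewrite DD rmorphD scalerDl. Qed.
Lemma TH_kc b c d : TH b (kc c *: d) = kc c *: TH b d.
Proof. by rewrite scaler_sumr; apply: eq_bigr => l _; rewrite DS D_kc kcM. Qed.
Lemma TH_e b i d : TH b (eC i *: d) = if i == qtail b then TH b d else 0.
Proof.
have [_ th0] := thC; case: (i =P qtail b) => [->|ib].
  apply: eq_bigr => l _; rewrite DS mB_E; case: eqP => // lb.
  by rewrite th0 ?scaler0 // eq_sym; apply/eqP.
rewrite /TH big1 // => l _; rewrite DS mB_E; case: eqP => [il|_]; last first.
  by rewrite (raddf0 d) kc0.
by rewrite th0 ?scaler0 // -il; apply/eqP.
Qed.
Lemma e_TH b i d : eC i *: TH b d = if qhead b == i then TH b d else 0.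
Proof.
have [thh _] := thC; rewrite scaler_sumr; case: eqP => [<-|bi].
  by apply: eq_bigr => l _; rewrite kcC thh.
rewrite big1 // => l _; rewrite kcC -thh eCe eq_sym; case: eqP => // _.
by rewrite scaler0.
Qed.
Lemma TH_ds b l : TH b (ds l) = th b l.
Proof.
rewrite /TH (bigD1 l) //= dsE [fdc _ _ _]fdcb eqxx kc1 big1 ?addr0 // => l' /negPf ll.
by rewrite dsE [fdc _ _ _]fdcb eq_sym ll kc0.
Qed.
Lemma TH0 b : TH b 0 = 0.
Proof. by rewrite -(kc0 (0 : D)) TH_kc kc0. Qed.

Notation Zs := (res_scalars kc (Y * D)%type).
Let eZf i (z : Zs) : Zs := (eC i *: z.1, eC i *: z.2).
Let aZf b (z : Zs) : Zs := (xC b *: z.1 + TH b z.2, xC b *: z.2).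
Fact eZ_linear i : linear (eZf i).
Proof. by move=> c x y; congr (_, _); rewrite /= scalerDr kcC. Qed.
Fact aZ_linear b : linear (aZf b).
Proof.
move=> c x y; congr (_, _); rewrite /= scalerDr kcC //.
by rewrite TH_add TH_kc scalerDr addrACA.
Qed.
Let eZ i : endo Zs := mk_endo (eZ_linear i).
Let aZ b : endo Zs := mk_endo (aZ_linear b).
Let mulZ (f g : endo Zs) : endo Zs := endo_comp g f.
Definition actZ : R -> endo Zs := @path_ext k Q (endo Zs) mulZ eZ aZ.

Fact actZ_linear : linear actZ. Proof. exact: path_ext_linear. Qed.
Fact actZM f g : actZ (f * g) = endo_comp (actZ g) (actZ f).
Proof.
apply: path_extM.
- by move=> y; exact: endo_comp_linr.
- by move=> y; exact: endo_comp_linl.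
- by move=> x y z; rewrite /mulZ endo_compA.
- move=> i j; apply: endo_ext => -[x d]; rewrite /= /eZf /= !eCe eq_sym.
  by case: eqP => [->|].
- move=> i b; apply: endo_ext => -[x d]; rewrite /= /eZf /aZf /= !xCe TH_e.
  by case: eqP => // _; rewrite addr0.
move=> i b; apply: endo_ext => -[x d]; rewrite /= /eZf /aZf /= scalerDr !eCx e_TH.
by case: eqP => // _; rewrite addr0.
Qed.
Fact actZ1 z : actZ 1 z = z.
Proof.
have evl : linear (fun f => actZ f z) by move=> c f g; rewrite actZ_linear endoDE endoZE.
rewrite -(idem_sum k Q) (lin_sum evl); case: z evl => x d evl.
rewrite (eq_bigr (fun i => (eC i *: x, eC i *: d) : Zs)) => [|i _]; last first.
  by rewrite /actZ path_ext_idem.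
have S1 (s : seq (vert Q)) : \sum_(i <- s) ((eC i *: x, eC i *: d) : Zs) =
    (\sum_(i <- s) eC i *: x, \sum_(i <- s) eC i *: d).
  by elim: s => [|i s IH]; rewrite ?big_nil // !big_cons IH.
by rewrite S1 -!eC_sum.
Qed.

Fact ext_axioms : @act_axioms R^c (Y * D)%type (fun r z => actZ r z).
Proof.
split=> [f g z|z|f z z'|z f g].
- by have := actZM g f => /(congr1 (fun h : endo Zs => h z)) /= <-.
- exact: actZ1.
- exact: linD (endo_linear (actZ f)) z z'.
- by rewrite (linD actZ_linear).
Qed.
Definition extm : lmodType R^c := actmod ext_axioms.

Lemma ext_e i (z : extm) : eC i *: z = (eC i *: z.1, eC i *: z.2) :> Y * D.
Proof. by rewrite actmodE /actZ path_ext_idem. Qed.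
Lemma ext_x b (z : extm) : xC b *: z = (xC b *: z.1 + TH b z.2, xC b *: z.2) :> Y * D.
Proof. by rewrite actmodE /actZ path_ext_arrow. Qed.
Lemma ext_kc c (z : extm) : kc c *: z = (kc c *: z.1, kc c *: z.2) :> Y * D.
Proof. by rewrite actmodE /kc (linZ actZ_linear) endoZE actZ1. Qed.

Lemma ext_snd : linear (fun z : extm => (z : Y * D).2).
Proof.
apply: rmod_linear => // [c z|i z|b z].
- by rewrite ext_kc.
- by rewrite ext_e.
- by rewrite ext_x.
Qed.

Lemma ext_fst (W : lmodType R^c) (h : W -> extm) : linear h -> (forall w, (h w : Y * D).2 = 0) ->
  linear (fun w => (h w : Y * D).1).
Proof.
move=> hl h2; have hZ r w : h (r *: w) = r *: h w.
  have h0 : h 0 = 0.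
    by have := hl 1 0 0; rewrite scaler0 addr0 scale1r -[Y in Y = _]addr0 => /addrI <-.
  by have := hl r w 0; rewrite h0 !addr0.
have hD (u w : W) : h (u + w) = h u + h w by rewrite -[u]scale1r hl !scale1r.
apply: rmod_linear => [x y|c w|i w|b w].
- by rewrite hD.
- by rewrite hZ ext_kc.
- by rewrite hZ ext_e.
- by rewrite hZ ext_x h2 TH0 addr0.
Qed.

End Extension.

Section Presentation.
Variables (P1 P0 : lmodType R^c) (p1 : {linear P1 -> P0}) (p0 : {linear P0 -> D}).
Hypothesis proj0 : projective P0.
Hypothesis p0_surj : forall d, exists x, p0 x = d.

Fact xl_exists l : exists x, p0 x = ds l /\ eC (src l) *: x = x.
Proof.
have [x xE] := p0_surj (ds l); exists (eC (src l) *: x); split.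
  by rewrite linS xE; exact: etrans (ds_E _ _) (ifT _ _ (eqxx _)).
by rewrite eCe eqxx.
Qed.
Definition xl l : P0 := sval (cid (xl_exists l)).
Lemma p0_xl l : p0 (xl l) = ds l. Proof. by rewrite /xl; case: cid => x []. Qed.
Lemma xl_src l : eC (src l) *: xl l = xl l. Proof. by rewrite /xl; case: cid => x []. Qed.

(** A k-linear section of [p0] respecting vertices. Its failure to commute with arrows is [kap], the
    relations of the standard resolution of D. *)
Definition sgm (d : D) : P0 := \sum_l kc (d (mB l)) *: xl l.

Lemma D_kcE c (d : D) (x : M) : (kc c *: d) x = c * (d x : k) :> k.
Proof. by rewrite DS; exact: D_kc. Qed.

Lemma ds_expand (d : D) : \sum_l kc (d (mB l)) *: ds l = d.
Proof.
apply: D_ext => x; rewrite sumD [RHS]D_expand; apply: eq_bigr => l _.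
by rewrite D_kcE dsE mulrC.
Qed.

Lemma p0_sgm d : p0 (sgm d) = d.
Proof.
rewrite /sgm linSum -[RHS]ds_expand; apply: eq_bigr => l _.
by rewrite linS p0_xl.
Qed.
Lemma sgm_add d d' : sgm (d + d') = sgm d + sgm d'.
Proof. by rewrite -big_split; apply: eq_bigr => l _; rewrite DD rmorphD scalerDl. Qed.
Lemma sgm_kc c d : sgm (kc c *: d) = kc c *: sgm d.
Proof. by rewrite scaler_sumr; apply: eq_bigr => l _; rewrite D_kcE kcM. Qed.
Lemma sgm_e i d : sgm (eC i *: d) = eC i *: sgm d.
Proof.
rewrite scaler_sumr; apply: eq_bigr => l _; rewrite DS mB_E kcC -xl_src eCe.
case: eqP => [->|_]; first by rewrite xl_src.
by rewrite (raddf0 d) kc0 scaler0.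
Qed.
Lemma sgm0 : sgm 0 = 0. Proof. by rewrite -(kc0 (0 : D)) sgm_kc kc0. Qed.

Definition kap b l : P0 := xC b *: xl l - sgm (xC b *: ds l).

Lemma p0_kap b l : p0 (kap b l) = 0.
Proof. by rewrite /kap linBB linS p0_xl p0_sgm subrr. Qed.
Lemma kap_e b l : eC (qhead b) *: kap b l = kap b l.
Proof. by rewrite /kap scalerBr eCx eqxx -sgm_e eCx eqxx. Qed.
Lemma kap_0 b l : src l != qtail b -> kap b l = 0.
Proof.
move=> /negPf lb; rewrite /kap -xl_src xCe lb.
have -> : ds l = eC (src l) *: ds l by rewrite ds_E eqxx.
by rewrite xCe lb sgm0 subr0.
Qed.
Lemma kapE b l : kap b l = xC b *: xl l - \sum_l' kc (sR b l l') *: xl l'.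
Proof.
rewrite /kap; congr (_ - _); apply: eq_bigr => l' _; rewrite DS dsE.
by rewrite (smX b (mB l')).
Qed.
Lemma kap_sum b d : xC b *: sgm d - sgm (xC b *: d) = \sum_l kc (d (mB l)) *: kap b l.
Proof.
transitivity (\sum_l kc (d (mB l)) *: (xC b *: xl l) - \sum_l kc (d (mB l)) *: sgm (xC b *: ds l)).
  congr (_ - _); first by rewrite scaler_sumr; apply: eq_bigr => l _; rewrite kcC.
  rewrite -{1}(ds_expand d) scaler_sumr; elim: (index_enum _) => [|l s IH]; first by rewrite !big_nil sgm0.
  by rewrite !big_cons sgm_add IH kcC sgm_kc.
by rewrite -sumrB; apply: eq_bigr => l _; rewrite -scalerBr.
Qed.

Fact ker_closed : smclosed (fun x : P0 => p0 x = 0).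
Proof. by split=> [|a x y x0 y0]; rewrite ?raddf0 // linearP x0 y0 scaler0 addr0. Qed.
Notation K := (submod ker_closed).
Definition kapK b l : K := smk ker_closed (p0_kap b l).

Lemma res_p0 (x : P0) : p0 (x - sgm (p0 x)) = 0.
Proof. by rewrite linBB p0_sgm subrr. Qed.
Definition res (x : P0) : K := smk ker_closed (res_p0 x).

Lemma res_add (x y : P0) : res (x + y) = res x + res y.
Proof. by apply: smv_inj; rewrite smvD /= linDD sgm_add opprD addrACA. Qed.
Lemma res_kc c x : res (kc c *: x) = kc c *: res x.
Proof. by apply: smv_inj; rewrite smvZ /= linS scalerBr; congr (_ - _); exact: sgm_kc. Qed.
Lemma res_e i x : res (eC i *: x) = eC i *: res x.
Proof. by apply: smv_inj; rewrite smvZ /= linS scalerBr; congr (_ - _); exact: sgm_e. Qed.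
Lemma res_x b x : res (xC b *: x) = xC b *: res x + \sum_l kc (p0 x (mB l)) *: kapK b l.
Proof.
have sS (s : seq 'I_N) : smv (\sum_(l <- s) kc (p0 x (mB l)) *: kapK b l) = \sum_(l <- s) kc (p0 x (mB l)) *: kap b l.
  by elim: s => [|l s IH]; rewrite ?big_nil // !big_cons -IH.
apply: smv_inj; rewrite smvD smvZ sS -kap_sum /= linS scalerBr.
by rewrite [RHS]addrA subrK.
Qed.
Lemma res_ker (w : K) : res (smv w) = w.
Proof. by apply: smv_inj; rewrite /= (smvP w) sgm0 subr0. Qed.

Lemma kapK_cocyc : cocyc kapK.
Proof.
split=> [b l|b l lb]; apply: smv_inj; first exact: kap_e.
exact: kap_0.
Qed.
Lemma map_cocyc (Y Y' : lmodType R^c) (f : {linear Y -> Y'}) th : cocyc th -> cocyc (fun b l => f (th b l)).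
Proof.
case=> th1 th2; split=> [b l|b l lb]; first by rewrite -linS th1.
by rewrite th2 // raddf0.
Qed.
Lemma map_TH (Y Y' : lmodType R^c) (f : {linear Y -> Y'}) th b d :
  f (TH th b d) = TH (fun b l => f (th b l)) b d.
Proof. by rewrite linSum; apply: eq_bigr => l _; rewrite linS. Qed.

(* A map on ker p0 extends to P0 once Y is replaced by the extension of D by Y given by th. *)
Lemma lift_ker (Y : lmodType R^c) (th : arrow Q -> 'I_N -> Y) (f : {linear K -> Y})
  (thC : cocyc th) : (forall b l, f (kapK b l) = th b l) ->
  exists h : {linear P0 -> extm thC}, forall x, h x = (f (res x), p0 x) :> Y * D.
Proof.
move=> fth; apply: mk_linear; apply: rmod_linear => [x y|c x|i x|b x].
- by rewrite res_add !linDD.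
- by rewrite ext_kc res_kc !linS.
- by rewrite ext_e res_e !linS.
rewrite ext_x res_x /= !linS linDD linS linSum; congr (_ + _, _).
by apply: eq_bigr => l _; rewrite linS -fth.
Qed.

(** To lift f through g, lift only the values of f on the [kapK b l]. Old and new values define
    extensions of D by Y' and by Y; f extends to P0 with values in the first ([lift_ker]),
    projectivity of P0 lifts it to the second, and on the kernel the component in D vanishes. *)
Lemma ker_projective : projective K.
Proof.
move=> Y Y' g f g_surj.
have thC' : cocyc (fun b l => f (kapK b l)) by exact: map_cocyc kapK_cocyc.
have /choice[u uE] : forall bl : arrow Q * 'I_N, exists y : Y, g y = f (kapK bl.1 bl.2).
  by move=> bl; exact: g_surj.
pose th b l := if src l == qtail b then eC (qhead b) *: u (b, l) else 0.
have gth b l : g (th b l) = f (kapK b l).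
  have [c1 c2] := thC'; rewrite /th; case: eqP => [_|/eqP lb]; last by rewrite c2 // raddf0.
  by rewrite linS uE c1.
have thC : cocyc th.
  split=> [b l|b l /negPf lb]; rewrite /th ?lb //; case: eqP => _; last by rewrite scaler0.
  by rewrite eCe eqxx.
have [G GE] : exists G : {linear extm thC -> extm thC'}, forall z, G z = (g z.1, z.2) :> Y' * D.
  apply: mk_linear; apply: rmod_linear => [x y|c x|i x|b x].
  - by congr (_, _); rewrite linDD.
  - by rewrite !ext_kc linS.
  - by rewrite !ext_e linS.
  rewrite !ext_x linDD linS map_TH; congr (_ + _, _).
  by apply: eq_bigr => l _; rewrite gth.
have G_surj (z : extm thC') : exists y : extm thC, G y = z.
  have [y yE] := g_surj (z : Y' * D).1; exists ((y, (z : Y' * D).2) : extm thC); rewrite GE yE.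
  by case: z {yE} => ? ?.
have [phi phiE] := @lift_ker Y' (fun b l => f (kapK b l)) f thC' (fun b l => erefl).
have [h hE] := @proj0 _ _ G phi G_surj.
have h2 (w : K) : (h (smv w) : Y * D).2 = 0.
  transitivity (G (h (smv w)) : Y' * D).2; first by rewrite GE.
  by rewrite hE phiE /= (smvP w).
have [h' h'E] := mk_linear (@ext_fst Y th thC K (fun w => h (smv w)) (fun r (x y : K) => linearP h r (smv x) (smv y)) h2).
exists h' => w; rewrite h'E; transitivity (G (h (smv w)) : Y' * D).1; first by rewrite GE.
by rewrite hE phiE /= res_ker.
Qed.

Hypothesis p1_range : range p1 = [set x | p0 x = 0]%classic.
Hypothesis p1_super : superfluous [set x | p1 x = 0]%classic.

Lemma p0p1 w : p0 (p1 w) = 0.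
Proof.
have : (range p1) (p1 w) by exists w.
by rewrite p1_range.
Qed.

Lemma p1_section : exists s : {linear K -> P1}, (forall w, p1 (s w) = smv w) /\
  forall w, s (smk ker_closed (p0p1 w)) = w.
Proof.
have [q qE] : exists q : {linear P1 -> K}, forall w, q w = smk ker_closed (p0p1 w).
  by apply: mk_linear => r x y; apply: smv_inj; rewrite smvD smvZ /= linearP.
have q_surj w : exists x, q x = w.
  have : [set x | p0 x = 0]%classic (smv w) by exact: smvP w.
  by rewrite -p1_range => -[x _ xw]; exists x; apply: smv_inj; rewrite qE.
have [_ /mk_linear[i iE]] : True /\ linear (fun w : K => w) by [].
have [s sE] := @ker_projective _ _ q i q_surj.
have p1s w : p1 (s w) = smv w by have := sE w; rewrite iE qE => /(congr1 (@smv _ _ _ _)).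
exists s; split=> // w; have sr x : x \in (fun y : P1 => `[< exists w, y = s w >]).
  have : submod_closed (fun y : P1 => `[< exists w, y = s w >]).
    split; first by apply/asboolP; exists 0; rewrite raddf0.
    move=> a y z /asboolP[y' ->] /asboolP[z' ->]; apply/asboolP.
    by exists (a *: y' + z'); rewrite linearP.
  move=> /p1_super; apply => y; exists (s (q y)), (y - s (q y)); split.
  - by apply/asboolP; exists (q y).
  - by rewrite /= linBB p1s qE /= subrr.
  - by rewrite addrC subrK.
have /asboolP[w' ->] := sr w; congr (s _); apply: smv_inj; exact: p1s.
Qed.
Definition s1 : {linear K -> P1} := sval (cid p1_section).
Lemma p1s1 w : p1 (s1 w) = smv w. Proof. by rewrite /s1; case: cid => s []. Qed.
Lemma s1p1 w : s1 (smk ker_closed (p0p1 w)) = w. Proof. by rewrite /s1; case: cid => s []. Qed.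

(** The values of the functional on the [kapK b l] become coefficients of the b^* m_l, which
    generate Pi_(n+1). Functionals that extend to P0 give the trivial relations of [cob0], and by
    [syzygy] there are no others. *)
Definition q0 (g : rdual P1) : P := \sum_b \sum_l pinc (g (s1 (kapK b l)) : R) * (ps b * mb l).
Lemma q0_prs g : prs n.+1%:Z (q0 g) = q0 g.
Proof.
rewrite (lin_sum (@prs_linear k Q _)); apply: eq_bigr => b _.
rewrite (lin_sum (@prs_linear k Q _)); apply: eq_bigr => l _.
by rewrite prs_pinc prs_pal stardr -addn1 PoszD addrK mb_prs.
Qed.
Lemma q1_exists : exists q : {linear rdual P1 -> @PImod k Q n.+1%:Z}, forall g, smv (q g) = q0 g :> P.
Proof.
have [|q qE] := @mk_linear R (rdual P1) (@PImod k Q n.+1%:Z) (fun g => smk (@PI_closed k Q n.+1%:Z) (q0_prs g)).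
  move=> r f g; apply: smv_inj; rewrite smvD smvZ.
  transitivity (pinc r * q0 f + q0 g); last by [].
  rewrite -[LHS]/(q0 (r *: f + g)) /q0 mulr_sumr -big_split; apply: eq_bigr => b _.
  rewrite mulr_sumr -big_split; apply: eq_bigr => l _.
  transitivity (pinc (r * (f (s1 (kapK b l)) : R) + (g (s1 (kapK b l)) : R)) * (ps b * mb l)); first by [].
  by rewrite rmorphD rmorphM mulrDl -mulrA.
by exists q => g; rewrite qE.
Qed.

(** After exchanging the sums, this is the preprojective relation applied to each m_l and multiplied
    by G_l. *)
Lemma cob0 (G : 'I_N -> R) :
  \sum_b \sum_l pinc (G l * X b - \sum_l' sR b l l' *: G l') * (ps b * mb l) = 0.
Proof.
transitivity (\sum_b \sum_l pinc (G l) * (pl b * (ps b * mb l)) - \sum_b \sum_l' pinc (G l') * (ps b * (pl b * mb l'))).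
  rewrite -sumrB; apply: eq_bigr => b _.
  transitivity (\sum_l (pinc (G l) * (pl b * (ps b * mb l)) - \sum_l' sR b l l' *: (pinc (G l') * (ps b * mb l)))).
    apply: eq_bigr => l _; rewrite pincB rmorphM pincX mulrBl -!mulrA; congr (_ - _).
    rewrite rmorph_sum mulr_suml; apply: eq_bigr => l' _.
    by rewrite pincZ -pZl.
  rewrite sumrB exchange_big; congr (_ - _); apply: eq_bigr => l' _.
  have E1 : pl b * mb l' = \sum_l sR b l l' *: mb l.
    by rewrite -(fdpi fdS) prs_pal subr0 mb_prs.
  by rewrite [in RHS]E1 !mulr_sumr; apply: eq_bigr => l _; rewrite -!pZr.
rewrite exchange_big [Y in _ - Y]exchange_big -sumrB big1 // => l _.
by rewrite -!mulr_sumr rhoE subrr.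
Qed.

Lemma PI_gen (y : P) : prs n.+1%:Z y = y -> exists Ga : arrow Q -> 'I_N -> R,
  [/\ forall b l, Ga b l * E (qhead b) = Ga b l, forall b l, src l != qtail b -> Ga b l = 0
    & y = \sum_b \sum_l pinc (Ga b l) * (ps b * mb l)].
Proof.
pose S (y : P) := exists Ga : arrow Q -> 'I_N -> R, y = \sum_b \sum_l pinc (Ga b l) * (ps b * mb l).
have S0 : S 0.
  exists (fun _ _ => 0); rewrite big1 // => b _; rewrite big1 // => l _.
  by rewrite rmorph0 mul0r.
have SD x z : S x -> S z -> S (x + z).
  move=> [G1 ->] [G2 ->]; exists (fun b l => G1 b l + G2 b l); rewrite -big_split; apply: eq_bigr => b _.
  by rewrite -big_split; apply: eq_bigr => l _; rewrite rmorphD mulrDl.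
have SM (r : R) x : S x -> S (pinc r * x).
  move=> [G1 ->]; exists (fun b l => r * G1 b l); rewrite mulr_sumr; apply: eq_bigr => b _.
  by rewrite mulr_sumr; apply: eq_bigr => l _; rewrite rmorphM mulrA.
have SN j x : inN n.+1%:Z j x -> S x.
  move: x; apply: N_ind => // [c x Sx|b x _ _ Sx|b x xN _].
  - by rewrite -[x]mul1r -(rmorph1 pinc) pZl -pincZ; exact: SM.
  - by rewrite -pincX; exact: SM.
  have xn : prs n%:Z x = x.
    by have := inN_prs xN; rewrite -addn1 PoszD addrK.
  exists (fun b' l => if b' == b then fdc fdS l x *: E (qhead b) else 0).
  rewrite (bigD1 b isT) [Y in _ = _ + Y]big1 ?addr0 => [|b' /andP[_ /negPf bb]]; last first.
    by rewrite big1 // => l _; rewrite bb rmorph0 mul0r.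
  rewrite -{1}xn (fdpi fdS) mulr_sumr; apply: eq_bigr => l _; rewrite eqxx pincZ pincE -pZl pe_ps.
  by rewrite -pZr.
move=> yn; have [Ga ->] : S y.
  rewrite (pe_decr y); elim/big_ind: _ => // j _; apply: (SN j).
  by rewrite /inN /nx prs_per yn -mulrA pee.
exists (fun b l => if src l == qtail b then Ga b l * E (qhead b) else 0); split=> [b l|b l /negPf -> //|].
  by case: eqP; rewrite ?mul0r // -mulrA idemM eqxx.
apply: eq_bigr => b _; apply: eq_bigr => l _; case: (eqVneq (src l) (qtail b)) => [_|lb].
  by rewrite rmorphM pincE -mulrA pe_ps.
by rewrite ps_mb0 // !mulr0.
Qed.

(** Coefficients of y define an extension of D by the regular module. Lifting [p0] to it and
    restricting to the kernel gives a functional with these values on [kapK], up to a term removed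
    by [cob0]. *)
Lemma q0_surj (y : P) : prs n.+1%:Z y = y -> exists g, q0 g = y.
Proof.
move=> /PI_gen[Ga [G1 G2 yE]]; pose th b l : (R^c)^o := Ga b l.
have thC : cocyc th by split=> [b l|b l /G2 //]; exact: G1.
have [snd sndE] := mk_linear (@ext_snd _ _ thC).
have snd_surj d : exists z, snd z = d by exists ((0, d) : extm thC); rewrite sndE.
have [h hE] := @proj0 _ _ snd p0 snd_surj.
have h2 x : (h x : (R^c)^o * D).2 = p0 x by rewrite -hE sndE.
have h2p w : (h (p1 w) : (R^c)^o * D).2 = 0 by rewrite h2 p0p1.
have [g gE] := mk_linear (@ext_fst (R^c)^o th thC P1 (fun w => h (p1 w))
  (fun r (x y : P1) => etrans (congr1 h (linearP p1 r x y)) (linearP h r (p1 x) (p1 y))) h2p).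
pose u l : R := (h (xl l) : (R^c)^o * D).1.
exists (g : rdual P1).
have fstS (s : seq 'I_N) b l : (h (\sum_(l' <- s) kc (sR b l l') *: xl l') : (R^c)^o * D).1 =
    \sum_(l' <- s) sR b l l' *: u l' :> R.
  elim: s => [|l' s IH]; first by rewrite !big_nil raddf0.
  rewrite !big_cons linDD linS; rewrite -IH; congr (_ + _).
  by rewrite ext_kc -[LHS]/(u l' * (sR b l l')%:A) -scalerAr mulr1.
have gth b l : g (s1 (kapK b l)) = Ga b l + (u l * X b - \sum_l' sR b l l' *: u l') :> R.
  rewrite gE p1s1 /= kapE linBB linS.
  transitivity ((xC b *: h (xl l) : (R^c)^o * D).1 - (h (\sum_l' kc (sR b l l') *: xl l') : (R^c)^o * D).1 : R); first by [].
  by rewrite fstS ext_x h2 p0_xl TH_ds addrA [Ga b l + _]addrC.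
rewrite /q0 yE -[RHS]addr0 -[Y in _ = _ + Y](cob0 u) -big_split; apply: eq_bigr => b _.
rewrite -big_split; apply: eq_bigr => l _; rewrite gth rmorphD mulrDl.
by [].
Qed.

(** The [G] from [syzygy] is the correction that makes the functional, transported to P0 by the
    k-linear retraction [res], compatible with the arrows. *)
Lemma q0_kernel (f : rdual P1) : q0 f = 0 <-> exists g : rdual P0, forall x, f x = g (p1 x).
Proof.
split=> [f0|[g gE]]; last first.
  pose u l : R := g (xl l).
  rewrite -[RHS](cob0 u); apply: eq_bigr => b _; apply: eq_bigr => l _; congr (pinc _ * _).
  rewrite gE p1s1 /= kapE linBB linS linSum; congr (_ - _); apply: eq_bigr => l' _.
  by rewrite linS -[LHS]/(u l' * (sR b l l')%:A) -scalerAr mulr1.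
pose Ga b l : R := f (s1 (kapK b l)).
have [GaC1 GaC2] := kapK_cocyc.
have [|||G [Gs GE]] := @syzygy Ga.
- by move=> b l; rewrite -[RHS]/(f (s1 (kapK b l)) : R) -GaC1 !linS.
- by move=> b l lb; rewrite /Ga GaC2 // !raddf0.
- exact: f0.
have [g gE] : exists g : {linear P0 -> (R^c)^o}, forall x, g x = f (s1 (res x)) + \sum_l kc (p0 x (mB l)) *: (G l : (R^c)^o).
  apply: mk_linear; apply: rmod_linear => [x y|c x|i x|b x].
  - rewrite res_add !linDD addrACA; congr (_ + _); rewrite -big_split; apply: eq_bigr => l _.
    by rewrite DD rmorphD scalerDl.
  - rewrite res_kc !linS scalerDr scaler_sumr; congr (_ + _); apply: eq_bigr => l _.
    by rewrite D_kcE kcM.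
  - rewrite res_e !linS scalerDr scaler_sumr; congr (_ + _); apply: eq_bigr => l _.
    rewrite DS mB_E kcC -[G l]Gs -[eC i *: _]/(G l * E (src l) * E i) -mulrA idemM eq_sym.
    case: eqP => // _; rewrite mulr0 (raddf0 (p0 x)) kc0.
    by rewrite scaler0.
  rewrite res_x !linDD !linS scalerDr -addrA; congr (_ + _).
  rewrite linSum linSum scaler_sumr.
  transitivity (\sum_l kc (p0 x (mB l)) *: ((Ga b l : (R^c)^o) + \sum_l' kc (sR b l l') *: (G l' : (R^c)^o))).
    under [RHS]eq_bigr do rewrite scalerDr; rewrite big_split; congr (_ + _).
      by apply: eq_bigr => l _; rewrite !linS.
    under [RHS]eq_bigr do rewrite scaler_sumr; rewrite exchange_big; apply: eq_bigr => l' _.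
    rewrite DS D_expand rmorph_sum scaler_suml; apply: eq_bigr => l _.
    by rewrite kcM mulrC (smX b (mB l')).
  apply: eq_bigr => l _; rewrite kcC; congr (_ *: _).
  rewrite -[RHS]/(G l * X b : R) [Y in Y + _]GE -[RHS]addr0 -addrA; congr (_ + _).
  apply/eqP; rewrite addrC subr_eq0; apply/eqP; apply: eq_bigr => l' _.
  by rewrite -[LHS]/(G l' * (sR b l l')%:A) -scalerAr mulr1.
exists g => w; rewrite gE big1 ?addr0 => [|l _]; last by rewrite p0p1 kc0.
have -> : res (p1 w) = smk ker_closed (p0p1 w).
  by apply: smv_inj; rewrite /= p0p1 sgm0 subr0.
by rewrite s1p1.
Qed.

End Presentation.

(** Any minimal presentation must be allowed, because [is_AR_translate_inv] only asserts that some
    presentation exists. *)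
Lemma min_pres_q (P1 P0 : lmodType R^c) (p1 : {linear P1 -> P0}) (p0 : {linear P0 -> D}) :
  min_proj_presentation p1 p0 -> exists q : {linear rdual P1 -> @PImod k Q n.+1%:Z}, range q = setT /\
      forall f : rdual P1, q f = 0 <-> exists g : rdual P0, forall x, f x = g (p1 x).
Proof.
move=> [[pr0 rg0 _] [_ rg1 sup1]].
have p0s d : exists x, p0 x = d.
  have : (@classical_sets.setT D) d by [].
  by rewrite -rg0 => -[x _ xd]; exists x.
have [q qE] := q1_exists pr0 p0s rg1 sup1.
exists q; split=> [|f].
  apply/seteqP; split=> // y _; have [g gy] := q0_surj pr0 p0s rg1 sup1 (smvP y).
  by exists g => //; apply: smv_inj; rewrite qE.
rewrite -(q0_kernel pr0 p0s rg1 sup1) -qE; split=> [-> //|qf].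
exact: smv_inj.
Qed.

Lemma AR_exists : (exists (P1 P0 : lmodType R^c) (p1 : {linear P1 -> P0}) (p0 : {linear P0 -> D}),
  min_proj_presentation p1 p0) -> is_AR_translate_inv M (@PImod k Q n.+1%:Z).
Proof.
move=> [P1 [P0 [p1 [p0 mp]]]]; exists P1, P0, p1, p0; split=> //.
exact: (min_pres_q mp).
Qed.

(** The isomorphism carries the given presentation of D M' to one of D M with the same [p1], so both
    modules are cokernels of the same map. *)
Lemma AR_unique (M' N' : lmodType R) : mod_iso M M' -> is_AR_translate_inv M' N' ->
  mod_iso N' (@PImod k Q n.+1%:Z).
Proof.
move=> /mod_isoE[f [g [fg gf]]] [P1 [P0 [p1 [p0 [[[pr0 rg0 sup0] [pr1 rg1 sup1]] [q [qs qk]]]]]]].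
have kl (M1 M2 : lmodType R) (h : {linear M1 -> M2}) (d : kdual M2) :
    exists d' : kdual M1, forall x : M1, d' x = d (h x).
  have [|d' d'E] := @mk_linear k (kspace M1) k^o (fun x => d (h x)).
    move=> c x y; rewrite -[c *: x + y]/(((c%:A : R) *: (x : M1) + (y : M1)) : M1) linearP.
    exact: (linearP d c (h x) (h y)).
  by exists d' => x; exact: d'E.
have /choice[U UE] := kl _ _ f.
have /choice[U' U'E] := kl _ _ g.
have [u uE] : exists u : {linear kdual M' -> D}, u =1 U.
  apply: mk_linear => r d d'; apply: D_ext => x; rewrite UE DD DS !UE linS.
  by [].
have uI d : u d = 0 -> d = 0.
  move=> ud; apply: linear_ext => x; rewrite -[x]gf -UE -uE ud.
  by [].
have [p0' p0'E] : exists p0' : {linear P0 -> D}, forall x, p0' x = u (p0 x).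
  by apply: mk_linear => r x y; rewrite !linearP.
have kE : [set x | p0' x = 0]%classic = [set x | p0 x = 0]%classic.
  apply/seteqP; split=> x /=; first by rewrite p0'E; exact: uI.
  by rewrite p0'E => ->; rewrite raddf0.
have [|q' [qs' qk']] := @min_pres_q P1 P0 p1 p0'.
  split; split=> //; rewrite ?kE //.
  apply/seteqP; split=> // d _; have : (@classical_sets.setT (kdual M')) (U' d) by [].
  rewrite -rg0 => -[x _ xd]; exists x => //; rewrite p0'E xd uE; apply: D_ext => y.
  by rewrite UE U'E fg.
apply: (coker_iso qs qs') => h; rewrite qk qk'.
by [].
Qed.

End TrD.

(** * Existence of minimal projective presentations *)

Section ProjectiveCover.
Variables (k : fieldType) (Q : quiver) (Qacyc : quiver_acyclic Q).
Notation R := (pathalg k Q).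
Notation E i := (path_idem k (i : vert Q)).
Notation X b := (path_arrow k (b : arrow Q)).
Notation eC i := (path_idem k (i : vert Q) : R^c).
Notation xC b := (path_arrow k (b : arrow Q) : R^c).
Notation kc := (@kc k Q).

Lemma rdiv_decomp (f : R) : exists (c : vert Q -> k) (z : arrow Q -> R),
  f = \sum_i c i *: E i + \sum_b z b * X b.
Proof.
elim/(@pathalg_indl k Q): f => [|f g [c [z ->]] [d [w ->]]|c f [d [w ->]]|i|a f [c [z ->]]].
- exists (fun=> 0), (fun=> 0); rewrite big1 => [|i _]; last by rewrite scale0r.
  by rewrite big1 ?addr0 // => b _; rewrite mul0r.
- exists (fun i => c i + d i), (fun b => z b + w b); rewrite addrACA -!big_split /=.
  congr (_ + _); apply: eq_bigr => ? _; first by rewrite scalerDl.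
  by rewrite mulrDl.
- exists (fun i => c * d i), (fun b => c *: w b); rewrite scalerDr !scaler_sumr.
  congr (_ + _); apply: eq_bigr => ? _; first by rewrite scalerA.
  by rewrite scalerAl.
- exists (fun j => (j == i)%:R), (fun=> 0); rewrite (bigD1 i) //= eqxx scale1r.
  rewrite big1 => [|j /negPf ->]; last by rewrite scale0r.
  by rewrite big1 ?addr0 // => b _; rewrite mul0r.
exists (fun=> 0), (fun b => X a * z b + (if b == a then (c (qhead a))%:A else 0)).
rewrite [Y in _ = Y + _]big1 ?add0r => [|i _]; last by rewrite scale0r.
under [RHS]eq_bigr do rewrite mulrDl; rewrite big_split mulrDr mulr_sumr addrC; congr (_ + _).
  by apply: eq_bigr => b _; rewrite mulrA.
rewrite mulr_sumr (bigD1 (qhead a)) //= -scalerAr arrow_idem eqxx big1 => [|i /negPf ia]; last first.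
  by rewrite -scalerAr arrow_idem eq_sym ia scaler0.
rewrite (bigD1 a) //= eqxx -scalerAl mul1r big1 // => b /negPf ->.
by rewrite mul0r.
Qed.

Section Cover.
Variable Y : lmodType R^c.

Lemma rad_closed (S : Y -> Prop) : smclosed S ->
  smclosed (fun x => exists s (y : arrow Q -> Y), S s /\ x = s + \sum_b xC b *: y b).
Proof.
move=> [S0 SZ]; have SD x y : S x -> S y -> S (x + y).
  by move=> Sx Sy; rewrite -[x]scale1r; exact: SZ.
have Sc r x : S x -> S (r *: x) by move=> Sx; rewrite -[_ *: x]addr0; exact: SZ.
pose T x := exists s (y : arrow Q -> Y), S s /\ x = s + \sum_b xC b *: y b.
have T0 : T 0.
  exists 0, (fun=> 0); split=> //; rewrite big1 ?addr0 // => b _.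
  by rewrite scaler0.
have TD x y : T x -> T y -> T (x + y).
  move=> [s [u [Ss ->]]] [t [w [St ->]]]; exists (s + t), (fun b => u b + w b).
  split; first exact: SD.
  rewrite addrACA -big_split; congr (_ + _); apply: eq_bigr => b _.
  by rewrite scalerDr.
have TR r x : T x -> T (r *: x).
  apply: (@rmod_ind k Q Y T) => // [c y|i y|b y _].
  - move=> [s [u [Ss ->]]]; exists (kc c *: s), (fun b => kc c *: u b); split; first exact: Sc.
    rewrite scalerDr scaler_sumr; congr (_ + _); apply: eq_bigr => b _.
    by rewrite kcC.
  - move=> [s [u [Ss ->]]]; exists (eC i *: s), (fun b => if qhead b == i then u b else 0); split; first exact: Sc.
    rewrite scalerDr scaler_sumr; congr (_ + _); apply: eq_bigr => b _.
    by rewrite eCx; case: eqP => _ //; rewrite scaler0.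
  exists 0, (fun b' => if b' == b then y else 0); split=> //.
  rewrite add0r (bigD1 b) //= eqxx big1 ?addr0 // => b' /negPf ->.
  by rewrite scaler0.
by split=> // r x y Tx Ty; apply: TD => //; exact: TR.
Qed.

Definition gens s := exists (i : 'I_s -> vert Q) (d : 'I_s -> Y),
  (forall t, eC (i t) *: d t = d t) /\ forall x, exists r : 'I_s -> R^c, x = \sum_t r t *: d t.

(** A relation with a nonzero constant coefficient at [t0] expresses that generator by the others
    modulo arrows; [nakayama] then discards it. *)
Lemma gens_reduce s (i : 'I_s -> vert Q) (d : 'I_s -> Y) : (forall t, eC (i t) *: d t = d t) ->
  (forall x, exists r : 'I_s -> R^c, x = \sum_t r t *: d t) ->
  forall (w : 'I_s -> R) c (z : 'I_s -> arrow Q -> R) t0,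
  (forall t, w t = c t *: E (i t) + \sum_b (E (i t) * z t b) * X b) -> c t0 <> 0 ->
  \sum_t (w t : R^c) *: d t = 0 -> gens s.-1.
Proof.
case: s i d => [|s] i d di dgen w c z t0 zE ct0 w0; first by case: t0 {ct0}.
exists (fun t => i (lift t0 t)), (fun t => d (lift t0 t)); split=> [t|]; first exact: di.
pose T y := exists r : 'I_s -> R^c, y = \sum_t r t *: d (lift t0 t).
have TC : smclosed T.
  split; first by exists (fun=> 0); rewrite big1 // => t _; rewrite scale0r.
  move=> a x1 x2 [r1 ->] [r2 ->]; exists (fun t => a * r1 t + r2 t).
  rewrite scaler_sumr -big_split; apply: eq_bigr => t _.
  by rewrite scalerDl scalerA.
apply: (nakayama Qacyc TC) => y; have [RC0 RCZ] := rad_closed TC.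
have [r ->] := dgen y; rewrite (bigD1_ord t0) //=; apply: (RCZ).
  have E1 : kc (c t0) *: d t0 = - (\sum_t (w (lift t0 t) : R^c) *: d (lift t0 t)) +
      \sum_b xC b *: (- ((z t0 b : R^c) *: d t0)).
    move: w0; rewrite (bigD1_ord t0) //= => /eqP; rewrite addr_eq0 => /eqP <-.
    rewrite zE scalerDl rZ di scaler_suml -addrA -[LHS]addr0; congr (_ + _).
    rewrite -big_split big1 // => b _; rewrite -rA.
    by rewrite -[((E (i t0) * z t0 b : R) : R^c) *: _]rA di scalerN; exact: addrN.
  exists (kc (c t0)^-1 *: - (\sum_t (w (lift t0 t) : R^c) *: d (lift t0 t))).
  exists (fun b => kc (c t0)^-1 *: (- ((z t0 b : R^c) *: d t0))); split.
    rewrite -[_ *: _]addr0; apply: (TC.2); last exact: TC.1.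
    exists (fun t => - (w (lift t0 t) : R^c)).
    by rewrite -sumrN; apply: eq_bigr => t _; rewrite scaleNr.
  under [Y in _ = _ + Y]eq_bigr do rewrite kcC.
  rewrite -scaler_sumr -scalerDr -E1 kcM mulVf ?kc1 //.
  exact/eqP.
exists (\sum_t r (lift t0 t) *: d (lift t0 t)), (fun=> 0); split; first by eexists.
by rewrite [Y in _ = _ + Y]big1 ?addr0 // => b _; rewrite scaler0.
Qed.

Section Free.
Variables (s : nat) (i : 'I_s -> vert Q) (d : 'I_s -> Y).
Hypothesis di : forall t, eC (i t) *: d t = d t.
Hypothesis dgen : forall x, exists r : 'I_s -> R^c, x = \sum_t r t *: d t.
Notation F := ({ffun 'I_s -> (R^c)^o}).

(** The module \bigoplus_t e_i(t) kQ, cut out of a free right module. *)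
Fact free_closed : smclosed (fun x : F => forall t, E (i t) * (x t : R) = x t).
Proof.
split=> [t|a x y Hx Hy t]; first by rewrite ffunE mulr0.
rewrite !ffunE -[a *: x t]/((x t : R) * (a : R) : R).
by rewrite [LHS]mulrDr Hy mulrA Hx.
Qed.
Notation P0 := (submod free_closed).

Lemma free_eps_in t : forall t', E (i t') * (([ffun t' => if t' == t then (E (i t) : (R^c)^o) else 0] : F) t' : R) =
  ([ffun t' => if t' == t then (E (i t) : (R^c)^o) else 0] : F) t'.
Proof. by move=> t'; rewrite ffunE; case: eqP => [->|_]; rewrite ?mulr0 // idemM eqxx. Qed.
Definition eps t : P0 := smk free_closed (free_eps_in t).

Lemma P0_expand (x : P0) : x = \sum_t ((smv x : F) t : R^c) *: eps t.
Proof.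
have sS (I : seq 'I_s) t' : (smv (\sum_(t <- I) ((smv x : F) t : R^c) *: eps t) : F) t' =
    \sum_(t <- I) (if t' == t then (smv x : F) t : R else 0) :> R.
  elim: I => [|t I IH]; first by rewrite !big_nil ffunE.
  rewrite !big_cons -IH smvD smvZ !ffunE; congr (_ + _).
  case: eqP => _; last by rewrite scaler0.
  exact: (smvP x t).
apply: smv_inj; apply/ffunP => t'; rewrite sS (bigD1 t') //= eqxx big1 ?addr0 // => t /negPf tt.
by rewrite eq_sym tt.
Qed.

Lemma P0_map (Z : lmodType R^c) (m : 'I_s -> Z) : exists h : {linear P0 -> Z},
  forall x : P0, h x = \sum_t ((smv x : F) t : R^c) *: m t.
Proof.
apply: mk_linear => r x y; rewrite scaler_sumr -big_split; apply: eq_bigr => t _.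
rewrite /= scalerA -scalerDl; congr (_ *: _).
by rewrite !ffunE.
Qed.

Lemma P0_projective : projective P0.
Proof.
move=> M1 N1 g f gs; have /choice[m mE] : forall t, exists m, g m = f (eps t) by move=> t; exact: gs.
have [h hE] := P0_map m; exists h => x; rewrite hE linSum {2}[x]P0_expand linSum.
by apply: eq_bigr => t _; rewrite !linS mE.
Qed.

Lemma P0_cover : (forall s', gens s' -> (s <= s')%N) ->
  exists p0 : {linear P0 -> Y}, projective_cover p0 setT.
Proof.
move=> smin; have [p0 p0E] := P0_map d; exists p0; split.
- exact: P0_projective.
- apply/seteqP; split=> // y _; have [r ->] := dgen y.
  have rP : forall t, E (i t) * (([ffun t => (E (i t) * (r t : R) : R)] : F) t : R) =
      ([ffun t => (E (i t) * (r t : R) : R)] : F) t.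
    by move=> t; rewrite ffunE mulrA idemM eqxx.
  exists (smk free_closed rP) => //; rewrite p0E; apply: eq_bigr => t _ /=.
  by rewrite ffunE -{2}di rA.
move=> S [S0 SZ] Sx.
apply: (@nakayama k Q P0 Qacyc (fun x => x \in S)) => [|x]; first by split.
have [u [w [uS w0 ->]]] := Sx x; exists u.
have /choice[c cE] : forall t, exists c : k, exists z : arrow Q -> R,
    (smv w : F) t = c *: E (i t) + \sum_b (E (i t) * z b) * X b :> R.
  move=> t; have [c [z fE]] := rdiv_decomp ((smv w : F) t); exists (c (i t)), z.
  rewrite -[LHS](smvP w t) fE mulrDr !mulr_sumr; congr (_ + _); last first.
    by apply: eq_bigr => b _; rewrite mulrA.
  rewrite (bigD1 (i t)) //= -scalerAr idemM eqxx big1 ?addr0 // => j /negPf ij.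
  by rewrite -scalerAr idemM eq_sym ij scaler0.
have {cE}/choice[z zE] := cE.
have [c0|/existsNP[t0 ct0]] := EM (forall t, c t = 0).
  have yP b : forall t, E (i t) * (([ffun t => (E (i t) * z t b : R)] : F) t : R) =
      ([ffun t => (E (i t) * z t b : R)] : F) t.
    by move=> t; rewrite ffunE mulrA idemM eqxx.
  exists (fun b => smk free_closed (yP b)); split=> //; congr (_ + _).
  have sS (I : seq (arrow Q)) t : (smv (\sum_(b <- I) xC b *: smk free_closed (yP b)) : F) t =
      \sum_(b <- I) (E (i t) * z t b) * X b :> R.
    elim: I => [|b I IH]; first by rewrite !big_nil ffunE.
    by rewrite !big_cons -IH smvD smvZ !ffunE.
  apply: smv_inj; apply/ffunP => t; rewrite sS zE c0 scale0r add0r.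
  by [].
have : gens s.-1.
  apply: (@gens_reduce s i d di dgen (fun t => (smv w : F) t) c z t0) => //.
  by rewrite -p0E.
by move=> /smin; have := ltn_ord t0; lia.
Qed.
End Free.

Lemma cover_exists s : gens s -> exists (P0 : lmodType R^c) (p0 : {linear P0 -> Y}), projective_cover p0 setT.
Proof.
move=> gs; have ex : exists m, `[< gens m >] by exists s; apply/asboolP.
case: (ex_minnP ex) => m /asboolP[i [d [di dgen]]] mmin.
have [|p0 p0c] := @P0_cover m i d di dgen; last by eexists; exists p0.
by move=> s' gs'; apply: mmin; apply/asboolP.
Qed.

End Cover.

Variable n : nat.
Notation M := (@PImod k Q n%:Z).
Notation D := (@kdual k R M).

Lemma kdual_gens : @gens D (fdn (@fdS k Q Qacyc n)).
Proof.
exists (fun l => src l), (fun l => ds l); split=> [t|x].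
  by rewrite ds_E eqxx.
by exists (fun l => kc (x (mB l))); rewrite ds_expand.
Qed.

(** The kernel of the cover is projective, hence its own projective cover. *)
Lemma min_presentation : exists (P1 P0 : lmodType R^c) (p1 : {linear P1 -> P0}) (p0 : {linear P0 -> D}),
  min_proj_presentation p1 p0.
Proof.
have [P0 [p0 [pr0 rg0 sup0]]] := cover_exists kdual_gens.
have p0s d : exists x, p0 x = d.
  have : (@classical_sets.setT D) d by [].
  by rewrite -rg0 => -[x _ xd]; exists x.
have [p1 p1E] := mk_linear (@smv_linear _ _ _ (ker_closed p0)).
exists (submod (ker_closed p0)), P0, p1, p0; split=> //; split.
- exact: (ker_projective Qacyc pr0 p0s).
- apply/seteqP; split=> [_ [x _ <-]|x /= x0]; first by rewrite /= p1E; exact: (smvP x).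
  by exists (smk (ker_closed p0) x0) => //; rewrite p1E.
move=> S [S0 _] Sx x; have [s [t [sS t0 ->]]] := Sx x.
have -> : t = 0 by apply: smv_inj; rewrite -p1E t0.
by rewrite addr0.
Qed.

Lemma PImod_AR : is_AR_translate_inv M (@PImod k Q n.+1%:Z).
Proof. exact: (AR_exists Qacyc min_presentation). Qed.

End ProjectiveCover.

(** * Identification of the translates of A *)

Section Preprojectives.
Variables (k : fieldType) (Q : quiver) (Qacyc : quiver_acyclic Q).
Notation R := (pathalg k Q).
Notation DQ := (double_quiver Q).
Notation P := (ppa k Q).
Notation pinc := (@pinc k Q).
Notation X b := (path_arrow k b).

(** Elements with no coefficient on star-free paths form an ideal containing [trho], and it meets
    the image of kQ in 0. *)
Lemma pinc_inj (r : R) : pinc r = 0 -> r = 0.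
Proof.
move=> /quot_map_eq0 rI.
pose J : set (pathalg k DQ) := fun f => forall q, star_free q -> coef f q = 0.
have JI : two_sided_ideal J.
  split=> [q _ //|x y Jx Jy q q0|a x b Jx q q0].
    by rewrite coefD (_ : coef (- y) q = - coef y q) // Jx // Jy // subrr.
  rewrite coefM big1 // => m _; rewrite coefM [Y in Y * _]big1 ?mul0r // => m' _.
  have /andP[q1 q2] : star_free (ptake m q) && star_free (pdrop m q) by rewrite -star_free_take_drop.
  move: q1; rewrite (star_free_take_drop m') => /andP[q3 q4].
  by rewrite (Jx _ q4) mulr0.
have JS : ([set trho k Q]%classic `<=` J)%classic.
  move=> _ -> q q0; rewrite /trho coef_sum big1 // => a _; rewrite coefZ.
  rewrite (_ : coef _ q = 0) ?mulr0 // arrow_pathbase; case: eqP => // aa.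
  rewrite coef_base; case: eqP => // qE; move: q0; rewrite /star_free qE parrows_pcat //.
  by case: a {qE aa}.
have rJ := ideal_gen_sub JI JS rI.
apply: pathalg_ext => p; have p0 : star_free (to_double p).
  by rewrite /star_free /parrows /= all_map; exact/allP.
by have := rJ _ p0; rewrite coef_embed p0 to_doubleK.
Qed.

Lemma prs0_pinc (r : R) : prs 0 (pinc r) = pinc r.
Proof.
rewrite -[pinc r]mulr1 prs_pinc; congr (_ * _).
rewrite -(pe_sum k Q) (lin_sum (@prs_linear k Q 0)); apply: eq_bigr => i _.
by rewrite /prs pr_pe eqxx.
Qed.

Lemma pinc_surj (y : P) : prs 0 y = y -> exists r, pinc r = y.
Proof.
pose S (y : P) := exists r, pinc r = y.
have SD x z : S x -> S z -> S (x + z).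
  by move=> [r <-] [s <-]; exists (r + s); rewrite rmorphD.
have SN j x : inN 0 j x -> S x.
  move: x; apply: N_ind => // [|c x [r <-]|_|b x _ _ [r <-]|b x xN _].
  - by exists 0; rewrite rmorph0.
  - by exists (c *: r); rewrite pincZ.
  - by exists (path_idem k (j : vert Q)); rewrite pincE.
  - by exists (X b * r); rewrite rmorphM pincX.
  by rewrite (inN_neg _ xN) // mulr0; exists 0; rewrite rmorph0.
move=> y0; rewrite (pe_decr y); elim/big_ind: _ => //; first by exists 0; rewrite rmorph0.
by move=> j _; apply: (SN j); rewrite /inN /nx prs_per y0 -mulrA pee.
Qed.

Lemma PImod0_iso : mod_iso R^o (@PImod k Q 0).
Proof.
have fl : linear (fun r : R^o => smk (@PI_closed k Q 0) (prs0_pinc r)).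
  move=> a x y; apply: smv_inj; rewrite smvD smvZ.
  exact: (etrans (rmorphD pinc (a * x) y) (congr1 (fun u => u + pinc y) (rmorphM pinc a x))).
have [f fE] := mk_linear fl.
have /choice[g gE] : forall y : @PImod k Q 0, exists r : R, pinc r = smv y :> P.
  by move=> y; exact: pinc_surj (smvP y).
exists f; exists g => x; last by apply: smv_inj; rewrite fE; exact: gE.
apply/eqP; rewrite -subr_eq0; apply/eqP; apply: pinc_inj.
by rewrite pincB gE fE subrr.
Qed.

Lemma PImod_iter n : is_AR_translate_inv_iter n R^o (@PImod k Q n%:Z).
Proof.
elim: n => [|n IH]; first exact: PImod0_iso.
by exists (@PImod k Q n%:Z); split=> //; exact: PImod_AR.
Qed.

Lemma iter_PImod n X : is_AR_translate_inv_iter n R^o X -> mod_iso X (@PImod k Q n%:Z).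
Proof.
elim: n X => [|n IH] X; first by move=> H; apply: mod_iso_trans (mod_iso_sym H) _; exact: PImod0_iso.
by move=> [L [/IH LI LX]]; apply: (AR_unique Qacyc (mod_iso_sym LI) LX).
Qed.

End Preprojectives.

(** * Indecomposable preprojective modules *)

Section DirectSums.
Variables (R : pzRingType) (I : finType) (X : I -> lmodType R).

Definition fin_dsum (f : forall i, X i) : dsum X :=
  Dsum (finite_finset : finite_set [set i | f i != 0]%classic).
Definition dinc i (x : X i) : dsum X := fin_dsum (dfwith (fun j => 0 : X j) x).

Lemma dinc_linear i : linear (@dinc i).
Proof.
move=> a x y; apply: dsum_ext => j; rewrite dsumDE dsumZE /=.
case: (eqVneq i j) => [ij|ij]; last by rewrite !dfwith_out // scaler0 addr0.
by case: j / ij; rewrite !dfwith_in.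
Qed.

Lemma dsum_sumE J (r : seq J) (T : pred J) (F : J -> dsum X) i :
  (\sum_(j <- r | T j) F j) i = \sum_(j <- r | T j) F j i.
Proof. by apply: (big_morph (fun x : dsum X => x i)). Qed.

Lemma dinc_sum (z : dsum X) : \sum_i dinc (z i) = z.
Proof.
apply: dsum_ext => j; rewrite dsum_sumE (bigD1 j) //= dfwith_in big1 ?addr0 // => i ij.
by rewrite dfwith_out.
Qed.

End DirectSums.

Section Indecomposables.
Variables (k : fieldType) (Q : quiver) (Qacyc : quiver_acyclic Q).
Notation R := (pathalg k Q).
Notation DQ := (double_quiver Q).
Notation V := (vert DQ).
Notation P := (ppa k Q).
Notation pe i := (@pe k Q i).
Notation rk := (rk Qacyc).
Notation dead := (@dead k Q).
Notation Nm m j := (@Nmod k Q m j).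
Notation PIm m := (@PImod k Q m).

(** A homomorphism is right multiplication by an element with m' - m stars, so nonzero ones never go
    down in the lexicographic order of (m, rank). *)
Lemma Nmod_hom_deg m j m' j' (f : Nm m j -> Nm m' j') x : linear f -> f x <> 0 ->
  m < m' \/ (m = m' /\ ((rk j < rk j')%N \/ j = j')).
Proof.
move=> /(Nmod_hom Qacyc)[u [uN ju uE]] fx.
have u0 : u <> 0 by move=> u0; apply: fx; apply: smv_inj; rewrite uE u0 mulr0.
have [mm|mm] := ltrP m m'; [by left|right].
have mE : m = m'.
  apply/eqP; rewrite eq_le mm andbT leNgt; apply/negP => mm'; apply: u0.
  by apply: inN_neg uN; rewrite subr_lt0.
split=> //; rewrite mE subrr in uN.
case: (boolP (rk j < rk j')%N) => [|jj]; [by left|right].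
have [c uc] := N0_rank jj uN ju; by move: uc; case: eqP.
Qed.

Lemma dead_neg m j : m < 0 -> dead m j.
Proof. by move=> m0 x; exact: inN_neg. Qed.

Lemma Nmod_iso_inj m j m' j' : ~ dead m j -> mod_iso (Nm m j) (Nm m' j') -> (m, j) = (m', j').
Proof.
move=> /Nmod_neq0[x x0] /mod_isoE[f [g [fg gf]]].
have fl : linear f by exact: linearP.
have gl : linear g by exact: linearP.
have fx : f x <> 0 by move=> fx; move: x0; rewrite -(fg x) fx raddf0 eqxx.
have gfx : g (f x) <> 0 by rewrite fg; exact/eqP.
have [H|[H1 H2]] := Nmod_hom_deg fl fx; have [H'|[H1' H2']] := Nmod_hom_deg gl gfx.
- by have := lt_trans H H'; rewrite ltxx.
- by rewrite H1' ltxx in H.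
- by rewrite H1 ltxx in H'.
rewrite H1; congr (_, _); case: H2 => // H2; case: H2' => // H2'.
by have := ltn_trans H2 H2'; rewrite ltnn.
Qed.

Lemma Nmod_split (M : lmodType R) m j m' j' (f : Nm m j -> M) (g : M -> Nm m' j') x :
  indecomposable M -> linear f -> linear g -> g (f x) <> 0 -> (m, j) = (m', j') ->
  mod_iso M (Nm m j).
Proof.
move=> indM fl gl gfx xx; case: xx g gl gfx => <- <- g gl gfx.
have gfl : linear (fun x => g (f x)) by move=> a y z; rewrite fl gl.
have [c cE] := Nmod_end Qacyc gfl.
have c0 : c != 0.
  by apply/eqP => c0; apply: gfx; rewrite cE c0 scale0r scale0r.
apply: (@split_summand _ (Nm m j) M f (fun y => (c^-1%:A : R) *: g y)) => //.
- by move=> a y z; rewrite gl scalerDr !scalerA -!scalerAl mul1r -scalerAr mulr1.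
- by move=> y; rewrite cE scalerA -scalerAl mul1r scalerA mulVf // scale1r scale1r.
exists x; apply/eqP => x0; apply: gfx; rewrite cE x0.
by rewrite scaler0.
Qed.

(** This stands in for Krull-Schmidt. Take t minimal with p_t nonzero. Some p_t i_s p_s is nonzero
    since the i_s p_s add up to the identity; then N_s -> N_t is nonzero, and minimality gives N_s =
    N_t. Its nonzero endomorphisms are invertible scalars, so it splits off M. *)
Lemma indec_summand (M : lmodType R) (T : finType) (m : T -> nat) (j : T -> V)
  (i : forall t, {linear Nm (m t)%:Z (j t) -> M}) (p : forall t, {linear M -> Nm (m t)%:Z (j t)}) :
  indecomposable M -> (forall x, \sum_t i t (p t x) = x) ->
  exists t, ~ dead (m t)%:Z (j t) /\ mod_iso M (Nm (m t)%:Z (j t)).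
Proof.
move=> indM ip; have [[x x0] _] := indM.
(* [B] exceeds every rank, so [key] encodes the lexicographic order of [Nmod_hom_deg]. *)
pose B := (\max_q rk q).+1; have rB q : (rk q < B)%N by rewrite ltnS; exact: (leq_bigmax q).
pose key t := (m t * B + rk (j t))%N.
pose S t := `[< exists y, p t y <> 0 >].
have [t0 St0] : exists t, S t.
  apply: contrapT => /forallNP H; case/eqP: x0; rewrite -[x]ip big1 // => t _.
  have -> : p t x = 0; last exact: raddf0.
  by apply: contrapT => px; apply: (H t); apply/asboolP; exists x.
case: (@arg_minnP T t0 S key St0) => t /asboolP[y py] tmin.
have [s ps] : exists s, p t (i s (p s y)) <> 0.
  apply: contrapT => /forallNP H; apply: py; rewrite -[y]ip linSum big1 // => s _.
  by apply: contrapT; exact: H.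
have Ss : S s.
  by apply/asboolP; exists y => psy; apply: ps; rewrite psy !raddf0.
have hl : linear (fun z => p t (i s z)) by move=> a z z'; rewrite !linearP.
have st : ((m s)%:Z, j s) = ((m t)%:Z, j t).
  have := tmin s Ss; rewrite /key; have [mm|[[mm] [jj|jj]]] := Nmod_hom_deg hl ps.
  - move: mm (rB (j s)); rewrite ltz_nat => mm sB ts.
    have : (m s * B + B <= m t * B)%N by rewrite -mulSnr leq_mul2r mm orbT.
    by lia.
  - by rewrite mm leq_add2l leqNgt jj.
  - by rewrite mm jj.
exists s; split.
  move=> dd; apply: ps; have -> : p s y = 0; last by rewrite !raddf0.
  by apply: smv_inj; apply: dd; exact: smvP.
exact: (@Nmod_split M _ _ _ _ (i s) (p t) (p s y) indM (linearP (i s)) (linearP (p t)) ps st).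
Qed.

(** In Pi_n, the elements killed by e_j on the right are a complement. *)
Lemma Nmod_preprojective n j : preprojective (Nm n%:Z j).
Proof.
have C : smclosed (fun x : @PM k Q => prs n%:Z (x : P) = x /\ (x : P) * pe j = 0).
  have pl' : linear (@prs k Q n%:Z) by exact: prs_linear.
  apply: PM_closed => [|x y [ex xj] [ey yj]|c x [ex xj]|i x [ex xj]|b x [ex xj]].
  - by rewrite (lin0 pl') mul0r.
  - by rewrite (linD pl') ex ey mulrDl xj yj addr0.
  - by rewrite (linZ pl') ex -pZl xj scaler0.
  - by rewrite prs_pel ex -mulrA xj mulr0.
  - by rewrite prs_pal subr0 ex -mulrA xj mulr0.
exists 1%N, (fun=> PIm n%:Z), (submod C); split=> [c|]; first by exists n; exact: PImod_iter.
have aP (z : Nm n%:Z j * submod C) : prs n%:Z (smv z.1 + smv z.2 : P) = smv z.1 + smv z.2.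
  by rewrite (linD (@prs_linear k Q _)) (inN_prs (smvP z.1)) (smvP z.2).1.
have bP (x : PIm n%:Z) : inN n%:Z j (smv x * pe j : P).
  by rewrite /inN /nx prs_per (smvP x) -mulrA pee.
have cP (x : PIm n%:Z) : prs n%:Z (smv x - smv x * pe j : P) = smv x - smv x * pe j /\ (smv x - smv x * pe j : P) * pe j = 0.
  by rewrite (linB (@prs_linear k Q _)) prs_per (smvP x) mulrBl -mulrA pee subrr.
have al a x y : smk (@PI_closed k Q n%:Z) (aP (a *: x + y)) =
    a *: smk (@PI_closed k Q n%:Z) (aP x) + smk (@PI_closed k Q n%:Z) (aP y).
  apply: smv_inj; transitivity ((smv (a *: x.1 + y.1) : @PM k Q) + smv (a *: x.2 + y.2)); first by [].
  by rewrite !smvD !smvZ addrACA -scalerDr.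
apply: (@mod_isoI _ _ _
   (fun z : Nm n%:Z j * submod C => fin_dsum (fun _ : 'I_1 => smk (@PI_closed k Q n%:Z) (aP z) : PIm n%:Z))
   (fun z => (smk (@N_closed k Q n%:Z j) (bP (z ord0)), smk C (cP (z ord0))))).
- by move=> a x y; apply: dsum_ext => c; exact: al.
- move=> [x y]; have xj : smv x * pe j = smv x :> P by exact: inN_pe (smvP x).
  have [_ yj] := smvP y.
  congr (_, _); apply: smv_inj; rewrite /= mulrDl xj.
    by rewrite [Y in _ + Y]yj addr0.
  by rewrite [Y in _ - (_ + Y)]yj addr0 addrC addKr.
move=> z; apply: dsum_ext => c; apply: smv_inj; rewrite /= addrC subrK.
by congr (smv (z _)); apply: val_inj; case: c => -[].
Qed.

(** M is a summand of a sum of translates tau^-n A = Pi_n = \bigoplus_j N_(n,j); the composed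
    inclusions and projections feed [indec_summand]. *)
Lemma preprojective_indec (M : lmodType R) : preprojective M -> indecomposable M ->
  exists (n : nat) j, ~ dead n%:Z j /\ mod_iso M (Nm n%:Z j).
Proof.
move=> [r [X [M' [XP /mod_isoE[f [g [fg gf]]]]]]] indM.
have /choice[n nP] : forall c, exists n, mod_iso (X c) (PIm n%:Z).
  by move=> c; have [n nX] := XP c; exists n; exact: (iter_PImod Qacyc nX).
have uw c : exists u : {linear X c -> PIm (n c)%:Z}, exists w : {linear PIm (n c)%:Z -> X c}, cancel u w.
  by have [u [w [uw _]]] := mod_isoE (nP c); exists u, w.
pose u c := sval (cid (uw c)); pose w c := sval (cid (svalP (cid (uw c)))).
have uK c : cancel (u c) (w c) by exact: svalP (cid (svalP (cid (uw c)))).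
have bP m j (x : PIm m) : inN m j (smv x * pe j : P).
  by rewrite /inN /nx prs_per (smvP x) -mulrA pee.
have aP m j (x : Nm m j) : prs m (smv x : P) = smv x by exact: inN_prs (smvP x).
pose a m j (x : Nm m j) : PIm m := smk (@PI_closed k Q m) (aP m j x).
pose b m j (x : PIm m) : Nm m j := smk (@N_closed k Q m j) (bP m j x).
have al m j : linear (a m j) by move=> e x y; apply: smv_inj; rewrite smvD smvZ.
have bl m j : linear (b m j).
  move=> e x y; apply: smv_inj; rewrite smvD smvZ /= mulrDl; congr (_ + _).
  exact: esym (mulrA _ _ _).
have ab m (x : PIm m) : \sum_j a m j (b m j x) = x.
  have sS (s : seq V) : smv (\sum_(j <- s) a m j (b m j x)) = \sum_(j <- s) (smv x * pe j : P).
    by elim: s => [|j s IH]; rewrite ?big_nil // !big_cons -IH.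
  by apply: smv_inj; rewrite sS -pe_decr.
have iE (t : 'I_r * V) : exists i : {linear Nm (n t.1)%:Z t.2 -> M},
    forall x, i x = (g (dinc (w t.1 (a _ _ x)))).1.
  by apply: mk_linear => e x y; rewrite al linearP dinc_linear linearP.
have pE (t : 'I_r * V) : exists p : {linear M -> Nm (n t.1)%:Z t.2},
    forall x, p x = b _ _ (u t.1 (f (x, 0) t.1)).
  apply: mk_linear => e x y; rewrite -bl -linearP; congr (b _ _ (u _ _)).
  have -> : f (e *: x + y, 0) = e *: f (x, 0) + f (y, 0); last by [].
  by rewrite -linearP; congr (f _); congr (_, _); rewrite /= ?scaler0 ?addr0.
pose i t := sval (cid (iE t)); pose p t := sval (cid (pE t)).
have [|t [al' tM]] := @indec_summand M ('I_r * V)%type (fun t => n t.1) (fun t => t.2) i p indM; last by exists (n t.1), t.2.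
move=> x; transitivity (\sum_c \sum_j i (c, j) (p (c, j) x)); first by rewrite pair_bigA; apply: eq_bigr => -[].
transitivity (\sum_c (g (dinc (f (x, 0) c))).1).
  apply: eq_bigr => c _.
  have Gl : linear (fun y : PIm (n c)%:Z => (g (dinc (w c y))).1).
    by move=> e y z; rewrite linearP dinc_linear linearP.
  have [G GE] := mk_linear Gl.
  transitivity (G (\sum_j a _ j (b _ j (u c (f (x, 0) c))))); last by rewrite ab GE uK.
  rewrite linSum; apply: eq_bigr => j _; rewrite GE /i; case: (cid (iE (c, j))) => i' -> /=.
  by rewrite /p; case: (cid (pE (c, j))) => p' ->.
have [G GE] : exists G : {linear dsum X -> M}, forall z, G z = (g z).1.
  by apply: mk_linear => e y z; rewrite linearP.
transitivity (G (\sum_c dinc (f (x, 0) c))); last by rewrite dinc_sum GE fg.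
by rewrite linSum; apply: eq_bigr => c _; rewrite GE.
Qed.

End Indecomposables.

(** * The decomposition of the quiver Heisenberg algebra *)

Section Assembly.
Variables (k : fieldType) (Q : quiver) (Qacyc : quiver_acyclic Q).
Notation R := (pathalg k Q).
Notation DQ := (double_quiver Q).
Notation V := (vert DQ).
Notation P := (ppa k Q).
Notation pe i := (@pe k Q i).
Notation base p := (pq (pathbase k p)).
Notation dead := (@dead k Q).
Notation Nm m j := (@Nmod k Q m j).
Variables (v : vert Q -> k) (vreg : regular_weight v).
Notation La := (@qHeis k Q v).
Notation he i := (@he k Q v i).
Notation ha a := (@ha k Q v a).
Notation hinc := (@qHeis_incl k Q v).

Lemma hincE i : hinc (path_idem k (i : vert Q)) = he i.
Proof.
rewrite /qHeis_incl /= /path_idem path_embed_base; congr (hq v (pathbase k _)).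
exact: val_inj.
Qed.
Lemma hincX b : hinc (path_arrow k (b : arrow Q)) = ha (inl b).
Proof.
rewrite /qHeis_incl /= /path_arrow path_embed_base; congr (hq v (pathbase k _)).
exact: val_inj.
Qed.
Lemma hincZ c (x : La) : hinc (c%:A : R) * x = c *: x.
Proof.
have -> : hinc (c%:A : R) = c *: (1 : La).
  by rewrite /qHeis_incl /= path_embedZ (rmorph1 (@path_embed k Q)) quot_mapZ rmorph1.
by rewrite -quot_scaleAl mul1r.
Qed.

Let vnz : forall i : V, v i != 0 := regular_neq0 vreg.
Let chi := Nmod_chi Qacyc vreg.

Variables (J : Type) (N : J -> lmodType R) (indN : ind_preprojective N).

Fact type_exists j : exists y : nat * V, ~ dead y.1%:Z y.2 /\ mod_iso (N j) (Nm y.1%:Z y.2).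
Proof.
have [/(_ j)[pj ij] _ _] := indN.
by have [n [q nq]] := preprojective_indec Qacyc pj ij; exists (n, q).
Qed.
(** By [tI_inj] and [tI_surj], this index identifies [J] with the set of nonzero pieces. *)
Definition tN j : nat * V := sval (cid (type_exists j)).
Definition tI j : int * V := ((tN j).1%:Z, (tN j).2).
Lemma tNP j : ~ dead (tI j).1 (tI j).2 /\ mod_iso (N j) (Nm (tI j).1 (tI j).2).
Proof. exact: svalP (cid (type_exists j)). Qed.
Lemma tI_inj : injective tI.
Proof.
have [_ ui _] := indN; move=> j j' jj; apply: ui; have [_ ij] := tNP j; have [_ ij'] := tNP j'.
by apply: mod_iso_trans ij _; rewrite jj; exact: mod_iso_sym.
Qed.
Lemma tI_surj m q : ~ dead m q -> exists j, tI j = (m, q).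
Proof.
move=> al; have [m0|] := ltrP m 0; first by case: al; exact: dead_neg.
case: m al => // n al _; have [_ _ ex] := indN.
have [j ij] := ex _ (Nmod_preprojective k Qacyc n q) (Nmod_indec Qacyc al).
exists j; apply/esym; apply: (Nmod_iso_inj Qacyc al); have [_ ij'] := tNP j.
exact: mod_iso_trans ij ij'.
Qed.

Fact tiso_exists j : exists f : {linear N j -> Nm (tI j).1 (tI j).2}, exists g : {linear Nm (tI j).1 (tI j).2 -> N j},
  cancel f g /\ cancel g f.
Proof. by have [_ /mod_isoE[f [g fg]]] := tNP j; exists f, g. Qed.
Definition tf j := sval (cid (tiso_exists j)).
Definition tg j := sval (cid (svalP (cid (tiso_exists j)))).
Lemma tfK j : cancel (tf j) (tg j). Proof. by case: (svalP (cid (svalP (cid (tiso_exists j))))). Qed.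
Lemma tgK j : cancel (tg j) (tf j). Proof. by case: (svalP (cid (svalP (cid (tiso_exists j))))). Qed.

Section Corner.
Variables (e : P) (eh : La) (F : forall m j, fdim (fun x => e * nx m j x)).
Hypothesis Fpath : forall m j (b : 'I_(fdn (F m j))), exists p : qpath DQ,
  [/\ starp p = m, ptgt p = j & fdb (F m j) b = base p].
Hypothesis eW : forall l m j w, W l m j w -> W l m j (e * w).
Hypothesis eeh : forall t m j w n, W t%:Z m j w -> inN m j n ->
  psis vnz chi t m j w n * eh = psis vnz chi t m j (e * w) n.
Notation PHv := (PHI vnz chi).
Notation PSv := (PSI vnz chi Fpath).
(** [uv] identifies [U] with the part of the algebra fixed by right multiplication by [eh]. *)
Variables (U : lmodType R) (uv : U -> La).
Hypothesis uvD : forall x y, uv (x + y) = uv x + uv y.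
Hypothesis uvZ : forall r x, uv (r *: x) = hinc r * uv x.
Hypothesis uv_inj : injective uv.
Hypothesis uv_eh : forall x, uv x * eh = uv x.
Hypothesis uv_ex : forall u, u * eh = u -> exists x, uv x = u.
Variable d : J -> nat.
Hypothesis dE : forall j m q, mod_iso (N j) (Nm m q) -> d j = fdn (F m q).

Fact dj j : d j = fdn (F (tI j).1 (tI j).2). Proof. by apply: dE; case: (tNP j). Qed.
Notation bc b := (cast_ord (dj _) b).

Fact coord_exists m q (b : 'I_(fdn (F m q))) : exists f : {linear U -> Nm m q}, forall x, smv (f x) = PHv b (uv x) :> P.
Proof.
have [|f fE] := @mk_linear R U (Nm m q) (fun x => smk (@N_closed k Q m q) (PHI_N vnz chi b (uv x))).
  have pl' := PHI_linear vnz chi b.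
  apply: mod_linear => [x y|c x|i x|a x]; apply: smv_inj.
  - by rewrite smvD /= uvD (linD pl').
  - by rewrite smA /= uvZ hincZ (linZ pl').
  - by rewrite smE /= uvZ hincE PHI_pe.
  - by rewrite smX /= uvZ hincX PHI_pl.
by exists f => x; rewrite fE.
Qed.
Definition coord m q b := sval (cid (@coord_exists m q b)).
Lemma coordE m q (b : 'I_(fdn (F m q))) x : smv (coord b x) = PHv b (uv x) :> P.
Proof. by rewrite /coord; case: cid. Qed.

Definition fam x j : {ffun 'I_(d j) -> N j} := [ffun b => tg j (coord (bc b) x)].

Lemma decomp x : exists s : seq (int * V), uniq s /\
  (forall m j (b : 'I_(fdn (F m j))), (m, j) \notin s -> PHv b (uv x) = 0) /\
  uv x = \sum_(y <- s) \sum_(b < fdn (F y.1 y.2)) PSv b (PHv b (uv x)).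
Proof. by have := heis_decomp Fpath eW eeh (uv x); rewrite uv_eh. Qed.

Lemma fam_finite x : finite_set [set j | fam x j != 0]%classic.
Proof.
have [s [_ [s0 _]]] := decomp x.
apply: (@sub_finite_set _ _ (tI @^-1` [set` s])%classic).
  move=> j /= fj; apply: contraNT fj => js; apply/eqP/ffunP => b; rewrite !ffunE.
  have -> : coord (bc b) x = 0; last exact: raddf0.
  by apply: smv_inj; rewrite coordE s0 // -surjective_pairing.
apply: finite_preimage; last exact: finite_seq.
by move=> ? ? _ _; exact: tI_inj.
Qed.

(** The component of [j] collects the coordinates [PHI]. Injectivity is the expansion [decomp]; a
    preimage of a finite family is the sum of its [PSI]. *)
Lemma corner_iso : mod_iso U (dsum (fun j : J => {ffun 'I_(d j) -> N j})).
Proof.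
have [f fE] : exists f : {linear U -> dsum (fun j : J => {ffun 'I_(d j) -> N j})}, forall x j, f x j = fam x j.
  have [|f fE] := @mk_linear R U (dsum (fun j : J => {ffun 'I_(d j) -> N j})) (fun x => Dsum (fam_finite x)).
    move=> r x y; apply: dsum_ext => j; rewrite dsumDE dsumZE /=; apply/ffunP => b.
    by rewrite !ffunE !linearP.
  by exists f => x j; rewrite fE.
have f_inj x : f x = 0 -> x = 0.
  move=> fx; have P0 m q (b : 'I_(fdn (F m q))) : PHv b (uv x) = 0.
    have [dd|al] := EM (dead m q); first by apply: dd; exact: PHI_N.
    have [j jE] := tI_surj al; move: b.
    have -> : m = (tI j).1 by rewrite jE.
    have -> : q = (tI j).2 by rewrite jE.
    move=> b.
    pose b' : 'I_(d j) := cast_ord (esym (dj j)) b.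
    have := congr1 (fun z : dsum _ => (z : forall j, _) j) fx; rewrite /= fE => /ffunP/(_ b').
    rewrite !ffunE => /(congr1 (tf j)); rewrite tgK raddf0 => /(congr1 (@smv _ _ _ _)).
    by rewrite coordE /b' cast_ordKV.
  apply: uv_inj; have -> : uv 0 = 0.
    by have /eqP := uvD 0 0; rewrite addr0 -subr_eq0 opprD addrA subrr sub0r oppr_eq0 => /eqP.
  have [s [_ [_ ->]]] := decomp x; rewrite big1 // => y _; rewrite big1 // => b _.
  by rewrite P0; exact: lin0 (PSI_linear vnz chi Fpath b).
have f_surj z : exists x, f x = z.
  have /finite_seqP[s0 sE] := (dsum_finite z : @finite_set {classic J} [set j | z j != 0]%classic).
  pose s := undup s0; have us : uniq s by exact: undup_uniq.
  have zs j : j \notin s -> z j = 0.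
    rewrite mem_undup => js; apply/eqP; apply: contraNT js => zj.
    by have : [set` s0]%classic j by rewrite -sE.
  pose n j b : P := smv (tf j (z j b)).
  have nN j b : inN (tI j).1 (tI j).2 (n j b) by exact: smvP.
  pose u := \sum_(j <- s) \sum_(b < d j) PSv (bc b) (n j b).
  have [|x xu] := @uv_ex u.
    rewrite /u mulr_suml; apply: eq_bigr => j _; rewrite mulr_suml; apply: eq_bigr => b _.
    exact: PSI_eh.
  exists x; apply: dsum_ext => j; rewrite fE; apply/ffunP => b; rewrite ffunE.
  rewrite -[z j b]tfK; congr (tg j _); apply: smv_inj; rewrite coordE xu /u.
  have pl' := PHI_linear vnz chi (bc b).
  have off (j' : J) : j' <> j -> \sum_(b' < d j') PHv (bc b) (PSv (bc b') (n j' b')) = 0.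
    move=> jj; rewrite big1 // => b' _; rewrite /PSI PHI_psis //; last exact: W_fpath.
    case: andP => // -[/eqP m1 /eqP m2]; case: jj; apply: tI_inj.
    by rewrite [LHS]surjective_pairing [RHS]surjective_pairing m1 m2.
  rewrite (lin_sum pl') (eq_bigr (fun j' => \sum_(b' < d j') PHv (bc b) (PSv (bc b') (n j' b')))); last first.
    by move=> j' _; rewrite (lin_sum pl').
  have [js|js] := boolP (j \in (s : seq {classic J})); last first.
    rewrite zs // ffunE !raddf0 (@big_seq _ _ _ {classic J}) big1 // => j' js'; apply: off => jj.
    by rewrite -jj js' in js.
  rewrite (@bigD1_seq _ _ _ {classic J} s j _ js us) /= [Y in _ + Y]big1 ?addr0 => [|j' /eqP]; last exact: off.
  rewrite (bigD1 b) //= (PHI_PSI vnz chi Fpath (bc b) (bc b) (nN j b)) eqxx big1 ?addr0 // => b' /eqP bb.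
  rewrite (PHI_PSI vnz chi Fpath (bc b') (bc b) (nN j b')); case: eqP => // bE.
  by case: bb; apply: (@cast_ord_inj _ _ (dj j)).
have /choice[g gE] := f_surj.
exists f; exists g => x; last exact: gE.
by apply/eqP; rewrite -subr_eq0; apply/eqP; apply: f_inj; rewrite linBB gE subrr.
Qed.

End Corner.

Lemma idem_corner i : mod_iso (qHeis_idem_mod v i)
  (dsum (fun j : J => {ffun 'I_(mdim_at (path_idem k i) (N j)) -> N j})).
Proof.
have hh : he i * he i = he i by rewrite -rmorphM idemM eqxx.
apply: (@corner_iso (pe i) (he i) (fun m j => @fdNe k Q Qacyc i m j) _ _ _ (qHeis_idem_mod v i)
  (fun x => left_ideal_val x)) => //.
- move=> m j b; have := svalP (cid (nxe_fdim k Qacyc i m j)) b.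
  by move=> [p [_ pm pj pb]]; exists p; split.
- by move=> l m j w; exact: W_pe.
- by move=> t m j w n wW nN; exact: (lv_er (psis_level vnz chi t) i wW nN).
- exact: val_inj.
- move=> x; have : (left_ideal_val x) \in left_ideal_pred (he i) by exact: valP x.
  by move=> /asboolP[y ->]; rewrite -[LHS]/(y * he i * he i) -mulrA hh.
- move=> u ui; have uP : u \in left_ideal_pred (he i) by apply/asboolP; exists u.
  by exists (LeftIdeal uP).
move=> j m q jq; apply: mdim_at_iso (mod_iso_sym jq) _.
exact: Nmod_basis_at.
Qed.

(** Kept transparent, so that its basis and size compute to those of [fdN] in [full_corner]. *)
Fact fd1 m j : fdim (fun x : P => 1 * nx m j x).
Proof.
pose G := @fdN k Q Qacyc m j.
apply: (@Fdim k P (fun x => 1 * nx m j x) (fdn G) (fdb G) (fdc G)).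
- exact: fdc_linear.
- exact: fdcb.
- by move=> i x; rewrite mul1r fdc_pi.
- by move=> x; rewrite mul1r; exact: fdpi.
- by move=> i; rewrite mul1r; exact: fdb_pi.
Defined.

Lemma full_corner : mod_iso (qHeis_mod v) (dsum (fun j : J => {ffun 'I_(mdim (N j)) -> N j})).
Proof.
apply: (@corner_iso 1 1 fd1 _ _ _ (qHeis_mod v) (fun x => (x : La))) => //.
- by move=> m j b; exact: (svalP (cid (nx_fdim k Qacyc m j)) b).
- by move=> l m j w; rewrite mul1r.
- by move=> t m j w n _ _; rewrite mulr1 mul1r.
- by move=> x; rewrite mulr1.
- by move=> u _; exists u.
move=> j m q jq; apply: mdim_iso (mod_iso_sym jq) _.
exact: Nmod_basis.
Qed.

End Assembly.

Theorem theorem1p12 (k : fieldType) (Q : quiver)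
  (Qconn : quiver_connected Q) (Qacyc : quiver_acyclic Q)
  (v : vert Q -> k) (vreg : regular_weight v)
  (J : Type) (N : J -> lmodType (pathalg k Q)) (indN : ind_preprojective N) :
  (forall i : vert Q,
     mod_iso (qHeis_idem_mod v i)
       (dsum (fun j : J => {ffun 'I_(mdim_at (path_idem k i) (N j)) -> N j}))) /\
  mod_iso (qHeis_mod v) (dsum (fun j : J => {ffun 'I_(mdim (N j)) -> N j})).
Proof.
split=> [i|]; first exact: (idem_corner Qacyc vreg indN).
exact: (full_corner Qacyc vreg indN).
Qed.
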